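(* Let $a\ge 1$ and $b$ be integers such that $-b$ is a quadratic non-residue modulo $a$. Let $A=a^2$ if $4\mid a$ and $A=4a^2$ otherwise, and let \[ G_a=\left\{\begin{pmatrix}\alpha&\beta\\ \gamma&\delta\end{pmatrix}\in\Gamma_0(A):\ \alpha^2\equiv 1\pmod a\right\}. \] Then the $q$-series \[ \mathscr{H}_1(z;a,b):=\sum_{\substack{N\ge 0,\\ N\equiv b\pmod a}}H(N)q^N,\qquad q=e^{2\pi i z},\ z\in\mathfrak{h}, \] is a holomorphic modular form of weight $3/2$ (with trivial character) on $G_a$.
   Context: $\mathfrak{h}$ is the complex upper half-plane. $H(N)$ denotes the Hurwitz class number: for an integer $N\ge 0$, $H(0)=-1/12$; $H(N)=0$ if $N\equiv 1,2\pmod 4$; otherwise $H(N)$ is the number of $\mathrm{SL}_2(\mathbb{Z})$-equivalence classes of (not necessarily primitive) positive definite binary quadratic forms of discriminant $-N$, where classes containing a multiple of $x^2+y^2$ are counted with weight $1/2$ and classes containing a multiple of $x^2+xy+y^2$ are counted with weight $1/3$. A holomorphic modular form of weight $k\in\frac12+\mathbb{Z}$ with trivial character on a subgroup $G\subseteq\Gamma_0(4)$ is a holomorphic $f:\mathfrak{h}\to\mathbb{C}$ such that $f(\gamma z)=\left(\frac{c}{d}\right)\varepsilon_d^{-2k}(cz+d)^k f(z)$ for all $\gamma=\begin{pmatrix}a'&b'\\c&d\end{pmatrix}\in G$ (Shimura's convention: $\left(\frac{c}{d}\right)$ is Shimura's extended Legendre symbol, $\varepsilon_d=1$ if $d\equiv1\pmod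 4$ and $\varepsilon_d=i$ if $d\equiv 3\pmod 4$, principal branch of the square root), and $f$ is holomorphic at all cusps of $G$. *)

(* Defs.v *)
From mathcomp Require Import all_boot all_order all_algebra.
From mathcomp Require Import all_classical all_reals all_analysis.
From mathcomp Require Import complex.
Import Order.TTheory GRing.Theory Num.Theory.
Import numFieldTopology.Exports numFieldNormedType.Exports.

Set Implicit Arguments.
Unset Strict Implicit.
Unset Printing Implicit Defensive.

Local Open Scope ring_scope.

(* a binary quadratic form a x^2 + b x y + c y^2, stored as ((a, b), c) *)
Definition qform := (int * int * int)%type.

Definition qf_a (f : qform) : int := f.1.1.
Definition qf_b (f : qform) : int := f.1.2.
Definition qf_c (f : qform) : int := f.2.

Definition qf_disc (f : qform) : int := qf_b f ^+ 2 - 4 * qf_a f * qf_c f.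

(* the form (x, y) |-> f (p x + q y, r x + s y) *)
Definition qf_act (p q r s : int) (f : qform) : qform :=
  let a := qf_a f in let b := qf_b f in let c := qf_c f in
  ((a * p ^+ 2 + b * p * r + c * r ^+ 2,
    2 * a * p * q + b * (p * s + q * r) + 2 * c * r * s),
    a * q ^+ 2 + b * q * s + c * s ^+ 2).

Definition qf_equiv (f g : qform) : Prop :=
  exists p q r s : int, p * s - q * r = 1 /\ qf_act p q r s f = g.

Definition pd_form (N : nat) (f : qform) : Prop :=
  0 < qf_a f /\ qf_disc f = - (N%:Z).

Definition class_reps (N : nat) (s : seq qform) : Prop :=
  [/\ (forall f, f \in s -> pd_form N f),
      (forall i j, (i < j < size s)%N ->
          ~ qf_equiv (nth ((0, 0), 0) s i) (nth ((0, 0), 0) s j))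
    & (forall f, pd_form N f -> exists2 g, g \in s & qf_equiv f g)].

Definition class_weight (f : qform) : rat :=
  if `[< exists k : int, qf_equiv f ((k, 0), k) >] then 1 / 2
  else if `[< exists k : int, qf_equiv f ((k, k), k) >] then 1 / 3
  else 1.

Definition weighted_class_count (N : nat) : rat :=
  match pselect (exists s : seq qform, class_reps N s) with
  | left e => \sum_(f <- sval (cid e)) class_weight f
  | right _ => 0
  end.

Definition hurwitz (N : nat) : rat :=
  if N == 0%N then - (1 / 12)
  else if (N %% 4 == 1)%N || (N %% 4 == 2)%N then 0
  else weighted_class_count N.

Definition legendre (c : int) (p : nat) : int :=
  if (p%:Z %| c)%Z then 0
  else if [exists x : 'I_p, ((x%:Z) ^+ 2 == c %[mod p%:Z])%Z] then 1 else -1.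

Definition jacobi (c : int) (n : nat) : int :=
  \prod_(p <- primes n) legendre c p ^+ logn p n.

(* Shimura's extended symbol (c / d) for d odd:
   (c/d) = Jacobi symbol (c/|d|), except that it is negated when c < 0 and d < 0;
   in particular (0 / +-1) = 1. *)
Definition shimura_symbol (c d : int) : int :=
  if (d < 0) && (c < 0) then - jacobi c `|d|%N else jacobi c `|d|%N.

Section Complex.
Variable R : realType.

Definition Cx : numFieldType := R[i].

Definition cre (z : Cx) : R := complex.Re (z : R[i]).
Definition cim (z : Cx) : R := complex.Im (z : R[i]).
Definition cmk (x y : R) : Cx := (Complex x y : R[i]).

Definition cI : Cx := cmk 0 1.

(* principal branch of the square root: argument in (-pi/2, pi/2] *)
Definition psqrt (w : Cx) : Cx :=
  let x := cre w in let y := cim w in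
  let r := Num.sqrt (x ^+ 2 + y ^+ 2) in
  cmk (Num.sqrt ((r + x) / 2))
      ((if y < 0 then -1 else 1) * Num.sqrt ((r - x) / 2)).

Definition half_pow (w : Cx) (m : int) : Cx := psqrt w ^ m.

Definition qexp (z : Cx) : Cx :=
  cmk (expR (- (2 * pi * cim z)) * cos (2 * pi * cre z))
      (expR (- (2 * pi * cim z)) * sin (2 * pi * cre z)).

Definition eps_d (d : int) : Cx := if (d %% 4)%Z == 1 then 1 else cI.

Definition mobius (al be ga de : int) (z : Cx) : Cx :=
  (al%:~R * z + be%:~R) / (ga%:~R * z + de%:~R).

(* holomorphic modular form of weight m/2 (m odd), trivial character,
   Shimura's convention, on the group G (a predicate on integer matrices
   [[al, be], [ga, de]], assumed to lie in Gamma_0(4)) *)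
Definition half_int_modular_form (m : int)
    (G : int -> int -> int -> int -> Prop) (f : Cx -> Cx) : Prop :=
  [/\
      (forall z : Cx, 0 < cim z -> derivable (f : Cx^o -> Cx^o) z 1),
      (forall al be ga de : int, G al be ga de ->
         forall z : Cx, 0 < cim z ->
           f (mobius al be ga de z) =
             (shimura_symbol ga de)%:~R * eps_d de ^ (- m)
             * half_pow (ga%:~R * z + de%:~R) m * f z)
    & (* holomorphic at all cusps: for every sigma in SL_2(Z), the slashed
         function (cz+d)^{-m/2} f(sigma z) is bounded as Im z -> +oo *)
      (forall al be ga de : int, al * de - be * ga = 1 ->
         exists M : R, exists Y : R, forall z : Cx, Y < cim z ->
           `| half_pow (ga%:~R * z + de%:~R) (- m) * f (mobius al be ga de z) |
             <= cmk M 0)].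

End Complex.

(* Main.v *)
(* For ep > 0 put F_ep(z) = sum over k >= 1 and (A, n) in Z^2 of
   k^-2 E(A, n; z) exp(-pi ep k^4 |4 A z + n|^2 / Im z), where E(A, n; z) is a quadratic
   Gauss sum times A^(-1/2) (-i (4 A z + n))^(-3/2).  The Gaussian is invariant under the
   action on (A, n), so Gauss sum reciprocity makes F_ep exactly modular of weight 3/2 on
   Gamma_0(4) (non-holomorphic, but absolutely convergent, unlike the Eisenstein series
   at ep = 0).  Poisson summation in n turns F_ep into a Fourier series in Re z whose N-th
   coefficient is a sum over roots B mod 2A of B^2 = -N mod 4A with nonnegative weights.
   Averaging the translates F_ep(z + j/a) keeps only N = b mod a and preserves modularity
   on G_a.  As -b is a nonresidue, no -N with N = b mod a is a square, so neither the
   constant term nor the non-holomorphic terms of Zagier's Eisenstein series survive: the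
   pairs (A, B) count primitive representations by forms of discriminant -N, and
   the N-th coefficient grows like a constant times H(N) exp(-2 pi N Im z) log(1/ep) for
   N > 0, and is o(log(1/ep)) for N < 0.  Dividing by log(1/ep) and letting ep tend to 0 by
   dominated convergence exhibits the class number series as a limit of modular functions.
   At the cusps no expansion is needed: counting reduced forms gives the growth bound
   O(1 + (Im z)^(-3/2)), and the slashed function is periodic up to modulus. *)
Require Import Defs.
From mathcomp Require Import all_boot all_order all_algebra.
From mathcomp Require Import all_classical all_reals all_analysis.
From mathcomp Require Import complex.
From mathcomp Require Import zify ring lra.
Import Order.TTheory GRing.Theory Num.Theory.
Import numFieldTopology.Exports numFieldNormedType.Exports.
Set Implicit Arguments.
Unset Strict Implicit.
Unset Printing Implicit Defensive.
Local Open Scope ring_scope.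

(** For a common factor d one has [gg (d A) (d n) = d * gg A n], hence E(dA, dn) = E(A, n)/d. The
    sum over all pairs is thus a harmonic sum over d times a sum over coprime pairs, and the cutoff
    turns the harmonic sum into a multiple of log(1/ep). This is the source of the normalisation,
    and the cutoff takes the place of analytic continuation. The summation over k serves the
    coefficients: with j = k^2 A the cutoff depends on j alone and the weight becomes 1/j. Up to
    automorphs a pair (A, B) is a primitive vector at which a form takes the value A, so (k, A, B)
    runs through all nonzero vectors and the count is a binary theta function. Its behaviour as t
    tends to 0, averaged against dt/t, gives the class number times a logarithm. Nonnegativity of
    the Fourier coefficients controls the rearrangement of the double series: bounds are read off at
    purely imaginary points. Integrals are limits of Riemann sums, so that Poisson summation comes
    from the finite Fourier transform. The symbol (c/d) is handled through Gauss sums, with the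
    Landsberg-Schaar identity as reciprocity law. *)

Section ComplexBasics.
Variable R : realType.
Local Notation C := R[i].
Implicit Types z w : C.

(** * Complex modulus, exponential and the additive character [ce] *)

Definition cabs z : R := Normc.normc z.
Definition rc (x : R) : C := Complex x 0.
Definition cexp z : C :=
  Complex (expR (complex.Re z) * cos (complex.Im z)) (expR (complex.Re z) * sin (complex.Im z)).

Lemma normcE' z : `|z| = rc (cabs z).
Proof. by rewrite normc_def; case: z. Qed.

Lemma cabsE z : cabs z = Num.sqrt (complex.Re z ^+ 2 + complex.Im z ^+ 2).
Proof. by case: z. Qed.

Lemma cabs_ge0 z : 0 <= cabs z.
Proof. by rewrite cabsE sqrtr_ge0. Qed.

Lemma cabs_sqr z : cabs z ^+ 2 = complex.Re z ^+ 2 + complex.Im z ^+ 2.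
Proof. by rewrite cabsE sqr_sqrtr // addr_ge0 ?sqr_ge0. Qed.

Lemma cabsM z w : cabs (z * w) = cabs z * cabs w.
Proof. exact: Normc.normcM. Qed.

Lemma cabsV z : cabs z^-1 = (cabs z)^-1.
Proof. exact: Normc.normcV. Qed.

Lemma cabs0 : cabs 0 = 0. Proof. exact: Normc.normc0. Qed.
Lemma cabs1 : cabs 1 = 1. Proof. exact: Normc.normc1. Qed.

Lemma cabs0_eq0 z : cabs z = 0 -> z = 0.
Proof. exact: Normc.eq0_normc. Qed.

Lemma cabs_eq0 z : (cabs z == 0) = (z == 0).
Proof. by apply/eqP/eqP => [/cabs0_eq0|->] //; rewrite cabs0. Qed.

Lemma cabs_gt0 z : (0 < cabs z) = (z != 0).
Proof. by rewrite lt_def cabs_ge0 cabs_eq0 andbT. Qed.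

Lemma cabsN z : cabs (- z) = cabs z.
Proof. by rewrite !cabsE; case: z => a b /=; rewrite !sqrrN. Qed.

Lemma cabsD z w : cabs (z + w) <= cabs z + cabs w.
Proof. exact: le_normcD. Qed.

Lemma cabsB z w : cabs (z - w) <= cabs z + cabs w.
Proof. by rewrite -[cabs w]cabsN cabsD. Qed.

Lemma cabs_distC z w : cabs (z - w) = cabs (w - z).
Proof. by rewrite -cabsN opprB. Qed.

Lemma cabsX z n : cabs (z ^+ n) = cabs z ^+ n.
Proof. by elim: n => [|n IH]; rewrite ?expr0 ?cabs1 // !exprS cabsM IH. Qed.

Lemma cabs_rc x : cabs (rc x) = `|x|.
Proof. by rewrite cabsE /= expr0n addr0 sqrtr_sqr. Qed.

Lemma cabs_sum (I : Type) (s : seq I) (P : pred I) (f : I -> C) :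
  cabs (\sum_(i <- s | P i) f i) <= \sum_(i <- s | P i) cabs (f i).
Proof.
elim/big_ind2: _ => //; first by rewrite cabs0.
by move=> a b c d ha hc; rewrite (le_trans (cabsD _ _)) // lerD.
Qed.

Lemma Re_le_cabs z : `|complex.Re z| <= cabs z.
Proof. by rewrite -sqrtr_sqr cabsE ler_wsqrtr // lerDl sqr_ge0. Qed.

Lemma Im_le_cabs z : `|complex.Im z| <= cabs z.
Proof. by rewrite -sqrtr_sqr cabsE ler_wsqrtr // lerDr sqr_ge0. Qed.

Lemma cabs_le_ReIm z : cabs z <= `|complex.Re z| + `|complex.Im z|.
Proof.
rewrite -(ler_pXn2r (n := 2)) ?nnegrE ?cabs_ge0 ?addr_ge0 // cabs_sqr.
rewrite sqrrD !real_normK ?num_real // -addrA [X in _ <= _ + X]addrC addrA.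
by rewrite lerDl mulrn_wge0 // mulr_ge0.
Qed.

Lemma rcD x y : rc (x + y) = rc x + rc y.
Proof. by apply/eqP; rewrite eq_complex /= addr0 !eqxx. Qed.
Lemma rcN x : rc (- x) = - rc x.
Proof. by apply/eqP; rewrite eq_complex /= oppr0 !eqxx. Qed.
Lemma rcB x y : rc (x - y) = rc x - rc y.
Proof. by rewrite rcD rcN. Qed.
Lemma rcM x y : rc (x * y) = rc x * rc y.
Proof. by apply/eqP; rewrite eq_complex /= !mulr0 !mul0r subr0 addr0 !eqxx. Qed.
Lemma rc0 : rc 0 = 0. Proof. by []. Qed.
Lemma rc1 : rc 1 = 1. Proof. by []. Qed.
Lemma rcX x n : rc (x ^+ n) = rc x ^+ n.
Proof. by elim: n => [|n IH]; rewrite ?expr0 // !exprS rcM IH. Qed.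
Lemma rcV x : rc x^-1 = (rc x)^-1.
Proof.
have [->|x0] := eqVneq x 0; first by rewrite invr0 rc0 invr0.
have r0 : rc x != 0 by rewrite eq_complex /= negb_and x0.
by apply: (mulfI r0); rewrite -rcM mulfV // mulfV.
Qed.
Lemma rc_nat n : rc n%:R = n%:R.
Proof. by elim: n => [|n IH]; rewrite ?rc0 // -addn1 !natrD rcD IH. Qed.
Lemma rc_int (n : int) : rc n%:~R = n%:~R.
Proof. by case: n => n; rewrite ?NegzE ?mulrNz ?rcN -!pmulrn rc_nat. Qed.
Lemma rc_sum (I : Type) (s : seq I) (P : pred I) (f : I -> R) :
  rc (\sum_(i <- s | P i) f i) = \sum_(i <- s | P i) rc (f i).
Proof. by apply: (big_morph rc rcD rc0). Qed.
Lemma rc_inj : injective rc. Proof. by move=> x y []. Qed.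
Lemma rc_eq0 x : (rc x == 0) = (x == 0).
Proof. by rewrite -rc0 (inj_eq rc_inj). Qed.

Lemma ReD z w : complex.Re (z + w) = complex.Re z + complex.Re w.
Proof. by case: z; case: w. Qed.
Lemma ImD z w : complex.Im (z + w) = complex.Im z + complex.Im w.
Proof. by case: z; case: w. Qed.
Lemma ReN z : complex.Re (- z) = - complex.Re z. Proof. by case: z. Qed.
Lemma ImN z : complex.Im (- z) = - complex.Im z. Proof. by case: z. Qed.
Lemma ReM z w : complex.Re (z * w) = complex.Re z * complex.Re w - complex.Im z * complex.Im w.
Proof. by case: z; case: w. Qed.
Lemma ImM z w : complex.Im (z * w) = complex.Re z * complex.Im w + complex.Im z * complex.Re w.
Proof. by case: z; case: w => c d a b /=. Qed.
Lemma Re_rcM x z : complex.Re (rc x * z) = x * complex.Re z.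
Proof. by rewrite ReM /= mul0r subr0. Qed.
Lemma Im_rcM x z : complex.Im (rc x * z) = x * complex.Im z.
Proof. by rewrite ImM /= mul0r addr0. Qed.

Lemma complexP z w : complex.Re z = complex.Re w -> complex.Im z = complex.Im w -> z = w.
Proof. by case: z; case: w => a b c d /= -> ->. Qed.

Lemma cexpD z w : cexp (z + w) = cexp z * cexp w.
Proof.
apply: complexP; rewrite ?ReM ?ImM /= ?ReD ?ImD expRD ?cosD ?sinD; ring.
Qed.

Lemma cexp0 : cexp 0 = 1.
Proof. by apply: complexP; rewrite /= expR0 ?cos0 ?sin0 mul1r. Qed.

Lemma cabs_cexp z : cabs (cexp z) = expR (complex.Re z).
Proof.
rewrite cabsE /= !exprMn -mulrDr cos2Dsin2 mulr1 sqrtr_sqr.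
by rewrite ger0_norm // expR_ge0.
Qed.

Lemma cexp_neq0 z : cexp z != 0.
Proof. by rewrite -cabs_gt0 cabs_cexp expR_gt0. Qed.

Lemma cexpMn z n : cexp (z *+ n) = cexp z ^+ n.
Proof. by elim: n => [|n IH]; rewrite ?mulr0n ?cexp0 // mulrS cexpD IH exprS. Qed.

Lemma cexp_rc x : cexp (rc x) = rc (expR x).
Proof. by apply: complexP; rewrite /= ?cos0 ?sin0 ?mulr1 ?mulr0. Qed.

Definition ci : C := Complex 0 1.
Lemma ci2 : ci * ci = -1.
Proof. by apply: complexP; rewrite /= ?mulr0 ?mul0r ?mulr1 ?sub0r ?addr0 ?oppr0. Qed.
Lemma ci_neq0 : ci != 0. Proof. by rewrite eq_complex /= oner_eq0 andbF. Qed.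

Lemma ciM_rc x : ci * rc x = Complex 0 x.
Proof. by apply: complexP; rewrite /= ?mul0r ?mulr0 ?mul1r ?subr0 ?add0r. Qed.

Lemma complex_ri z : z = rc (complex.Re z) + ci * rc (complex.Im z).
Proof. by case: z => a b; apply: complexP; rewrite /= !(mulr0,mul0r,mul1r,addr0,add0r,subr0). Qed.

Definition ce (x : R) : C := cexp (ci * rc (2 * pi * x)).

Lemma ceE x : ce x = Complex (cos (2 * pi * x)) (sin (2 * pi * x)).
Proof.
by rewrite /ce ciM_rc /cexp /= expR0 !mul1r.
Qed.

Lemma ceD x y : ce (x + y) = ce x * ce y.
Proof. by rewrite /ce -cexpD; congr cexp; rewrite mulrDr rcD mulrDr. Qed.

Lemma ce0 : ce 0 = 1. Proof. by rewrite /ce mulr0 rc0 mulr0 cexp0. Qed.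

Lemma cabs_ce x : cabs (ce x) = 1.
Proof. by rewrite /ce ciM_rc cabs_cexp /= expR0. Qed.

Lemma ce_neq0 x : ce x != 0. Proof. exact: cexp_neq0. Qed.

Lemma ceN x : ce (- x) = (ce x)^-1.
Proof. by apply: (mulfI (ce_neq0 x)); rewrite -ceD subrr ce0 mulfV ?ce_neq0. Qed.

Lemma ce1 : ce 1 = 1.
Proof. by rewrite ceE mulr1 mulr_natl cos2pi sin2pi. Qed.

Lemma ce_nat n : ce n%:R = 1.
Proof. by elim: n => [|n IH]; rewrite ?ce0 // -addn1 natrD ceD IH ce1 mulr1. Qed.

Lemma ce_int (n : int) : ce n%:~R = 1.
Proof. by case: n => n; rewrite ?NegzE ?mulrNz ?ceN -!pmulrn ce_nat ?invr1. Qed.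

Lemma ceDint x (n : int) : ce (x + n%:~R) = ce x.
Proof. by rewrite ceD ce_int mulr1. Qed.

Lemma ceMn x n : ce (x *+ n) = ce x ^+ n.
Proof. by elim: n => [|n IH]; rewrite ?mulr0n ?ce0 // mulrS ceD IH exprS. Qed.

Definition cj z : C := conjc z.
Lemma cjD z w : cj (z + w) = cj z + cj w. Proof. exact: (rmorphD (@conjc R)). Qed.
Lemma cjM z w : cj (z * w) = cj z * cj w. Proof. exact: (rmorphM (@conjc R)). Qed.
Lemma cj_rc x : cj (rc x) = rc x. Proof. by rewrite /cj /= /rc oppr0. Qed.
Lemma cj_ce x : cj (ce x) = ce (- x).
Proof. by rewrite !ceE mulrN cosN sinN. Qed.
Lemma cj_sum (I : Type) (s : seq I) (P : pred I) (f : I -> C) :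
  cj (\sum_(i <- s | P i) f i) = \sum_(i <- s | P i) cj (f i).
Proof. by apply: (big_morph cj cjD); rewrite /cj conjc0. Qed.
Lemma mulcj z : z * cj z = rc (cabs z ^+ 2).
Proof. by rewrite cabs_sqr; case: z => a b; apply: complexP => /=; ring. Qed.

End ComplexBasics.

(** * Unordered summation with explicit bounds, Fubini and dominated convergence *)

Section Sums.
Variable R : realType.
Local Notation C := R[i].

(** For nonnegative [g] this is summability with total at most [M]. Carrying the bound as a number
    lets estimates be composed by Fubini and kept uniform in parameters. *)
Definition bsum (I : eqType) (g : I -> R) (M : R) :=
  forall G : seq I, uniq G -> \sum_(i <- G) g i <= M.

Definition absb (I : eqType) (f : I -> C) (M : R) := bsum (fun i => cabs (f i)) M.

(* Unordered summation: [F] is a finite set of indices beyond which partial sums are [e]-close to [s]. *)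
Definition hsum (I : eqType) (f : I -> C) (s : C) :=
  forall e : R, 0 < e -> exists F : seq I, forall G : seq I,
    uniq G -> {subset F <= G} -> cabs (\sum_(i <- G) f i - s) < e.

Lemma sum_const_le (I : Type) (r : seq I) (c : R) : 0 <= c ->
  \sum_(i <- r) c / ((size r)%:R + 1) <= c.
Proof.
move=> c0; rewrite big_const_seq count_predT iter_addr_0 -[X in X <= _]mulr_natr mulrAC.
by rewrite ler_pdivrMr ?ltr_wpDl ?ler0n // ler_wpM2l // lerDl.
Qed.

Lemma sum_subseq_le (I : eqType) (g : I -> R) (F G : seq I) :
  (forall i, 0 <= g i) -> uniq F -> uniq G -> {subset F <= G} ->
  \sum_(i <- F) g i <= \sum_(i <- G) g i.
Proof.
move=> g0 uF uG FG.
rewrite (bigID (mem F) xpredT) /= [X in _ <= X](bigID (mem F) xpredT) /=.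
rewrite [X in X + _ <= _]big_mkcond /= [X in _ + X <= _]big_mkcond /=.
have -> : \sum_(i <- F) (if i \notin F then g i else 0) = 0.
  by rewrite big1_seq // => i /andP[_ iF]; rewrite iF.
rewrite addr0 -[X in X <= _]addr0 lerD ?sumr_ge0 // -big_mkcond /= -big_filter -[X in _ <= X]big_filter.
rewrite [X in _ <= X](perm_big [seq i <- F | i \in F]) //.
apply: uniq_perm; rewrite ?filter_uniq // => i; rewrite !mem_filter andbb.
by have [/FG ->|] := boolP (i \in F).
Qed.

Lemma bsum_ge0 (I : eqType) (g : I -> R) M : bsum g M -> 0 <= M.
Proof. by move=> /(_ [::] isT); rewrite big_nil. Qed.

Lemma bsum_le (I : eqType) (g h : I -> R) M : (forall i, g i <= h i) -> bsum h M -> bsum g M.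
Proof. by move=> gh hM G uG; rewrite (le_trans _ (hM G uG)) // ler_sum. Qed.

Lemma bsumW (I : eqType) (g : I -> R) M M' : M <= M' -> bsum g M -> bsum g M'.
Proof. by move=> MM gM G uG; rewrite (le_trans (gM G uG)). Qed.

Lemma bsumZ (I : eqType) (g : I -> R) M c : 0 <= c -> bsum g M -> bsum (fun i => c * g i) (c * M).
Proof. by move=> c0 gM G uG; rewrite -mulr_sumr ler_wpM2l // gM. Qed.

Lemma bsumD (I : eqType) (g h : I -> R) M M' :
  bsum g M -> bsum h M' -> bsum (fun i => g i + h i) (M + M').
Proof. by move=> gM hM G uG; rewrite big_split lerD ?gM ?hM. Qed.

Lemma bsum_one (I : eqType) (g : I -> R) M i : bsum g M -> g i <= M.
Proof. by move=> /(_ [:: i] isT); rewrite big_seq1. Qed.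

Lemma bsum_inj (I J : eqType) (h : J -> I) (g : I -> R) M :
  injective h -> bsum g M -> bsum (fun j => g (h j)) M.
Proof.
move=> hi gM G uG; rewrite -(big_map h xpredT g); apply: gM.
by rewrite map_inj_uniq.
Qed.

Lemma bsum_prod (I J : eqType) (f : I * J -> R) (m : I -> R) M :
  (forall p, 0 <= f p) ->
  (forall i, bsum (fun j => f (i, j)) (m i)) -> bsum m M -> bsum f M.
Proof.
move=> f0 fm mM G uG.
pose A := undup (map fst G); pose B := undup (map snd G).
apply: le_trans (mM A (undup_uniq _)).
apply: (@le_trans _ _ (\sum_(p <- [seq (i, j) | i <- A, j <- B]) f p)).
  apply: sum_subseq_le => //.
    by apply: allpairs_uniq; rewrite ?undup_uniq // => -[a b] [c d] _ _ [] -> ->.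
  move=> [i j] ijG; apply/allpairsP; exists (i, j); split => //.
    by rewrite mem_undup; apply/mapP; exists (i, j).
  by rewrite mem_undup; apply/mapP; exists (i, j).
rewrite big_allpairs_dep /= ler_sum // => i _; exact: fm (undup_uniq _).
Qed.

Lemma bsum_mul (I J : eqType) (g : I -> R) (h : J -> R) M M' :
  (forall i, 0 <= g i) -> (forall j, 0 <= h j) -> bsum g M -> bsum h M' ->
  bsum (fun p : I * J => g p.1 * h p.2) (M * M').
Proof.
move=> g0 h0 gM hM; apply: (@bsum_prod _ _ _ (fun i => g i * M')).
- by move=> p; rewrite mulr_ge0.
- by move=> i; exact: (bsumZ (g0 i) hM).
- by move=> G uG; rewrite -mulr_suml ler_wpM2r ?(bsum_ge0 hM) //; exact: gM.
Qed.

(** A finite set whose sum lies within [e] of the supremum of all finite sums leaves at most [e] for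
    every finite set disjoint from it. *)
Lemma bsum_tail (I : eqType) (g : I -> R) M e : (forall i, 0 <= g i) -> bsum g M -> 0 < e ->
  exists F : seq I, forall G, uniq G -> (forall i, i \in F -> i \notin G) ->
    \sum_(i <- G) g i <= e.
Proof.
move=> g0 gM e0.
pose S := [set x : R | exists2 F : seq I, uniq F & x = \sum_(i <- F) g i]%classic.
have hS : has_sup S.
  split; first by exists 0, [::]; rewrite ?big_nil.
  by exists M => x [F uF ->]; exact: gM.
have [_ [F uF ->] hF] := sup_adherent e0 hS.
exists F => G uG FG.
have : \sum_(i <- F ++ G) g i <= sup S.
  apply: ub_le_sup; first by case: hS.
  exists (F ++ G) => //; rewrite cat_uniq uF uG andbT /=.
  by apply/hasPn => i iG; apply/negP => iF; move: (FG i iF); rewrite iG.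
rewrite big_cat /=; lra.
Qed.

Section One.
Variable I : eqType.
Implicit Types (f g : I -> C).

Lemma hsum_unique f s t : hsum f s -> hsum f t -> s = t.
Proof.
move=> hs ht; apply/eqP; rewrite -subr_eq0 -cabs_eq0; apply/negPn/negP => n0.
have e0 : 0 < cabs (s - t) / 2 by rewrite divr_gt0 // lt_def n0 cabs_ge0.
have [F hF] := hs _ e0; have [F' hF'] := ht _ e0.
pose G := undup (F ++ F').
have uG : uniq G by rewrite undup_uniq.
have h1 := hF G uG _; have h2 := hF' G uG _.
have : cabs (s - t) < cabs (s - t).
  rewrite -[X in cabs X < _](subrKA (\sum_(i <- G) f i)).
  apply: le_lt_trans (cabsD _ _) _.
  rewrite [cabs (s - \sum_(i <- G) f i)]cabs_distC [X in _ < X]splitr ltrD //.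
    by apply: h1 => i iF; rewrite mem_undup mem_cat iF.
  by apply: h2 => i iF; rewrite mem_undup mem_cat iF orbT.
by rewrite ltxx.
Qed.

Lemma hsum_ext f g s : (forall i, f i = g i) -> hsum f s -> hsum g s.
Proof. by move=> /funext ->. Qed.

Lemma hsumD f g s t : hsum f s -> hsum g t -> hsum (fun i => f i + g i) (s + t).
Proof.
move=> hs ht e e0; have e2 : 0 < e / 2 by rewrite divr_gt0.
have [F hF] := hs _ e2; have [F' hF'] := ht _ e2.
exists (F ++ F') => G uG FG; rewrite big_split /=.
have -> : forall a b : C, a + b - (s + t) = (a - s) + (b - t) by move=> a b; ring.
apply: le_lt_trans (cabsD _ _) _; rewrite [X in _ < X]splitr ltrD //.
  by apply: hF => // i iF; rewrite FG // mem_cat iF.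
by apply: hF' => // i iF; rewrite FG // mem_cat iF orbT.
Qed.

Lemma hsumZ f s c : hsum f s -> hsum (fun i => c * f i) (c * s).
Proof.
move=> hs e e0.
have c0 : 0 < cabs c + 1 by rewrite ltr_wpDl ?cabs_ge0.
have [F hF] := hs (e / (cabs c + 1)) (divr_gt0 e0 c0).
exists F => G uG FG; rewrite -mulr_sumr -mulrBr cabsM.
have := hF G uG FG; rewrite ltr_pdivlMr // => h.
apply: le_lt_trans h; rewrite mulrC ler_wpM2l ?cabs_ge0 // lerDl //.
Qed.

Lemma hsum0 : hsum (fun _ : I => 0) 0.
Proof. by move=> e e0; exists [::] => G _ _; rewrite big1 // subrr cabs0. Qed.

Lemma hsumB f g s t : hsum f s -> hsum g t -> hsum (fun i => f i - g i) (s - t).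
Proof.
move=> hs ht; have := hsumD hs (hsumZ (-1) ht); rewrite mulN1r.
by apply: hsum_ext => i; rewrite mulN1r.
Qed.

Lemma hsum_finsum (J : Type) (r : seq J) (f : J -> I -> C) (s : J -> C) :
  (forall j, hsum (f j) (s j)) ->
  hsum (fun i => \sum_(j <- r) f j i) (\sum_(j <- r) s j).
Proof.
move=> h; elim: r => [|j r IH].
  by rewrite big_nil; apply: hsum_ext hsum0 => i; rewrite big_nil.
by rewrite big_cons; apply: hsum_ext (hsumD (h j) IH) => i; rewrite big_cons.
Qed.

Lemma hsum_le f s M : hsum f s -> absb f M -> cabs s <= M.
Proof.
move=> hs fM; apply/ler_addgt0Pr => e e0.
have [F hF] := hs e e0; have uF := undup_uniq F.
have hF' := hF _ uF; rewrite -[s](subKr (\sum_(i <- undup F) f i)).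
apply: le_trans (cabsB _ _) _; rewrite lerD //.
  by rewrite (le_trans (cabs_sum _ _ _)) // fM.
by apply/ltW/hF' => i; rewrite mem_undup.
Qed.

Lemma hsum_nonneg (g : I -> R) M : (forall i, 0 <= g i) -> bsum g M ->
  exists2 s : R, 0 <= s & hsum (fun i => rc (g i)) (rc s).
Proof.
move=> g0 gM.
pose S := [set x : R | exists2 F : seq I, uniq F & x = \sum_(i <- F) g i]%classic.
have hS : has_sup S.
  split; first by exists 0, [::]; rewrite ?big_nil.
  by exists M => x [F uF ->]; exact: gM.
have S_ub G : uniq G -> \sum_(i <- G) g i <= sup S.
  by move=> uG; apply: ub_le_sup; [case: hS|exists G].
exists (sup S); first by have := S_ub [::] isT; rewrite big_nil.
move=> e e0; have [_ [F uF ->] hF] := sup_adherent e0 hS.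
exists F => G uG FG; rewrite -rc_sum -rcB cabs_rc distrC.
have h1 := sum_subseq_le g0 uF uG FG; have h2 := S_ub _ uG.
by rewrite ger0_norm; lra.
Qed.

Lemma hsum_ex f M : absb f M -> exists s, hsum f s.
Proof.
move=> fM.
(* [P] is applied to the real and to the imaginary part. Each is split into its positive and
   negative parts, for which the supremum of the finite sums is the sum. *)
have P (p : C -> R) : (forall z, `|p z| <= cabs z) ->
    exists s, hsum (fun i => rc (p (f i))) s.
  move=> hp.
  have [s1 _ h1] : exists2 s : R, 0 <= s & hsum (fun i => rc (Num.max (p (f i)) 0)) (rc s).
    apply: (@hsum_nonneg _ M) => [i|]; first by rewrite le_max lexx orbT.
    apply: bsum_le fM => i; rewrite ge_max cabs_ge0 andbT.
    by apply: le_trans (hp _); rewrite ler_norm.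
  have [s2 _ h2] : exists2 s : R, 0 <= s & hsum (fun i => rc (Num.max (- p (f i)) 0)) (rc s).
    apply: (@hsum_nonneg _ M) => [i|]; first by rewrite le_max lexx orbT.
    apply: bsum_le fM => i; rewrite ge_max cabs_ge0 andbT.
    by apply: le_trans (hp _); rewrite -normrN ler_norm.
  exists (rc s1 - rc s2); apply: hsum_ext (hsumB h1 h2) => i.
  rewrite -rcB; congr rc; rewrite /Num.max.
  by case: ltP => ?; case: ltP => ?; lra.
have [s1 h1] := P _ (@Re_le_cabs R); have [s2 h2] := P _ (@Im_le_cabs R).
exists (s1 + ci R * s2); apply: hsum_ext (hsumD h1 (hsumZ (ci R) h2)) => i.
by rewrite [RHS]complex_ri.
Qed.

Lemma hsum_fin (F : seq I) f : uniq F -> (forall i, i \notin F -> f i = 0) ->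
  hsum f (\sum_(i <- F) f i).
Proof.
move=> uF h e e0; exists F => G uG FG.
rewrite (bigID (mem F) xpredT) /= [X in _ + X - _]big1; last by move=> i /h.
rewrite addr0 -big_filter (perm_big F) ?subrr ?cabs0 //.
apply: uniq_perm; rewrite ?filter_uniq // => i; rewrite mem_filter.
by have [/FG ->|] := boolP (i \in F).
Qed.

Lemma hsum_near f s e (G0 : seq I) : hsum f s -> 0 < e ->
  exists G, [/\ uniq G, {subset G0 <= G} & cabs (\sum_(i <- G) f i - s) < e].
Proof.
move=> hs e0; have [F hF] := hs e e0; exists (undup (F ++ G0)); split.
- exact: undup_uniq.
- by move=> i iG; rewrite mem_undup mem_cat iG orbT.
- by apply: hF => [|i iF]; rewrite ?undup_uniq // mem_undup mem_cat iF.
Qed.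

Lemma hsum_real (g : I -> R) s : hsum (fun i => rc (g i)) s -> s = rc (complex.Re s).
Proof.
move=> hs; apply: complexP => //=; apply/eqP; rewrite -normr_eq0; apply/negPn/negP => n0.
have e0 : 0 < `|complex.Im s| by rewrite lt_def n0 normr_ge0.
have [G [_ _]] := hsum_near [::] hs e0; rewrite -rc_sum => h.
have := le_lt_trans (Im_le_cabs _) h.
by rewrite ImD ImN /= sub0r normrN ltxx.
Qed.

Lemma hsum_ge0 (g : I -> R) s : (forall i, 0 <= g i) -> hsum (fun i => rc (g i)) (rc s) -> 0 <= s.
Proof.
move=> g0 hs; rewrite leNgt; apply/negP => s0.
have e0 : 0 < - s by rewrite oppr_gt0.
have [G [_ _]] := hsum_near [::] hs e0; rewrite -rc_sum -rcB cabs_rc => /ltr_normlP[_ h].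
have : 0 <= \sum_(i <- G) g i by rewrite sumr_ge0.
lra.
Qed.

Lemma hsum_bsum (g : I -> R) s : (forall i, 0 <= g i) ->
  hsum (fun i => rc (g i)) (rc s) -> bsum g s.
Proof.
move=> g0 hs G uG; apply/ler_addgt0Pr => e e0.
have [H [uH GH]] := hsum_near G hs e0; rewrite -rc_sum -rcB cabs_rc => /ltr_normlP[_ h].
have := sum_subseq_le g0 uG uH GH; lra.
Qed.

(* Dominated convergence in a form that needs no filter: [F] and [d] depend only on
   the dominating family. *)
Lemma tannery (g : I -> R) M e : (forall i, 0 <= g i) -> bsum g M -> 0 < e ->
  exists F : seq I, exists2 d : R, 0 < d & forall (f f' : I -> C) s s',
    hsum f s -> hsum f' s' ->
    (forall i, cabs (f i) <= g i) -> (forall i, cabs (f' i) <= g i) ->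
    (forall i, i \in F -> cabs (f i - f' i) <= d) -> cabs (s - s') <= e.
Proof.
move=> g0 gM e0; have e4 : 0 < e / 4 by rewrite divr_gt0.
have [F hF] := bsum_tail g0 gM e4.
pose F0 := undup F; pose n : R := (size F0)%:R.
have n1 : 0 < n + 1 by rewrite ltr_wpDl ?ler0n.
exists F0, (e / 4 / (n + 1)); first by rewrite !divr_gt0.
move=> f f' s s' hs hs' fg f'g fd.
have [G [uG FG hG]] := hsum_near F0 (hsumB hs hs') e4.
rewrite -[s - s'](subKr (\sum_(i <- G) (f i - f' i))).
apply: le_trans (cabsB _ _) _.
(* On [F0] the differences are at most [d], chosen small enough for [size F0] terms; outside [F0]
   they are at most [g + g], whose finite sums are at most [e / 4 + e / 4]. *)
suff : cabs (\sum_(i <- G) (f i - f' i)) <= e / 4 + (e / 4 + e / 4) by lra.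
apply: le_trans (cabs_sum _ _ _) _.
rewrite (bigID (mem F0) xpredT) /= lerD //.
  rewrite -big_filter; apply: (@le_trans _ _ (\sum_(i <- F0) (e / 4 / (n + 1)))).
    rewrite (perm_big F0); last first.
      apply: uniq_perm; rewrite ?filter_uniq ?undup_uniq // => i; rewrite mem_filter.
      by have [/FG ->|] := boolP (i \in F0).
    by rewrite big_seq [X in _ <= X]big_seq; apply: ler_sum => i /fd.
  exact: sum_const_le (ltW e4).
rewrite -big_filter; apply: (@le_trans _ _ (\sum_(i <- [seq i <- G | i \notin F0]) (g i + g i))).
  by apply: ler_sum => i _; rewrite (le_trans (cabsB _ _)) // lerD.
rewrite big_split lerD //; apply: hF; rewrite ?filter_uniq // => i iF.
  by rewrite mem_filter /F0 mem_undup iF.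
by rewrite mem_filter /F0 mem_undup iF.
Qed.
End One.

(** [h] has to reach only the indices where [f] does not vanish. So a sum over a progression, or
    over the naturals, can be exchanged with a sum over all integers whose other terms are zero. *)
Lemma hsum_reindex (I J : eqType) (h : J -> I) (k : I -> J) (f : I -> C) s :
  cancel h k -> (forall i, f i != 0 -> h (k i) = i) ->
  hsum f s <-> hsum (fun j => f (h j)) s.
Proof.
move=> hk kh; have hi := can_inj hk; split=> hs e e0.
  have [F hF] := hs e e0; exists [seq k i | i <- F] => G uG FG.
  pose G1 := [seq h j | j <- G]; pose G2 := [seq i <- undup F | i \notin G1].
  have uG1 : uniq G1 by rewrite map_inj_uniq.
  have := hF (G1 ++ G2); rewrite big_cat /= [X in _ + X - _]big1_seq.
    rewrite addr0 big_map; apply.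
      rewrite cat_uniq uG1 filter_uniq ?undup_uniq // andbT.
      by apply/hasPn => i; rewrite mem_filter => /andP[].
    move=> i iF; rewrite mem_cat mem_filter mem_undup iF andbT orbN //.
  move=> i; rewrite mem_filter mem_undup => /and3P[_ iG iF].
  apply/eqP; apply/negPn/negP => /kh hki; move/negP: iG; apply.
  by rewrite -hki; apply: map_f; apply: FG; apply: map_f.
have [F hF] := hs e e0; exists [seq h j | j <- F] => G uG FG.
pose G1 := [seq i <- G | h (k i) == i].
have := hF [seq k i | i <- G1]; rewrite big_map big_filter.
have -> : \sum_(i <- G | h (k i) == i) f (h (k i)) = \sum_(i <- G) f i.
  rewrite [RHS](bigID (fun i => h (k i) == i)) /= [X in _ + X]big1 ?addr0.
    by apply: eq_bigr => i /eqP ->.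
  by move=> i ki; apply/eqP; apply/negPn/negP => /kh /eqP; apply/negP.
apply.
  rewrite map_inj_in_uniq ?filter_uniq // => i j.
  by rewrite !mem_filter => /andP[/eqP hi1 _] /andP[/eqP hj1 _] kij; rewrite -hi1 -hj1 kij.
move=> j jF; apply/mapP; exists (h j); last by rewrite hk.
by rewrite mem_filter hk eqxx; apply: FG; apply: map_f.
Qed.

Lemma hsum_bij (I J : eqType) (h : J -> I) (k : I -> J) (f : I -> C) s :
  cancel h k -> cancel k h -> hsum f s -> hsum (fun j => f (h j)) s.
Proof. by move=> hk kh; exact: (hsum_reindex s hk (fun i _ => kh i)).1. Qed.

Lemma hsum_fubini (I J : eqType) (f : I * J -> C) (t : I -> C) s :
  (forall i, hsum (fun j => f (i, j)) (t i)) -> hsum f s -> hsum t s.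
Proof.
move=> ht hs e e0; have e2 : 0 < e / 2 by rewrite divr_gt0.
have [F0 hF0] := hs _ e2; exists (map fst F0) => A uA FA.
pose n : R := (size A)%:R; have n1 : 0 < n + 1 by rewrite ltr_wpDl ?ler0n.
have d0 : 0 < e / 2 / (n + 1) by rewrite divr_gt0.
have [H hH] := choice (fun i => ht i _ d0).
(* [B] is large enough for the inner sums at all indices of [A] at once and contains the second
   coordinates of [F0], so that the rectangle over [A] and [B] contains [F0]. *)
pose B := undup (flatten [seq H i | i <- A] ++ map snd F0).
have uB : uniq B by exact: undup_uniq.
pose G := [seq (i, j) | i <- A, j <- B].
have uG : uniq G by apply: allpairs_uniq => // -[a b] [c d] _ _ [] -> ->.
have FG : {subset F0 <= G}.
  move=> [i j] ij; apply/allpairsP; exists (i, j); split => //.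
    by apply: FA; apply/mapP; exists (i, j).
  by rewrite mem_undup mem_cat; apply/orP; right; apply/mapP; exists (i, j).
have h1 := hF0 G uG FG; rewrite big_allpairs_dep /= in h1.
have -> : \sum_(i <- A) t i - s = (\sum_(i <- A) t i - \sum_(i <- A) \sum_(j <- B) f (i, j)) +
   (\sum_(i <- A) \sum_(j <- B) f (i, j) - s) by ring.
apply: le_lt_trans (cabsD _ _) _; rewrite [X in _ < X]splitr ler_ltD //.
rewrite -sumrB; apply: le_trans (cabs_sum _ _ _) _.
apply: (@le_trans _ _ (\sum_(i <- A) (e / 2 / (n + 1)))).
  rewrite big_seq [X in _ <= X]big_seq; apply: ler_sum => i iA.
  rewrite cabs_distC; apply/ltW/hH => // j jH; rewrite mem_undup mem_cat; apply/orP; left.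
  by apply/flattenP; exists (H i) => //; apply: map_f.
exact: sum_const_le (ltW e2).
Qed.

Lemma hsum_swap (I J : eqType) (f : I * J -> C) s :
  hsum f s -> hsum (fun p : J * I => f (p.2, p.1)) s.
Proof.
by apply: (@hsum_bij _ _ (fun p : J * I => (p.2, p.1)) (fun p : I * J => (p.2, p.1))); case.
Qed.

Lemma absb_slice (I J : eqType) (f : I * J -> C) M i : absb f M -> absb (fun j => f (i, j)) M.
Proof. by move=> fM; apply: (bsum_inj (h := fun j => (i, j))) fM => a b [] ->. Qed.

(** The sums of moduli [m i] dominate the moduli of [t i], and Fubini for this nonnegative family
    shows that they add up to at most [M]. *)
Lemma absb_sum (I J : eqType) (f : I * J -> C) (t : I -> C) M :
  absb f M -> (forall i, hsum (fun j => f (i, j)) (t i)) -> absb t M.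
Proof.
move=> fM ht.
have mex i : exists m, hsum (fun j => rc (cabs (f (i, j)))) m.
  apply: (@hsum_ex _ _ M); have := absb_slice i fM.
  by apply: bsum_le => j; rewrite cabs_rc ger0_norm ?cabs_ge0.
have [m hm] := choice mex.
have [s s0 hs] := hsum_nonneg (fun p => cabs_ge0 (f p)) fM.
have hms := hsum_fubini hm hs.
have mE i : m i = rc (complex.Re (m i)) by exact: hsum_real (hm i).
have m0 i : 0 <= complex.Re (m i).
  by apply: (hsum_ge0 (g := fun j => cabs (f (i, j)))) => [j|]; rewrite ?cabs_ge0 // -mE.
have sM : s <= M.
  have := hsum_le hs (M := M); rewrite cabs_rc ger0_norm //; apply.
  by apply: bsum_le fM => p; rewrite cabs_rc ger0_norm ?cabs_ge0.
apply: (bsumW sM); apply: (@bsum_le _ _ (fun i => complex.Re (m i))).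
  move=> i; apply: (hsum_le (ht i)) => /=.
  apply: (hsum_bsum (g := fun j => cabs (f (i, j)))) => [j|]; rewrite ?cabs_ge0 // -mE.
  exact: hm.
apply: hsum_bsum => //; apply: hsum_ext hms => i; exact: mE.
Qed.

Lemma hsum_nat (f : nat -> C) s : hsum f s -> forall e, 0 < e ->
  exists N, forall n, (N <= n)%N -> cabs (\sum_(i < n) f i - s) < e.
Proof.
move=> hs e e0; have [F hF] := hs e e0; exists (\max_(i <- F) i).+1 => n hn.
have -> : \sum_(i < n) f i = \sum_(i <- iota 0 n) f i.
  by rewrite -(big_mkord xpredT f) /index_iota subn0.
apply: hF; first exact: iota_uniq.
by move=> i iF; rewrite mem_iota /= add0n (leq_ltn_trans _ hn) // leq_bigmax_seq.
Qed.

Lemma bsum_nat (g : nat -> R) M : (forall i, 0 <= g i) ->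
  (forall n, \sum_(i < n) g i <= M) -> bsum g M.
Proof.
move=> g0 h G uG; pose n := (\max_(i <- G) i).+1; apply: le_trans (h n).
have -> : \sum_(i < n) g i = \sum_(i <- iota 0 n) g i.
  by rewrite -(big_mkord xpredT g) /index_iota subn0.
apply: sum_subseq_le => //; first exact: iota_uniq.
by move=> i iF; rewrite mem_iota /= add0n ltnS leq_bigmax_seq.
Qed.

Lemma bsum_int (g : int -> R) M M' : (forall i, 0 <= g i) ->
  bsum (fun n : nat => g n%:Z) M -> bsum (fun n : nat => g (- n.+1%:Z)) M' -> bsum g (M + M').
Proof.
move=> g0 h h' G uG; pose n := (\max_(i <- G) `|i|%N).+1.
apply: le_trans (lerD (h _ (iota_uniq 0 n)) (h' _ (iota_uniq 0 n))).
rewrite -(big_map (fun n : nat => n%:Z) xpredT g) -(big_map (fun n : nat => - n.+1%:Z) xpredT g).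
rewrite -big_cat; apply: sum_subseq_le => //.
  rewrite cat_uniq !map_inj_uniq ?iota_uniq => [|i j|i j]; [|lia|lia].
  rewrite andbT andTb; apply/hasPn => i /mapP[j _ ->]; apply/mapP => -[k _]; lia.
move=> i iG; have : (`|i| < n)%N by rewrite ltnS; apply: leq_bigmax_seq.
rewrite mem_cat; case: (lerP 0 i) => i0 hi; apply/orP; [left|right]; apply/mapP.
  by exists `|i|%N; rewrite ?mem_iota //; lia.
by exists `|i|%N.-1; rewrite ?mem_iota; lia.
Qed.
End Sums.

(** * Riemann sums over the meshes [h Z] and their limit *)

Section Mesh.
Variable R : realType.
Local Notation C := R[i].

Definition tsum (I : eqType) (f : I -> C) : C := xget 0 [set s | hsum f s]%classic.

Lemma tsumP (I : eqType) (f : I -> C) M : absb f M -> hsum f (tsum f).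
Proof. by move=> /hsum_ex[s hs]; apply: (xgetPex 0); exists s. Qed.

Lemma tsum_eq (I : eqType) (f : I -> C) s : hsum f s -> tsum f = s.
Proof. by move=> hs; apply: (hsum_unique _ hs); apply: (xgetPex 0); exists s. Qed.

(** Its mesh sums are bounded by 8, uniformly in the shift and in [h <= 1]. The square [w2] is the
    decay required of integrands: it leaves one factor [w] to absorb [|x|] when a mesh is
    rescaled. *)
Definition w (x : R) : R := (1 + x ^+ 2)^-1.
Definition w2 (x : R) : R := w x ^+ 2.

Lemma w_den (x : R) : 0 < 1 + x ^+ 2.
Proof. by rewrite ltr_wpDr ?sqr_ge0. Qed.
Lemma w_gt0 x : 0 < w x. Proof. by rewrite invr_gt0 w_den. Qed.
Lemma w_ge0 x : 0 <= w x. Proof. exact: ltW (w_gt0 x). Qed.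
Lemma w_le1 x : w x <= 1.
Proof. by rewrite invf_le1 ?w_den // lerDl sqr_ge0. Qed.
Lemma w2_ge0 x : 0 <= w2 x. Proof. exact: sqr_ge0. Qed.
Lemma w2_le_w x : w2 x <= w x.
Proof. by rewrite /w2 expr2 ler_piMr ?w_ge0 ?w_le1. Qed.
Lemma w_shift x t : `|t| <= 1 -> w (x + t) <= 3 * w x.
Proof.
move=> t1; have t2 : t ^+ 2 <= 1 by rewrite -real_normK ?num_real // expr_le1.
rewrite /w ler_pdivlMr ?w_den // mulrC ler_pdivrMr ?w_den //.
have := sqr_ge0 (x + 2 * t); nra.
Qed.
Lemma w2_shift x t : `|t| <= 1 -> w2 (x + t) <= 9 * w2 x.
Proof.
move=> /w_shift h; have := h x; have := w_ge0 (x + t); have := w_ge0 x; rewrite /w2; nra.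
Qed.
Lemma xw_le x : 2 * `|x| * w x <= 1.
Proof.
rewrite /w ler_pdivrMr ?w_den // mul1r -[x ^+ 2]real_normK ?num_real //.
have := sqr_ge0 (`|x| - 1); nra.
Qed.
Lemma wN x : w (- x) = w x. Proof. by rewrite /w sqrrN. Qed.

(** Telescoping: for [h <= 1] each term [h * w z] is at most four times the decrement of
    [1 / (1 + x)] from [z] to [z + h]. *)
Lemma w_half_mesh (h y : R) : 0 < h <= 1 -> 0 <= y ->
  bsum (fun n : nat => h * w (y + n%:R * h)) 4.
Proof.
move=> /andP[h0 h1] y0; apply: bsum_nat => [i|n].
  by rewrite mulr_ge0 ?w_ge0 // ltW.
pose phi (x : R) := (1 + x)^-1.
suff : \sum_(i < n) h * w (y + i%:R * h) <= 4 * (phi y - phi (y + n%:R * h)).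
  move=> /le_trans; apply.
  have a1 : phi y <= 1 by rewrite invf_le1; lra.
  have a2 : 0 <= phi (y + n%:R * h).
    have := ler0n R n; rewrite invr_ge0; nra.
  lra.
elim: n => [|n IH]; first by rewrite big_ord0 mul0r addr0 subrr mulr0.
rewrite big_ord_recr /=.
set z := y + n%:R * h in IH *.
have z0 : 0 <= z by have := ler0n R n; rewrite /z; nra.
have -> : y + n.+1%:R * h = z + h by rewrite /z -natr1; ring.
have : h * w z <= 4 * (phi z - phi (z + h)).
  rewrite /phi; have -> : (1 + z)^-1 - (1 + (z + h))^-1 = h / ((1 + z) * (1 + (z + h))).
    by field; apply/andP; split; lra.
  rewrite mulrCA ler_wpM2l ?(ltW h0) // /w ler_pdivlMr ?mulr_gt0 //; try lra.
  rewrite [X in X <= _]mulrC ler_pdivrMr ?w_den //.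
  have := sqr_ge0 (z - 1).
  have : 0 <= (1 + z) * (1 - h) by rewrite mulr_ge0; lra.
  nra.
by move=> ?; lra.
Qed.

Lemma w_mesh (h x : R) : 0 < h <= 1 -> bsum (fun n : int => h * w (x + n%:~R * h)) 8.
Proof.
move=> h01; have /andP[h0 h1] := h01.
(* The shift is reduced modulo [h], so that the two half-lines start at the nonnegative points [y]
   and [h - y]. *)
pose m := Num.floor (x / h); pose y := x - m%:~R * h.
have y0 : 0 <= y by rewrite subr_ge0 -ler_pdivlMr // ge_floor.
have y1 : y <= h.
  have := floorD1_gt (x / h); rewrite -/m intrD ltr_pdivrMr // => hx.
  by rewrite /y; nra.
suff : bsum (fun n : int => h * w (y + n%:~R * h)) 8.
  move=> hy; have := bsum_inj (h := fun n : int => n + m) (@addIr _ m) hy; apply: bsum_le => n.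
  by rewrite intrD (_ : y + _ = x + n%:~R * h) // /y; ring.
rewrite (_ : 8 = 4 + 4); last by ring.
apply: bsum_int => [i||]; first by rewrite mulr_ge0 ?w_ge0 // ltW.
  exact: w_half_mesh.
have := @w_half_mesh h (h - y) h01; rewrite subr_ge0 => /(_ y1); apply: bsum_le => n.
rewrite -wN (_ : - (y + (- n.+1%:Z)%:~R * h) = h - y + n%:R * h) //.
by rewrite mulrNz -pmulrn -natr1; ring.
Qed.

(* Lipschitz functions with quadratic decay, for which [Itg] is the limit of [Sm h] as the mesh [h] tends to 0. *)
Definition wl (K : R) (f : R -> C) :=
  (forall x, cabs (f x) <= K * w2 x) /\
  (forall x h, `|h| <= 1 -> cabs (f (x + h) - f x) <= K * `|h| * w2 x).

Lemma wl_ge0 K f : wl K f -> 0 <= K.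
Proof.
move=> [/(_ 0) h _]; have := le_trans (cabs_ge0 _) h.
by rewrite pmulr_lge0 // exprn_gt0 // w_gt0.
Qed.

Definition Sm (h : R) (f : R -> C) : C := tsum (fun n : int => rc h * f (n%:~R * h)).

Lemma absb_mesh K f h x : 0 < h <= 1 -> (forall x, cabs (f x) <= K * w x) ->
  absb (fun n : int => rc h * f (x + n%:~R * h)) (K * 8).
Proof.
move=> h01 fK; have K0 : 0 <= K.
  have := le_trans (cabs_ge0 _) (fK 0); by rewrite pmulr_lge0 // w_gt0.
apply: bsum_le (bsumZ K0 (w_mesh x h01)) => n.
have /andP[h0 _] := h01.
by rewrite cabsM cabs_rc gtr0_norm // mulrCA ler_wpM2l ?(ltW h0).
Qed.

Lemma Sm_hsum K f h : 0 < h <= 1 -> (forall x, cabs (f x) <= K * w x) ->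
  hsum (fun n : int => rc h * f (n%:~R * h)) (Sm h f).
Proof.
move=> h01 fK; apply: (@tsumP _ _ (K * 8)).
by have := absb_mesh 0 h01 fK; apply: bsum_le => n; rewrite add0r.
Qed.

Lemma cabs_Sm_le K f h : 0 < h <= 1 -> (forall x, cabs (f x) <= K * w x) -> cabs (Sm h f) <= K * 8.
Proof.
move=> h01 fK; apply: (hsum_le (Sm_hsum h01 fK)).
by have := absb_mesh 0 h01 fK; apply: bsum_le => n; rewrite add0r.
Qed.

Lemma wl_w K f : wl K f -> forall x, cabs (f x) <= K * w x.
Proof.
by move=> fK x; rewrite (le_trans (fK.1 x)) // ler_wpM2l ?(wl_ge0 fK) ?w2_le_w.
Qed.

Lemma int_split (m : nat) (f : int -> C) s : (0 < m)%N -> hsum f s ->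
  hsum (fun p : int * 'I_m => f (p.1 * m%:Z + p.2%:Z)) s.
Proof.
move=> m0 hs.
have mz : (m%:Z != 0) by lia.
pose k (n : int) : int * 'I_m := ((n %/ m%:Z)%Z, Ordinal (ltn_pmod `|(n %% m%:Z)%Z|%N m0)).
apply: (@hsum_bij _ _ _ (fun p : int * 'I_m => p.1 * m%:Z + p.2%:Z) k) hs.
  move=> [a [b bm]]; rewrite /k /=; congr pair.
    by rewrite divzMDl // divz_small ?addr0 // normr_nat; lia.
  by apply: val_inj; rewrite /= modzMDl modz_small ?modn_small //=; lia.
move=> n; rewrite /k /= modn_small.
  have := divz_eq n m%:Z; have := modz_ge0 n mz; lia.
have := modz_ge0 n mz; have := ltz_mod n mz; lia.
Qed.

(** Each coarse mesh point is compared with the [m] fine points of its cell. The Lipschitz bound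
    makes every difference at most [K h w], and the mesh sum of [w] supplies the 8. *)
Lemma Sm_refine K f h m : 0 < h <= 1 -> (0 < m)%N -> wl K f ->
  cabs (Sm h f - Sm (h / m%:R) f) <= 8 * K * h.
Proof.
move=> h01 m0 fK; have /andP[h0 h1] := h01; have K0 := wl_ge0 fK.
have m0' : (0 : R) < m%:R by rewrite ltr0n.
have hm01 : 0 < h / m%:R <= 1.
  by rewrite divr_gt0 //= ler_pdivrMr // mul1r (le_trans h1) // ler1n.
have h2 := int_split m0 (Sm_hsum hm01 (wl_w fK)).
have h3 : forall n : int, hsum (fun j : 'I_m => rc (h / m%:R) * f ((n * m%:Z + j%:Z)%:~R * (h / m%:R)))
   (\sum_(j <- enum 'I_m) rc (h / m%:R) * f ((n * m%:Z + j%:Z)%:~R * (h / m%:R))).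
  by move=> n; apply: hsum_fin => [|j]; rewrite ?enum_uniq // mem_enum.
have h4 := hsumB (Sm_hsum h01 (wl_w fK)) (hsum_fubini h3 h2).
apply: (hsum_le h4); rewrite (_ : 8 * K * h = (K * h) * 8); last by ring.
apply: bsum_le (bsumZ (mulr_ge0 K0 (ltW h0)) (w_mesh 0 h01)) => n.
rewrite add0r -mulr_sumr.
have -> : rc h * f (n%:~R * h) - rc (h / m%:R) * \sum_(j <- enum 'I_m) f ((n * m%:Z + j%:Z)%:~R * (h / m%:R)) =
  rc (h / m%:R) * \sum_(j <- enum 'I_m) (f (n%:~R * h) - f (n%:~R * h + j%:R * (h / m%:R))).
  rewrite sumrB mulrBr; congr (_ - _).
    rewrite big_const_seq count_predT size_enum_ord iter_addr_0.
    rewrite -[X in _ = _ * X]mulr_natr -rc_nat mulrCA -rcM divfK ?gt_eqF //.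
    exact: mulrC.
  congr (_ * _); apply: eq_bigr => j _; congr f.
  rewrite intrD intrM -!pmulrn mulrDl; congr (_ + _); rewrite -mulrA; congr (_ * _).
  by rewrite mulrC divfK // gt_eqF.
rewrite cabsM cabs_rc gtr0_norm ?divr_gt0 //.
apply: (@le_trans _ _ (h / m%:R * \sum_(j <- enum 'I_m) (K * h * w (n%:~R * h)))).
  rewrite ler_wpM2l ?divr_ge0 ?(ltW h0) //.
  apply: (le_trans (cabs_sum _ _ _)); apply: ler_sum => j _.
  have j1 : `|j%:R * (h / m%:R)| <= h.
    rewrite ger0_norm ?mulr_ge0 ?divr_ge0 ?(ltW h0) // mulrCA -[X in _ <= X]mulr1.
    by rewrite ler_wpM2l ?(ltW h0) // ler_pdivrMr // mul1r ler_nat ltnW.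
  rewrite cabs_distC (le_trans (fK.2 _ _ _)) ?(le_trans j1) //.
  by rewrite -!mulrA ler_wpM2l // ler_pM ?normr_ge0 ?w2_ge0 ?w2_le_w.
rewrite big_const_seq count_predT size_enum_ord iter_addr_0 -[X in _ * X]mulr_natr.
have -> : h / m%:R * (K * h * w (n%:~R * h) * m%:R) = K * h * (h * w (n%:~R * h)).
  by field; rewrite gt_eqF.
exact: lexx.
Qed.

(** Rescaling displaces [x] by [x t], which grows with [x]. One factor of [w2] absorbs [|x|]; where
    [|x t| > 1] the sum of the two values is itself at most [K t w x]. *)
Lemma Sm_stretch K f h t : 0 < h -> h * (1 + t) <= 1 -> 0 <= t -> wl K f ->
  cabs (Sm (h * (1 + t)) f - Sm h f) <= 16 * K * t.
Proof.
move=> h0 ht1 t0 fK; have K0 := wl_ge0 fK.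
have h1 : h <= 1 by nra.
have h01 : 0 < h <= 1 by rewrite h0.
have ht01 : 0 < h * (1 + t) <= 1 by rewrite ht1 andbT; nra.
have h4 := hsumB (Sm_hsum ht01 (wl_w fK)) (Sm_hsum h01 (wl_w fK)).
apply: (hsum_le h4); rewrite (_ : 16 * K * t = (2 * (K * t)) * 8); last by ring.
apply: bsum_le (bsumZ (mulr_ge0 _ (mulr_ge0 K0 t0)) (w_mesh 0 h01)) => // n.
rewrite add0r; set x := n%:~R * h.
have -> : n%:~R * (h * (1 + t)) = x + x * t by rewrite /x; ring.
have -> : rc (h * (1 + t)) * f (x + x * t) - rc h * f x =
    rc h * (rc t * f (x + x * t)) + rc h * (f (x + x * t) - f x).
  by rewrite !rcM rcD rc1; ring.
rewrite -mulrDr cabsM cabs_rc gtr0_norm // mulrCA ler_wpM2l ?(ltW h0) //.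
have wx := w_ge0 x; have w1 := w_le1 x.
have wxt : w (x + x * t) <= w x.
  rewrite /w lef_pV2 ?posrE ?w_den // lerD2l; have := sqr_ge0 x; nra.
have a1 : cabs (rc t * f (x + x * t)) <= K * t * w x.
  rewrite cabsM cabs_rc ger0_norm // (_ : K * t * w x = t * (K * w x)); last by ring.
  by rewrite ler_wpM2l // (le_trans (wl_w fK _)) // ler_wpM2l.
have a2 : cabs (f (x + x * t) - f x) <= K * t * w x.
  have Kw : 0 <= K * t * w x by rewrite !mulr_ge0.
  have xw := xw_le x.
  have [xt|xt] := lerP `|x * t| 1.
    rewrite (le_trans (fK.2 _ _ xt)) // normrM (ger0_norm t0) /w2 expr2.
    have -> : K * (`|x| * t) * (w x * w x) = K * t * w x * (`|x| * w x) by ring.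
    have := normr_ge0 x; nra.
  rewrite (le_trans (cabsB _ _)) //.
  have h3 : cabs (f (x + x * t)) <= K * w x ^+ 2.
    rewrite (le_trans (fK.1 _)) // ler_wpM2l // /w2 ler_pXn2r ?nnegrE ?w_ge0 //.
  have h5 : cabs (f x) <= K * w x ^+ 2 by exact: fK.1.
  rewrite normrM (ger0_norm t0) in xt.
  suff : 2 * (K * w x ^+ 2) <= K * t * w x by lra.
  have : (K * w x ^+ 2) <= (K * w x ^+ 2) * (`|x| * t).
    by rewrite ler_peMr ?mulr_ge0 ?sqr_ge0 // ltW.
  have -> : (K * w x ^+ 2) * (`|x| * t) = K * t * w x * (`|x| * w x) by ring.
  nra.
rewrite (le_trans (cabsD _ _)) //; lra.
Qed.

(** The two meshes are refined to [h / m] and [h' / m'], whose ratio [1 + t] is as close to 1 as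
    desired. The stretching error is then at most [e], and the two refinement errors remain. *)
Lemma Sm_compare K f h h' : 0 < h <= 1 -> 0 < h' <= 1 -> wl K f ->
  cabs (Sm h f - Sm h' f) <= 8 * K * (h + h').
Proof.
move=> /andP[h0 h1] /andP[h0' h1'] fK; have K0 := wl_ge0 fK.
apply/ler_addgt0Pr => e e0.
(* [m'] exceeds [A], which makes the stretching error [16 K t] at most [e], and exceeds [h' / h],
   which gives [y >= 1]. *)
pose A := 16 * K * h' / (h * e).
have A0 : 0 <= A by rewrite !mulr_ge0 // ?invr_ge0 ?mulr_ge0 // ltW.
pose m' := (Num.truncn (A + h' / h + 1)).+1.
have m'0 : (0 : R) < m'%:R by rewrite ltr0n.
have m'A : A + h' / h + 1 < m'%:R by rewrite truncnS_gt.
pose y := h * m'%:R / h'; pose m := (Num.truncn y).+1.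
have hh0 : 0 <= h' / h by rewrite divr_ge0 // ltW.
have y1 : 1 <= y.
  rewrite /y ler_pdivlMr // mul1r mulrC -ler_pdivrMr //; lra.
have ym : y < m%:R by rewrite truncnS_gt.
have my : m%:R <= y + 1.
  by rewrite /m -natr1 lerD2r truncn_le // (le_trans ler01).
have m0 : (0 : R) < m%:R by rewrite ltr0n.
pose t := m%:R * h' / (h * m'%:R) - 1.
have tE : h / m%:R * (1 + t) = h' / m'%:R.
  by rewrite /t; field; rewrite !gt_eqF.
have t0 : 0 <= t.
  rewrite subr_ge0 ler_pdivlMr ?mulr_gt0 // mul1r -ler_pdivrMr //; exact: ltW.
have t1 : t <= h' / (h * m'%:R).
  rewrite /t lerBlDr ler_pdivrMr ?mulr_gt0 // mulrDl divfK ?mul1r ?mulf_neq0 ?gt_eqF //.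
  have : m%:R * h' <= (y + 1) * h' by rewrite ler_wpM2r // ltW.
  by rewrite mulrDl /y divfK ?gt_eqF //; lra.
have hm0 : 0 < h / m%:R by rewrite divr_gt0.
have hm1 : h / m%:R * (1 + t) <= 1.
  by rewrite tE ler_pdivrMr // mul1r (le_trans h1') // ler1n.
have r1 := @Sm_refine K f h m _ isT fK; have r2 := @Sm_refine K f h' m' _ isT fK.
have r3 := Sm_stretch hm0 hm1 t0 fK; rewrite tE in r3.
have {}r1 := r1 (introT andP (conj h0 h1)); have {}r2 := r2 (introT andP (conj h0' h1')).
have -> : Sm h f - Sm h' f = (Sm h f - Sm (h / m%:R) f) + (Sm (h / m%:R) f - Sm (h' / m'%:R) f)
  + (Sm (h' / m'%:R) f - Sm h' f) by ring.
rewrite (le_trans (cabsD _ _)) // (_ : _ + e = 8 * K * h + e + 8 * K * h'); last by ring.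
rewrite lerD //; last by rewrite cabs_distC.
rewrite (le_trans (cabsD _ _)) // lerD // cabs_distC (le_trans r3) //.
have : 16 * K * t <= 16 * K * (h' / (h * m'%:R)) by rewrite ler_wpM2l // mulr_ge0.
move=> /le_trans; apply.
rewrite mulrA ler_pdivrMr ?mulr_gt0 // mulrA -ler_pdivrMl ?mulr_gt0 // mulrC.
rewrite (_ : _ / _ = A); last by rewrite /A; congr (_ / _); ring.
by apply: ltW (le_lt_trans _ m'A); rewrite -addrA lerDl addr_ge0.
Qed.

Definition isI (f : R -> C) (s : C) := exists K h0 : R, 0 < h0 <= 1 /\
  forall h, 0 < h <= h0 -> cabs (Sm h f - s) <= K * h.

Definition Itg (f : R -> C) : C := xget 0 [set s | isI f s]%classic.

Lemma small_le (K h0 e : R) : 0 < h0 -> 0 < e -> exists2 h, 0 < h <= h0 & K * h <= e.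
Proof.
move=> h00 e0; have K1 : 0 < `|K| + 1 by rewrite ltr_wpDl.
exists (Num.min h0 (e / (`|K| + 1))).
  by rewrite lt_min h00 divr_gt0 //= ge_min lexx.
apply: (@le_trans _ _ ((`|K| + 1) * (e / (`|K| + 1)))); last by rewrite mulrC divfK ?gt_eqF.
apply: (@le_trans _ _ ((`|K| + 1) * Num.min h0 (e / (`|K| + 1)))).
  rewrite ler_wpM2r // ?le_min ?(ltW h00) ?divr_ge0 // ?(ltW e0) ?(ltW K1) //.
  by rewrite (le_trans (ler_norm _)) // lerDl.
by rewrite ler_wpM2l ?(ltW K1) // ge_min lexx orbT.
Qed.

Lemma isI_unique f s t : isI f s -> isI f t -> s = t.
Proof.
move=> [K [h0 [/andP[h00 h01] hs]]] [K' [h0' [/andP[h00' h01'] ht]]].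
apply/eqP; rewrite -subr_eq0 -cabs_eq0; apply/negPn/negP => n0.
have d0 : 0 < cabs (s - t) / 2 by rewrite divr_gt0 // lt_def n0 cabs_ge0.
have m0 : 0 < Num.min h0 h0' by rewrite lt_min h00.
have [h /andP[hp hm] hK] := small_le (K + K') m0 d0.
rewrite le_min in hm; have /andP[hm1 hm2] := hm.
have a1 : cabs (Sm h f - s) <= K * h by apply: hs; rewrite hp.
have a2 : cabs (Sm h f - t) <= K' * h by apply: ht; rewrite hp.
have : cabs (s - t) <= K * h + K' * h.
  rewrite -(subrKA (Sm h f)) (le_trans (cabsD _ _)) // lerD //.
  by rewrite cabs_distC.
have := cabs_ge0 (s - t); lra.
Qed.

Lemma Sm_Itg_le K f : wl K f -> forall h, 0 < h <= 1 -> cabs (Sm h f - Itg f) <= 16 * K * h.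
Proof.
move=> fK; have K0 := wl_ge0 fK.
(* The intervals of radius [8 K h] about the real (or imaginary) parts of [Sm h f] meet pairwise by
   [Sm_compare], hence have a common point. Adding the two parts doubles the constant to 16. *)
have nest (p : C -> R) : (forall a b, p (a - b) = p a - p b) -> (forall z, `|p z| <= cabs z) ->
    exists s, forall h, 0 < h <= 1 -> `|p (Sm h f) - s| <= 8 * K * h.
  move=> pB pa; pose E := [set x : R | exists2 h, 0 < h <= 1 & x = p (Sm h f) - 8 * K * h]%classic.
  have cmp h h' : 0 < h <= 1 -> 0 < h' <= 1 -> p (Sm h f) - 8 * K * h <= p (Sm h' f) + 8 * K * h'.
    move=> hh hh'; have := le_trans (pa _) (Sm_compare hh hh' fK).
    by rewrite pB => /ler_normlP[_]; lra.
  have h11 : 0 < (1 : R) <= 1 by rewrite ltr01 lexx.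
  have hE : has_sup E.
    split; first by exists (p (Sm 1 f) - 8 * K * 1), 1.
    by exists (p (Sm 1 f) + 8 * K * 1) => x [h hh ->]; exact: cmp.
  exists (sup E) => h hh; apply/ler_normlP; split.
    rewrite opprB lerBlDr; apply: ge_sup; first by case: hE.
    by move=> x [h' hh' ->]; rewrite [X in _ <= X]addrC; exact: cmp.
  rewrite lerBlDr addrC -lerBlDr; apply: ub_le_sup; first by case: hE.
  by exists h.
have [a ha] := nest _ (fun a b => (etrans (ReD a (- b)) (congr1 _ (ReN b)))) (@Re_le_cabs R).
have [b hb] := nest _ (fun a b => (etrans (ImD a (- b)) (congr1 _ (ImN b)))) (@Im_le_cabs R).
have hs h : 0 < h <= 1 -> cabs (Sm h f - Complex a b) <= 16 * K * h.
  move=> hh; rewrite (le_trans (cabs_le_ReIm _)) // ReD ImD ReN ImN /=.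
  have := ha h hh; have := hb h hh; lra.
have : isI f (Itg f).
  apply: (xgetPex 0); exists (Complex a b), (16 * K), 1; split; first by rewrite ltr01 lexx.
  exact: hs.
suff h1 : isI f (Complex a b) by move=> /(isI_unique h1) <-.
by exists (16 * K), 1; split; first by rewrite ltr01 lexx.
Qed.

Lemma isI_Itg K f : wl K f -> isI f (Itg f).
Proof. by move=> fK; exists (16 * K), 1; split; [rewrite ltr01 lexx|exact: Sm_Itg_le fK]. Qed.

Lemma isI_eq f s : isI f s -> Itg f = s.
Proof. by move=> hs; apply: isI_unique (hs); apply: (xgetPex 0); exists s. Qed.

End Mesh.

(** * Linearity, invariance and limit theorems for the integral [Itg] *)

Section Integral.
Variable R : realType.
Local Notation C := R[i].
Implicit Types (f g : R -> C) (K : R).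

Lemma wlD K K' f g : wl K f -> wl K' g -> wl (K + K') (fun x => f x + g x).
Proof.
move=> [f1 f2] [g1 g2]; split=> [x|x h h1].
  by rewrite mulrDl (le_trans (cabsD _ _)) // lerD.
rewrite !mulrDl opprD addrACA (le_trans (cabsD _ _)) // lerD //; [exact: f2|exact: g2].
Qed.

Lemma wlZ K f c : wl K f -> wl (cabs c * K) (fun x => c * f x).
Proof.
move=> [f1 f2]; split=> [x|x h h1].
  by rewrite cabsM -mulrA ler_wpM2l ?cabs_ge0.
by rewrite -mulrBr cabsM -!mulrA ler_wpM2l ?cabs_ge0 // mulrA f2.
Qed.

Lemma wl_trans K f t : `|t| <= 1 -> wl K f -> wl (9 * K) (fun x => f (x + t)).
Proof.
move=> t1 fK; have K0 := wl_ge0 fK; split=> [x|x h h1].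
  rewrite (le_trans (fK.1 _)) // (_ : 9 * K * w2 x = K * (9 * w2 x)); last by ring.
  by rewrite ler_wpM2l // w2_shift.
rewrite addrAC (le_trans (fK.2 _ _ h1)) //.
rewrite (_ : 9 * K * `|h| * w2 x = K * `|h| * (9 * w2 x)); last by ring.
by rewrite ler_wpM2l ?mulr_ge0 // w2_shift.
Qed.

Lemma SmD K K' f g h : 0 < h <= 1 -> wl K f -> wl K' g ->
  Sm h (fun x => f x + g x) = Sm h f + Sm h g.
Proof.
move=> h01 fK gK; apply: tsum_eq.
apply: hsum_ext (hsumD (Sm_hsum h01 (wl_w fK)) (Sm_hsum h01 (wl_w gK))) => n.
by rewrite mulrDr.
Qed.

Lemma SmZ K f c h : 0 < h <= 1 -> wl K f -> Sm h (fun x => c * f x) = c * Sm h f.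
Proof.
move=> h01 fK; apply: tsum_eq; apply: hsum_ext (hsumZ c (Sm_hsum h01 (wl_w fK))) => n.
by rewrite mulrCA.
Qed.

Lemma ItgD K K' f g : wl K f -> wl K' g -> Itg (fun x => f x + g x) = Itg f + Itg g.
Proof.
move=> fK gK; apply: isI_eq; exists (16 * K + 16 * K'), 1; split; first by rewrite ltr01 lexx.
move=> h h01; rewrite (SmD h01 fK gK) opprD addrACA (le_trans (cabsD _ _)) //.
by rewrite mulrDl lerD //; [exact: Sm_Itg_le fK _ h01|exact: Sm_Itg_le gK _ h01].
Qed.

Lemma ItgZ K f c : wl K f -> Itg (fun x => c * f x) = c * Itg f.
Proof.
move=> fK; apply: isI_eq; exists (cabs c * (16 * K)), 1; split; first by rewrite ltr01 lexx.
move=> h h01; rewrite (SmZ c h01 fK) -mulrBr cabsM -mulrA ler_wpM2l ?cabs_ge0 //.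
exact: Sm_Itg_le fK _ h01.
Qed.

Lemma ItgB K K' f g : wl K f -> wl K' g -> Itg (fun x => f x - g x) = Itg f - Itg g.
Proof.
move=> fK gK; have := ItgD fK (wlZ (-1) gK); rewrite (ItgZ _ gK) mulN1r => <-.
by congr Itg; apply/funext => x; rewrite mulN1r.
Qed.

Lemma Itg_le K K' f : wl K f -> (forall x, cabs (f x) <= K' * w x) -> cabs (Itg f) <= K' * 8.
Proof.
move=> fK fK'; apply/ler_addgt0Pr => e e0.
have [h hh hK] := small_le (16 * K) ltr01 e0.
rewrite -[Itg f](subKr (Sm h f)) (le_trans (cabsB _ _)) // lerD ?(cabs_Sm_le hh) //.
exact: le_trans (Sm_Itg_le fK hh) hK.
Qed.

Lemma Itg_ge0 K (g : R -> R) : wl K (fun x => rc (g x)) -> (forall x, 0 <= g x) ->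
  exists2 s, 0 <= s & Itg (fun x => rc (g x)) = rc s.
Proof.
move=> gK g0; have Sr h : 0 < h <= 1 -> exists2 s : R, 0 <= s & Sm h (fun x => rc (g x)) = rc s.
  move=> h01; have /andP[h0 _] := h01; have := Sm_hsum h01 (wl_w gK).
  move=> hs0; have hs : hsum (fun n : int => rc (h * g (n%:~R * h))) (Sm h (fun x => rc (g x))).
    by apply: hsum_ext hs0 => n; rewrite rcM.
  have sE := hsum_real hs.
  exists (complex.Re (Sm h (fun x => rc (g x)))) => //.
  apply: (@hsum_ge0 _ _ (fun n : int => h * g (n%:~R * h))) => [n|]; last by rewrite -sE.
  by rewrite mulr_ge0 // ltW.
pose s := Itg (fun x => rc (g x)).
have Im0 : complex.Im s = 0.
  apply/eqP; rewrite -normr_eq0; apply/negPn/negP => n0.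
  have d0 : 0 < `|complex.Im s| / 2 by rewrite divr_gt0 // lt_def n0 normr_ge0.
  have [h hh hK] := small_le (16 * K) ltr01 d0; have [r _ rE] := Sr _ hh.
  have := le_trans (Im_le_cabs _) (le_trans (Sm_Itg_le gK hh) hK).
  rewrite rE ImD ImN /= sub0r normrN -/s; have := normr_ge0 (complex.Im s).
  move: d0; lra.
exists (complex.Re s); last by apply: complexP; rewrite //= -/s Im0.
rewrite leNgt; apply/negP => s0.
have d0 : 0 < - complex.Re s / 2 by rewrite divr_gt0 // oppr_gt0.
have [h hh hK] := small_le (16 * K) ltr01 d0; have [r r0 rE] := Sr _ hh.
have := le_trans (Re_le_cabs _) (le_trans (Sm_Itg_le gK hh) hK).
by rewrite rE ReD ReN /= -/s => /ler_normlP[_]; lra.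
Qed.

Lemma Sm_mesh_trans K f h (n : int) : 0 < h <= 1 -> wl K f ->
  Sm h (fun x => f (x + n%:~R * h)) = Sm h f.
Proof.
move=> h01 fK; apply: tsum_eq.
have := hsum_bij (@addrK _ n) (@subrK _ n) (Sm_hsum h01 (wl_w fK)).
by apply: hsum_ext => m; rewrite intrD mulrDl.
Qed.

Lemma Itg_trans K f t : wl K f -> Itg (fun x => f (x + t)) = Itg f.
Proof.
move=> fK; have K0 := wl_ge0 fK; apply: isI_eq; exists (16 * K + 8 * K), 1.
split; first by rewrite ltr01 lexx.
move=> h h01; have /andP[h0 h1] := h01.
(* Translation by a multiple of the mesh leaves the Riemann sum unchanged; the remainder [s] lies
   between 0 and [h] and costs a Lipschitz error of order [h]. *)
pose n := Num.floor (t / h); pose s := t - n%:~R * h.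
have s0 : 0 <= s by rewrite subr_ge0 -ler_pdivlMr // ge_floor.
have s1 : s <= h.
  by have := floorD1_gt (t / h); rewrite -/n intrD ltr_pdivrMr // /s; nra.
have sn : `|s| <= 1 by rewrite ger0_norm // (le_trans s1).
have gK := wl_trans sn fK.
have -> : (fun x => f (x + t)) = (fun x => (fun y => f (y + s)) (x + n%:~R * h)).
  by apply/funext => x; congr f; rewrite /s; ring.
rewrite (Sm_mesh_trans n h01 gK).
rewrite -(subrKA (Sm h f)) (le_trans (cabsD _ _)) // mulrDl addrC lerD //.
  exact: Sm_Itg_le fK _ h01.
apply: (hsum_le (hsumB (Sm_hsum h01 (wl_w gK)) (Sm_hsum h01 (wl_w fK)))).
rewrite (_ : 8 * K * h = K * h * 8); last by ring.
apply: bsum_le (bsumZ (mulr_ge0 K0 (ltW h0)) (w_mesh 0 h01)) => m.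
rewrite add0r -mulrBr cabsM cabs_rc gtr0_norm // mulrCA ler_wpM2l ?(ltW h0) //.
rewrite (le_trans (fK.2 _ _ sn)) // -!mulrA ler_wpM2l // ger0_norm //.
by rewrite ler_pM ?w2_ge0 ?w2_le_w.
Qed.

Lemma Itg_scale K f c : 0 < c -> wl K f -> Itg (fun x => f (c * x)) = rc c^-1 * Itg f.
Proof.
move=> c0 fK; have K0 := wl_ge0 fK; apply: isI_eq; exists (16 * K), (Num.min 1 c^-1); split.
  by rewrite lt_min ltr01 invr_gt0 c0 ge_min lexx.
move=> h /andP[h0]; rewrite le_min => /andP[h1 hc].
have ch : 0 < c * h <= 1 by rewrite mulr_gt0 //= -ler_pdivlMl // mulr1.
have -> : Sm h (fun x => f (c * x)) = rc c^-1 * Sm (c * h) f.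
  apply: tsum_eq; apply: hsum_ext (hsumZ (rc c^-1) (Sm_hsum ch (wl_w fK))) => n.
  rewrite mulrA -rcM mulKf ?gt_eqF //; congr (_ * f _); ring.
rewrite -mulrBr cabsM cabs_rc gtr0_norm ?invr_gt0 //.
rewrite mulrC ler_pdivrMr // (le_trans (Sm_Itg_le fK ch)) //; lra.
Qed.

(* Dominated convergence at [0+] for a family indexed by a positive real. *)
Lemma Itg_dct K (f : R -> R -> C) g (d0 : R) : 0 < d0 ->
  (forall t, 0 < t < d0 -> wl K (f t)) -> wl K g ->
  (forall x e, 0 < e -> exists2 d, 0 < d & forall t, 0 < t < d -> cabs (f t x - g x) <= e) ->
  forall e, 0 < e -> exists2 d, 0 < d & forall t, 0 < t < d -> cabs (Itg (f t) - Itg g) <= e.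
Proof.
move=> d00 fK gK fg e e0; have K0 := wl_ge0 gK.
have e3 : 0 < e / 3 by rewrite divr_gt0.
have [h hh hK] := small_le (16 * K) ltr01 e3; have /andP[h0 h1] := hh.
have w0 n : 0 <= K * (h * w (0 + n%:~R * h)) :> R.
  by rewrite !mulr_ge0 ?w_ge0 // ltW.
have [F [d dp hF]] := tannery (e := e / 3) w0 (bsumZ K0 (w_mesh 0 hh)) e3.
have dh : 0 < d / h by rewrite divr_gt0.
have ex n : exists D, 0 < D /\ forall t, 0 < t < D -> cabs (f t (n%:~R * h) - g (n%:~R * h)) <= d / h.
  by have [D D0 hD] := fg (n%:~R * h) _ dh; exists D.
have [D hD] := choice (fun n : int => ex n).
have [D0 D00 hD0] : exists2 D0, 0 < D0 & forall n, n \in F -> D0 <= D n.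
  elim: F {hF} => [|n F [D0 D00 IH]]; first by exists 1.
  exists (Num.min D0 (D n)); first by rewrite lt_min D00 (hD n).1.
  move=> m; rewrite inE => /predU1P[->|/IH hm]; first by rewrite ge_min lexx orbT.
  by rewrite ge_min hm.
exists (Num.min D0 d0); first by rewrite lt_min D00.
move=> t /andP[t0]; rewrite lt_min => /andP[tD td].
have ftK : wl K (f t) by apply: fK; rewrite t0.
have h2 := hF _ _ _ _ (Sm_hsum hh (wl_w ftK)) (Sm_hsum hh (wl_w gK)).
have -> : Itg (f t) - Itg g = (Itg (f t) - Sm h (f t)) + (Sm h (f t) - Sm h g) + (Sm h g - Itg g).
  by ring.
have -> : e = e / 3 + e / 3 + e / 3 by field.
rewrite (le_trans (cabsD _ _)) // lerD //; last exact: le_trans (Sm_Itg_le gK hh) hK.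
rewrite (le_trans (cabsD _ _)) // lerD //.
  rewrite cabs_distC; exact: le_trans (Sm_Itg_le ftK hh) hK.
have bd (u : R -> C) : wl K u -> forall n : int, cabs (rc h * u (n%:~R * h)) <= K * (h * w (0 + n%:~R * h)).
  move=> uK n; rewrite add0r cabsM cabs_rc gtr0_norm // mulrCA ler_wpM2l ?(ltW h0) //.
  exact: wl_w uK _.
apply: h2 => [n|n|n nF]; [exact: bd|exact: bd|].
rewrite -mulrBr cabsM cabs_rc gtr0_norm // mulrC -ler_pdivlMr //.
by apply: (hD n).2; rewrite t0 (lt_le_trans tD) // hD0.
Qed.

(** Summation commutes with [Sm h] exactly, by Fubini. Dominated convergence, with the family
    [m n * 8], carries the identity to the limit in [h]. *)
Lemma Itg_series (f : int -> R -> C) (k : int -> R) (m : int -> R) M g K :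
  (forall n, wl (k n) (f n)) -> (forall n x, cabs (f n x) <= m n * w x) -> bsum m M ->
  wl K g -> (forall x, hsum (fun n => f n x) (g x)) -> hsum (fun n => Itg (f n)) (Itg g).
Proof.
move=> fk fm mM gK fg.
have m0 n : 0 <= m n.
  have := le_trans (cabs_ge0 _) (fm n 0); by rewrite pmulr_lge0 // w_gt0.
have Sf h : 0 < h <= 1 -> hsum (fun n => Sm h (f n)) (Sm h g).
  move=> hh; have /andP[h0 h1] := hh.
  pose F (p : int * int) := rc h * f p.1 (p.2%:~R * h).
  have aF : absb F (M * 8).
    apply: bsum_le (bsum_mul m0 _ mM (w_mesh 0 hh)) => [[n j]|j].
      rewrite /F /= add0r cabsM cabs_rc gtr0_norm // mulrCA ler_wpM2l ?(ltW h0) //.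
    by rewrite mulr_ge0 ?w_ge0 // ltW.
  have [s hs] := hsum_ex aF.
  have h1' n : hsum (fun j => F (n, j)) (Sm h (f n)).
    exact: Sm_hsum hh (fm n).
  have h2' (j : int) : hsum (fun n => F (n, j)) (rc h * g (j%:~R * h)).
    by have := hsumZ (rc h) (fg (j%:~R * h)); apply: hsum_ext.
  have a1 := hsum_fubini h1' hs; have a2 := hsum_fubini h2' (hsum_swap hs).
  by rewrite /Sm (tsum_eq a2).
have mM8 : bsum (fun n => m n * 8) (M * 8).
  by rewrite mulrC; apply: bsum_le (bsumZ (ler0n R 8) mM) => n; rewrite mulrC.
have aI : absb (fun n => Itg (f n)) (M * 8).
  by apply: bsum_le mM8 => n; exact: Itg_le (fk n) (fm n).
have [s hs] := hsum_ex aI; suff -> : Itg g = s by [].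
apply/eqP; rewrite -subr_eq0 -cabs_eq0; apply/negPn/negP => n0.
have e0 : 0 < cabs (Itg g - s) / 3 by rewrite divr_gt0 // lt_def n0 cabs_ge0.
have m8 n : 0 <= m n * 8 by rewrite mulr_ge0.
have [F [d dp hF]] := tannery m8 mM8 e0.
have [h0 /andP[h00 h01] hh0] : exists2 h0, 0 < h0 <= 1 & forall n, n \in F -> 16 * k n * h0 <= d.
  elim: F {hF} => [|n F [h0 /andP[h00 h01] IH]]; first by exists 1; rewrite ?ltr01 ?lexx.
  have [h /andP[hp hl] hK] := small_le (16 * k n) h00 dp.
  exists h; first by rewrite hp (le_trans hl).
  move=> j; rewrite inE => /predU1P[->//|/IH hj].
  by rewrite (le_trans _ hj) // ler_wpM2l // mulr_ge0 // (wl_ge0 (fk j)).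
have [h /andP[hp hl] hK] := small_le (16 * K) h00 e0.
have hh : 0 < h <= 1 by rewrite hp (le_trans hl).
have a1 : cabs (Sm h g - s) <= cabs (Itg g - s) / 3.
  apply: (hF _ _ _ _ (Sf h hh) hs) => [n|n|n nF].
  - exact: cabs_Sm_le hh (fm n).
  - exact: Itg_le (fk n) (fm n).
  - rewrite (le_trans (Sm_Itg_le (fk n) hh)) // (le_trans _ (hh0 n nF)) //.
    by rewrite ler_wpM2l // mulr_ge0 // (wl_ge0 (fk n)).
have a2 := le_trans (Sm_Itg_le gK hh) hK.
have tri : cabs (Itg g - s) <= cabs (Sm h g - Itg g) + cabs (Sm h g - s).
  by rewrite [cabs (Sm h g - Itg g)]cabs_distC -(subrKA (Sm h g) (Itg g)) cabsD.
have := le_trans tri (lerD a2 a1).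
move: e0; lra.
Qed.

End Integral.

(** * Fourier inversion at a point from the finite Fourier transform *)

Section FourierInversion.
Variable R : realType.
Local Notation C := R[i].

Lemma mvt_global (f f' : R -> R) (a b : R) : (forall x : R, is_derive x (1 : R) f (f' x)) -> a <= b ->
  exists2 c, a <= c <= b & f b - f a = f' c * (b - a).
Proof.
move=> df ab; have [|c cab] := @MVT_segment _ f f' _ _ ab (fun x _ => df x).
  by apply: derivable_within_continuous => x _; have dfx := df x; exact: ex_derive.
by move=> E; exists c => //; move: cab; rewrite in_itv.
Qed.

Lemma sin_le_id (x : R) : 0 <= x -> sin x <= x.
Proof.
move=> x0; have [c _] := mvt_global (@is_derive_sin R) x0.
rewrite sin0 !subr0 => ->; rewrite ler_piMl // cos_le1.
Qed.

Lemma sin_ge_quarter (x : R) : 0 <= x <= pi / 2 -> x / 4 <= sin x.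
Proof.
move=> /andP[x0 x1].
have low (y : R) : 0 <= y <= 1 -> y / 2 <= sin y.
  move=> /andP[y0 y1]; have [c /andP[c0 cy]] := mvt_global (@is_derive_sin R) y0.
  rewrite sin0 !subr0 => ->; rewrite mulrC ler_wpM2r //.
  have -> : cos c = cos ((c / 2) *+ 2) by congr cos; rewrite -mulr_natr divfK.
  rewrite cos_mulr2n cos2sin2.
  have c2 : 0 <= c / 2 by rewrite divr_ge0.
  have h1 := sin_le_id c2.
  have h2 : 0 <= sin (c / 2).
    by rewrite sin_ge0_pi // c2 /=; have := @pi_ge2 R; lra.
  have : sin (c / 2) ^+ 2 <= (c / 2) ^+ 2 by rewrite ler_pXn2r.
  nra.
have [x2|x2] := lerP x 1; first by have := low x; rewrite x0 x2 => /(_ isT); lra.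
have h1 := low 1; rewrite ler01 lexx in h1; have {}h1 := h1 isT.
have h2 : sin 1 <= sin x.
  by apply: ltW; rewrite ltr_sin // in_itv /=; apply/andP; split; have := @pihalf_ge1 R; lra.
have := @pihalf_lt2 R; lra.
Qed.

Lemma one_cos_ge (x : R) : `|x| <= pi -> x ^+ 2 / 32 <= 1 - cos x.
Proof.
move=> xpi; rewrite -cos_norm -[x ^+ 2]real_normK ?num_real //.
move: `|x| (normr_ge0 x) xpi => y y0 yp.
have -> : cos y = cos ((y / 2) *+ 2) by congr cos; rewrite -mulr_natr divfK.
rewrite cos_mulr2n cos2sin2.
have h : 0 <= y / 2 <= pi / 2 by rewrite divr_ge0 //= ler_pM2r.
have := sin_ge_quarter h; move: (sin _) => s hs.
have : (y / 2 / 4) ^+ 2 <= s ^+ 2 by rewrite ler_pXn2r ?nnegrE //; lra.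
lra.
Qed.

(** The left-hand factor arises when a second difference of step h acts on the Fourier coefficient
    of frequency n, with x = n h. The bound turns smoothness into decay of order n^-2. *)
Lemma ce_two_sub (x : R) : `|x| <= 1 / 2 -> x ^+ 2 <= cabs (ce x + ce (- x) - 2).
Proof.
move=> x2; apply: le_trans (Re_le_cabs _).
have -> : complex.Re (ce x + ce (- x) - 2) = - (2 * (1 - cos (2 * pi * x))).
  by rewrite !ceE -rc_nat !ReD ReN /= mulrN cosN; ring.
rewrite normrN ger0_norm; last by rewrite mulr_ge0 // subr_ge0 cos_le1.
have pi2 := @pi_ge2 R.
have h : `|2 * pi * x| <= pi.
  rewrite normrM ger0_norm; last by lra.
  by have := normr_ge0 x; nra.
have := one_cos_ge h; rewrite !exprMn.
have : 4 <= pi ^+ 2 :> R by nra.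
have := sqr_ge0 x; nra.
Qed.

Lemma ce_neq1 (x : R) : 0 < x < 1 -> ce x != 1.
Proof.
move=> /andP[x0 x1]; apply/eqP; rewrite ceE => -[h _].
have : 0 < sin (pi * x).
  by rewrite sin_gt0_pi // mulr_gt0 ?pi_gt0 //= -[X in _ < X]mulr1 ltr_pM2l ?pi_gt0.
have : cos ((pi * x) *+ 2) = 1 by rewrite -h; congr cos; rewrite -mulr_natr; ring.
rewrite cos_mulr2n cos2sin2; nra.
Qed.

Definition Pm (M : nat) (phi : R -> C) : C :=
  rc (M%:R)^-1 * \sum_(j < M) phi (j%:R / M%:R).

Lemma Pm_le M phi B : (forall x, cabs (phi x) <= B) -> cabs (Pm M phi) <= B.
Proof.
move=> hB; have B0 := le_trans (cabs_ge0 _) (hB 0).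
rewrite cabsM cabs_rc ger0_norm ?invr_ge0 ?ler0n //.
case: M => [|M]; first by rewrite invr0 mul0r.
rewrite mulrC ler_pdivrMr ?ltr0n // (le_trans (cabs_sum _ _ _)) //.
apply: (@le_trans _ _ (\sum_(j < M.+1) B)); first exact: ler_sum.
by rewrite big_const_ord iter_addr_0 mulr_natr.
Qed.

Lemma Pm_shift M (psi : R -> C) : (forall x, psi (x + 1) = psi x) ->
  Pm M (fun x => psi (x + M%:R^-1)) = Pm M psi.
Proof.
case: M => [|M] per; first by rewrite /Pm !big_ord0.
rewrite /Pm; congr (_ * _).
rewrite big_ord_recr [RHS]big_ord_recl /= addrC; congr (_ + _).
  rewrite mul0r -[RHS]per add0r; congr psi.
  by rewrite -[X in _ + X]mul1r -mulrDl natr1 mulfV // pnatr_eq0.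
by apply: eq_bigr => j _; congr psi; rewrite /= -[X in _ + X]mul1r -mulrDl natr1.
Qed.

Lemma PmD M f g : Pm M (fun x => f x + g x) = Pm M f + Pm M g.
Proof. by rewrite /Pm big_split mulrDr. Qed.
Lemma PmZ M c f : Pm M (fun x => c * f x) = c * Pm M f.
Proof. by rewrite /Pm -mulr_sumr mulrCA. Qed.

Definition Fh (phi : R -> C) M (n : int) : C := Pm M (fun x => phi x * ce (- n%:~R * x)).

(** Exact inversion on a cyclic group of odd order 2 m + 1: the frequencies -m, ..., m form a
    complete residue system, so the geometric sums at the nonzero points vanish. *)
Lemma Fh_sum phi m : \sum_(i < m.*2.+1) Fh phi m.*2.+1 (i%:Z - m%:Z) = phi 0.
Proof.
set M := m.*2.+1; have M0 : M%:R != 0 :> R by rewrite pnatr_eq0.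
rewrite /Fh /Pm -mulr_sumr exchange_big /=.
rewrite (eq_bigr (fun j : 'I_M => if j == ord0 then rc M%:R * phi 0 else 0)).
  by rewrite -big_mkcond /= big_pred1_eq mulrA -rcM mulVf // mul1r.
move=> j _; rewrite -mulr_sumr; case: eqP => [->|/eqP j0].
  rewrite /= mul0r (eq_bigr (fun=> 1)); last by move=> i _; rewrite mulr0 ce0.
  by rewrite big_const_ord iter_addr_0 -rc_nat mulrC.
have jM : 0 < (j%:R / M%:R : R) < 1.
  rewrite divr_gt0 ?ltr0n ?lt0n //= ltr_pdivrMr ?ltr0n // mul1r ltr_nat //.
set z := ce (- (j%:R / M%:R) : R).
have zM : z ^+ M = 1.
  rewrite /z -ceMn (_ : _ *+ M = (- j%:Z)%:~R) ?ce_int //.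
  by rewrite -[LHS]mulr_natr mulNr divfK // mulrNz -pmulrn.
have z1 : z - 1 != 0.
  rewrite subr_eq0 /z ceN; apply/eqP => /(congr1 (fun x => x^-1)); rewrite invrK invr1.
  by apply/eqP; exact: ce_neq1.
rewrite (eq_bigr (fun i : 'I_M => ce (m%:R * (j%:R / M%:R)) * z ^+ i)).
  have := subrX1 z M; rewrite zM subrr => /esym/eqP; rewrite mulf_eq0 (negbTE z1) /= => /eqP zs.
  by rewrite -mulr_sumr zs !mulr0.
by move=> i _; rewrite /z -ceMn -ceD; congr ce; rewrite -mulr_natr intrB -!pmulrn; ring.
Qed.

(** A shift by [1 / M] multiplies a discrete coefficient by a phase, so the second difference of
    that step has coefficient [(u + 1/u - 2) * Fh]. Its modulus is at most [K / M^2], while the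
    factor is at least (n / M)^2 because |n / M| <= 1/2. *)
Lemma Fh_le (phi : R -> C) K (m : nat) (n : int) : (forall x, phi (x + 1) = phi x) ->
  (forall x h, 0 <= h <= 1 -> cabs (phi (x + h) + phi (x - h) - phi x - phi x) <= K * h ^+ 2) ->
  n != 0 -> (`|n| <= m)%N -> cabs (Fh phi m.*2.+1 n) <= K / n%:~R ^+ 2.
Proof.
move=> per hK n0 nm; set M := m.*2.+1.
have M0 : (0 : R) < M%:R by rewrite ltr0n.
have nR : n%:~R != 0 :> R by rewrite intr_eq0.
pose psi x := phi x * ce (- n%:~R * x).
have psiper x : psi (x + 1) = psi x.
  by rewrite /psi per mulrDr mulr1 -mulrNz ceDint.
pose u := ce (n%:~R / M%:R : R); pose h : R := M%:R^-1.
have E : Pm M (fun x => (phi (x + h) + phi (x - h) - phi x - phi x) * ce (- n%:~R * x)) =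
   (u + ce (- (n%:~R / M%:R)) - 2) * Fh phi M n.
  have -> : (fun x => (phi (x + h) + phi (x - h) - phi x - phi x) * ce (- n%:~R * x)) =
     (fun x => (u * psi (x + h) + ce (- (n%:~R / M%:R)) * psi (x - h)) + (-2) * psi x).
    apply/funext => x; rewrite /psi /u.
    rewrite (mulrCA (ce _) (phi (x + h))) -ceD (mulrCA (ce _) (phi (x - h))) -ceD.
    rewrite (_ : n%:~R / M%:R + - n%:~R * (x + h) = - n%:~R * x); last by rewrite /h; ring.
    rewrite (_ : - (n%:~R / M%:R) + - n%:~R * (x - h) = - n%:~R * x); last by rewrite /h; ring.
    by ring.
  rewrite !PmD !PmZ Pm_shift //.
  have -> : Pm M (fun x => psi (x - h)) = Pm M psi.
    rewrite -[LHS]Pm_shift; last by move=> x; rewrite addrAC psiper.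
    by congr Pm; apply/funext => x; rewrite /h addrK.
  by rewrite -/psi /Fh -/psi; ring.
have K0 : 0 <= K.
  have := hK 0 1; rewrite ler01 lexx => /(_ isT); rewrite expr1n mulr1; exact: le_trans (cabs_ge0 _).
have nM : `|n%:~R / M%:R : R| <= 1 / 2.
  rewrite normrM normfV (gtr0_norm M0) ler_pdivrMr // -intr_norm -[`|n|]abszE -pmulrn.
  rewrite mulrC mulrA mulr1 ler_pdivlMr // -natrM ler_nat /M; lia.
have h01 : 0 <= h <= 1 by rewrite invr_ge0 ltW //= invf_le1 // ler1n.
have B : cabs (Pm M (fun x => (phi (x + h) + phi (x - h) - phi x - phi x) * ce (- n%:~R * x))) <= K * h ^+ 2.
  by apply: Pm_le => x; rewrite cabsM cabs_ce mulr1; exact: hK.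
rewrite E cabsM in B.
have n2 : (0 : R) < n%:~R ^+ 2 by rewrite lt_def sqrf_eq0 nR sqr_ge0.
rewrite ler_pdivlMr // mulrC.
have : (n%:~R / M%:R) ^+ 2 * cabs (Fh phi M n) <= K * h ^+ 2.
  by apply: le_trans B; rewrite ler_wpM2r ?cabs_ge0 // ce_two_sub.
rewrite exprMn -/h mulrAC; rewrite ler_pM2r // exprn_gt0 // invr_gt0 //.
Qed.

(** Finite inversion holds for every odd order, and [Fh_le] bounds the coefficients of all orders by
    one summable family [g]. Dominated convergence replaces them by their limits [c]. *)
Lemma fourier_inversion (phi : R -> C) (c : int -> C) (K B : R) :
  (forall x, phi (x + 1) = phi x) -> (forall x, cabs (phi x) <= B) ->
  (forall x h, 0 <= h <= 1 -> cabs (phi (x + h) + phi (x - h) - phi x - phi x) <= K * h ^+ 2) ->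
  (forall n e, 0 < e -> exists N, forall M, (N <= M)%N -> cabs (Fh phi M n - c n) <= e) ->
  absb c ((2 * K + B) * 8) /\ hsum c (phi 0).
Proof.
move=> per hB hK hc.
have K0 : 0 <= K.
  have := hK 0 1; rewrite ler01 lexx => /(_ isT); rewrite expr1n mulr1; exact: le_trans (cabs_ge0 _).
have B0 := le_trans (cabs_ge0 _) (hB 0).
pose g (n : int) := (2 * K + B) * w (n%:~R : R).
have KB0 : 0 <= 2 * K + B by rewrite addr_ge0 // mulr_ge0.
have g0 n : 0 <= g n by rewrite mulr_ge0 ?w_ge0.
have gM : bsum g ((2 * K + B) * 8).
  have := bsumZ KB0 (@w_mesh R 1 0 _); rewrite ltr01 lexx => /(_ isT).
  by apply: bsum_le => n; rewrite mul1r add0r mulr1.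
have Fg m n : (`|n| <= m)%N -> cabs (Fh phi m.*2.+1 n) <= g n.
  move=> nm; have [->|n0] := eqVneq n 0.
    rewrite /g /w expr0n /= addr0 invr1 mulr1 (le_trans (Pm_le _ _) (y := B)) //.
      by move=> x; rewrite cabsM cabs_ce mulr1.
    by rewrite lerDr mulr_ge0.
  apply: le_trans (Fh_le per hK n0 nm) _.
  have nR : n%:~R != 0 :> R by rewrite intr_eq0.
  have n2 : (1 : R) <= n%:~R ^+ 2.
    rewrite -[n%:~R ^+ 2]real_normK ?num_real // expr_ge1 // -intr_norm.
    by rewrite (ler_int R 1); lia.
  rewrite /g /w ler_pdivrMr ?(lt_le_trans ltr01) // mulrAC ler_pdivlMr ?w_den //.
  by nra.
have cg n : cabs (c n) <= g n.
  apply/ler_addgt0Pr => e e0; have [N hN] := hc n e e0.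
  pose m := maxn N `|n|%N.
  rewrite -[c n](subKr (Fh phi m.*2.+1 n)) (le_trans (cabsB _ _)) // lerD ?Fg ?leq_maxr //.
  by apply: hN; rewrite /m; lia.
have ac : absb c ((2 * K + B) * 8) by exact: bsum_le cg gM.
split => //; have [s hs] := hsum_ex ac.
suff -> : phi 0 = s by [].
apply/eqP; rewrite -subr_eq0 -cabs_eq0 eq_le cabs_ge0 andbT; apply/ler_addgt0Pr => e e0.
rewrite add0r; have [F [d d0 hF]] := tannery g0 gM e0.
have [N hN] : exists N, forall n, n \in F -> forall m, (N <= m)%N -> cabs (Fh phi m.*2.+1 n - c n) <= d /\ (`|n| <= m)%N.
  elim: F {hF} => [|n F [N IH]]; first by exists 0%N.
  have [N' hN'] := hc n d d0; exists (maxn N (maxn N' `|n|%N)) => k.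
  rewrite inE => /predU1P[->|/IH hk] m hm; last by apply: hk; lia.
  by split; [apply: hN'; lia|lia].
pose r := [seq i%:Z - N%:Z | i <- iota 0 N.*2.+1].
pose f n := if (`|n| <= N)%N then Fh phi N.*2.+1 n else 0.
have ur : uniq r by rewrite map_inj_uniq ?iota_uniq // => i j; lia.
have hf : hsum f (phi 0).
  rewrite -(Fh_sum phi N).
  have -> : \sum_(i < N.*2.+1) Fh phi N.*2.+1 (i%:Z - N%:Z) = \sum_(n <- r) f n.
    rewrite /r big_map -[iota 0 _]/(index_iota 0 N.*2.+1) big_mkord.
    by apply: eq_bigr => i _; rewrite /f ifT //; have := ltn_ord i; lia.
  apply: hsum_fin => // n nr; rewrite /f; case: leqP => // nN; case/negP: nr.
  by apply/mapP; exists (absz (n + N%:Z)); rewrite ?mem_iota; lia.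
apply: (hF _ _ _ _ hf hs) => // n.
  by rewrite /f; case: leqP => nN; rewrite ?Fg ?cabs0.
by move=> nF; rewrite /f (hN _ nF _ (leqnn _)).2; exact: (hN _ nF _ (leqnn _)).1.
Qed.
End FourierInversion.

(** * Differentiation of complex-valued functions of a real variable *)

Section RealToComplexDerivative.
Variable R : realType.
Local Notation C := R[i].
Implicit Types (f g : R -> C) (x : R).

Definition cder f x (l : C) :=
  is_derive x (1 : R) (fun t => complex.Re (f t)) (complex.Re l) /\
  is_derive x (1 : R) (fun t => complex.Im (f t)) (complex.Im l).

Lemma cder_eq f x l l' : cder f x l -> l = l' -> cder f x l'.
Proof. by move=> h <-. Qed.

Lemma cder_cst (c : C) x : cder (fun _ => c) x 0.
Proof. by split; exact: is_derive_cst. Qed.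

Lemma cder_rc x : cder (@rc R) x 1.
Proof. by split => /=; [exact: is_derive_id|exact: is_derive_cst]. Qed.

Lemma cder_add f g x a b : cder f x a -> cder g x b -> cder (fun t => f t + g t) x (a + b).
Proof.
move=> [h1 h2] [h3 h4]; split; rewrite ?ReD ?ImD.
  by under eq_fun do rewrite ReD; exact: is_deriveD.
by under eq_fun do rewrite ImD; exact: is_deriveD.
Qed.

Lemma cder_mul f g x a b : cder f x a -> cder g x b ->
  cder (fun t => f t * g t) x (a * g x + f x * b).
Proof.
move=> [h1 h2] [h3 h4]; split.
  under eq_fun do rewrite ReM.
  apply: is_derive_eq; rewrite ReD !ReM /GRing.scale /=; ring.
under eq_fun do rewrite ImM.
by apply: is_derive_eq; rewrite ImD !ImM /GRing.scale /=; ring.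
Qed.

Lemma cder_scale c f x a : cder f x a -> cder (fun t => c * f t) x (c * a).
Proof. by move=> h; apply: cder_eq (cder_mul (cder_cst c x) h) _; rewrite mul0r add0r. Qed.

Lemma cder_sub f g x a b : cder f x a -> cder g x b -> cder (fun t => f t - g t) x (a - b).
Proof.
move=> h1 h2; have := cder_add h1 (cder_scale (-1) h2); rewrite mulN1r.
by under eq_fun do rewrite mulN1r.
Qed.

Lemma cder_cexp f x a : cder f x a -> cder (fun t => cexp (f t)) x (a * cexp (f x)).
Proof.
move=> [h1 h2]; split => /=.
  have e1 := is_derive1_comp (@is_derive_expR R _) h1.
  have e2 := is_derive1_comp (@is_derive_cos R _) h2.
  apply: (@is_derive_eq _ _ _ _ _ _ _ _ (is_deriveM e1 e2)).
  by rewrite ReM /GRing.scale /=; ring.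
have e1 := is_derive1_comp (@is_derive_expR R _) h1.
have e2 := is_derive1_comp (@is_derive_sin R _) h2.
apply: (@is_derive_eq _ _ _ _ _ _ _ _ (is_deriveM e1 e2)).
by rewrite ImM /GRing.scale /=; ring.
Qed.

Lemma cder_shift f c x a : cder f (x + c) a -> cder (fun t => f (t + c)) x a.
Proof.
have d : is_derive x (1 : R) (fun t => t + c) 1.
  by apply: is_derive_eq; rewrite addr0.
move=> [h1 h2]; split.
  have := @is_derive1_comp R (fun t => complex.Re (f t)) (fun t => t + c) x _ _ h1 d.
  by rewrite mulr1.
have := @is_derive1_comp R (fun t => complex.Im (f t)) (fun t => t + c) x _ _ h2 d.
by rewrite mulr1.
Qed.

Lemma cder_horner (p : {poly C}) x : cder (fun t => p.[rc t]) x p^`().[rc x].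
Proof.
elim/poly_ind: p => [|p c IH].
  by rewrite deriv0 horner0; under eq_fun do rewrite horner0; exact: cder_cst.
rewrite derivD derivM derivX derivC mulr1 addr0.
have -> : (fun t => (p * 'X + c%:P).[rc t]) = (fun t => p.[rc t] * rc t + c).
  by apply/funext => t; rewrite !hornerE.
apply: cder_eq (cder_add (cder_mul IH (cder_rc x)) (cder_cst c x)) _.
by rewrite !hornerE.
Qed.

(* The factor 2 comes from applying the mean value theorem to both components. *)
Lemma cmvt f f' (a b B : R) : (forall x, cder f x (f' x)) -> a <= b ->
  (forall x, a <= x <= b -> cabs (f' x) <= B) -> cabs (f b - f a) <= 2 * B * (b - a).
Proof.
move=> df ab hB; have ba : 0 <= b - a by rewrite subr_ge0.
apply: le_trans (cabs_le_ReIm _) _; rewrite ReD ImD ReN ImN.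
have [c hc ->] := mvt_global (fun x => (df x).1) ab.
have [d hd ->] := mvt_global (fun x => (df x).2) ab.
rewrite !normrM (ger0_norm ba) -mulrDl ler_wpM2r // mulr_natl mulr2n.
by rewrite lerD ?(le_trans (Re_le_cabs _)) ?(le_trans (Im_le_cabs _)) ?hB.
Qed.

Lemma cmvt_abs f f' (a t B : R) : (forall x, cder f x (f' x)) ->
  (forall s, `|s| <= `|t| -> cabs (f' (a + s)) <= B) -> cabs (f (a + t) - f a) <= 2 * B * `|t|.
Proof.
move=> df hB; have [t0|t0] := lerP 0 t.
  rewrite (_ : `|t| = a + t - a); last by rewrite ger0_norm //; lra.
  apply: (cmvt df); first by lra.
  move=> x /andP[x1 x2]; rewrite -(subrK a x) addrC hB // !ger0_norm //; lra.
rewrite (_ : `|t| = a - (a + t)); last by rewrite ltr0_norm //; lra.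
rewrite cabs_distC; apply: (cmvt df); first by lra.
move=> x /andP[x1 x2]; rewrite -(subrK a x) addrC hB // !ler0_norm //; lra.
Qed.

Lemma cabs_ce_sub1 (x : R) : cabs (ce x - 1) <= 16 * `|x|.
Proof.
have pi4 : pi <= 4 :> R by have := @pihalf_lt2 R; lra.
have d y : cder (@ce R) y (rc (2 * pi) * (ci R * ce y)).
  have -> : @ce R = fun t => cexp ((ci R * rc (2 * pi)) * rc t).
    by apply/funext => t; rewrite /ce rcM mulrA.
  by apply: cder_eq (cder_cexp (cder_scale _ (cder_rc y))) _; ring.
have := @cmvt_abs _ _ 0 x (2 * pi) d; rewrite add0r ce0.
have h s : `|s| <= `|x| -> cabs (rc (2 * pi) * (ci R * ce (0 + s))) <= 2 * pi.
  move=> _; rewrite !cabsM cabs_ce cabs_rc mulr1 ger0_norm; last by have := @pi_ge0 R; lra.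
  by rewrite cabsE /= expr0n expr1n add0r sqrtr1 mulr1.
move=> /(_ h) /le_trans; apply; rewrite ler_wpM2r //; lra.
Qed.

Definition C2 (K : R) f f' f'' :=
  [/\ forall x, cder f x (f' x), forall x, cder f' x (f'' x) &
   forall x, [/\ cabs (f x) <= K * w2 x, cabs (f' x) <= K * w2 x & cabs (f'' x) <= K * w2 x]].

Lemma wl_of_der K f f' : (forall x, cder f x (f' x)) ->
  (forall x, cabs (f x) <= K * w2 x) -> (forall x, cabs (f' x) <= K * w2 x) -> wl (18 * K) f.
Proof.
move=> df fK f'K.
have K0 : 0 <= K.
  have := le_trans (cabs_ge0 _) (fK 0); by rewrite pmulr_lge0 // exprn_gt0 // w_gt0.
split=> [x|x h h1].
  rewrite (le_trans (fK x)) // ler_wpM2r ?w2_ge0 //; lra.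
rewrite (_ : 18 * K * `|h| * w2 x = 2 * (K * (9 * w2 x)) * `|h|); last by ring.
apply: cmvt_abs => // s hs; rewrite (le_trans (f'K _)) // ler_wpM2l // w2_shift //.
exact: le_trans hs h1.
Qed.

Lemma C2_wl K f f' f'' : C2 K f f' f'' -> wl (18 * K) f.
Proof. by move=> [d1 d2 h]; apply: wl_of_der d1 _ _ => x; have [] := h x. Qed.
Lemma C2_wl' K f f' f'' : C2 K f f' f'' -> wl (18 * K) f'.
Proof. by move=> [d1 d2 h]; apply: wl_of_der d2 _ _ => x; have [] := h x. Qed.
Lemma C2_ge0 K f f' f'' : C2 K f f' f'' -> 0 <= K.
Proof. by move=> /C2_wl /wl_ge0; lra. Qed.

(** Two applications of the mean value theorem. The constant is 2 * 18 * 9, where 9 pays for moving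
    the argument of [w2] by at most one unit. *)
Lemma C2_second K f f' f'' x h : C2 K f f' f'' -> 0 <= h <= 1 ->
  cabs (f (x + h) + f (x - h) - f x - f x) <= 324 * K * h ^+ 2 * w2 x.
Proof.
move=> fC /andP[h0 h1]; have K0 := C2_ge0 fC; have [d1 d2 hb] := fC.
have -> : f (x + h) + f (x - h) - f x - f x =
   (fun y => f (y + h) - f y) (x - h + h) - (fun y => f (y + h) - f y) (x - h).
  by rewrite /= subrK; ring.
have d3 y : cder (fun y => f (y + h) - f y) y (f' (y + h) - f' y).
  by apply: cder_sub (d1 y); apply: cder_shift; exact: d1.
have -> : 324 * K * h ^+ 2 * w2 x = 2 * (18 * K * h * (9 * w2 x)) * ((x - h + h) - (x - h)) by ring.
apply: (cmvt d3); first by lra.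
move=> y /andP[y1 y2].
rewrite (le_trans ((C2_wl' fC).2 _ _ _)) ?ger0_norm //.
rewrite ler_wpM2l ?mulr_ge0 // -(subrK x y) addrC w2_shift // ler_norml; lra.
Qed.

Lemma C2_taylor K f f' f'' x h : C2 K f f' f'' -> `|h| <= 1 ->
  cabs (f (x + h) - f x - rc h * f' x) <= 36 * K * h ^+ 2 * w2 x.
Proof.
move=> fC h1; have K0 := C2_ge0 fC; have [d1 d2 hb] := fC.
have d3 y : cder (fun y => f y - rc y * f' x) y (f' y - f' x).
  apply: cder_sub (d1 y) _; apply: cder_eq (cder_mul (cder_rc y) (cder_cst _ _)) _.
  by rewrite mulr0 addr0 mul1r.
have -> : f (x + h) - f x - rc h * f' x = (fun y => f y - rc y * f' x) (x + h) - (fun y => f y - rc y * f' x) x.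
  by rewrite /= rcD; ring.
have -> : 36 * K * h ^+ 2 * w2 x = 2 * (18 * K * `|h| * w2 x) * `|h|.
  by rewrite -[h ^+ 2]real_normK ?num_real //; ring.
apply: (cmvt_abs d3) => s sh; rewrite (le_trans ((C2_wl' fC).2 _ _ _)) ?(le_trans sh) //.
by rewrite ler_wpM2r ?w2_ge0 // ler_wpM2l // mulr_ge0.
Qed.

(** By translation invariance the integral of f(x + h) - f(x) is 0, so Taylor's formula shows that h
    times the integral of [f'] is of order h^2. *)
Lemma Itg_der K f f' f'' : C2 K f f' f'' -> Itg f' = 0.
Proof.
move=> fC; have K0 := C2_ge0 fC; apply: cabs0_eq0; apply/eqP; rewrite eq_le cabs_ge0 andbT.
apply/ler_addgt0Pr => e e0; rewrite add0r.
have [h /andP[h0 h1] hK] := small_le (36 * K * 8) ltr01 e0.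
have f1 := C2_wl fC; have f2 := C2_wl' fC.
have hn : `|h| <= 1 by rewrite gtr0_norm.
have w1 := wl_trans hn f1.
have w2' := wlD (wlD w1 (wlZ (-1) f1)) (wlZ (- rc h) f2).
have : cabs (Itg (fun x => f (x + h) + -1 * f x + - rc h * f' x)) <= 36 * K * h ^+ 2 * 8.
  apply: (Itg_le w2') => x.
  rewrite mulN1r mulNr (le_trans (C2_taylor _ fC hn)) // ler_wpM2l ?w2_le_w //.
  by apply: mulr_ge0; rewrite ?sqr_ge0 //; lra.
rewrite (ItgD (wlD w1 (wlZ (-1) f1)) (wlZ (- rc h) f2)) (ItgD w1 (wlZ (-1) f1)).
rewrite (ItgZ _ f1) (ItgZ _ f2) (Itg_trans _ f1) mulN1r subrr add0r cabsM cabsN cabs_rc gtr0_norm //.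
move=> H; apply: le_trans hK.
rewrite -(ler_pM2l h0) (le_trans H) // le_eqVlt; apply/orP; left; apply/eqP; ring.
Qed.

End RealToComplexDerivative.

(** * Poisson summation, and functions [p * exp Q] to which it applies *)

Section PoissonSummation.
Variable R : realType.
Local Notation C := R[i].
Implicit Types (f g : R -> C) (x : R).

Lemma wl_ce K f y : wl K f -> wl (K * (1 + 16 * 9 * `|y|)) (fun x => f x * ce (y * x)).
Proof.
move=> fK; have K0 := wl_ge0 fK; have y0 := normr_ge0 y; split=> [x|x h h1].
  rewrite cabsM cabs_ce mulr1 (le_trans (fK.1 x)) // ler_wpM2r ?w2_ge0 //.
  by rewrite ler_peMr // lerDl !mulr_ge0.
rewrite (_ : _ - _ = (f (x + h) - f x) * ce (y * x) + f (x + h) * (ce (y * x) * (ce (y * h) - 1))).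
  rewrite (le_trans (cabsD _ _)) // !cabsM !cabs_ce mulr1 mul1r.
  rewrite (_ : K * (1 + 16 * 9 * `|y|) * `|h| * w2 x =
    K * `|h| * w2 x + (K * (9 * w2 x)) * (16 * (`|y| * `|h|))); last by ring.
  rewrite lerD ?fK.2 // -normrM ler_pM ?cabs_ge0 ?cabs_ce_sub1 //.
  by rewrite (le_trans (fK.1 _)) // ler_wpM2l // w2_shift.
rewrite mulrDr ceD; ring.
Qed.

Definition per f x : C := tsum (fun n : int => f (x + n%:~R)).

Lemma perP K f x : (forall x, cabs (f x) <= K * w x) -> 0 <= K ->
  absb (fun n : int => f (x + n%:~R)) (K * 8).
Proof.
move=> fK K0.
have := bsumZ K0 (@w_mesh R 1 x _); rewrite ltr01 lexx => /(_ isT).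
by apply: bsum_le => n; rewrite mul1r mulr1.
Qed.

(** Unfolding: the points [j / M] together with their integer translates form the mesh of step
    [1 / M], and a character of integral frequency is unaffected by the translates. A discrete
    coefficient of the periodisation is thus a Riemann sum. *)
Lemma Fh_per K f M n : (0 < M)%N -> wl K f ->
  Fh (per f) M n = Sm (M%:R^-1) (fun x => f x * ce (- n%:~R * x)).
Proof.
move=> M0 fK; have K0 := wl_ge0 fK; have Mr : (0 : R) < M%:R by rewrite ltr0n.
have hM : 0 < (M%:R^-1 : R) <= 1 by rewrite invr_gt0 Mr /= invf_le1 // ler1n.
have h1 := int_split M0 (Sm_hsum hM (wl_w (wl_ce (- n%:~R) fK))).
have h2 := hsum_swap h1.
have hj (j : 'I_M) : hsum (fun q : int => rc M%:R^-1 * (f (j%:R / M%:R + q%:~R) * ce (- n%:~R * (j%:R / M%:R))))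
    (rc M%:R^-1 * (per f (j%:R / M%:R) * ce (- n%:~R * (j%:R / M%:R)))).
  apply: hsumZ; have := hsumZ (ce (- n%:~R * (j%:R / M%:R))) (tsumP (perP (j%:R / M%:R) (wl_w fK) K0)).
  by rewrite [per f _ * _]mulrC; apply: hsum_ext => q; rewrite mulrC.
rewrite /Fh /Pm mulr_sumr.
have h3 := hsum_fubini (t := fun j : 'I_M => rc M%:R^-1 * (per f (j%:R / M%:R) * ce (- n%:~R * (j%:R / M%:R)))) _ h2.
apply: (hsum_unique _ (h3 _)); last first.
  move=> j; apply: hsum_ext (hj j) => q /=; congr (_ * _).
  have -> : (q * M%:Z + j%:Z)%:~R * M%:R^-1 = j%:R / M%:R + q%:~R :> R.
    by rewrite intrD intrM -!pmulrn mulrDl mulfK ?gt_eqF // addrC.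
  rewrite mulrDr (_ : - n%:~R * q%:~R = (- (n * q))%:~R) ?ceDint //.
  by rewrite mulrNz intrM mulNr.
have := @hsum_fin R 'I_M (enum 'I_M) (fun j => rc M%:R^-1 * (per f (j%:R / M%:R) * ce (- n%:~R * (j%:R / M%:R)))).
by rewrite enum_uniq big_enum => /(_ isT); apply => j; rewrite mem_enum.
Qed.

(** Fourier inversion for [per f]: by [Fh_per] its discrete coefficients converge to the integrals,
    and its second differences are bounded by summing [C2_second] over the translates. *)
Theorem poisson K f f' f'' : C2 K f f' f'' ->
  exists2 B, absb (fun n : int => Itg (fun x => f x * ce (- n%:~R * x))) B &
    hsum (fun n : int => Itg (fun x => f x * ce (- n%:~R * x))) (tsum (fun n : int => f n%:~R)).
Proof.
move=> fC; have K0 := C2_ge0 fC; have fw := C2_wl fC; have fK := wl_w fw.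
have K18 : 0 <= 18 * K by rewrite mulr_ge0.
have pP x := tsumP (perP x fK K18).
have [||||a b] := @fourier_inversion R (per f) (fun n : int => Itg (fun x => f x * ce (- n%:~R * x)))
  (324 * K * 8) (18 * K * 8) _ _ _ _.
- move=> x; apply: tsum_eq.
  have := hsum_bij (h := fun n : int => n + 1) (k := fun n => n - 1) (addrK 1) (subrK 1) (pP x).
  by apply: hsum_ext => n; rewrite intrD addrA addrAC.
- by move=> x; apply: hsum_le (pP x) _; exact: perP.
- move=> x h hh; have h2 := hsumB (hsumB (hsumD (pP (x + h)) (pP (x - h))) (pP x)) (pP x).
  apply: (hsum_le h2).
  have Kh : 0 <= 324 * K * h ^+ 2 by apply: mulr_ge0 (sqr_ge0 h); apply: mulr_ge0 K0; exact: ler0n.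
  have := bsumZ Kh (@w_mesh R 1 x _); rewrite ltr01 lexx => /(_ isT).
  rewrite (_ : 324 * K * 8 * h ^+ 2 = 324 * K * h ^+ 2 * 8); last by ring.
  apply: bsum_le => n; rewrite mul1r mulr1.
  rewrite (addrAC x h) (addrAC x (- h)) (le_trans (C2_second _ fC hh)) //.
  by rewrite ler_wpM2l // w2_le_w.
- move=> n e e0; have wn := wl_ce (- n%:~R) fw; have L0 := wl_ge0 wn.
  set L := 18 * K * _ in wn L0.
  exists (Num.truncn (16 * L / e)).+1 => M NM; have M0 : (0 < M)%N by lia.
  have Mr : (0 : R) < M%:R by rewrite ltr0n.
  have hM : 0 < (M%:R^-1 : R) <= 1 by rewrite invr_gt0 Mr /= invf_le1 // ler1n.
  rewrite (Fh_per n M0 fw) (le_trans (Sm_Itg_le wn hM)) // ler_pdivrMr //.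
  have NM' : ((Num.truncn (16 * L / e)).+1%:R : R) <= M%:R by rewrite ler_nat.
  have := lt_le_trans (truncnS_gt (16 * L / e)) NM'; rewrite ltr_pdivrMr //; lra.
exists ((2 * (324 * K * 8) + 18 * K * 8) * 8) => //.
have -> : tsum (fun n : int => f n%:~R) = per f 0 by rewrite /per; congr tsum; apply/funext => n; rewrite add0r.
exact: b.
Qed.

(** Polynomials times the exponential of a polynomial are closed under differentiation, so a single
    decay estimate in terms of the real part of [Q] yields all three bounds of [C2]. *)
Definition pe (p Q : {poly C}) x : C := p.[rc x] * cexp Q.[rc x].

Lemma cder_pe p Q x : cder (pe p Q) x (pe (p^`() + p * Q^`()) Q x).
Proof.
apply: cder_eq (cder_mul (cder_horner p x) (cder_cexp (cder_horner Q x))) _.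
by rewrite /pe hornerD hornerM; ring.
Qed.

Lemma poly_growth (p : {poly C}) : exists2 A, 0 <= A &
  forall x, cabs p.[rc x] <= A * (1 + x ^+ 2) ^+ size p.
Proof.
elim/poly_ind: p => [|p c [A A0 IH]].
  by exists 0 => // x; rewrite horner0 cabs0 mul0r.
exists (A + cabs c); first by rewrite addr_ge0 ?cabs_ge0.
move=> x; have [pc|pc] := eqVneq (p * 'X + c%:P) 0.
  by rewrite pc horner0 cabs0 mulr_ge0 ?addr_ge0 ?cabs_ge0 ?exprn_ge0 ?addr_ge0 ?sqr_ge0 //.
have W1 : 1 <= 1 + x ^+ 2 by rewrite lerDl sqr_ge0.
have W0 : 0 <= 1 + x ^+ 2 by lra.
have sz : size (p * 'X + c%:P) = (size p).+1.
  rewrite size_MXaddC; case: ifP => // /andP[/eqP p0 /eqP c0].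
  by move: pc; rewrite p0 c0 mul0r add0r eqxx.
rewrite !hornerE sz (le_trans (cabsD _ _)) // mulrDl lerD //.
  rewrite cabsM cabs_rc exprSr mulrA ler_pM ?cabs_ge0 //.
  by have := sqr_ge0 (`|x| - 1); rewrite -[x ^+ 2]real_normK ?num_real //; nra.
by rewrite ler_peMr ?cabs_ge0 // exprn_ege1.
Qed.

Lemma exp_growth (c : R) (m : nat) : 0 < c ->
  exists2 B, 0 <= B & forall x, (1 + x ^+ 2) ^+ m * expR (- (c * x ^+ 2)) <= B.
Proof.
move=> c0; pose d : R := Num.min 1 (c / m.+1%:R).
have d0 : 0 < d by rewrite lt_min ltr01 divr_gt0 // ltr0n.
exists (d ^- m) => [|x]; first by rewrite invr_ge0 exprn_ge0 // ltW.
have y0 := sqr_ge0 x; set y := x ^+ 2 in y0 *.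
rewrite expRN ler_pdivrMr ?expR_gt0 // mulrC ler_pdivlMr ?exprn_gt0 //.
rewrite mulrC -exprMn.
have -> : c * y = m.+1%:R * (c * y / m.+1%:R) by rewrite [RHS]mulrC divfK // pnatr_eq0.
rewrite expRM_natl.
have h1 : d * (1 + y) <= expR (c * y / m.+1%:R).
  apply: le_trans (expR_ge1Dx _); rewrite mulrDr mulr1 lerD // ?ge_min ?lexx //.
  by rewrite mulrAC ler_wpM2r // /d ge_min lexx orbT.
have h2 : 1 <= expR (c * y / m.+1%:R).
  by apply: le_trans (expR_ge1Dx _); rewrite lerDl; have c1 := ltW c0; apply: mulr_ge0; [exact: mulr_ge0|rewrite invr_ge0 ler0n].
rewrite exprS (le_trans _ (ler_peMl _ h2)) ?exprn_ge0 ?expR_ge0 //.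
apply: lerXn2r; rewrite ?nnegrE ?expR_ge0 //.
by apply: mulr_ge0; [exact: ltW|exact: addr_ge0].
Qed.

Lemma pe_bound p Q (c c0 : R) : 0 < c -> (forall x, complex.Re Q.[rc x] <= c0 - c * x ^+ 2) ->
  exists2 K, 0 <= K & forall x, cabs (pe p Q x) <= K * w2 x.
Proof.
move=> cp hQ; have [A A0 hA] := poly_growth p.
have [B B0 hB] := exp_growth (size p).+2 cp.
exists (A * expR c0 * B); first by rewrite !mulr_ge0 ?expR_ge0.
move=> x; rewrite cabsM cabs_cexp /w2 exprVn ler_pdivlMr ?exprn_gt0 ?w_den //.
have W0 : 0 <= 1 + x ^+ 2 by rewrite addr_ge0 ?sqr_ge0.
apply: (@le_trans _ _ (A * (1 + x ^+ 2) ^+ size p * expR (c0 - c * x ^+ 2) * (1 + x ^+ 2) ^+ 2)).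
  by rewrite ler_wpM2r ?exprn_ge0 // ler_pM ?cabs_ge0 ?expR_ge0 ?ler_expR.
rewrite expRD.
have -> : A * (1 + x ^+ 2) ^+ size p * (expR c0 * expR (- (c * x ^+ 2))) * (1 + x ^+ 2) ^+ 2 =
  A * expR c0 * ((1 + x ^+ 2) ^+ (size p).+2 * expR (- (c * x ^+ 2))).
  have -> : (1 + x ^+ 2) ^+ (size p).+2 = (1 + x ^+ 2) ^+ size p * (1 + x ^+ 2) ^+ 2.
    by rewrite -exprD addn2.
  move: ((1 + x ^+ 2) ^+ size p) ((1 + x ^+ 2) ^+ 2) => a b; ring.
by rewrite ler_wpM2l // mulr_ge0 ?expR_ge0.
Qed.

Lemma pe_C2 p Q (c c0 : R) : 0 < c -> (forall x, complex.Re Q.[rc x] <= c0 - c * x ^+ 2) ->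
  exists K, C2 K (pe p Q) (pe (p^`() + p * Q^`()) Q)
    (pe ((p^`() + p * Q^`())^`() + (p^`() + p * Q^`()) * Q^`()) Q).
Proof.
move=> cp hQ; set p1 := p^`() + _; set p2 := p1^`() + _.
have [K0 K00 h0] := pe_bound p cp hQ.
have [K1 K10 h1] := pe_bound p1 cp hQ.
have [K2 K20 h2] := pe_bound p2 cp hQ.
exists (K0 + K1 + K2); split => [x|x|x]; [exact: cder_pe|exact: cder_pe|].
split.
- by rewrite (le_trans (h0 x)) // ler_wpM2r ?w2_ge0 //; lra.
- by rewrite (le_trans (h1 x)) // ler_wpM2r ?w2_ge0 //; lra.
- by rewrite (le_trans (h2 x)) // ler_wpM2r ?w2_ge0 //; lra.
Qed.
End PoissonSummation.

(** * Complex Gaussians and independence of the normalised integral from the parameter *)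

Section Gaussian.
Variable R : realType.
Local Notation C := R[i].
Implicit Types (x t : R) (l z : C).

(* Replaces differentiation under the integral sign in the homotopy of the Gaussian parameter. *)
Lemma const_of_quadratic (A : R -> C) (K : R) :
  (forall t h, 0 <= t -> 0 <= h -> t + h <= 1 -> cabs (A (t + h) - A t) <= K * h ^+ 2) -> A 1 = A 0.
Proof.
move=> hA; have K0 : 0 <= K.
  have := hA 0 1 (lexx _) ler01; rewrite add0r lexx => /(_ isT); rewrite expr1n mulr1.
  exact: le_trans (cabs_ge0 _).
apply/eqP; rewrite -subr_eq0 -cabs_eq0 eq_le cabs_ge0 andbT.
apply/ler_addgt0Pr => e e0; rewrite add0r.
pose n := (Num.truncn (K / e)).+1; have n0 : (0 : R) < n%:R by rewrite ltr0n.
have h0 : 0 <= (n%:R^-1 : R) by rewrite invr_ge0 ltW.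
have step k : (k <= n)%N -> cabs (A (k%:R / n%:R) - A 0) <= k%:R * (K * n%:R^-1 ^+ 2).
  elim: k => [_|k IH kn]; first by rewrite !mul0r subrr cabs0.
  rewrite -(subrKA (A (k%:R / n%:R))) (le_trans (cabsD _ _)) // -natr1 !mulrDl !mul1r addrC.
  rewrite lerD ?(IH (ltnW kn)) // hA // ?divr_ge0 ?ler0n ?(ltW n0) //.
  rewrite -[X in _ + X]mul1r -mulrDl natr1 ler_pdivrMr // mul1r ler_nat //.
have := step n (leqnn n); rewrite mulfV ?gt_eqF // => /le_trans; apply.
rewrite (_ : n%:R * (K * n%:R^-1 ^+ 2) = K / n%:R); last by field; rewrite gt_eqF.
rewrite ler_pdivrMr // mulrC -ler_pdivrMr //; exact: ltW (truncnS_gt _).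
Qed.

Definition segment_to l t : C := 1 + rc t * (l - 1).

(** The cone |Im l| < Re l, in which Re (l^2) > 0, is convex and contains 1. Along the segment from
    1 to [l] both factors Re - Im and Re + Im stay above the same positive number, which keeps the
    Gaussians uniformly decaying. *)
Lemma cone_le l t : `|complex.Im l| < complex.Re l -> 0 <= t <= 1 ->
  Num.min 1 (complex.Re l - `|complex.Im l|) ^+ 2 <= complex.Re (segment_to l t ^+ 2).
Proof.
move=> hl /andP[t0 t1]; set m := Num.min _ _.
have m0 : 0 < m by rewrite lt_min ltr01 subr_gt0.
have m1 : m <= 1 by rewrite ge_min lexx.
have m2 : m <= complex.Re l - `|complex.Im l| by rewrite ge_min lexx orbT.
rewrite /segment_to; case: l hl m m0 m1 m2 => p q /= hl m m0 m1 m2.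
have := ler_norm q; have := ler_norm (- q); rewrite normrN => q1 q2.
set P := t * (p - 1); set Q := t * q.
have h1 : m <= 1 + P - Q by rewrite /P /Q; nra.
have h2 : m <= 1 + P + Q by rewrite /P /Q; nra.
apply: (@le_trans _ _ ((1 + P - Q) * (1 + P + Q))); first by rewrite expr2 ler_pM // ltW.
by rewrite le_eqVlt; apply/orP; left; apply/eqP; rewrite /P /Q; ring.
Qed.

Lemma quad_le (a b c x M N : R) : 0 < M -> M <= a -> `|b| <= N ->
  - (a * x ^+ 2 + 2 * b * x + c) <= (2 * N ^+ 2 / M - c) - M / 2 * x ^+ 2.
Proof.
move=> M0 Ma bN; have N0 := le_trans (normr_ge0 _) bN.
have x0 := sqr_ge0 x.
have h1 : - (2 * b * x) <= M / 2 * x ^+ 2 + 2 * N ^+ 2 / M.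
  have h2 : - (b * x) <= N * `|x|.
    by rewrite (le_trans (ler_norm _)) // normrN normrM ler_wpM2r.
  have : 0 <= M / 2 * (`|x| - 2 * N / M) ^+ 2 by rewrite mulr_ge0 ?sqr_ge0 // divr_ge0 // ltW.
  have -> : M / 2 * (`|x| - 2 * N / M) ^+ 2 = M / 2 * `|x| ^+ 2 - 2 * N * `|x| + 2 * N ^+ 2 / M.
    by field; rewrite gt_eqF.
  rewrite real_normK ?num_real //; lra.
have h3 : M * x ^+ 2 <= a * x ^+ 2 by rewrite ler_wpM2r.
lra.
Qed.

(** The parameter is the root [l] of the quadratic coefficient, so that the integral is [1 / l] and
    involves no choice of branch. *)
Definition gau l z x : C := cexp (- (rc pi * (l * rc x + z) ^+ 2)).

Lemma gau_exponent l z t x (m := Num.min 1 (complex.Re l - `|complex.Im l|)) :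
  `|complex.Im l| < complex.Re l -> 0 <= t <= 1 ->
  complex.Re (- (rc pi * (segment_to l t * rc x + rc t * z) ^+ 2)) <=
    pi * (2 * ((1 + cabs (l - 1)) * cabs z) ^+ 2 / m ^+ 2 + cabs z ^+ 2) - pi * m ^+ 2 / 2 * x ^+ 2.
Proof.
move=> hl ht; have /andP[t0 t1] := ht.
have m0 : 0 < m by rewrite lt_min ltr01 subr_gt0.
have M0 : 0 < m ^+ 2 by rewrite exprn_gt0.
have Ma := cone_le hl ht; rewrite -/m in Ma.
rewrite ReN Re_rcM.
have -> : complex.Re ((segment_to l t * rc x + rc t * z) ^+ 2) =
  complex.Re (segment_to l t ^+ 2) * x ^+ 2 + 2 * complex.Re (segment_to l t * (rc t * z)) * x + complex.Re ((rc t * z) ^+ 2).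
  have -> : (segment_to l t * rc x + rc t * z) ^+ 2 = rc (x ^+ 2) * segment_to l t ^+ 2 + rc (2 * x) * (segment_to l t * (rc t * z)) + (rc t * z) ^+ 2.
    by rewrite rcX rcM (rc_nat _ 2); ring.
  by rewrite !ReD !Re_rcM; ring.
have tz : cabs (rc t * z) <= cabs z.
  by rewrite cabsM cabs_rc ger0_norm // ler_piMl ?cabs_ge0.
have lL : cabs (segment_to l t) <= 1 + cabs (l - 1).
  rewrite (le_trans (cabsD _ _)) // cabs1 lerD2l cabsM cabs_rc ger0_norm //.
  by rewrite ler_piMl ?cabs_ge0.
have bN : `|complex.Re (segment_to l t * (rc t * z))| <= (1 + cabs (l - 1)) * cabs z.
  by rewrite (le_trans (Re_le_cabs _)) // cabsM ler_pM ?cabs_ge0.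
have cN : - complex.Re ((rc t * z) ^+ 2) <= cabs z ^+ 2.
  rewrite (le_trans (ler_norm _)) // normrN (le_trans (Re_le_cabs _)) // cabsX.
  by rewrite ler_pXn2r ?nnegrE ?cabs_ge0.
rewrite -mulrN.
have := quad_le (complex.Re ((rc t * z) ^+ 2)) x M0 Ma bN; move=> H.
apply: le_trans (ler_wpM2l (pi_ge0 R) H) _.
rewrite (_ : pi * m ^+ 2 / 2 * x ^+ 2 = pi * (m ^+ 2 / 2 * x ^+ 2)); last by ring.
by rewrite -mulrBr ler_wpM2l ?pi_ge0 //; lra.
Qed.

Definition gauQ l z : {poly C} := - ((rc pi)%:P * (l *: 'X + z%:P) ^+ 2).

Lemma gauQE l z x : (gauQ l z).[rc x] = - (rc pi * (l * rc x + z) ^+ 2).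
Proof. by rewrite /gauQ !hornerE. Qed.

Lemma gau_pe p l z x : pe p (gauQ l z) x = p.[rc x] * gau l z x.
Proof. by rewrite /pe gauQE. Qed.

Lemma gau_pe_der p l z x : pe (p^`() + p * (gauQ l z)^`()) (gauQ l z) x =
  (p^`().[rc x] - p.[rc x] * (rc (2 * pi) * l * (l * rc x + z))) * gau l z x.
Proof.
rewrite gau_pe; congr (_ * _); rewrite /gauQ derivN derivM derivC mul0r add0r.
rewrite expr2 derivM derivD derivZ derivX derivC addr0.
rewrite !(hornerD, hornerM, hornerN, hornerZ, hornerX, hornerC) rcM (rc_nat _ 2); ring.
Qed.

Lemma gau_C2 p l z t : `|complex.Im l| < complex.Re l -> 0 <= t <= 1 ->
  exists K, C2 K (pe p (gauQ (segment_to l t) (rc t * z)))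
    (pe (p^`() + p * (gauQ (segment_to l t) (rc t * z))^`()) (gauQ (segment_to l t) (rc t * z)))
    (pe ((p^`() + p * (gauQ (segment_to l t) (rc t * z))^`())^`() +
      (p^`() + p * (gauQ (segment_to l t) (rc t * z))^`()) * (gauQ (segment_to l t) (rc t * z))^`()) (gauQ (segment_to l t) (rc t * z))).
Proof.
move=> hl ht; have m0 : 0 < Num.min 1 (complex.Re l - `|complex.Im l|) by rewrite lt_min ltr01 subr_gt0.
apply: (@pe_C2 _ _ _ (pi * Num.min 1 (complex.Re l - `|complex.Im l|) ^+ 2 / 2)).
  by rewrite divr_gt0 // mulr_gt0 ?pi_gt0 // exprn_gt0.
by move=> x; rewrite gauQE; exact: gau_exponent.
Qed.

Lemma rc2pi_le : cabs (rc (2 * pi) : C) <= 8.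
Proof.
rewrite cabs_rc ger0_norm ?mulr_ge0 ?pi_ge0 //; have := @pihalf_lt2 R; lra.
Qed.

(** The t-derivative of the normalised Gaussian equals the x-derivative of ((l - 1) x + z) times the
    Gaussian. The first-order term subtracted here is therefore an exact x-derivative, and the error
    is of order h^2. *)
Lemma homotopy_step l z : `|complex.Im l| < complex.Re l -> exists2 K, 0 <= K &
  forall t h, 0 <= t -> 0 <= h -> t + h <= 1 -> forall x,
  cabs (segment_to l (t + h) * gau (segment_to l (t + h)) (rc (t + h) * z) x - segment_to l t * gau (segment_to l t) (rc t * z) x -
    rc h * (((l - 1) - ((l - 1) * rc x + z) * (rc (2 * pi) * segment_to l t * (segment_to l t * rc x + rc t * z))) *
       gau (segment_to l t) (rc t * z) x)) <= 4 * K * h ^+ 2 * w2 x.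
Proof.
move=> hl; set m := Num.min 1 (complex.Re l - `|complex.Im l|).
have m0 : 0 < m by rewrite lt_min ltr01 subr_gt0.
have cp : 0 < pi * m ^+ 2 / 2 by rewrite divr_gt0 // mulr_gt0 ?pi_gt0 // exprn_gt0.
set c := pi * m ^+ 2 / 2 in cp.
(* Seven powers of [1 + x ^ 2]: five from the polynomial factors of the second t-derivative [F2],
   two from [w2]. The constant 88 below is 16 + 72, from the two summands of [F2]. *)
have [B B0 hB] := exp_growth 7 cp.
set c0 := pi * (2 * ((1 + cabs (l - 1)) * cabs z) ^+ 2 / m ^+ 2 + cabs z ^+ 2).
pose D := 1 + cabs (l - 1) + cabs z.
have D1 : 1 <= D by rewrite /D -addrA lerDl addr_ge0 ?cabs_ge0.
have D0 : 0 <= D by exact: le_trans D1.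
have e0 : 0 <= expR c0 * B by rewrite mulr_ge0 ?expR_ge0.
exists (88 * D ^+ 5 * (expR c0 * B)); first by rewrite !mulr_ge0 ?exprn_ge0.
move=> t h t0 h0 th x.
pose L s := segment_to l s; pose u s := L s * rc x + rc s * z; pose mm := (l - 1) * rc x + z.
pose E s := cexp (- (rc pi * u s ^+ 2)).
pose F s := L s * E s; pose F1 s := ((l - 1) - mm * (rc (2 * pi) * L s * u s)) * E s.
pose F2 s := (- (mm * (rc (2 * pi) * ((l - 1) * u s + L s * mm)))) * E s +
  ((l - 1) - mm * (rc (2 * pi) * L s * u s)) * (- (rc (2 * pi) * u s * mm) * E s).
have dL s : cder L s (l - 1).
  apply: cder_eq (cder_add (cder_cst 1 s) (cder_mul (cder_rc s) (cder_cst (l - 1) s))) _.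
  by rewrite mulr0 mul1r add0r addr0.
have du s : cder u s mm.
  apply: cder_eq (cder_add (cder_mul (dL s) (cder_cst (rc x) s)) (cder_mul (cder_rc s) (cder_cst z s))) _.
  by rewrite !mulr0 mul1r !addr0.
have dE s : cder E s (- (rc (2 * pi) * u s * mm) * E s).
  have -> : E = fun s => cexp (- rc pi * (u s * u s)).
    by apply/funext => y; rewrite /E expr2 mulNr.
  apply: cder_eq (cder_cexp (cder_scale (- rc pi) (cder_mul (du s) (du s)))) _.
  by rewrite rcM (rc_nat _ 2); ring.
have dF s : cder F s (F1 s).
  by apply: cder_eq (cder_mul (dL s) (dE s)) _; rewrite /F1; ring.
have dF1 s : cder F1 s (F2 s).
  have d1 := cder_sub (cder_cst (l - 1) s) (cder_scale mm (cder_mul (cder_scale (rc (2 * pi)) (dL s)) (du s))).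
  by apply: cder_eq (cder_mul d1 (dE s)) _; rewrite /F2; ring.
pose W := 1 + x ^+ 2; have W1 : 1 <= W by rewrite lerDl sqr_ge0.
have xW : `|x| <= W by have := sqr_ge0 (`|x| - 1); rewrite /W -[x ^+ 2]real_normK ?num_real //; nra.
have DW1 : 1 <= D * W by rewrite -[X in X <= _]mulr1 ler_pM.
have D0' : 0 <= cabs z by exact: cabs_ge0.
have D0'' : 0 <= cabs (l - 1) by exact: cabs_ge0.
have F2b s : 0 <= s <= 1 -> cabs (F2 s) <= 88 * D ^+ 5 * (expR c0 * B) * w2 x.
  move=> /andP[s0 s1]; set Y := D * W in DW1.
  have Y0 : 0 <= Y by exact: le_trans DW1.
  have lY : cabs (l - 1) <= Y by rewrite /Y /D; nra.
  have LD : cabs (L s) <= 1 + cabs (l - 1).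
    rewrite (le_trans (cabsD _ _)) // cabs1 lerD2l cabsM cabs_rc ger0_norm //.
    by rewrite ler_piMl.
  have LY : cabs (L s) <= Y.
    by rewrite (le_trans LD) // /Y /D; nra.
  have uY : cabs (u s) <= Y.
    rewrite (le_trans (cabsD _ _)) // !cabsM !cabs_rc (ger0_norm s0).
    have h1 : cabs (L s) * `|x| <= (1 + cabs (l - 1)) * W by rewrite ler_pM ?cabs_ge0.
    have h2 : s * cabs z <= cabs z * W.
      by rewrite (le_trans (ler_piMl D0' s1)) // ler_peMr.
    by rewrite /Y /D mulrDl lerD.
  have mY : cabs mm <= Y.
    rewrite (le_trans (cabsD _ _)) // cabsM cabs_rc /Y /D.
    have h1 : cabs (l - 1) * `|x| <= cabs (l - 1) * W by rewrite ler_wpM2l.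
    have h2 : cabs z <= cabs z * W by rewrite ler_peMr.
    have : 0 <= W by exact: le_trans W1.
    rewrite !mulrDl; move: h1 h2; clear; lra.
  have p8 := rc2pi_le; set p2 := cabs (rc (2 * pi)) in p8.
  have p20 : 0 <= p2 by exact: cabs_ge0.
  have Eb : cabs (E s) <= expR c0 * expR (- (c * x ^+ 2)).
    rewrite cabs_cexp -expRD ler_expR; apply: (gau_exponent z (t := s) x hl).
    by rewrite s0.
  have YY k n : (k <= n)%N -> Y ^+ k <= Y ^+ n by move=> ?; rewrite ler_weXn2l.
  have b1 : cabs (mm * (rc (2 * pi) * ((l - 1) * u s + L s * mm))) <= 16 * Y ^+ 3.
    rewrite !cabsM -/p2.
    have h1 : cabs ((l - 1) * u s + L s * mm) <= Y * Y + Y * Y.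
      by rewrite (le_trans (cabsD _ _)) // !cabsM lerD // ler_pM ?cabs_ge0.
    have h2 : p2 * cabs ((l - 1) * u s + L s * mm) <= 8 * (Y * Y + Y * Y).
      by rewrite ler_pM ?cabs_ge0.
    rewrite (_ : 16 * Y ^+ 3 = Y * (8 * (Y * Y + Y * Y))); last by ring.
    by rewrite ler_pM ?cabs_ge0 // mulr_ge0 ?cabs_ge0.
  have b2 : cabs ((l - 1) - mm * (rc (2 * pi) * L s * u s)) <= 9 * Y ^+ 3.
    rewrite (le_trans (cabsB _ _)) // !cabsM -/p2.
    have h1 : p2 * cabs (L s) * cabs (u s) <= 8 * Y * Y.
      by rewrite ler_pM ?mulr_ge0 ?cabs_ge0 // ler_pM ?cabs_ge0.
    have h2 : cabs mm * (p2 * cabs (L s) * cabs (u s)) <= Y * (8 * Y * Y).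
      by rewrite ler_pM ?mulr_ge0 ?cabs_ge0.
    have := YY 1%N 3%N isT; rewrite expr1.
    have h3 : Y * (8 * Y * Y) = 8 * Y ^+ 3 by ring.
    by rewrite h3 in h2; move: lY h2; clear; lra.
  have b3 : cabs (rc (2 * pi) * u s * mm) <= 8 * Y ^+ 2.
    rewrite !cabsM -/p2 (_ : 8 * Y ^+ 2 = 8 * Y * Y); last by ring.
    by rewrite ler_pM ?mulr_ge0 ?cabs_ge0 // ler_pM ?cabs_ge0.
  have bT : cabs (F2 s) <= 88 * Y ^+ 5 * cabs (E s).
    have -> : F2 s = (- (mm * (rc (2 * pi) * ((l - 1) * u s + L s * mm))) +
      ((l - 1) - mm * (rc (2 * pi) * L s * u s)) * (- (rc (2 * pi) * u s * mm))) * E s.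
      by rewrite /F2; ring.
    rewrite cabsM ler_wpM2r ?cabs_ge0 //; apply: le_trans (cabsD _ _) _.
    rewrite (cabsM (l - 1 - _)) !cabsN.
    have h1 : cabs ((l - 1) - mm * (rc (2 * pi) * L s * u s)) * cabs (rc (2 * pi) * u s * mm) <=
      9 * Y ^+ 3 * (8 * Y ^+ 2) by rewrite ler_pM ?cabs_ge0.
    have h2 := YY 3%N 5%N isT.
    have h3 : 9 * Y ^+ 3 * (8 * Y ^+ 2) = 72 * Y ^+ 5 by ring.
    lra.
  apply: le_trans bT _.
  have W0 : 0 < W by exact: lt_le_trans W1.
  have -> : w2 x = W ^- 2 by rewrite /w2 /w exprVn.
  rewrite ler_pdivlMr ?exprn_gt0 //.
  apply: (@le_trans _ _ (88 * Y ^+ 5 * (expR c0 * expR (- (c * x ^+ 2))) * W ^+ 2)).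
    by rewrite ler_wpM2r ?exprn_ge0 ?(ltW W0) // ler_wpM2l // mulr_ge0 // exprn_ge0.
  rewrite (_ : _ * W ^+ 2 = 88 * D ^+ 5 * (expR c0 * (W ^+ 7 * expR (- (c * x ^+ 2))))); last by rewrite /Y; ring.
  apply: ler_wpM2l; first by rewrite mulr_ge0 ?exprn_ge0.
  by apply: ler_wpM2l; [exact: expR_ge0|exact: hB].
set K := 88 * D ^+ 5 * (expR c0 * B) in F2b *.
have d s : cder (fun s => F s - rc s * F1 t) s (F1 s - F1 t).
  apply: cder_eq (cder_sub (dF s) (cder_mul (cder_rc s) (cder_cst (F1 t) s))) _.
  by rewrite mulr0 addr0 mul1r.
have K0 : 0 <= K * w2 x by apply: le_trans (F2b t _); [exact: cabs_ge0|rewrite t0; lra].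
have bd s : t <= s <= t + h -> cabs (F1 s - F1 t) <= 2 * (K * w2 x) * h.
  move=> /andP[ts sh].
  have h1 := @cmvt _ F1 F2 t s (K * w2 x) dF1 ts.
  apply: le_trans (h1 _) _.
    by move=> y /andP[y1 y2]; apply: F2b; rewrite (le_trans t0 y1) (le_trans y2) // (le_trans sh).
  by apply: ler_wpM2l; [exact: mulr_ge0|rewrite lerBlDl].
have th' : t <= t + h by rewrite lerDl.
have := cmvt d th' bd.
rewrite rcD (_ : t + h - t = h); last by ring.
rewrite -rcD => H.
have -> : segment_to l (t + h) * gau (segment_to l (t + h)) (rc (t + h) * z) x - segment_to l t * gau (segment_to l t) (rc t * z) x -
    rc h * (((l - 1) - ((l - 1) * rc x + z) * (rc (2 * pi) * segment_to l t * (segment_to l t * rc x + rc t * z))) *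
       gau (segment_to l t) (rc t * z) x) = F (t + h) - rc (t + h) * F1 t - (F t - rc t * F1 t).
  by rewrite /F /F1 /mm /E /u /L /gau rcD; ring.
apply: le_trans H _; rewrite le_eqVlt; apply/orP; left; apply/eqP; ring.
Qed.

Lemma gau_wl p l z t : `|complex.Im l| < complex.Re l -> 0 <= t <= 1 ->
  exists K, wl K (fun x => p.[rc x] * gau (segment_to l t) (rc t * z) x).
Proof.
move=> hl ht; have [K hK] := gau_C2 p z hl ht; exists (18 * K).
have -> : (fun x => p.[rc x] * gau (segment_to l t) (rc t * z) x) = pe p (gauQ (segment_to l t) (rc t * z)).
  by apply/funext => x; rewrite gau_pe.
exact: C2_wl hK.
Qed.

Lemma gau_homotopy l z : `|complex.Im l| < complex.Re l ->
  Itg (fun x => l * gau l z x) = Itg (fun x => gau 1 0 x).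
Proof.
move=> hl; have [K K0 hK] := homotopy_step z hl.
pose A t := Itg (fun x => segment_to l t * gau (segment_to l t) (rc t * z) x).
have A1 : A 1 = Itg (fun x => l * gau l z x).
  rewrite /A (_ : segment_to l 1 = l) ?rc1 ?mul1r //.
  by rewrite /segment_to rc1 mul1r addrC subrK.
have A0 : A 0 = Itg (fun x => gau 1 0 x).
  rewrite /A (_ : segment_to l 0 = 1); last by rewrite /segment_to rc0 mul0r addr0.
  by congr Itg; apply/funext => x; rewrite rc0 mul0r mul1r.
rewrite -A1 -A0; apply: (@const_of_quadratic _ (4 * K * 8)) => t h t0 h0 th.
have ht : 0 <= t <= 1 by apply/andP; split; lra.
have hth : 0 <= t + h <= 1 by apply/andP; split; lra.
(* [p] times the Gaussian is the x-primitive of the first-order term in t, which therefore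
   integrates to 0 by [Itg_der]. *)
pose p : {poly C} := (l - 1) *: 'X + z%:P.
have [K1 c1] := gau_C2 p z hl ht.
have [K2 c2] := gau_wl (segment_to l (t + h))%:P z hl hth.
have [K3 c3] := gau_wl (segment_to l t)%:P z hl ht.
have e1 s : (fun x => (segment_to l s)%:P.[rc x] * gau (segment_to l s) (rc s * z) x) =
  fun x => segment_to l s * gau (segment_to l s) (rc s * z) x by apply/funext => x; rewrite hornerC.
rewrite e1 in c2; rewrite e1 in c3.
have i1 := Itg_der c1; have w1 := C2_wl' c1.
set G := pe (_ + _) _ in i1 w1.
have GE x : G x = ((l - 1) - ((l - 1) * rc x + z) * (rc (2 * pi) * segment_to l t * (segment_to l t * rc x + rc t * z))) *
       gau (segment_to l t) (rc t * z) x.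
  by rewrite /G gau_pe_der /p derivD derivZ derivX derivC addr0 !hornerE.
have -> : A (t + h) - A t = Itg (fun x => segment_to l (t + h) * gau (segment_to l (t + h)) (rc (t + h) * z) x -
   segment_to l t * gau (segment_to l t) (rc t * z) x - rc h * G x).
  have cB : wl (K2 + cabs (-1) * K3) (fun x => segment_to l (t + h) * gau (segment_to l (t + h)) (rc (t + h) * z) x -
      segment_to l t * gau (segment_to l t) (rc t * z) x).
    by have := wlD c2 (wlZ (-1) c3); congr wl; apply/funext => x; rewrite mulN1r.
  by rewrite (ItgB cB (wlZ (rc h) w1)) (ItgZ _ w1) i1 mulr0 subr0 (ItgB c2 c3).
have wr := wlD (wlD c2 (wlZ (-1) c3)) (wlZ (- rc h) w1).
apply: (@le_trans _ _ (4 * K * h ^+ 2 * 8)); last by rewrite le_eqVlt; apply/orP; left; apply/eqP; ring.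
apply: (Itg_le (K := K2 + cabs (-1) * K3 + cabs (- rc h) * (18 * K1))).
  by move: wr; congr wl; apply/funext => x; rewrite mulN1r mulNr.
move=> x; rewrite GE; apply: le_trans (hK _ _ t0 h0 th x) _.
by rewrite ler_wpM2l ?w2_le_w // !mulr_ge0 ?sqr_ge0.
Qed.

End Gaussian.

(** * Gaussian integrals, Poisson summation for theta series, principal square roots *)

Section GaussianTransform.
Variable R : realType.
Local Notation C := R[i].
Implicit Types (x y t : R) (l z : C).

Definition cone l := `|complex.Im l| < complex.Re l.

Lemma cone_neq0 l : cone l -> l != 0.
Proof.
by move=> h; apply/eqP => l0; move: h; rewrite l0 /cone /= normr0 ltxx.
Qed.

Lemma gau_wlp p l z : cone l -> exists K, wl K (fun x => p.[rc x] * gau l z x).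
Proof.
move=> hl; have h1 : 0 <= (1 : R) <= 1 by rewrite lexx ler01.
have [K hK] := gau_wl p z hl h1; exists K.
by move: hK; rewrite rc1 mul1r (_ : segment_to l 1 = l) // /segment_to rc1 mul1r addrC subrK.
Qed.

Lemma gau_C2' p l z : cone l -> exists K f' f'', C2 K (fun x => p.[rc x] * gau l z x) f' f'' /\
  forall x, f' x = (p^`().[rc x] - p.[rc x] * (rc (2 * pi) * l * (l * rc x + z))) * gau l z x.
Proof.
move=> hl; have h1 : 0 <= (1 : R) <= 1 by rewrite lexx ler01.
have [K] := gau_C2 p z hl h1.
rewrite rc1 mul1r (_ : segment_to l 1 = l); last by rewrite /segment_to rc1 mul1r addrC subrK.
rewrite (_ : pe p (gauQ l z) = fun x => p.[rc x] * gau l z x); last first.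
  by apply/funext => x; rewrite gau_pe.
by move=> hK; exists K; do 2 eexists; split; [exact: hK|move=> x; rewrite gau_pe_der].
Qed.

Lemma gau_wl1 l z : cone l -> exists K, wl K (gau l z).
Proof.
move=> /(gau_wlp 1%:P z)[K hK]; exists K; move: hK; congr wl.
by apply/funext => x; rewrite hornerC mul1r.
Qed.

Lemma gau_ce l z y x : l != 0 -> gau l z x * ce (- y * x) =
  cexp (ci R * rc (2 * pi * y) * z / l - rc (pi * y ^+ 2) / l ^+ 2) * gau l (z + ci R * rc y / l) x.
Proof.
move=> l0; rewrite /gau /ce -!cexpD; congr cexp.
have i2 : ci R ^+ 2 = -1 by rewrite expr2 ci2.
rewrite !rcM rcN (rc_nat _ 2) ?rcX.
have -> : (l * rc x + (z + ci R * rc y / l)) ^+ 2 = (l * rc x + z) ^+ 2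
  + 2 * (l * rc x + z) * (ci R * rc y / l) + ci R ^+ 2 * (rc y ^+ 2 / l ^+ 2) by field.
by rewrite i2; field.
Qed.

Definition gauss_mass : C := Itg (gau 1 0).

Lemma gau_Itg l z : cone l -> Itg (gau l z) = l^-1 * gauss_mass.
Proof.
move=> hl; have [K hK] := gau_wl1 z hl.
by rewrite /gauss_mass -(gau_homotopy z hl) (ItgZ _ hK) mulKf ?cone_neq0.
Qed.

Lemma gau_FT0 l z y : cone l -> Itg (fun x => gau l z x * ce (- y * x)) =
  cexp (ci R * rc (2 * pi * y) * z / l - rc (pi * y ^+ 2) / l ^+ 2) * (l^-1 * gauss_mass).
Proof.
move=> hl; have [K hK] := gau_wl1 (z + ci R * rc y / l) hl.
rewrite -(gau_Itg (z + ci R * rc y / l) hl) -(ItgZ _ hK); congr Itg; apply/funext => x.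
exact: gau_ce (cone_neq0 hl).
Qed.

Lemma gau_poisson0 l z : cone l -> exists2 B,
  absb (fun n : int => cexp (ci R * rc (2 * pi * n%:~R) * z / l - rc (pi * n%:~R ^+ 2) / l ^+ 2) * (l^-1 * gauss_mass)) B &
  hsum (fun n : int => cexp (ci R * rc (2 * pi * n%:~R) * z / l - rc (pi * n%:~R ^+ 2) / l ^+ 2) * (l^-1 * gauss_mass))
    (tsum (fun n : int => gau l z n%:~R)).
Proof.
move=> hl; have [K [f' [f'' [hC _]]]] := gau_C2' 1%:P z hl.
have fE : (fun x => 1%:P.[rc x] * gau l z x) = gau l z by apply/funext => x; rewrite hornerC mul1r.
rewrite fE in hC; have [B hB hs] := poisson hC; exists B.
  by apply: bsum_le hB => n; rewrite gau_FT0.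
by apply: hsum_ext hs => n; rewrite gau_FT0.
Qed.

(** At [l = 1], [z = 0] the two sides of Poisson summation are the same theta series, up to the
    unknown mass. The series is nonzero because its terms are positive, so the mass is 1. *)
Lemma ka0E : gauss_mass = 1.
Proof.
have h1 : cone (1 : C) by rewrite /cone /= normr0 ltr01.
have [B hB hs] := gau_poisson0 0 h1.
have e (n : R) : cexp (ci R * rc (2 * pi * n) * 0 / 1 - rc (pi * n ^+ 2) / 1 ^+ 2) = rc (expR (- (pi * n ^+ 2))).
  by rewrite mulr0 mul0r sub0r expr1n divr1 -rcN cexp_rc.
have ge (n : R) : gau 1 0 n = rc (expR (- (pi * n ^+ 2))).
  by rewrite /gau mul1r addr0 -rcX -rcM -rcN cexp_rc.
have [K hK] := gau_wl1 0 h1.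
have ht : hsum (fun n : int => @gau R 1 0 n%:~R) (tsum (fun n : int => @gau R 1 0 n%:~R)).
  have a := perP 0 (wl_w hK) (wl_ge0 hK).
  by apply: (tsumP (M := K * 8)); apply: bsum_le a => n; rewrite add0r.
set th := tsum _ in hs ht.
have hs' : hsum (fun n : int => gauss_mass * gau 1 0 n%:~R) th.
  by apply: hsum_ext hs => n; rewrite e ge invr1 mul1r mulrC.
have h := hsum_unique hs' (hsumZ gauss_mass ht).
have th0 : th != 0.
  apply/eqP => t0; have ht0 := ht; rewrite t0 in ht0.
  have ht' : hsum (fun n : int => rc (expR (- (pi * n%:~R ^+ 2))) : C) (rc 0).
    by apply: hsum_ext ht0 => n; rewrite ge.
  have b := hsum_bsum (fun n : int => expR_ge0 _) ht'.
  by have := bsum_one (0 : int) b; rewrite leNgt expR_gt0.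
by apply: (mulIf th0); rewrite -h mul1r.
Qed.

Lemma gau_I l z : cone l -> Itg (gau l z) = l^-1.
Proof. by move=> /gau_Itg ->; rewrite ka0E mulr1. Qed.

Lemma gau_poisson l z : cone l -> exists2 B,
  absb (fun n : int => cexp (ci R * rc (2 * pi * n%:~R) * z / l - rc (pi * n%:~R ^+ 2) / l ^+ 2) * l^-1) B &
  hsum (fun n : int => cexp (ci R * rc (2 * pi * n%:~R) * z / l - rc (pi * n%:~R ^+ 2) / l ^+ 2) * l^-1)
    (tsum (fun n : int => gau l z n%:~R)).
Proof.
move=> hl; have [B hB hs] := gau_poisson0 z hl; exists B.
  by apply: bsum_le hB => n; rewrite ka0E mulr1.
by apply: hsum_ext hs => n; rewrite ka0E mulr1.
Qed.

Lemma gau_sum l z : cone l -> hsum (fun n : int => gau l z n%:~R) (tsum (fun n : int => gau l z n%:~R)).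
Proof.
move=> hl; have [K hK] := gau_wl1 z hl; have a := perP 0 (wl_w hK) (wl_ge0 hK).
by apply: (tsumP (M := K * 8)); apply: bsum_le a => n; rewrite add0r.
Qed.

(** The derivative of x times the Gaussian integrates to 0, which expresses the second moment
    through the integral [1 / l]. *)
Lemma gau_moment l : cone l -> Itg (fun x => rc (x ^+ 2) * gau l 0 x) = (rc (2 * pi) * l ^+ 3)^-1.
Proof.
move=> hl; have [K [f' [f'' [hC hf']]]] := gau_C2' 'X 0 hl.
have [K1 w1] := gau_wl1 0 hl; have [K2 w2] := gau_wlp 'X^2 0 hl.
have wX : wl K2 (fun x => rc (x ^+ 2) * gau l 0 x).
  by move: w2; congr wl; apply/funext => x; rewrite hornerXn rcX.
have := Itg_der hC.
have -> : f' = fun x => gau l 0 x - (rc (2 * pi) * l ^+ 2) * (rc (x ^+ 2) * gau l 0 x).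
  by apply/funext => x; rewrite hf' derivX hornerC hornerX rcX addr0; ring.
rewrite (ItgB w1 (wlZ _ wX)) (ItgZ _ wX) (gau_I 0 hl) => /eqP; rewrite subr_eq0 => /eqP h.
have l0 := cone_neq0 hl.
have p0 : rc (2 * pi) != 0 :> C by rewrite rc_eq0 gt_eqF // mulr_gt0 ?pi_gt0.
have d0 : rc (2 * pi) * l ^+ 2 != 0 by rewrite mulf_neq0 // expf_neq0.
by apply: (mulfI d0); rewrite -h; field; rewrite l0 p0.
Qed.

Definition psq (z : C) : C := psqrt (z : Cx R).

Lemma psqE z : psq z = Complex (Num.sqrt ((cabs z + complex.Re z) / 2))
  ((if complex.Im z < 0 then -1 else 1) * Num.sqrt ((cabs z - complex.Re z) / 2)).
Proof. by rewrite cabsE. Qed.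

Lemma psq_sqr z : psq z ^+ 2 = z.
Proof.
rewrite psqE expr2; have := Re_le_cabs z; rewrite ler_norml => /andP[r1 r2].
have a0 : 0 <= (cabs z + complex.Re z) / 2 by lra.
have b0 : 0 <= (cabs z - complex.Re z) / 2 by lra.
set s := if _ then _ else _.
have s2 : s * s = 1 :> R by rewrite /s; case: ifP; rewrite ?mulr1 // mulrNN mulr1.
apply: complexP => /=.
  rewrite (_ : s * _ * _ = s * s * Num.sqrt ((cabs z - complex.Re z) / 2) ^+ 2); last by ring.
  by rewrite -expr2 !sqr_sqrtr // s2; field.
rewrite (_ : _ + _ = 2 * s * (Num.sqrt ((cabs z + complex.Re z) / 2) * Num.sqrt ((cabs z - complex.Re z) / 2))); last by ring.
rewrite -sqrtrM //.
have -> : (cabs z + complex.Re z) / 2 * ((cabs z - complex.Re z) / 2) = (complex.Im z / 2) ^+ 2.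
  have h := cabs_sqr z; rewrite exprMn (_ : complex.Im z ^+ 2 = cabs z ^+ 2 - complex.Re z ^+ 2); last by rewrite h; ring.
  by field.
rewrite sqrtr_sqr normrM (ger0_norm (_ : 0 <= 2^-1)) ?invr_ge0 ?ler0n // /s.
by case: ltrP => h; [rewrite ltr0_norm //|rewrite ger0_norm //]; lra.
Qed.

Lemma psq_Re_ge0 z : 0 <= complex.Re (psq z).
Proof. by rewrite psqE /= sqrtr_ge0. Qed.

Lemma psq_Re_eq0 z : complex.Re (psq z) = 0 -> 0 <= complex.Im (psq z).
Proof.
move=> /eqP; rewrite psqE /= sqrtr_eq0 => h; case: ifP => [z0|_]; last by rewrite mul1r sqrtr_ge0.
have : 0 < cabs z ^+ 2 - complex.Re z ^+ 2 by rewrite cabs_sqr; nra.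
by have := Re_le_cabs z; rewrite ler_norml => /andP[]; nra.
Qed.

Lemma psq_unique (s z : C) : s ^+ 2 = z ->
  0 < complex.Re s \/ complex.Re s = 0 /\ 0 <= complex.Im s -> psq z = s.
Proof.
move=> sz hs; have : (psq z) ^+ 2 == s ^+ 2 by rewrite psq_sqr sz.
rewrite eqf_sqr => /orP[/eqP//|/eqP h].
have r := psq_Re_ge0 z; have i := @psq_Re_eq0 z; rewrite h ReN ImN in r i.
rewrite h; case: hs => [s0|[r0 i0]]; first by move: r; rewrite oppr_ge0 leNgt s0.
rewrite r0 in i; have {}i := i (oppr0 R).
by apply: complexP; rewrite ?ReN ?ImN; clear sz h; lra.
Qed.

Lemma psq_Re_gt0 z : complex.Im z != 0 \/ 0 < complex.Re z -> 0 < complex.Re (psq z).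
Proof.
move=> h; rewrite lt_def psq_Re_ge0 andbT; apply/eqP => r0.
have := psq_sqr z; case: (psq z) r0 => a b /= -> e.
have e1 : complex.Im z = 0 by rewrite -e /= mul0r mulr0 addr0.
have e2 : complex.Re z = - b ^+ 2 by rewrite -e /= mul0r sub0r expr2.
by case: h; [rewrite e1 eqxx|rewrite e2; have := sqr_ge0 b; lra].
Qed.

Lemma cone_sqr (s : C) : 0 < complex.Re s -> 0 < complex.Re (s ^+ 2) -> cone s.
Proof.
case: s => a b; rewrite /cone /= => a0 h.
by rewrite ltr_norml; apply/andP; split; nra.
Qed.

Lemma psq_cone z : 0 < complex.Re z -> cone (psq z).
Proof. by move=> h; apply: cone_sqr; [apply: psq_Re_gt0; right|rewrite psq_sqr]. Qed.

Lemma cabs_psq z : cabs (psq z) ^+ 2 = cabs z.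
Proof. by rewrite -cabsX psq_sqr. Qed.

Lemma psq_eq0 z : (psq z == 0) = (z == 0).
Proof. by rewrite -[in RHS](psq_sqr z) expf_eq0. Qed.

Lemma psq_rc t : 0 <= t -> psq (rc t) = rc (Num.sqrt t).
Proof.
move=> t0; apply: psq_unique; first by rewrite -rcX sqr_sqrtr.
by have := sqrtr_ge0 t; rewrite /= le0r => /orP[/eqP->|]; [right|left].
Qed.

Lemma psq_rcM t z : 0 <= t -> psq (rc t * z) = rc (Num.sqrt t) * psq z.
Proof.
rewrite le0r => /orP[/eqP->|t0]; first by rewrite sqrtr0 rc0 !mul0r psq_rc // sqrtr0.
have s0 : 0 < Num.sqrt t by rewrite sqrtr_gt0.
apply: psq_unique; first by rewrite exprMn psq_sqr -rcX sqr_sqrtr // ltW.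
rewrite Re_rcM Im_rcM; have := psq_Re_ge0 z; rewrite le0r => /orP[/eqP h|h].
  by right; rewrite h mulr0; split=> //; rewrite mulr_ge0 ?psq_Re_eq0 // ltW.
by left; rewrite mulr_gt0.
Qed.

End GaussianTransform.

(** * Reciprocity of quadratic Gauss sums from the asymptotics of theta series *)

Section LandsbergSchaar.
Variable R : realType.
Local Notation C := R[i].
Implicit Types (x y t h : R) (l z : C).

Lemma cone_rc h : 0 < h -> cone (rc h).
Proof. by move=> h0; rewrite /cone /= normr0. Qed.

Lemma periodic_mod (M : nat) (c : int -> C) : (forall B, c (B + M%:Z) = c B) ->
  forall (m B : int), c (m * M%:Z + B) = c B.
Proof.
move=> hc m B; elim: m => [|m IH|m IH]; first by rewrite mul0r add0r.
  by rewrite -IH -[RHS]hc; congr c; rewrite -addn1 PoszD; ring.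
rewrite -IH -[LHS]hc; congr c; rewrite -addn1 PoszD; ring.
Qed.

(** On each residue class modulo [M] the sum is a Riemann sum of step [h M] for an integral equal to
    1. Hence [h S] tends to the mean of [c] over a period, with linear error. *)
Lemma theta_small (M : nat) (c : int -> C) : (0 < M)%N -> (forall B, c (B + M%:Z) = c B) ->
  exists K, forall h S, 0 < h -> h * M%:R <= 1 ->
    hsum (fun B : int => c B * gau (rc h) 0 B%:~R) S ->
    cabs (rc h * S - rc M%:R^-1 * \sum_(r < M) c r%:Z) <= K * h.
Proof.
move=> M0 hc; have h1 : cone (1 : C) by rewrite /cone /= normr0 ltr01.
have Mr : (0 : R) < M%:R by rewrite ltr0n.
have [K hK] := @gau_wl1 R 1 0 h1; have K0 := wl_ge0 hK.
exists (\sum_(r < M) cabs (c r%:Z) * (16 * (9 * K))) => h S h0 hM hS.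
have hs := int_split M0 hS.
have hM' : 0 < h * M%:R <= 1 by rewrite mulr_gt0.
pose f r x := @gau R 1 0 (x + r%:R * h).
have rh (r : 'I_M) : `|r%:R * h| <= 1.
  rewrite ger0_norm ?mulr_ge0 ?(ltW h0) //; apply: le_trans hM.
  by rewrite mulrC ler_wpM2l ?(ltW h0) // ler_nat ltnW.
have fw (r : 'I_M) : wl (9 * K) (f r) := wl_trans (rh r) hK.
have fI (r : 'I_M) : Itg (f r) = 1.
  by rewrite /f (Itg_trans _ hK) gau_I // invr1.
have hsl (r : 'I_M) : hsum (fun m : int => c (m * M%:Z + r%:Z) * gau (rc h) 0 (m * M%:Z + r%:Z)%:~R)
    (c r%:Z * rc (h * M%:R)^-1 * Sm (h * M%:R) (f r)).
  have := hsumZ (c r%:Z * rc (h * M%:R)^-1) (Sm_hsum hM' (wl_w (fw r))).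
  apply: hsum_ext => m; rewrite (periodic_mod hc) -!mulrA; congr (_ * _).
  have hM0 : rc (h * M%:R) != 0 :> C by rewrite rc_eq0 gt_eqF // mulr_gt0.
  rewrite mulrA -rcM mulVf ?mul1r; last by rewrite gt_eqF // mulr_gt0.
  rewrite /f /gau !addr0 mul1r -rcM; congr (cexp (- (_ * rc _ ^+ 2))).
  by rewrite rmorphD rmorphM /=; rewrite -!pmulrn; ring.
have hS2 : hsum (fun r : 'I_M => c r%:Z * rc (h * M%:R)^-1 * Sm (h * M%:R) (f r)) S.
  by apply: hsum_fubini hsl _; apply: hsum_swap hs || exact: (hsum_swap hs).
have hS3 : hsum (fun r : 'I_M => c r%:Z * rc (h * M%:R)^-1 * Sm (h * M%:R) (f r))
    (\sum_(r < M) c r%:Z * rc (h * M%:R)^-1 * Sm (h * M%:R) (f r)).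
  have := hsum_fin (enum_uniq 'I_M) (f := fun r : 'I_M => c r%:Z * rc (h * M%:R)^-1 * Sm (h * M%:R) (f r)).
  by rewrite big_enum /=; apply => i; rewrite mem_enum.
rewrite (hsum_unique hS2 hS3) !mulr_sumr -sumrB (le_trans (cabs_sum _ _ _)) // mulr_suml.
apply: ler_sum => r _.
have -> : rc h * (c r%:Z * rc (h * M%:R)^-1 * Sm (h * M%:R) (f r)) - rc M%:R^-1 * c r%:Z =
   c r%:Z * rc M%:R^-1 * (Sm (h * M%:R) (f r) - Itg (f r)).
  rewrite fI !rcV rcM; field; rewrite !rc_eq0 !gt_eqF //.
rewrite !cabsM -!mulrA ler_wpM2l ?cabs_ge0 //.
rewrite cabs_rc ger0_norm ?invr_ge0 ?ler0n // ler_pdivrMl //.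
apply: le_trans (Sm_Itg_le (fw r) hM') _; rewrite le_eqVlt; apply/orP; left; apply/eqP; ring.
Qed.

Lemma expR_inv_le (y : R) : 0 < y -> expR (- y) <= y^-1.
Proof.
move=> y0; rewrite expRN lef_pV2 ?posrE ?expR_gt0 //.
by have := expR_ge1Dx y; lra.
Qed.

(* the terms [j != 0] of the dual theta series *)
Lemma theta_tail (f : int -> C) (s : C) (c : R) : 0 < c -> hsum f s ->
  (forall j, cabs (f j) <= expR (- (pi * j%:~R ^+ 2 * c))) -> cabs (s - f 0) <= 16 / c.
Proof.
move=> c0 hs hf; have h0 := hsum_fin (F := [:: 0 : int]) (f := fun j => if j == 0 then f j else 0) isT.
have h0' : hsum (fun j => if j == 0 then f j else 0) (f 0).
  by move: h0; rewrite big_seq1 eqxx; apply => i; rewrite inE; case: eqP.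
have h := hsumB hs h0'.
have wm := @w_mesh R 1 0; rewrite ltr01 lexx in wm; have {}wm := wm isT.
rewrite (_ : 16 / c = (2 / c) * 8); last by ring.
apply: (hsum_le h); apply: bsum_le (bsumZ _ wm) => [j|]; last by rewrite divr_ge0 // ltW.
rewrite add0r mulr1 mul1r; case: eqP => [->|/eqP j0].
  by rewrite subrr cabs0 mulr_ge0 ?w_ge0 // divr_ge0 // ltW.
rewrite subr0 (le_trans (hf j)) //.
have j1 : (1 : R) <= j%:~R ^+ 2.
  have : (1 : int) <= j ^+ 2 by rewrite -[1]addr0 lez1D exprn_even_gt0.
  by rewrite -(ler_int R) rmorphXn.
have p1 : (1 : R) <= pi by have := @pi_ge2 R; lra.
have p0 := pi_gt0 R; set J : R := j%:~R ^+ 2 in j1 *; have J1 := j1; rewrite /w -/J.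
clearbody J; clear j1.
have y0 : 0 < pi * J * c by rewrite !mulr_gt0 //; lra.
apply: le_trans (expR_inv_le y0) _.
rewrite (_ : 2 / c * (1 + J)^-1 = (c * (1 + J) / 2)^-1); last by field; apply/andP; split; apply/eqP; lra.
have h1 : c <= c * J by rewrite ler_peMr // ltW.
have h2 : c * J <= pi * (c * J) by rewrite ler_peMl // mulr_ge0; lra.
rewrite lef_pV2 ?posrE //; first by lra.
by rewrite divr_gt0 // mulr_gt0 //; lra.
Qed.

Lemma ce_fourth : ce (1 / 4) = ci R.
Proof.
rewrite ceE (_ : 2 * pi * (1 / 4) = pi / 2); last by field.
by rewrite cos_pihalf sin_pihalf.
Qed.

Lemma ce_eighth_sqr : ce (1 / 8) ^+ 2 = ci R.
Proof. by rewrite -ce_fourth expr2 -ceD; congr ce; field. Qed.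

Lemma Re_ce_eighth (x : R) : `|x| <= 1 / 8 -> 0 < complex.Re (ce x).
Proof.
move=> h; rewrite ceE /=; have p0 := pi_gt0 R; have := h; rewrite ler_norml => /andP[h1 h2].
by apply: cos_gt0_pihalf; apply/andP; split; nra.
Qed.

Lemma psq_ci (x : R) : 0 <= x -> psq (- (ci R * rc x)) = rc (Num.sqrt x) * ce (- (1 / 8)).
Proof.
move=> x0; have -> : - (ci R * rc x) = rc x * - ci R by ring.
rewrite psq_rcM //; congr (_ * _); apply: psq_unique.
  rewrite ceN exprVn ce_eighth_sqr; apply: (mulfI (ci_neq0 R)).
  by rewrite mulfV ?ci_neq0 // mulrN ci2 opprK.
by left; apply: Re_ce_eighth; rewrite normrN ger0_norm; lra.
Qed.

(** Half of the quadratic Gauss sum modulo 4 A, since the phase n B^2 / (4 A) modulo 1 has period 2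
    A in B. *)
Definition gg (A : nat) (n : int) : C :=
  \sum_(B < A.*2) ce (n%:~R * B%:R ^+ 2 / (4 * A%:R)).
Definition gs (a : int) (n : nat) : C := \sum_(k < n) ce (a%:~R * k%:R ^+ 2 / n%:R).

Lemma eq_of_lin (z z' : C) (K h0 : R) : 0 < h0 ->
  (forall h, 0 < h <= h0 -> cabs (z - z') <= K * h) -> z = z'.
Proof.
move=> h00 H; apply/eqP; rewrite -subr_eq0 -cabs_eq0 eq_le cabs_ge0 andbT.
apply/ler_addgt0Pr => e e0; rewrite add0r.
by have [h hh /(le_trans (H h hh))] := small_le K h00 e0.
Qed.

Lemma re_mul_gt0 (s t : C) : cone s -> cone t -> 0 < complex.Re (s * t).
Proof.
case: s t => a b [c d]; rewrite /cone /= => h1 h2.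
have : `|b * d| < a * c by rewrite normrM ltr_pM.
by rewrite ltr_norml => /andP[_]; lra.
Qed.

(** One theta series, with squared parameter h^2 - i n / (2 A), is evaluated twice as h tends to 0.
    Directly, [h S] tends to the mean of the phases modulo 2 A; after Poisson summation it tends to
    a multiple of the mean of the dual phases modulo [n]. *)
Lemma landsberg_schaar (A n : nat) : (0 < A)%N -> (0 < n)%N ->
  gg A n = ce (1 / 8) * rc (Num.sqrt (2 * A%:R / n%:R)) * gs (- A%:Z) n.
Proof.
move=> A0 n0; have Ar : (0 : R) < A%:R by rewrite ltr0n.
have nr : (0 : R) < n%:R by rewrite ltr0n.
have [be beE] : exists b : R, b = n%:R / (2 * A%:R) by eexists.
have be0 : 0 < be by rewrite beE divr_gt0 // mulr_gt0.
have A2 : (0 < A.*2)%N by rewrite double_gt0.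
have A2r : (A.*2)%:R = 2 * A%:R :> R by rewrite -mul2n natrM.
pose c (B : int) : C := ce (n%:R * B%:~R ^+ 2 / (4 * A%:R)).
pose d (k : int) : C := ce (- (A%:R * k%:~R ^+ 2 / n%:R)).
have cp B : c (B + A.*2%:Z) = c B.
  rewrite /c -[RHS](ceDint _ (n%:Z * (B + A%:Z))); congr ce.
  by rewrite rmorphD rmorphM rmorphD /= -!pmulrn A2r; field; apply/eqP; lra.
have dp B : d (B + n%:Z) = d B.
  rewrite /d -[RHS](ceDint _ (- (A%:Z * (2 * B + n%:Z)))); congr ce.
  by rewrite rmorphN rmorphD rmorphM rmorphD rmorphM /= -!pmulrn; field; apply/eqP; lra.
have [K hK] := theta_small A2 cp.
have gE : gg A n = \sum_(B < A.*2) c B%:Z by apply: eq_bigr => B _; rewrite /c -!pmulrn.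
have dE : gs (- A%:Z) n = \sum_(k < n) d k%:Z.
  by apply: eq_bigr => k _; rewrite /d rmorphN /= -!pmulrn; congr ce; ring.
pose Y : C := ce (1 / 8) * rc (Num.sqrt be / n%:R) * \sum_(k < n) d k%:Z.
suff XY : rc (A.*2)%:R^-1 * gg A n = Y.
  have z0 : rc (A.*2)%:R != 0 :> C by rewrite rc_eq0 A2r gt_eqF // mulr_gt0.
  rewrite dE; apply: (mulfI (invr_neq0 z0)); rewrite -rcV XY /Y !mulrA.
  congr (_ * _); rewrite [_ * ce _]mulrC -[RHS]mulrA -rcM; congr (_ * _); congr rc.
  have sb : Num.sqrt be ^+ 2 = be by rewrite sqr_sqrtr // ltW.
  have s0 : 0 < Num.sqrt be by rewrite sqrtr_gt0.
  have -> : 2 * A%:R / n%:R = (Num.sqrt be)^-1 ^+ 2 :> R.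
    by rewrite exprVn sb beE invf_div.
  rewrite sqrtr_sqr ger0_norm ?invr_ge0 ?ltW // A2r.
  apply: (mulIf (lt0r_neq0 s0)); rewrite [RHS]divfK ?gt_eqF //.
  by rewrite mulrAC -expr2 sb beE; field; apply/andP; split; apply/eqP; lra.
pose D : R := (16 * Num.sqrt be / n%:R * n%:R) * (n%:R ^+ 2 / be ^+ 2).
apply: (@eq_of_lin _ _ (K + D) (Num.min 1 (A.*2%:R)^-1)).
  by rewrite lt_min ltr01 invr_gt0 A2r mulr_gt0.
move=> h /andP[h0]; rewrite le_min => /andP[h1 hA].
have hA' : h * A.*2%:R <= 1 by rewrite -ler_pdivlMr ?div1r // A2r mulr_gt0.
have [de deE] : exists d : R, d = h ^+ 2 by eexists.
have de0 : 0 < de by rewrite deE exprn_gt0.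
(* [la] is the square of the Gaussian parameter: its real part [h ^ 2] gives the damping, its
   imaginary part the phases [c B]. *)
pose la : C := rc de - ci R * rc be.
pose l := psq la.
have laR : complex.Re la = de by rewrite /la ReD ReN ciM_rc /= subr0.
have cl : cone l by apply: psq_cone; rewrite laR.
have l2 : l ^+ 2 = la by exact: psq_sqr.
have la0 : la != 0 by rewrite -l2 expf_neq0 // cone_neq0.
(* [1 / la = ze + i / be] *)
pose ze : C := - (ci R * rc (de / be)) / la.
have be0' : rc be != 0 :> C by rewrite rc_eq0 gt_eqF.
have de0' : rc de != 0 :> C by rewrite rc_eq0 gt_eqF.
have lai : la^-1 = ze + ci R / rc be.
  rewrite /ze rcM rcV; apply: (mulfI la0); rewrite mulfV // mulrDr.
  rewrite (_ : la * (_ / la) = - (ci R * (rc de / rc be))); last by field; rewrite la0 be0'.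
  rewrite /la mulrBl mulrA; have := ci2 R.
  rewrite (_ : ci R * rc be * (ci R / rc be) = ci R * ci R); last by field.
  by move=> ->; field.
have zeR : 0 < complex.Re ze.
  have -> : ze = la^-1 - ci R * rc be^-1 by rewrite lai rcV addrK.
  rewrite ReD ReN ciM_rc (_ : complex.Re (Complex 0 _) = 0) // subr0.
  have -> : la^-1 = rc (cabs la ^+ 2)^-1 * cj la.
    by apply: (mulfI la0); rewrite mulfV // mulrCA mulcj -rcM mulVf // expf_neq0 // cabs_eq0.
  rewrite Re_rcM (_ : complex.Re (cj la) = de); last by rewrite -laR; case: (la).
  by rewrite mulr_gt0 // invr_gt0 exprn_gt0 // cabs_gt0.
pose s := psq ze.
have cs : cone s by exact: psq_cone.
have s2 : s ^+ 2 = ze by exact: psq_sqr.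
(* This fixes the branch: both roots lie in the cone, so their product has positive real part and is
   the principal root of -i de / be. The eighth root of unity in the reciprocity law comes from
   here. *)
have ls : l * s = rc (Num.sqrt (de / be)) * ce (- (1 / 8)).
  have q0 : 0 <= de / be by rewrite divr_ge0 // ltW.
  rewrite -(psq_ci q0); apply/esym; apply: psq_unique.
    by rewrite exprMn l2 s2 /ze mulrCA mulfV ?mulr1.
  by left; exact: re_mul_gt0.
have [B _ hS] := gau_poisson 0 cl; set S := tsum _ in hS.
have hS1 : hsum (fun B : int => c B * gau (rc h) 0 B%:~R) S.
  apply: hsum_ext (gau_sum 0 cl) => k; rewrite /c /ce /gau -cexpD !addr0 !exprMn l2; congr cexp.
  rewrite (_ : 2 * pi * (n%:R * k%:~R ^+ 2 / (4 * A%:R)) = pi * be * k%:~R ^+ 2); last first.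
    by rewrite beE; field; apply/eqP; lra.
  rewrite /la deE !(rcM, rcX); ring.
have hS2 : hsum (fun k : int => d k * gau s 0 k%:~R) (l * S).
  apply: hsum_ext (hsumZ l hS) => k.
  rewrite mulr0 mul0r sub0r mulrC -mulrA mulVf ?cone_neq0 // mulr1 l2 lai /d /ce /gau -cexpD addr0 exprMn s2.
  congr cexp; rewrite (_ : 2 * pi * - (A%:R * k%:~R ^+ 2 / n%:R) = - (pi * be^-1 * k%:~R ^+ 2)); last first.
    by rewrite beE invf_div; field; apply/eqP; lra.
  rewrite rcN !rcM rcV ?rcX; field; exact: be0'.
pose T (r : 'I_n) := tsum (fun m : int => gau (s * rc n%:R) (s * rc r%:R) m%:~R).
have csn : cone (s * rc n%:R).
  by rewrite mulrC /cone Re_rcM Im_rcM normrM ger0_norm ?ler0n // ltr_pM2l.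
have hT (r : 'I_n) : hsum (fun m : int => d (m * n%:Z + r%:Z) * gau s 0 (m * n%:Z + r%:Z)%:~R) (d r%:Z * T r).
  apply: hsum_ext (hsumZ (d r%:Z) (gau_sum (s * rc r%:R) csn)) => m.
  rewrite (periodic_mod dp) /gau addr0; congr (_ * cexp (- (_ * _ ^+ 2))).
  by rewrite rmorphD rmorphM /= -!pmulrn rcD rcM; ring.
have hlS : l * S = \sum_(r < n) d r%:Z * T r.
  apply: (@hsum_unique _ _ (fun r : 'I_n => d r%:Z * T r)).
    exact: (hsum_fubini hT (hsum_swap (int_split n0 hS2))).
  have := hsum_fin (enum_uniq 'I_n) (f := fun r : 'I_n => d r%:Z * T r).
  by rewrite big_enum /=; apply => i; rewrite mem_enum.
(* [cc] is the real part of 1 / (n^2 ze), the decay rate of the dual series on a residue class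
   modulo [n]. It grows like h^-2, so in the limit the zero frequency remains. *)
set cc : R := be ^+ 2 / (de * n%:R ^+ 2).
have cc0 : 0 < cc.
  by apply: divr_gt0; [exact: exprn_gt0|apply: mulr_gt0 => //; exact: exprn_gt0].
have nz : rc n%:R != 0 :> C by rewrite rc_eq0 gt_eqF.
have s0 := cone_neq0 cs.
have zei : ze^-1 = rc (be ^+ 2 / de) + ci R * rc be.
  apply: (mulfI (_ : ze != 0)); first by rewrite -s2 expf_neq0.
  rewrite mulfV -?s2 ?expf_neq0 // s2 /ze !(rcM, rcV) ?rcX.
  apply/esym/eqP; rewrite -subr_eq0; apply/eqP; have := ci2 R; have := la0; rewrite /la.
  move: (rc be) (rc de) be0' de0' (ci R) => b e b0 e0 i la0' i2.
  have -> : - (i * (e / b)) / (e - i * b) * (b ^+ 2 / e + i * b) - 1 =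
    (- (i * b) - i * i * e - (e - i * b)) / (e - i * b) by field; rewrite la0' b0 e0.
  by rewrite i2; field.
have Tb (r : 'I_n) : cabs (s * rc n%:R * T r - 1) <= 16 / cc.
  have [B' _ hP] := gau_poisson (s * rc r%:R) csn; rewrite -/(T r) in hP.
  have hh := hsumZ (s * rc n%:R) hP.
  have := @theta_tail (fun j : int => s * rc n%:R * (cexp (ci R * rc (2 * pi * j%:~R) * (s * rc r%:R) /
    (s * rc n%:R) - rc (pi * j%:~R ^+ 2) / (s * rc n%:R) ^+ 2) / (s * rc n%:R))) _ cc cc0 hh.
  have fE (j : R) : s * rc n%:R * (cexp (ci R * rc (2 * pi * j) * (s * rc r%:R) /
    (s * rc n%:R) - rc (pi * j ^+ 2) / (s * rc n%:R) ^+ 2) / (s * rc n%:R)) =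
    cexp (ci R * rc (2 * pi * j * r%:R / n%:R - pi * j ^+ 2 * be / n%:R ^+ 2) - rc (pi * j ^+ 2 * cc)).
    rewrite mulrC divfK ?mulf_neq0 //; congr cexp.
    rewrite [(s * rc n%:R) ^+ 2]exprMn s2 (invfM ze) zei /cc.
    rewrite (_ : be ^+ 2 / (de * n%:R ^+ 2) = be ^+ 2 / de / n%:R ^+ 2); last by rewrite invfM mulrA.
    rewrite rcB !(rcM, rcV) ?rcX.
    by field; rewrite s0 nz de0'.
  rewrite fE (_ : cexp _ = 1) => [H|]; last first.
    by rewrite expr0n !(mulr0, mul0r) !(mul0r, subrr) rc0 mulr0 subrr cexp0.
  apply: H => j; rewrite fE cabs_cexp ler_expR ReD ReN ciM_rc /=; lra.
have hY : rc h * S - Y = ce (1 / 8) * rc (Num.sqrt be / n%:R) *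
    \sum_(r < n) d r%:Z * (s * rc n%:R * T r - 1).
  rewrite (eq_bigr (fun r : 'I_n => s * rc n%:R * (d r%:Z * T r) - d r%:Z)); last by move=> r _; ring.
  rewrite sumrB -mulr_sumr -hlS mulrBr -/Y; congr (_ - _).
  have s0' : 0 < Num.sqrt be by rewrite sqrtr_gt0.
  have : l * s = rc (h / Num.sqrt be) * ce (- (1 / 8)).
    rewrite ls; congr (rc _ * _); rewrite sqrtrM ?ltW // sqrtrV ?ltW // deE sqrtr_sqr ger0_norm // ltW //.
  rewrite ceN !rcM !rcV => e.
  rewrite (_ : s * rc n%:R * (l * S) = (l * s) * rc n%:R * S); last by ring.
  rewrite e; field; rewrite !rc_eq0 ce_neq0 !gt_eqF //.
rewrite -(subrKA (rc h * S)) (le_trans (cabsD _ _)) // mulrDl lerD //.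
  by rewrite cabs_distC gE; apply: hK.
rewrite hY !cabsM cabs_ce mul1r cabs_rc ger0_norm ?divr_ge0 ?sqrtr_ge0 ?ler0n //.
have hsumle : cabs (\sum_(r < n) d r%:Z * (s * rc n%:R * T r - 1)) <= n%:R * (16 / cc).
  apply: le_trans (cabs_sum _ _ _) _.
  rewrite mulr_natl -[n in X in _ <= X](card_ord n) -sumr_const; apply: ler_sum => r _.
  by rewrite cabsM cabs_ce mul1r.
apply: le_trans (ler_wpM2l _ hsumle) _; first by rewrite divr_ge0 ?sqrtr_ge0 ?ler0n.
have -> : Num.sqrt be / n%:R * (n%:R * (16 / cc)) = D * h * h.
  by rewrite /D /cc deE; field; rewrite !gt_eqF.
have D0 : 0 <= D.
  rewrite /D; do ?[apply: mulr_ge0 | rewrite invr_ge0 | apply: exprn_ge0 | apply: sqrtr_ge0 | apply: ler0n | exact: ltW].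
by apply: ler_piMr h1; apply: mulr_ge0 => //; exact: ltW.
Qed.

End LandsbergSchaar.

(** * The terms of the Eisenstein series under the generators of Gamma_0(4) *)

Section EisensteinTerms.
Variable R : realType.
Local Notation C := R[i].
Implicit Types (x y t h : R) (tau z : C).

Lemma psq_mI z : 0 < complex.Im z -> psq (- (ci R * z)) = ce (- (1 / 8)) * psq z.
Proof.
move=> z0; apply: psq_unique.
  by rewrite exprMn psq_sqr ceN exprVn ce_eighth_sqr -mulNr; congr (_ * _); apply: (mulfI (ci_neq0 R)); rewrite mulfV ?ci_neq0 // mulrN ci2 opprK.
have hr : 0 < complex.Re (psq z) by apply: psq_Re_gt0; left; rewrite gt_eqF.
have hi : 0 < complex.Im (psq z).
  have := psq_sqr z => e; move: z0; rewrite -{1}e expr2 ImM; nra.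
left; rewrite ReM ceE /= mulrN cosN sinN (_ : 2 * pi * (1 / 8) = pi / 2 / 2); last by field.
have p0 := pi_gt0 R.
have c1 : 0 < cos (pi / 2 / 2 : R) by apply: cos_gt0_pihalf; apply/andP; split; lra.
have s1 : 0 < sin (pi / 2 / 2 : R) by apply: sin_gt0_pi; apply/andP; split; lra.
by rewrite mulNr opprK addr_gt0 // mulr_gt0.
Qed.

Lemma psq_I z : complex.Im z < 0 -> psq (ci R * z) = ce (1 / 8) * psq z.
Proof.
move=> z0; apply: psq_unique; first by rewrite exprMn psq_sqr ce_eighth_sqr.
have hr : 0 < complex.Re (psq z) by apply: psq_Re_gt0; left; rewrite lt_eqF.
have hi : complex.Im (psq z) < 0.
  have := psq_sqr z => e; move: z0; rewrite -{1}e expr2 ImM; nra.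
left; rewrite ReM ceE /= (_ : 2 * pi * (1 / 8) = pi / 2 / 2); last by field.
have p0 := pi_gt0 R.
have c1 : 0 < cos (pi / 2 / 2 : R) by apply: cos_gt0_pihalf; apply/andP; split; lra.
have s1 : 0 < sin (pi / 2 / 2 : R) by apply: sin_gt0_pi; apply/andP; split; lra.
by rewrite subr_gt0 (lt_trans (y := 0)) ?mulr_gt0 // pmulr_rlt0.
Qed.

(** Only the sign of the root is at stake. If Im X >= 0, the difference of the arguments stays in
    (-pi, pi); if Im X < 0, the condition Im (X / Y) < 0 confines it to (-pi, 0). The two cases
    occur according to the sign of the lower left entry in [EE_U] and [jfac_U]. *)
Lemma psq_div (X Y : C) : 0 < complex.Im Y -> X != 0 ->
  0 <= complex.Im X \/ complex.Im (X / Y) < 0 -> psq (X / Y) = psq X / psq Y.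
Proof.
move=> Y0 X0 hX; have Yn : Y != 0 by apply/eqP => e; move: Y0; rewrite e /= ltxx.
have hr : 0 < complex.Re (psq Y) by apply: psq_Re_gt0; left; rewrite gt_eqF.
have hi : 0 < complex.Im (psq Y).
  have := psq_sqr Y => e; move: Y0; rewrite -{1}e expr2 ImM; nra.
have qn : psq Y != 0 by rewrite psq_eq0.
have pn : psq X != 0 by rewrite psq_eq0.
have qi : (psq Y)^-1 = rc (cabs (psq Y) ^+ 2)^-1 * cj (psq Y).
  by apply: (mulfI qn); rewrite mulfV // mulrCA mulcj -rcM mulVf // expf_neq0 // cabs_eq0.
have c0 : 0 < (cabs (psq Y) ^+ 2)^-1 by rewrite invr_gt0 exprn_gt0 // cabs_gt0.
have s2 : (psq X / psq Y) ^+ 2 = X / Y by rewrite exprMn exprVn !psq_sqr.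
apply: psq_unique => //; left; rewrite qi mulrCA Re_rcM mulr_gt0 //.
have pr := psq_Re_ge0 X; have pi0 := @psq_Re_eq0 _ X.
have ImX : complex.Im X = 2 * complex.Re (psq X) * complex.Im (psq X).
  by rewrite -{1}(psq_sqr X) expr2 ImM; ring.
have Ims : complex.Im (X / Y) = 2 * ((cabs (psq Y) ^+ 2)^-1 ^+ 2 * (complex.Re (psq X * cj (psq Y)) * complex.Im (psq X * cj (psq Y)))).
  rewrite -s2 qi mulrCA; move: (_ ^- 2) (_ * cj _) => c z.
  by rewrite exprMn -rcX Im_rcM (expr2 z) ImM; ring.
case: (psq X) (psq Y) hr hi pr pi0 pn ImX Ims c0 => a b [c d] /= hc hd a0 ab pn ImX Ims c0.
have [b0|b0] := lerP 0 b.
  have [a1|a1] := ltrP 0 a; first by nra.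
  have a00 : a = 0 by lra.
  have b1 : 0 < b.
    rewrite lt_def b0 andbT; apply: contra pn => /eqP ->; rewrite a00.
    by rewrite eq_complex /= eqxx.
  by rewrite a00; nra.
have a1 : 0 < a by rewrite lt_def a0 andbT; apply/eqP => e; have := ab e; lra.
case: hX; first by rewrite ImX; nra.
rewrite Ims pmulr_rlt0 // pmulr_rlt0 ?exprn_gt0 // => h.
have : a * - d + b * c < 0 by nra.
nra.
Qed.

Definition W (A n : int) tau : C := 4 * A%:~R * tau + n%:~R.

(* [Eterm A n] is even in [(A, n)]; its value at [A = 0] is the one forced by reciprocity, and is [0] at [n = 0]
   because division by zero gives [0]. *)
Definition Ep (a : nat) (n : int) tau : C :=
  gg R a n * (rc (Num.sqrt a%:R))^-1 * psq (- (ci R * W a n tau)) ^- 3.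

Definition Eterm (A n : int) tau : C :=
  match A with
  | Posz 0 => - rc (Num.sqrt 2 / `|n%:~R|)
  | Posz a => Ep a n tau
  | Negz a => Ep a.+1 (- n) tau
  end.

Lemma Im_W A n tau : complex.Im (W A n tau) = 4 * A%:~R * complex.Im tau.
Proof. by rewrite /W -!rc_int -(rc_nat R 4) -rcM ImD Im_rcM /= addr0. Qed.

Lemma Re_W A n tau : complex.Re (W A n tau) = 4 * A%:~R * complex.Re tau + n%:~R.
Proof. by rewrite /W -!rc_int -(rc_nat R 4) -rcM ReD Re_rcM. Qed.

Lemma WN A n tau : W (- A) (- n) tau = - W A n tau.
Proof. by rewrite /W !rmorphN /=; ring. Qed.

Lemma EE_N A n tau : Eterm (- A) (- n) tau = Eterm A n tau.
Proof.
case: A => [[|a]|a]; first by rewrite oppr0 /Eterm rmorphN normrN.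
  by rewrite -NegzE /Eterm opprK.
by rewrite -[- Negz a]/(Posz a.+1) /Eterm.
Qed.

Lemma gs_period (A : int) (n : nat) (m : int) : gs R (A + m * n%:Z) n = gs R A n.
Proof.
apply: eq_bigr => k _; have n0 : (0 : R) < n%:R by rewrite ltr0n; case: k => k /=; case: (n).
rewrite -[RHS](ceDint _ (m * k%:Z ^+ 2)); congr ce.
by rewrite rmorphD !rmorphM /= -!pmulrn; field; rewrite gt_eqF.
Qed.

Lemma gg_period (A : nat) (n m : int) : gg R A (n + m * (4 * A%:Z)) = gg R A n.
Proof.
have [->|A0] := posnP A; first by rewrite !mulr0 addr0.
have A1 : (0 : R) < A%:R by rewrite ltr0n.
apply: eq_bigr => k _; rewrite -[RHS](ceDint _ (m * k%:Z ^+ 2)); congr ce.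
by rewrite rmorphD !rmorphM /= -!pmulrn; field; rewrite gt_eqF.
Qed.

Lemma gg_cj (A : nat) (n : int) : gg R A (- n) = cj (gg R A n).
Proof.
by rewrite /gg cj_sum; apply: eq_bigr => k _; rewrite cj_ce rmorphN /= !mulNr.
Qed.

Lemma gs_cj (A : int) (n : nat) : gs R (- A) n = cj (gs R A n).
Proof.
by rewrite /gs cj_sum; apply: eq_bigr => k _; rewrite cj_ce rmorphN /= !mulNr.
Qed.

Lemma ce_half : ce (1 / 2) = -1 :> C.
Proof. by rewrite (_ : 1 / 2 = 1 / 4 + 1 / 4 :> R) ?ceD ?ce_fourth ?ci2 //; field. Qed.

(** For [n > 0] reciprocity moves the Gauss sum to the modulus [n], where it depends on [A] modulo
    [n] alone. One formula then covers positive, zero and negative [A], so that [A] may be replaced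
    by [A + n]. *)
Lemma EE_pos (A : int) (n : nat) tau : (0 < n)%N -> 0 < complex.Im tau ->
  Eterm A n tau = - rc (Num.sqrt 2 / Num.sqrt n%:R) * gs R (- A) n * psq (W A n tau) ^- 3.
Proof.
move=> n0 v0; have nr : (0 : R) < n%:R by rewrite ltr0n.
have sn : 0 < Num.sqrt (n%:R : R) by rewrite sqrtr_gt0.
have sq (a : nat) : Num.sqrt (2 * a%:R / n%:R) = Num.sqrt 2 / Num.sqrt n%:R * Num.sqrt a%:R :> R.
  by rewrite !sqrtrM ?mulr_ge0 // sqrtrV // ?ler0n //; ring.
have c3 : ce (1 / 8) ^+ 4 = -1 :> C by rewrite (exprM _ 2 2) ce_eighth_sqr expr2 ci2.
have w0 : ce (1 / 8) != 0 :> C by exact: ce_neq0.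
case: A => [[|a]|a].
- rewrite /Eterm oppr0 /W mulr0 mul0r add0r.
  have -> : gs R 0 n = n%:R.
    rewrite /gs (eq_bigr (fun _ => 1)) => [|k _]; last by rewrite !mul0r ce0.
    by rewrite sumr_const card_ord.
  rewrite -!pmulrn -!(rc_nat R n) psq_rc ?ler0n // ger0_norm ?ler0n //.
  rewrite -!(rcM, rcV, rcN, rcX); congr rc.
  have e : n%:R = Num.sqrt (n%:R : R) ^+ 2 by rewrite sqr_sqrtr // ler0n.
  set s := Num.sqrt n%:R in sn e *; clearbody s.
  by rewrite e; field; rewrite gt_eqF.
- have W0 : 0 < complex.Im (W a.+1 n tau) by rewrite Im_W !mulr_gt0 // -pmulrn ltr0n.
  rewrite /Eterm /Ep landsberg_schaar // psq_mI // ceN sq !rcM.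
  have sa : rc (Num.sqrt (a.+1%:R : R)) != 0 by rewrite rc_eq0 gt_eqF // sqrtr_gt0 ltr0n.
  have pW : psq (W a.+1 n tau) != 0.
    by rewrite psq_eq0; apply/eqP => e; move: W0; rewrite e /= ltxx.
  rewrite exprMn exprVn invfM invrK.
  rewrite (_ : _ * _ = ce (1 / 8) ^+ 4 * rc (Num.sqrt 2) * rc (Num.sqrt n%:R)^-1 * gs R (- a.+1%:Z) n * psq (W a.+1 n tau) ^- 3).
    by rewrite c3; ring.
  by field; rewrite sa pW.
have W0 : complex.Im (W (Negz a) n tau) < 0.
  by rewrite Im_W pmulr_llt0 // NegzE rmorphN /= mulrN oppr_lt0 mulr_gt0 // -pmulrn ltr0n.
rewrite /Eterm /Ep gg_cj landsberg_schaar // cjM cjM cj_ce cj_rc -gs_cj sq !rcM.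
have -> : - (ci R * W a.+1 (- n%:Z) tau) = ci R * W (Negz a) n tau.
  by rewrite NegzE -[n%:Z in RHS]opprK WN; ring.
rewrite psq_I //.
have sa : rc (Num.sqrt (a.+1%:R : R)) != 0 by rewrite rc_eq0 gt_eqF // sqrtr_gt0 ltr0n.
have pW : psq (W (Negz a) n tau) != 0.
  by rewrite psq_eq0; apply/eqP => e; move: W0; rewrite e /= ltxx.
rewrite NegzE ceN exprMn invfM.
have c3' : (ce (1 / 8))^-1 * ce (1 / 8) ^- 3 = -1 :> C by rewrite -invfM -exprS c3 invrN1.
rewrite (_ : _ * _ = ((ce (1 / 8))^-1 * ce (1 / 8) ^- 3) * rc (Num.sqrt 2) * rc (Num.sqrt n%:R)^-1 * gs R (- - a.+1%:Z) n * psq (W (- a.+1%:Z) n tau) ^- 3).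
  by rewrite c3'; ring.
by rewrite NegzE in pW; field; rewrite sa pW w0.
Qed.

(** The action of the matrix (1 0; 4 1), which together with translations by integers and the sign
    change generates Gamma_0(4); [descent] makes this explicit. *)
Definition Ut tau : C := tau / (4 * tau + 1).

Lemma Im_den tau : complex.Im (4 * tau + 1) = 4 * complex.Im tau.
Proof. by rewrite -(rc_nat R 4) ImD Im_rcM /= addr0. Qed.

Lemma den_neq0 tau : 0 < complex.Im tau -> 4 * tau + 1 != 0.
Proof. by move=> v0; apply/eqP => e; have := Im_den tau; rewrite e /=; lra. Qed.

Lemma W_U A n tau : 0 < complex.Im tau -> W A n (Ut tau) = W (A + n) n tau / (4 * tau + 1).
Proof. by move=> v0; rewrite /W /Ut rmorphD /=; field; exact: den_neq0. Qed.

Lemma Im_U tau : 0 < complex.Im tau -> complex.Im (Ut tau) = complex.Im tau / cabs (4 * tau + 1) ^+ 2.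
Proof.
move=> v0; have d0 := den_neq0 v0.
have di : (4 * tau + 1)^-1 = rc (cabs (4 * tau + 1) ^+ 2)^-1 * cj (4 * tau + 1).
  by apply: (mulfI d0); rewrite mulfV // mulrCA mulcj -rcM mulVf // expf_neq0 // cabs_eq0.
rewrite /Ut di mulrCA Im_rcM mulrC; congr (_ * _).
by rewrite -(rc_nat R 4); case: (tau) => u v /=; ring.
Qed.

Lemma W_neq0 A n tau : 0 < complex.Im tau -> (A, n) != (0, 0) -> W A n tau != 0.
Proof.
move=> v0; apply: contraNneq => e; have := Im_W A n tau; have := Re_W A n tau; rewrite e /=.
have [->|A0] := eqVneq A 0.
  by rewrite mulr0 mul0r add0r => /esym/eqP; rewrite intr_eq0 => /eqP ->.
by move=> _ /esym/eqP; rewrite !mulf_eq0 intr_eq0 (negbTE A0) (gt_eqF v0) pnatr_eq0.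
Qed.

(** For [n > 0] this is [EE_pos] with the periodicity of [gs] in its first argument, the branch
    being settled by [psq_div]. At [n = 0] the pair (A, n) is fixed, and negative [n] follows from
    evenness. *)
Lemma EE_U (A n : int) tau : 0 < complex.Im tau ->
  Eterm A n (Ut tau) = psq (4 * tau + 1) ^+ 3 * Eterm (A + n) n tau.
Proof.
move=> v0; have d0 := den_neq0 v0.
have U0 : 0 < complex.Im (Ut tau) by rewrite Im_U // divr_gt0 // exprn_gt0 // cabs_gt0.
have dI : 0 < complex.Im (4 * tau + 1) by rewrite Im_den; lra.
have pd : psq (4 * tau + 1) != 0 by rewrite psq_eq0.
have pos (A' : int) (m : nat) : (0 < m)%N -> Eterm A' m (Ut tau) = psq (4 * tau + 1) ^+ 3 * Eterm (A' + m) m tau.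
  move=> m0; rewrite !EE_pos //.
  have Wn : W (A' + m) m tau != 0 by apply: W_neq0 => //; rewrite xpair_eqE negb_and orbC -lt0n m0.
  rewrite W_U // psq_div //; last first.
    have [h|h] := lerP 0 (A' + m); [left|right].
      by rewrite Im_W; apply: mulr_ge0; [apply: mulr_ge0; rewrite ?ler0z|exact: ltW].
    by rewrite -(W_U A' m v0) Im_W pmulr_llt0 // pmulr_rlt0 // ltrz0; lia.
  have -> : gs R (- A') m = gs R (- (A' + m)) m.
    by rewrite -(gs_period (- A') m (-1)); congr gs; ring.
  have pW : psq (W (A' + m) m tau) != 0 by rewrite psq_eq0.
  by rewrite exprMn exprVn invfM invrK; ring.
case: n => [[|n]|n].
- have E0 (a : nat) : Eterm a 0 (Ut tau) = psq (4 * tau + 1) ^+ 3 * Eterm a 0 tau.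
    case: a => [|a]; first by rewrite /Eterm /= normr0 invr0 mulr0 rc0 oppr0 mulr0.
    have W0 : 0 < complex.Im (W a.+1 0 tau) by rewrite Im_W !mulr_gt0 // -pmulrn ltr0n.
    have W1 : 0 < complex.Im (W a.+1 0 (Ut tau)) by rewrite Im_W !mulr_gt0 // -pmulrn ltr0n.
    rewrite /Eterm /Ep !psq_mI // W_U // addr0 psq_div //; last 2 first.
    + by apply: W_neq0.
    + by left; exact: ltW.
    by rewrite mulrA exprMn exprVn invfM invrK; ring.
  rewrite addr0; case: A => [a|a]; first exact: E0.
  by rewrite -!(EE_N (Negz a)) oppr0 NegzE opprK; exact: E0.
- exact: pos.
rewrite -(EE_N A) -[Eterm (A + _) _ _]EE_N NegzE opprD !opprK.
exact: pos.
Qed.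

Lemma EE_T (A n : int) tau : Eterm A n (tau + 1) = Eterm A (n + 4 * A) tau.
Proof.
have hW (B m : int) : W B m (tau + 1) = W B (m + 4 * B) tau by rewrite /W rmorphD rmorphM /=; ring.
have hp (a : nat) (m : int) : Ep a m (tau + 1) = Ep a (m + 4 * a%:Z) tau.
  by rewrite /Ep hW; congr (_ * _ * _); rewrite -[RHS](gg_period _ _ (-1)); congr gg; ring.
case: A => [[|a]|a]; rewrite /Eterm ?mulr0 ?addr0 ?hp //.
by congr Ep; rewrite NegzE; ring.
Qed.

End EisensteinTerms.

(** * The series with Gaussian cutoff: absolute convergence and exact transformation laws *)

Section RegularisedSeries.
Variable R : realType.
Local Notation C := R[i].
Implicit Types (tau z : C).

Lemma expR_le_inv1 (y : R) : 0 <= y -> expR (- y) <= (1 + y)^-1.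
Proof.
move=> y0; rewrite expRN lef_pV2 ?posrE ?expR_gt0 ?expR_ge1Dx //; lra.
Qed.

Lemma expR_le_w (X y : R) : 0 < X -> expR (- (X * y ^+ 2)) <= (1 + X^-1) * w y.
Proof.
move=> X0; have y0 := sqr_ge0 y; have Xy : 0 <= X * y ^+ 2 by rewrite mulr_ge0 // ltW.
apply: le_trans (expR_le_inv1 Xy) _.
rewrite /w -[X in X <= _]mul1r ler_pdivrMr; last by lra.
rewrite mulrAC ler_pdivlMr ?w_den // mul1r.
have -> : (1 + X^-1) * (1 + X * y ^+ 2) = 1 + X * y ^+ 2 + X^-1 + y ^+ 2 by field; rewrite gt_eqF.
have : 0 < X^-1 by rewrite invr_gt0.
lra.
Qed.

Lemma gg_le (a : nat) (n : int) : cabs (gg R a n) <= 2 * a%:R.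
Proof.
apply: le_trans (cabs_sum _ _ _) _; rewrite -(natrM _ 2) mul2n.
rewrite (eq_bigr (fun _ => 1)) => [|k _]; last by rewrite cabs_ce.
by rewrite sumr_const card_ord.
Qed.

(** Together with |W| >= 4 a v, the trivial bound 2 a for the Gauss sum gives v^(-3/2) / (4 a),
    uniformly in [n]; convergence of the series is left to the cutoff. *)
Lemma Ep_le (a : nat) (n : int) tau : (0 < a)%N -> 0 < complex.Im tau ->
  cabs (Ep a n tau) <= (Num.sqrt (complex.Im tau)) ^- 3.
Proof.
move=> a0 v0; set v := complex.Im tau in v0 *.
have ar : (0 : R) < a%:R by rewrite ltr0n.
have sv : 0 < Num.sqrt v by rewrite sqrtr_gt0.
have sa : 0 < Num.sqrt (a%:R : R) by rewrite sqrtr_gt0.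
rewrite /Ep !cabsM !cabsV cabsX cabs_rc (ger0_norm (ltW sa)).
set P := cabs (psq _).
have P0 : 0 <= P by exact: cabs_ge0.
have hP : 2 * Num.sqrt v * Num.sqrt a%:R <= P.
  rewrite -(ler_pXn2r (n := 2)) ?nnegrE ?mulr_ge0 ?sqrtr_ge0 //.
  have -> : (2 * Num.sqrt v * Num.sqrt a%:R) ^+ 2 = 4 * v * a%:R.
    by rewrite !exprMn !sqr_sqrtr ?ler0n ?ltW //; ring.
  rewrite /P cabs_psq cabsN cabsM (_ : cabs (ci R) = 1) ?mul1r; last first.
    by rewrite -ce_fourth cabs_ce.
  apply: le_trans (Im_le_cabs _); rewrite Im_W ger0_norm -?pmulrn; last by rewrite !mulr_ge0 ?ler0n // ltW.
  by rewrite -/v; rewrite -/v; lra.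
have hP3 : (2 * Num.sqrt v * Num.sqrt a%:R) ^+ 3 <= P ^+ 3.
  by rewrite ler_pXn2r ?nnegrE // !mulr_ge0 ?sqrtr_ge0.
apply: (@le_trans _ _ (2 * a%:R / Num.sqrt a%:R / (2 * Num.sqrt v * Num.sqrt a%:R) ^+ 3)).
  apply: ler_pM; rewrite ?invr_ge0 ?exprn_ge0 // ?divr_ge0 ?cabs_ge0 ?sqrtr_ge0 //.
    by rewrite ler_wpM2r ?invr_ge0 ?(ltW sa) // gg_le.
  by rewrite lef_pV2 ?posrE ?(lt_le_trans _ hP3) // exprn_gt0 // !mulr_gt0.
have e : a%:R = Num.sqrt (a%:R : R) ^+ 2 by rewrite sqr_sqrtr // ltW.
have a1 : (1 : R) <= a%:R by rewrite ler1n.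
rewrite e in a1; rewrite [X in 2 * X / _ / _]e.
set s := Num.sqrt a%:R in sa a1 *; set t := Num.sqrt v in sv *.
rewrite (_ : 2 * s ^+ 2 / s / (2 * t * s) ^+ 3 = t ^- 3 * (4 * s ^+ 2)^-1); last first.
  by field; rewrite !gt_eqF.
by rewrite ler_piMr ?invr_ge0 ?exprn_ge0 ?(ltW sv) // invf_le1; lra.
Qed.

Lemma EE_le (A n : int) tau : 0 < complex.Im tau ->
  cabs (Eterm A n tau) <= (Num.sqrt (complex.Im tau)) ^- 3 + 2.
Proof.
move=> v0; have s0 : 0 <= (Num.sqrt (complex.Im tau)) ^- 3 by rewrite invr_ge0 exprn_ge0 // sqrtr_ge0.
have hp (a : nat) (m : int) : (0 < a)%N -> cabs (Ep a m tau) <= (Num.sqrt (complex.Im tau)) ^- 3 + 2.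
  by move=> a0; rewrite (le_trans (Ep_le m a0 v0)) // lerDl.
case: A => [[|a]|a]; [|exact: hp|exact: hp].
rewrite /Eterm cabsN cabs_rc ger0_norm ?divr_ge0 ?sqrtr_ge0 //.
have s2 : Num.sqrt 2 <= 2 :> R.
  by rewrite -(ler_pXn2r (n := 2)) ?nnegrE ?sqrtr_ge0 // sqr_sqrtr //; lra.
have [->|n0] := eqVneq n 0; first by rewrite normr0 invr0 mulr0; lra.
have n1 : (1 : R) <= `|n%:~R| by rewrite -intr_norm ler1z; lia.
apply: (@le_trans _ _ 2); last by lra.
by rewrite ler_pdivrMr; [have := sqrtr_ge0 (2 : R); nra|lra].
Qed.

Definition Qf (A n : int) tau : R := cabs (W A n tau) ^+ 2 / complex.Im tau.

Lemma Qf_ge tau : 0 < complex.Im tau -> exists2 c, 0 < c &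
  forall A n : int, c * (A%:~R ^+ 2 + n%:~R ^+ 2) <= Qf A n tau.
Proof.
move=> v0; rewrite /Qf; have W2 A n : cabs (W A n tau) ^+ 2 =
   (4 * A%:~R * complex.Re tau + n%:~R) ^+ 2 + (4 * A%:~R * complex.Im tau) ^+ 2.
  by rewrite cabs_sqr Re_W Im_W.
move: (complex.Re tau) (complex.Im tau) v0 W2 => u v v0 W2.
pose D := 2 + 2 * u ^+ 2 / v ^+ 2 + (16 * v ^+ 2)^-1.
have v2 : 0 < v ^+ 2 by rewrite exprn_gt0.
have D0 : 0 < D.
  have h1 : 0 <= 2 * u ^+ 2 / v ^+ 2 by apply: divr_ge0; [apply: mulr_ge0 => //; exact: sqr_ge0|exact: sqr_ge0].
  have h2 : 0 < (16 * v ^+ 2)^-1 by rewrite invr_gt0 mulr_gt0.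
  by rewrite /D; lra.
exists (D * v)^-1; first by rewrite invr_gt0 mulr_gt0.
move=> A n; rewrite W2; move: (A%:~R) (n%:~R) => x y.
rewrite mulrC ler_pdivrMr ?mulr_gt0 // mulrCA divfK ?gt_eqF //.
set X := (_ + y) ^+ 2; set Y := (_ * v) ^+ 2.
have hx : x ^+ 2 = (16 * v ^+ 2)^-1 * Y by rewrite /Y; field; rewrite gt_eqF.
have hy : y ^+ 2 <= 2 * X + 2 * u ^+ 2 / v ^+ 2 * Y.
  have -> : 2 * u ^+ 2 / v ^+ 2 * Y = 2 * (4 * x * u) ^+ 2 by rewrite /Y; field; rewrite gt_eqF.
  by rewrite /X; have := sqr_ge0 (4 * x * u * 2 + y); nra.
have X0 : 0 <= X by exact: sqr_ge0.
have Y0 : 0 <= Y by exact: sqr_ge0.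
have h1 : 0 <= 2 * u ^+ 2 / v ^+ 2 by apply: divr_ge0; [apply: mulr_ge0 => //; exact: sqr_ge0|exact: sqr_ge0].
have h2 : 0 < (16 * v ^+ 2)^-1 by rewrite invr_gt0 mulr_gt0.
rewrite hx /D; set p := 2 * u ^+ 2 / v ^+ 2 in h1 hy *; set q := (16 * v ^+ 2)^-1 in h2 *.
rewrite mulrDl (mulrDr _ X Y); have := mulr_ge0 h1 X0; have := mulr_ge0 (ltW h2) X0.
rewrite !mulrDl !mulrDr; lra.
Qed.

(* The weights [k^-2] and [k^4] make the sum over [(A, n)] of all lattice points behave like a sum over [k] times
   coprime pairs, without any coprimality condition. *)
Definition Ft (ep : R) tau (p : nat * (int * int)) : C :=
  rc ((p.1.+1%:R ^+ 2)^-1) * Eterm p.2.1 p.2.2 tau * rc (expR (- (pi * ep * p.1.+1%:R ^+ 4 * Qf p.2.1 p.2.2 tau))).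

Lemma inv_sq_le_w (k : nat) : (k.+1%:R ^+ 2)^-1 <= 2 * w (k.+1%:R : R).
Proof.
have k1 : (1 : R) <= k.+1%:R by rewrite ler1n.
have k2 : (1 : R) <= k.+1%:R ^+ 2 by rewrite exprn_ege1.
rewrite /w -[X in X <= _]mul1r ler_pdivrMr; last by lra.
by rewrite mulrAC ler_pdivlMr ?w_den //; lra.
Qed.

Lemma bsum_w : bsum (fun n : int => @w R n%:~R) 8.
Proof.
have h1 : 0 < (1 : R) <= 1 by rewrite ltr01 lexx.
by apply: bsum_le (w_mesh 0 h1) => n; rewrite mul1r add0r mulr1.
Qed.

Lemma bsum_invsq : bsum (fun k : nat => (k.+1%:R ^+ 2 : R)^-1) 16.
Proof.
rewrite (_ : 16 = 2 * 8); last by ring.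
have := bsum_inj (h := fun k : nat => k.+1%:Z) _ bsum_w => h.
apply: bsum_le (bsumZ _ (h _)) => [k||a b []] //; exact: inv_sq_le_w.
Qed.

Lemma Ft_absb ep tau : 0 < ep -> 0 < complex.Im tau -> exists M, absb (Ft ep tau) M.
Proof.
move=> e0 v0; have [c c0 hc] := Qf_ge v0.
set B := (Num.sqrt (complex.Im tau)) ^- 3 + 2.
have B0 : 0 <= B by rewrite addr_ge0 // invr_ge0 exprn_ge0 // sqrtr_ge0.
set X := pi * ep * c; have X0 : 0 < X by rewrite !mulr_gt0 ?pi_gt0.
have m0 : 0 <= 1 + X^-1 by rewrite addr_ge0 // invr_ge0 ltW.
exists (16 * (B * (((1 + X^-1) * 8) * ((1 + X^-1) * 8)))).
have hw := bsumZ m0 bsum_w.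
have w0 (n : int) : 0 <= (1 + X^-1) * @w R n%:~R by rewrite mulr_ge0 // w_ge0.
have h2 := bsumZ B0 (bsum_mul w0 w0 hw hw).
have h3 := bsum_mul _ _ bsum_invsq h2.
apply: bsum_le (h3 _ _) => [[k [A n]]|k|[A n]] /=; last 2 first.
- by rewrite invr_ge0 exprn_ge0.
- by rewrite mulr_ge0 // mulr_ge0.
rewrite /Ft !cabsM !cabs_rc ger0_norm ?invr_ge0 ?exprn_ge0 // (ger0_norm (expR_ge0 _)) -mulrA.
rewrite ler_wpM2l ?invr_ge0 ?exprn_ge0 //; apply: ler_pM; rewrite ?cabs_ge0 ?expR_ge0 //.
  exact: EE_le.
apply: (@le_trans _ _ (expR (- (X * A%:~R ^+ 2)) * expR (- (X * n%:~R ^+ 2)))).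
  rewrite -expRD ler_expR -opprD lerN2 -mulrDr /X.
  have k4 : 1 <= (k.+1%:R : R) ^+ 4 by rewrite exprn_ege1 // ler1n.
  have h := hc A n; have s0 : 0 <= (A%:~R : R) ^+ 2 + n%:~R ^+ 2 by rewrite addr_ge0 ?sqr_ge0.
  have Q0 : 0 <= Qf A n tau by rewrite (le_trans _ h) // mulr_ge0 // ltW.
  rewrite -[pi * ep * c * _]mulrA -[pi * ep * _ * _]mulrA ler_wpM2l //.
    by rewrite mulr_ge0 ?pi_ge0 // ltW.
  by apply: le_trans h _; rewrite ler_peMl.
by apply: ler_pM; rewrite ?expR_ge0 ?expR_le_w.
Qed.

Definition Fe (ep : R) tau : C := tsum (Ft ep tau).

Lemma Fe_hsum ep tau : 0 < ep -> 0 < complex.Im tau -> hsum (Ft ep tau) (Fe ep tau).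
Proof. by move=> e0 /(Ft_absb e0)[M hM]; exact: tsumP hM. Qed.

Lemma Qf_T (A n : int) tau : Qf A n (tau + 1) = Qf A (n + 4 * A) tau.
Proof.
rewrite /Qf ImD addr0 (_ : W A n (tau + 1) = W A (n + 4 * A) tau) //.
by rewrite /W rmorphD rmorphM /=; ring.
Qed.

Lemma Qf_U (A n : int) tau : 0 < complex.Im tau -> Qf A n (Ut tau) = Qf (A + n) n tau.
Proof.
move=> v0; rewrite /Qf W_U // Im_U // cabsM cabsV.
have d0 : cabs (4 * tau + 1) != 0 by rewrite cabs_eq0 den_neq0.
by field; rewrite d0 gt_eqF.
Qed.

Lemma Fe_T ep tau : 0 < ep -> 0 < complex.Im tau -> Fe ep (tau + 1) = Fe ep tau.
Proof.
move=> e0 v0; have v1 : complex.Im (tau + 1) = complex.Im tau by rewrite ImD /= addr0.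
apply: tsum_eq.
have h := @hsum_bij _ _ _ (fun p : nat * (int * int) => (p.1, (p.2.1, p.2.2 + 4 * p.2.1)))
  (fun p => (p.1, (p.2.1, p.2.2 - 4 * p.2.1))) _ _ _ _ (Fe_hsum e0 v0).
apply: hsum_ext (h _ _) => [[k [A n]]|[k [A n]]|[k [A n]]] /=; rewrite ?addrK ?subrK //.
by rewrite /Ft EE_T Qf_T.
Qed.

Lemma Fe_U ep tau : 0 < ep -> 0 < complex.Im tau -> Fe ep (Ut tau) = psq (4 * tau + 1) ^+ 3 * Fe ep tau.
Proof.
move=> e0 v0; apply: tsum_eq.
have h := @hsum_bij _ _ _ (fun p : nat * (int * int) => (p.1, (p.2.1 + p.2.2, p.2.2)))
  (fun p => (p.1, (p.2.1 - p.2.2, p.2.2))) _ _ _ _ (Fe_hsum e0 v0).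
apply: hsum_ext (hsumZ _ (h _ _)) => [[k [A n]]|[k [A n]]|[k [A n]]] /=; rewrite ?addrK ?subrK //.
rewrite /Ft EE_U // Qf_U //.
by move: (rc _) (psq _) (Eterm _ _ _) (rc _) => x y z t; ring.
Qed.

End RegularisedSeries.

(** * Quadratic Gauss sums modulo odd numbers and the Jacobi symbol *)

Section GaussSums.
Variable R : realType.
Local Notation C := R[i].

Section Prime.
Variable p : nat.
Hypothesis p_pr : prime p.
Hypothesis p_odd : odd p.

Let pr0 : (0 : R) < p%:R. Proof. by rewrite ltr0n prime_gt0. Qed.

Definition psi (x : 'F_p) : C := ce ((x : nat)%:R / p%:R).

Lemma ce_mod (k : nat) : ce ((k %% p)%:R / p%:R) = ce (k%:R / p%:R) :> C.
Proof.
rewrite {2}(divn_eq k p) natrD natrM mulrDl mulfK ?gt_eqF //.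
by rewrite addrC (pmulrn _ (k %/ p)) ceDint.
Qed.

Lemma psi_nat (k : nat) : psi k%:R = ce (k%:R / p%:R).
Proof. by rewrite /psi val_Fp_nat // ce_mod. Qed.

Lemma psi_natr (x : 'F_p) : x = (x : nat)%:R.
Proof. by rewrite natr_Zp. Qed.

Lemma psiD x y : psi (x + y) = psi x * psi y.
Proof. by rewrite (psi_natr x) (psi_natr y) -natrD !psi_nat natrD mulrDl ceD. Qed.

Lemma psi0 : psi 0 = 1. Proof. by rewrite /psi mul0r ce0. Qed.

Lemma psiN x : psi (- x) = (psi x)^-1.
Proof.
have h : psi x * psi (- x) = 1 by rewrite -psiD subrr psi0.
by apply: (mulfI (ce_neq0 _ : psi x != 0)); rewrite h mulfV // ce_neq0.
Qed.

Lemma psi_int (k : int) : psi k%:~R = ce (k%:~R / p%:R).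
Proof.
case: k => k; first by rewrite -!pmulrn psi_nat.
by rewrite NegzE !rmorphN /= -!pmulrn psiN psi_nat mulNr ceN.
Qed.

Lemma gsF (a : int) : gs R a p = \sum_(x : 'F_p) psi (a%:~R * x ^+ 2).
Proof.
rewrite /gs -(big_mkord xpredT (fun k => ce (a%:~R * k%:R ^+ 2 / p%:R))).
transitivity (\sum_(0 <= k < (Zp_trunc (pdiv p)).+2) ce (a%:~R * k%:R ^+ 2 / p%:R) : C).
  by rewrite (Fp_cast p_pr).
rewrite big_mkord; apply: eq_bigr => x _; have -> : a%:~R * x ^+ 2 = (a * (x : nat)%:Z ^+ 2)%:~R :> 'F_p.
  by rewrite intrM rmorphXn /= -pmulrn -psi_natr.
by rewrite psi_int intrM rmorphXn /= -pmulrn.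
Qed.

Lemma psi_sum (c : 'F_p) : c != 0 -> \sum_(x : 'F_p) psi (c * x) = 0.
Proof.
move=> c0.
have -> : \sum_(x : 'F_p) psi (c * x) = \sum_(x : 'F_p) psi x.
  by rewrite [RHS](reindex_inj (mulfI c0)).
have h : \sum_(x : 'F_p) psi x = psi 1 * \sum_(x : 'F_p) psi x.
  rewrite [LHS](reindex_inj (addrI 1)) mulr_sumr; apply: eq_bigr => x _; exact: psiD.
have p1 : psi 1 != 1.
  have := psi_nat 1; rewrite mulr1n => ->; apply: ce_neq1.
  by rewrite divr_gt0 //= ltr_pdivrMr // mul1r ltr1n prime_gt1.
have : (psi 1 - 1) * \sum_(x : 'F_p) psi x = 0 by rewrite mulrBl mul1r -h subrr.
by move/eqP; rewrite mulf_eq0 subr_eq0 (negbTE p1) => /eqP.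
Qed.

Definition sqF : {set 'F_p} := [set y | [exists x : 'F_p, (x != 0) && (x ^+ 2 == y)]].

Lemma two_neq0 : (2 : 'F_p) != 0.
Proof.
rewrite -(dvdn_pcharf (pchar_Fp p_pr)) gtnNdvd //.
by case: p p_odd p_pr => [|[|[|]]].
Qed.

Lemma sqF_sum (f : 'F_p -> C) : \sum_(x : 'F_p | x != 0) f (x ^+ 2) = 2 * \sum_(y in sqF) f y.
Proof.
rewrite (partition_big (fun x : 'F_p => x ^+ 2) (fun y => y \in sqF)) /=; last first.
  by move=> x x0; rewrite inE; apply/existsP; exists x; rewrite x0 eqxx.
rewrite mulr_sumr; apply: eq_bigr => y; rewrite inE => /existsP[x /andP[x0 /eqP xy]].
rewrite (eq_bigr (fun _ => f y)) => [|z /andP[_ /eqP->]] //.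
rewrite sumr_const (_ : #|_| = 2%N) ?mulr_natl //.
have nx : x != - x.
  by rewrite -subr_eq0 opprK -mulr2n -mulr_natl mulf_neq0 // two_neq0.
transitivity #|[set x; - x]|; last by rewrite cards2 nx.
apply: eq_card => z; rewrite !inE -topredE /= -xy eqf_sqr.
by apply: andb_idl => /orP[/eqP->|/eqP->] //; rewrite oppr_eq0.
Qed.

Lemma sqF_card : #|sqF|.*2 = p.-1.
Proof.
have := sqF_sum (fun _ => 1); rewrite !sumr_const -natrM mul2n => /eqP.
rewrite eqr_nat => /eqP <-.
by rewrite cardC1 card_Fp.
Qed.

Lemma sqF_mul (r y : 'F_p) : r \in sqF -> (r * y \in sqF) = (y \in sqF).
Proof.
rewrite !inE => /existsP[s /andP[s0 /eqP <-]].
apply/existsP/existsP => -[x /andP[x0 /eqP xy]].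
  by exists (x / s); rewrite mulf_neq0 ?invr_eq0 //= exprMn exprVn xy mulrAC mulfV ?mul1r // expf_neq0.
by exists (s * x); rewrite mulf_neq0 //= exprMn xy.
Qed.

(** By [sqF_mul] a nonsquare multiplies squares into nonsquares, and since both sets have (p - 1) /
    2 elements the inclusion is an equality. *)
Lemma nsqF (r : 'F_p) : r != 0 -> r \notin sqF -> [set r * y | y in sqF] = [set y | y != 0] :\: sqF.
Proof.
move=> r0 rs; apply/eqP; rewrite eqEcard; apply/andP; split.
  apply/fintype.subsetP => _ /imsetP[y ys ->]; rewrite !inE; apply/andP; split; last first.
    rewrite mulf_neq0 //; move: ys; rewrite inE => /existsP[x /andP[x0 /eqP <-]].
    by rewrite expf_neq0.
  by apply: contra rs => h; rewrite -(sqF_mul r ys) mulrC inE.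
rewrite card_imset; last exact: mulfI.
have sub : sqF \subset [set y | y != 0].
  by apply/fintype.subsetP => y; rewrite !inE => /existsP[x /andP[x0 /eqP <-]]; rewrite expf_neq0.
rewrite cardsD (finset.setIidPr sub).
have -> : #|[set y : 'F_p | y != 0]| = p.-1.
  transitivity #|predC1 (0 : 'F_p)|; first by apply: eq_card => y; rewrite !inE.
  by rewrite cardC1 card_Fp.
by rewrite -sqF_card -addnn addnK.
Qed.

Lemma gsF_sq (b : 'F_p) : \sum_(x : 'F_p) psi (b * x ^+ 2) = 1 + 2 * \sum_(y in sqF) psi (b * y).
Proof.
rewrite (bigD1 0) //= expr0n mulr0 psi0; congr (_ + _).
exact: (sqF_sum (fun y => psi (b * y))).
Qed.

Lemma legendre_sq (a : int) : ~~ (p%:Z %| a)%Z ->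
  legendre a p = if (a%:~R : 'F_p) \in sqF then 1 else -1.
Proof.
move=> pa; rewrite /legendre (negbTE pa); congr (if _ then _ else _).
have F0 (k : int) : (k%:~R == 0 :> 'F_p) = (p%:Z %| k)%Z.
  by rewrite dvdzE /=; case: k => k; rewrite ?NegzE ?rmorphN ?oppr_eq0 /= -pmulrn
    -(dvdn_pcharf (pchar_Fp p_pr)).
have cong (k l : int) : (k == l %[mod p%:Z])%Z = (k%:~R == l%:~R :> 'F_p).
  by rewrite eqz_mod_dvd -F0 rmorphB subr_eq0.
apply/existsP/idP => [[x]|].
  rewrite cong rmorphXn /= -pmulrn => /eqP h; rewrite inE; apply/existsP; exists (x%:R).
  rewrite h eqxx andbT; apply: contra pa => /eqP x0.
  by rewrite -F0 -h x0 expr0n.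
rewrite inE => /existsP[x /andP[x0 /eqP h]].
have xp : ((x : nat) < p)%N by rewrite -[X in (_ < X)%N](Fp_cast p_pr).
exists (Ordinal xp); rewrite cong rmorphXn /= -pmulrn -h; apply/eqP; congr (_ ^+ _).
by rewrite -psi_natr.
Qed.

(** A square factor t^2 is absorbed by the substitution x -> t x. A nonsquare exchanges squares and
    nonsquares, and because the nontrivial additive character sums to 0 the two quadratic sums are
    negatives of each other. *)
Lemma gs_prime (a b : int) : ~~ (p%:Z %| a)%Z -> ~~ (p%:Z %| b)%Z ->
  gs R (a * b) p = (legendre a p)%:~R * gs R b p.
Proof.
move=> pa pb; rewrite legendre_sq // !gsF !rmorphM /=.
have F0 (k : int) : (k%:~R == 0 :> 'F_p) = (p%:Z %| k)%Z.
  by rewrite dvdzE /=; case: k => k; rewrite ?NegzE ?rmorphN ?oppr_eq0 /= -pmulrn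
    -(dvdn_pcharf (pchar_Fp p_pr)).
rewrite -F0 in pa; rewrite -F0 in pb; move: (a%:~R) (b%:~R) pa pb => r s r0 s0.
case: ifP => [|/negbT rs].
  rewrite inE => /existsP[t /andP[t0 /eqP <-]]; rewrite mul1r.
  rewrite [RHS](reindex_inj (mulfI t0)); apply: eq_bigr => x _.
  by congr psi; rewrite exprMn; ring.
rewrite mulN1r; apply/eqP; rewrite -addr_eq0 !gsF_sq.
have -> : \sum_(y in sqF) psi (r * s * y) = \sum_(y in [set y : 'F_p | y != 0] :\: sqF) psi (s * y).
  rewrite -(nsqF r0 rs) big_imset /=; last by move=> x y _ _; exact: mulfI.
  by apply: eq_bigr => y _; congr psi; ring.
have h := psi_sum s0; rewrite (bigD1 0) //= mulr0 psi0 in h.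
have sub : sqF \subset [set y : 'F_p | y != 0].
  by apply/fintype.subsetP => y; rewrite !inE => /existsP[x /andP[x0 /eqP <-]]; rewrite expf_neq0.
have : \sum_(y : 'F_p | y != 0) psi (s * y) =
   \sum_(y in sqF) psi (s * y) + \sum_(y in [set y : 'F_p | y != 0] :\: sqF) psi (s * y).
  rewrite (bigID (mem sqF)) /=; congr (_ + _); apply: eq_bigl => y; last by rewrite !inE andbC.
  by apply: andb_idl => /(fintype.subsetP sub); rewrite inE.
move=> e; rewrite e in h.
have aux (S1 S2 : C) : 1 + (S1 + S2) = 0 -> 1 + 2 * S2 + (1 + 2 * S1) = 0.
  move=> h0; have -> : 1 + 2 * S2 + (1 + 2 * S1) = 2 * (1 + (S1 + S2)) by ring.
  by rewrite h0 mulr0.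
by apply/eqP; exact: aux.
Qed.

Lemma Fp_eq0 (k : int) : (k%:~R == 0 :> 'F_p) = (p%:Z %| k)%Z.
Proof.
by rewrite dvdzE /=; case: k => k; rewrite ?NegzE ?rmorphN ?oppr_eq0 /= -pmulrn
    -(dvdn_pcharf (pchar_Fp p_pr)).
Qed.

Lemma psi_lin (c : int) : ~~ (p%:Z %| c)%Z -> \sum_(y < p) ce (c%:~R * y%:R / p%:R) = 0 :> C.
Proof.
rewrite -Fp_eq0 => c0; rewrite -[RHS](psi_sum c0).
rewrite -(big_mkord xpredT (fun k => ce (c%:~R * k%:R / p%:R))).
transitivity (\sum_(0 <= k < (Zp_trunc (pdiv p)).+2) ce (c%:~R * k%:R / p%:R) : C).
  by rewrite (Fp_cast p_pr).
rewrite big_mkord; apply: eq_bigr => x _.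
have -> : c%:~R * x = (c * (x : nat)%:Z)%:~R :> 'F_p by rewrite intrM /= -pmulrn -psi_natr.
by rewrite psi_int intrM /= -pmulrn.
Qed.

End Prime.

Lemma gs_mod (a b : int) (n : nat) : (a == b %[mod n%:Z])%Z -> gs R a n = gs R b n.
Proof.
rewrite eqz_mod_dvd => /dvdzP[q e]; rewrite -(gs_period R b n q); congr gs.
by rewrite -e; ring.
Qed.

Lemma sum_split (m n : nat) (f : nat -> C) : (0 < m)%N ->
  \sum_(k < m * n) f k = \sum_(y < n) \sum_(x < m) f (x + m * y)%N.
Proof.
move=> m0; elim: n => [|n IH]; first by rewrite muln0 !big_ord0.
rewrite big_ord_recr /= -IH mulnS addnC -!(big_mkord xpredT f).
rewrite (big_cat_nat (n := (m * n)%N)) ?leq_addr //=; congr (_ + _).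
rewrite -{1}[(m * n)%N]add0n big_addn addKn big_mkord; apply: eq_bigr => x _.
by [].
Qed.

Lemma gs_prime_pow (p m : nat) (a b : int) : prime p -> odd p ->
  ~~ (p%:Z %| a)%Z -> ~~ (p%:Z %| b)%Z ->
  gs R (a * b) (p ^ m) = (legendre a p ^+ m)%:~R * gs R b (p ^ m).
Proof.
move=> p_pr p_odd pa pb; have p0 := prime_gt0 p_pr; have pr0 : (0 : R) < p%:R by rewrite ltr0n.
(* With the index written as x + p^(l+1) y the phase is linear in y modulo 1, so that only the x
   divisible by p contribute. They give p times the sum for the exponent l. *)
have rec (c : int) (l : nat) : ~~ (p%:Z %| c)%Z -> gs R c (p ^ l.+2) = p%:R * gs R c (p ^ l).
  move=> pc; have pl : (0 < p ^ l.+1)%N by rewrite expn_gt0 p0.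
  rewrite /gs expnSr (sum_split p (fun k => ce (c%:~R * k%:R ^+ 2 / (p ^ l.+1 * p)%:R)) pl) exchange_big /=.
  have inner (x : nat) : \sum_(y < p) ce (c%:~R * (x + p ^ l.+1 * y)%:R ^+ 2 / (p ^ l.+1 * p)%:R) =
      ce (c%:~R * x%:R ^+ 2 / (p ^ l.+2)%:R) * (if (p %| x)%N then p%:R else 0) :> C.
    rewrite (eq_bigr (fun y : 'I_p => ce (c%:~R * x%:R ^+ 2 / (p ^ l.+2)%:R) * ce ((2 * c * x%:Z)%:~R * y%:R / p%:R))); last first.
      move=> y _; rewrite -ceD -[RHS](ceDint _ (c * y%:Z ^+ 2 * (p%:Z ^+ l))); congr ce.
      rewrite !rmorphM !rmorphXn /= -!pmulrn natrD !natrM !natrX !exprS; field.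
      by rewrite ?expf_neq0 // gt_eqF // ?exprn_gt0.
    rewrite -mulr_sumr; congr (_ * _); case: ifP => px.
      rewrite (eq_bigr (fun _ => 1)) ?sumr_const ?card_ord // => y _.
      case/dvdnP: px => q ->; rewrite -(ce_int R (2 * c * q%:Z * y%:Z)); congr ce.
      by rewrite !rmorphM /= -!pmulrn ?natrM; field; rewrite gt_eqF.
    apply: psi_lin => //; rewrite dvdzE !abszM !Euclid_dvdM // !negb_or -!dvdzE pc /=.
    have -> : x%:Z \notin dvdz p by rewrite dvdzE /= px.
    rewrite !andbT dvdzE /= gtnNdvd //.
    by case: p p_odd p_pr {p0 pr0 pa pb pc pl px} => [|[|[|]]].
  rewrite (eq_bigr (fun x : 'I_(p ^ l.+1) => ce (c%:~R * x%:R ^+ 2 / (p ^ l.+2)%:R) * (if (p %| x)%N then p%:R else 0))) => [|x _]; last exact: inner.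
  rewrite expnS.
  rewrite (sum_split (p ^ l) (fun x => ce (c%:~R * x%:R ^+ 2 / (p * p ^ l.+1)%:R) * (if (p %| x)%N then p%:R else 0)) p0).
  rewrite mulr_sumr; apply: eq_bigr => y _; rewrite (bigD1 (Ordinal p0)) //= add0n dvdn_mulr // big1 ?addr0.
    rewrite mulrC; congr (_ * ce _); rewrite !natrM !natrX !exprS; field.
    by rewrite ?expf_neq0 // gt_eqF // ?exprn_gt0.
  move=> x x0; rewrite dvdn_addl ?dvdn_mulr // gtnNdvd ?mulr0 // lt0n.
  by move: x0; rewrite -val_eqE.
elim/ltn_ind: m => -[_|[_|m IH]].
- by rewrite expn0 expr0 mul1r /gs !big_ord_recl !big_ord0 /= !expr0n !mulr0 !mul0r.
- by rewrite expn1 expr1 gs_prime.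
rewrite !rec //; last first.
  by rewrite dvdzE abszM Euclid_dvdM // negb_or -!dvdzE pa.
rewrite IH // !exprS mulrCA; congr (_ * _).
have : legendre a p * legendre a p = 1.
  by rewrite /legendre (negbTE pa); case: ifP.
by move=> e; rewrite mulrA e mul1r.
Qed.

Lemma modn_cancel (m n x y : nat) : coprime m n -> (x < m)%N -> (y < m)%N ->
  n * x = n * y %[mod m] -> x = y.
Proof.
move=> co; wlog xy : x y / (x <= y)%N => [H xm ym e|].
  by case/orP: (leq_total x y) => h; [exact: H|apply/esym; exact: H].
move=> xm ym /esym/eqP; rewrite eqn_mod_dvd ?leq_mul2l ?xy ?orbT // -mulnBr Gauss_dvdr // => d.
have := dvdn_leq _ d; rewrite subn_gt0; case: ltngtP xy => // xy _ /(_ isT).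
by rewrite leqNgt (leq_ltn_trans (leq_subr _ _) ym).
Qed.

Lemma gs_crt (m n : nat) (a : int) : (0 < m)%N -> (0 < n)%N -> coprime m n ->
  gs R a (m * n) = gs R (a * n%:Z) m * gs R (a * m%:Z) n.
Proof.
move=> m0 n0 co; have mn : (0 < m * n)%N by rewrite muln_gt0 m0.
pose h (p : 'I_m * 'I_n) := Ordinal (ltn_pmod (n * p.1 + m * p.2) mn).
have hi : injective h.
  move=> [x y] [x' y'] /(congr1 val) /= e.
  have e1 : n * x = n * x' %[mod m].
    by have := congr1 (fun k => k %% m)%N e; rewrite !modn_dvdm ?dvdn_mulr // ![(n * _ + _)%N]addnC !modnMDl || rewrite !modn_dvdm ?dvdn_mulr // ![(n * _ + m * _)%N]addnC ![(m * _)%N]mulnC !modnMDl.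
  have e2 : m * y = m * y' %[mod n].
    by have := congr1 (fun k => k %% n)%N e; rewrite !modn_dvdm ?dvdn_mull // ![(n * _)%N]mulnC !modnMDl.
  have co' : coprime n m by rewrite coprime_sym.
  by congr pair; apply: val_inj; [apply: (modn_cancel co) e1|apply: (modn_cancel co') e2].
have hb : bijective h by apply: inj_card_bij hi _; rewrite card_prod !card_ord.
rewrite /gs (reindex h) /=; last by case: hb => g gh hg; exists g => ? _; [exact: gh|exact: hg].
rewrite big_distrlr /= pair_bigA /=; apply: eq_bigr => -[x y] _ /=.
have mr : (0 : R) < m%:R by rewrite ltr0n.
have nr : (0 : R) < n%:R by rewrite ltr0n.
set k := (n * x + m * y)%N.
have -> : ce (a%:~R * (k %% (m * n))%:R ^+ 2 / (m * n)%:R) = ce (a%:~R * k%:R ^+ 2 / (m * n)%:R) :> C.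
  rewrite {2}(divn_eq k (m * n)); set q := (k %/ _)%N; set r := (k %% _)%N.
  rewrite -[LHS](ceDint _ (a * (q%:Z ^+ 2 * (m * n)%:Z + 2 * q%:Z * r%:Z))); congr ce.
  rewrite !(rmorphD, rmorphM, rmorphXn) /= -!pmulrn ?natrD ?natrM; field.
  by rewrite !gt_eqF.
rewrite -ceD -[RHS](ceDint _ (2 * a * x%:Z * y%:Z)); congr ce.
rewrite !rmorphM /= -!pmulrn /k natrD ?natrM; field.
by rewrite !gt_eqF.
Qed.

Lemma gs_jacobi_seq (e : nat -> nat) (ps : seq nat) (a b : int) : uniq ps ->
  (forall p, p \in ps -> [/\ prime p, odd p, ~~ (p%:Z %| a)%Z & ~~ (p%:Z %| b)%Z]) ->
  gs R (a * b) (\prod_(p <- ps) p ^ e p) =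
    (\prod_(p <- ps) legendre a p ^+ e p)%:~R * gs R b (\prod_(p <- ps) p ^ e p).
Proof.
elim: ps a b => [|p ps IH] a b.
  by move=> _ _; rewrite !big_nil mul1r /gs !big_ord_recl !big_ord0 /= !expr0n !mulr0 !mul0r.
move=> /= /andP[pps ups] hp; rewrite !big_cons; set N := (\prod_(q <- ps) q ^ e q)%N.
have [p_pr p_odd pa pb] := hp p (mem_head _ _).
have hq q : q \in ps -> [/\ prime q, odd q, ~~ (q%:Z %| a)%Z & ~~ (q%:Z %| b)%Z].
  by move=> qs; apply: hp; rewrite inE qs orbT.
have neq q : q \in ps -> q != p by move=> qs; apply: contraNneq pps => <-.
have pN : ~~ (p %| N)%N.
  rewrite /N big_seq; elim/big_ind: _ => [|x y hx hy|q qs]; first by rewrite dvdn1 neq_ltn prime_gt1 // orbT.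
    by rewrite Euclid_dvdM // negb_or hx.
  have [q_pr _ _ _] := hq q qs; rewrite Euclid_dvdX // negb_and; apply/orP; left.
  by rewrite dvdn_prime2 // eq_sym neq.
have N0 : (0 < N)%N by rewrite lt0n; apply: contraNneq pN => ->; rewrite dvdn0.
have pe0 : (0 < p ^ e p)%N by rewrite expn_gt0 prime_gt0.
have co : coprime (p ^ e p) N by rewrite coprimeXl // prime_coprime.
rewrite !gs_crt // -!mulrA gs_prime_pow //; last first.
  by rewrite dvdzE abszM Euclid_dvdM // negb_or -!dvdzE pb.
rewrite IH //; first by rewrite intrM rmorphXn /=; ring.
move=> q qs; have [q_pr q_odd qa qb] := hq q qs; split=> //.
rewrite dvdzE abszM Euclid_dvdM // negb_or -dvdzE qb /= Euclid_dvdX // negb_and.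
by apply/orP; left; rewrite dvdn_prime2 // neq.
Qed.

Lemma gs_jacobi (n : nat) (a b : int) : odd n -> coprimez a n%:Z -> coprimez b n%:Z ->
  gs R (a * b) n = (jacobi a n)%:~R * gs R b n.
Proof.
move=> on ca cb; have n0 : (0 < n)%N by case: n on {ca cb}.
have nE : n = (\prod_(p <- primes n) p ^ logn p n)%N.
  by rewrite {1}(prod_prime_decomp n0) prime_decompE big_map.
have np (p : nat) (c : int) : prime p -> (p %| n)%N -> coprimez c n%:Z -> ~~ (p%:Z %| c)%Z.
  move=> p_pr pn; apply: contraTN => pc; rewrite /coprimez; apply/negP => /eqP g1.
  have : (p%:Z %| gcdz c n%:Z)%Z by rewrite dvdz_gcd pc dvdzE.
  by rewrite g1 dvdzE /= dvdn1 => /eqP p1; rewrite p1 in p_pr.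
have := @gs_jacobi_seq (fun p => logn p n) (primes n) a b (primes_uniq n).
rewrite -nE /jacobi; apply => p; rewrite mem_primes => /and3P[p_pr _ pn].
split=> //; try exact: np; by apply: dvdn_odd pn _ || apply: (dvdn_odd pn).
Qed.

End GaussSums.

(** * Laws of the Jacobi symbol read off from Gauss sums *)

Section Jacobi.
Variable R : realType.
Local Notation C := R[i].

Lemma ce_three_fourth : ce (3 / 4) = - ci R.
Proof.
by rewrite (_ : 3 / 4 = 1 / 2 + 1 / 4 :> R) ?ceD ?ce_half ?ce_fourth ?mulN1r //; field.
Qed.

(** This is 1 + i^n, the value of [gg 1 n]. It carries the dependence on n modulo 4 that the epsilon
    factor records. *)
Definition quarter (n : int) : C := 1 + ce (n%:~R / 4).

Lemma quarterE (n : int) : odd `|n|%N -> quarter n = 1 + (if (n %% 4)%Z == 1 then ci R else - ci R).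
Proof.
move=> on; rewrite /quarter; congr (_ + _).
have e : n = (n %/ 4)%Z * 4 + (n %% 4)%Z by exact: divz_eq.
have -> : ce (n%:~R / 4) = ce ((n %% 4)%Z%:~R / 4) :> C.
  rewrite {1}e -[RHS](ceDint _ (n %/ 4)%Z); congr ce.
  by rewrite rmorphD rmorphM /=; field.
case: eqP => [->|h]; first by rewrite -ce_fourth.
have -> : (n %% 4)%Z = 3 by lia.
by rewrite -ce_three_fourth.
Qed.

Lemma quarter_neq0 (n : int) : odd `|n|%N -> quarter n != 0.
Proof.
move=> /quarterE ->; case: ifP => _; rewrite eq_complex /= ?oppr0 ?addr0 oner_eq0 //.
Qed.

Lemma gg1 (n : int) : gg R 1 n = quarter n.
Proof.
rewrite /gg big_ord_recl big_ord1 /= expr0n mulr0 mul0r ce0; congr (_ + ce _).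
by rewrite expr1n !mulr1.
Qed.

Lemma sqrt_split (a n : R) : 0 <= a -> 0 <= n -> Num.sqrt (2 * a / n) = Num.sqrt a * Num.sqrt (2 * 1 / n).
Proof.
by move=> a0 n0; rewrite -sqrtrM //; congr Num.sqrt; ring.
Qed.

Lemma coprimez_N1 n : coprimez (-1) n.
Proof. by rewrite /coprimez /gcdz /= gcd1n. Qed.

(** Reciprocity is applied to [A] and to 1. Both lead to Gauss sums modulo [n], and the quotient of
    these is the Jacobi symbol. *)
Lemma gg_jacobi_nat (A n : nat) : (0 < A)%N -> odd n -> coprime A n ->
  gg R A n = rc (Num.sqrt A%:R) * (jacobi A n)%:~R * quarter n.
Proof.
move=> A0 on co; have n0 : (0 < n)%N by case: n on {co}.
rewrite -gg1 !landsberg_schaar // -[- A%:Z]mulrN1 gs_jacobi //; last exact: coprimez_N1.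
by rewrite sqrt_split ?ler0n // rcM; ring.
Qed.

Lemma gg_jacobi (A : nat) (n : int) : (0 < A)%N -> odd `|n|%N -> coprime A `|n|%N ->
  gg R A n = rc (Num.sqrt A%:R) * (jacobi A `|n|%N)%:~R * quarter n.
Proof.
case: n => n A0; first exact: gg_jacobi_nat.
rewrite NegzE abszN => on co; rewrite gg_cj gg_jacobi_nat // !cjM cj_rc -rc_int cj_rc; congr (_ * _).
by rewrite /quarter cjD cj_ce rmorphN mulNr /cj conjc1.
Qed.

Lemma legendre_abs (c : int) p : ~~ (p%:Z %| c)%Z -> legendre c p * legendre c p = 1.
Proof. by rewrite /legendre => /negbTE ->; case: ifP. Qed.

Lemma jacobi_sqr (c : int) (n : nat) : (0 < n)%N -> coprimez c n%:Z -> jacobi c n * jacobi c n = 1.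
Proof.
move=> n0 co; rewrite /jacobi -big_split /= big_seq big1 // => p.
rewrite mem_primes => /and3P[p_pr _ pn]; rewrite -exprMn legendre_abs ?expr1n //.
apply/negP => pc; have : (p%:Z %| gcdz c n%:Z)%Z by rewrite dvdz_gcd pc dvdzE.
by move: co => /eqP ->; rewrite dvdzE /= dvdn1 => /eqP p1; rewrite p1 in p_pr.
Qed.

Lemma gsN1_neq0 (n : nat) : odd n -> gs R (-1) n != 0.
Proof.
move=> on; have n0 : (0 < n)%N by case: n on.
have := quarter_neq0 (n := n) on; rewrite -gg1 landsberg_schaar //.
by apply: contraNneq => ->; rewrite mulr0.
Qed.

Lemma jacobi_ext (c c' : int) (n : nat) : odd n -> coprimez c n%:Z -> (c == c' %[mod n%:Z])%Z ->
  jacobi c n = jacobi c' n.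
Proof.
move=> on co e.
have co' : coprimez c' n%:Z.
  by move: co; rewrite /coprimez -gcdz_modl (eqP e) gcdz_modl.
have h := gs_jacobi R on co (coprimez_N1 _); have h' := gs_jacobi R on co' (coprimez_N1 _).
have e2 : gs R (c * -1) n = gs R (c' * -1) n.
  by apply: gs_mod; move: e; rewrite !eqz_mod_dvd -mulrBl => d; exact: dvdz_mulr d.
have : (jacobi c n)%:~R = (jacobi c' n)%:~R :> R.
  by apply: (@rc_inj R); rewrite !rc_int; apply: (mulIf (gsN1_neq0 on)); rewrite -h -h'.
by move/eqP; rewrite eqr_int => /eqP.
Qed.

Lemma coprimezM (a b n : int) : coprimez (a * b) n = coprimez a n && coprimez b n.
Proof. by rewrite /coprimez /gcdz abszM; exact: coprimeMl. Qed.

Lemma jacobiM (c c' : int) (n : nat) : odd n -> coprimez c n%:Z -> coprimez c' n%:Z ->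
  jacobi (c * c') n = jacobi c n * jacobi c' n.
Proof.
move=> on co co'.
have h := gs_jacobi R on (_ : coprimez (c * c') n%:Z) (coprimez_N1 _).
rewrite coprimezM co co' in h; have {}h := h isT.
have co1 : coprimez (c' * -1) n%:Z by rewrite coprimezM co' coprimez_N1.
rewrite -mulrA (gs_jacobi R on co co1) (gs_jacobi R on co' (coprimez_N1 _)) mulrA in h.
have : (jacobi (c * c') n)%:~R = (jacobi c n * jacobi c' n)%:~R :> R.
  by apply: (@rc_inj R); rewrite intrM rcM !rc_int; apply: (mulIf (gsN1_neq0 on)); rewrite -h.
by move/eqP; rewrite eqr_int => /eqP.
Qed.

(** Complex conjugation of the reciprocity law at [A = 1] exchanges [gs (-1)] and [gs 1], whose
    quotient is the symbol. Comparing 1 + i and 1 - i with their conjugates gives the sign. *)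
Lemma jacobiN1 (n : nat) : odd n -> jacobi (-1) n = if (n %% 4 == 1)%N then 1 else -1.
Proof.
move=> on; have n0 : (0 < n)%N by case: n on.
have h := gs_jacobi R on (coprimez_N1 n%:Z) (coprimez_N1 n%:Z).
rewrite mulrNN mulr1 in h.
have q := landsberg_schaar R (isT : (0 < 1)%N) n0; rewrite gg1 in q.
have qc : cj (quarter n) = ce (- (1 / 8)) * rc (Num.sqrt (2 * 1 / n%:R)) * gs R 1 n.
  by rewrite q !cjM cj_ce cj_rc -gs_cj.
rewrite h in qc.
have w0 : ce (1 / 8) != 0 :> C by exact: ce_neq0.
have qe : cj (quarter n) * ci R = (jacobi (-1) n)%:~R * quarter n.
  by rewrite qc q -ce_eighth_sqr ceN; field.
have q0 := quarter_neq0 (n := n) on.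
have odd' : odd `|n%:Z|%N by [].
rewrite quarterE // in qe q0.
have -> : (n %% 4 == 1)%N = (((n : int) %% 4)%Z == 1) by lia.
have : (jacobi (-1) n)%:~R = (if ((n : int) %% 4)%Z == 1 then 1 else -1)%:~R :> R.
  apply: (@rc_inj R); rewrite !rc_int; apply: (mulIf q0); rewrite -qe.
  case: ifP => _; apply: complexP; rewrite /cj /= ?oppr0; ring.
by move/eqP; rewrite eqr_int => /eqP.
Qed.

(** A form of quadratic reciprocity: [gg A n] has period 4 A in [n] by its definition, and by
    [gg_jacobi] it is the symbol times nonzero factors with the same period. *)
Lemma jacobi_period (A : nat) (n m : int) : (0 < A)%N -> odd `|n|%N -> coprime A `|n|%N ->
  jacobi A (absz (n + m * (4 * A%:Z))) = jacobi A `|n|%N.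
Proof.
move=> A0 on co.
have on' : odd (absz (n + m * (4 * A%:Z))) by lia.
have co' : coprime A (absz (n + m * (4 * A%:Z))).
  have : coprimez A%:Z (m * 4 * A%:Z + n) by rewrite /coprimez gcdzMDl.
  by rewrite coprimezE addrC -mulrA.
have h := gg_jacobi A0 on co; have h' := gg_jacobi A0 on' co'.
rewrite gg_period h in h'.
have qe : quarter (n + m * (4 * A%:Z)) = quarter n.
  rewrite /quarter; congr (_ + _); rewrite -[RHS](ceDint _ (m * A%:Z)); congr ce.
  by rewrite rmorphD !rmorphM /=; field.
rewrite qe in h'; have q0 := quarter_neq0 on.
have s0 : rc (Num.sqrt (A%:R : R)) != 0 by rewrite rc_eq0 gt_eqF // sqrtr_gt0 ltr0n.
have : (jacobi A `|n|%N)%:~R = (jacobi A (absz (n + m * (4 * A%:Z))))%:~R :> R.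
  by apply: (@rc_inj R); rewrite !rc_int; apply: (mulfI s0); apply: (mulIf q0).
by move/eqP; rewrite eqr_int => /eqP.
Qed.

Lemma coprimez_odd4 (n : int) : odd `|n|%N -> coprimez 4 n.
Proof. by move=> on; rewrite coprimezE -[`|4|%N]/(2 ^ 2)%N coprimeXl // coprime2n. Qed.

Lemma jacobi4 (c : int) (n : nat) : odd n -> coprimez c n%:Z -> jacobi (4 * c) n = jacobi c n.
Proof.
move=> on co; have c4 : coprimez 4 n%:Z by apply: coprimez_odd4.
have c2 : coprimez 2 n%:Z by rewrite coprimezE -[`|2|%N]/2%N coprime2n.
have n0 : (0 < n)%N by case: n on {co c4 c2}.
by rewrite jacobiM // -[4]/(2 * 2 :> int) jacobiM // jacobi_sqr // mul1r.
Qed.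

End Jacobi.

(** * The weight 3/2 automorphy factor and descent to generators *)

Section Automorphy.
Variable R : realType.
Local Notation C := R[i].
Implicit Types (tau : C).

Definition eps (d : int) : C := if (d %% 4)%Z == 1 then 1 else ci R.
(** In weight 3/2 the factor carries eps^-3, which equals eps because eps is 1 or i. *)
Definition jfac (c d : int) tau : C :=
  (shimura_symbol c d)%:~R * eps d * psq (c%:~R * tau + d%:~R) ^+ 3.

Lemma Im_aff (c d : int) tau : complex.Im (c%:~R * tau + d%:~R) = c%:~R * complex.Im tau.
Proof. by rewrite -!rc_int ImD Im_rcM addr0. Qed.

Lemma psqN (z : C) : 0 < complex.Im z -> psq (- z) = - (ci R * psq z).
Proof.
move=> z0; have hr : 0 < complex.Re (psq z) by apply: psq_Re_gt0; left; rewrite gt_eqF.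
have hi : 0 < complex.Im (psq z).
  by have := psq_sqr z => e; move: z0; rewrite -{1}e expr2 ImM; nra.
apply: psq_unique; first by rewrite sqrrN exprMn psq_sqr expr2 ci2 mulN1r.
by left; rewrite ReN ReM /= mul0r mul1r sub0r opprK.
Qed.

Lemma jacobiN (c : int) (n : nat) : odd n -> coprimez c n%:Z ->
  jacobi (- c) n = (if (n %% 4 == 1)%N then 1 else -1) * jacobi c n.
Proof. by move=> on co; rewrite -[- c]mulN1r (jacobiM R) // ?(jacobiN1 R) // coprimez_N1. Qed.

(** A matrix and its negative act alike, so the factors must agree. The root contributes a factor i,
    which is matched by the law for -1, the change of epsilon and the sign convention of the
    extended symbol. *)
Lemma jfacN_pos (c d : int) tau : 0 < c -> odd `|d|%N -> coprimez c d -> 0 < complex.Im tau ->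
  jfac (- c) (- d) tau = jfac c d tau.
Proof.
move=> c0 od co v0; rewrite /jfac !rmorphN mulNr -opprD psqN ?Im_aff ?mulr_gt0 ?ltr0z //.
have co' : coprimez c `|d|%N by rewrite coprimezE in co *.
have -> : (- (ci R * psq (c%:~R * tau + d%:~R))) ^+ 3 = ci R * psq (c%:~R * tau + d%:~R) ^+ 3.
  rewrite exprNn exprMn (_ : ci R ^+ 3 = - ci R); last by rewrite exprS expr2 ci2 mulrN1.
  by ring.
rewrite mulrA; congr (_ * _); rewrite /shimura_symbol abszN jacobiN // /eps.
have -> : (- c < 0) = true by lia.
have -> : (c < 0) = false by lia.
rewrite andbT andbF.
have i2 := ci2 R.
set J : int := jacobi c _; have [d0|d0] := ltrP d 0.
  have -> : (- d < 0) = false by lia.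
  have [h|h] := boolP (`|d| %% 4 == 1)%N.
    have -> : (((- d) %% 4)%Z == 1) = true by lia.
    have -> : ((d %% 4)%Z == 1) = false by lia.
    by rewrite mul1r mulr1.
  have -> : (((- d) %% 4)%Z == 1) = false by lia.
  have -> : ((d %% 4)%Z == 1) = true by lia.
  by rewrite mulN1r rmorphN /= -mulrA i2; ring.
have -> : (- d < 0) = true by lia.
rewrite /= rmorphN /=.
have [h|h] := boolP (`|d| %% 4 == 1)%N.
  have -> : (((- d) %% 4)%Z == 1) = false by lia.
  have -> : ((d %% 4)%Z == 1) = true by lia.
  by rewrite mul1r -mulrA i2; ring.
have -> : (((- d) %% 4)%Z == 1) = true by lia.
have -> : ((d %% 4)%Z == 1) = false by lia.
by rewrite mulN1r rmorphN /= ; ring.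
Qed.

Lemma jfacN (c d : int) tau : c != 0 -> odd `|d|%N -> coprimez c d -> 0 < complex.Im tau ->
  jfac (- c) (- d) tau = jfac c d tau.
Proof.
move=> c0 od co v0; have [h|h] := ltrP 0 c; first exact: jfacN_pos.
have := @jfacN_pos (- c) (- d) tau; rewrite !opprK => <- //; first by lia.
  by rewrite abszN.
by rewrite coprimezE !abszN -coprimezE.
Qed.

Lemma jacobi_period4 (c d m : int) : 0 < c -> (4 %| c)%Z -> odd `|d|%N -> coprimez c d ->
  jacobi c (absz (d + m * c)) = jacobi c `|d|%N.
Proof.
move=> c0 /dvdzP[c1 e] od co.
have [A A0 eA] : exists2 A : nat, (0 < A)%N & c1 = A%:Z by exists `|c1|%N; lia.
have e4 : c = 4 * A%:Z by rewrite e eA mulrC.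
have cA : coprimez A%:Z d by move: co; rewrite e4 coprimezM => /andP[].
have od' : odd (absz (d + m * (4 * A%:Z))) by lia.
have cA' : coprimez A%:Z (d + m * (4 * A%:Z)).
  by rewrite addrC mulrA /coprimez gcdzMDl.
rewrite e4 !(jacobi4 R) //.
by apply: (jacobi_period R) => //; rewrite coprimezE in cA.
Qed.

Lemma jfac_T (c d m : int) tau : 0 < c -> (4 %| c)%Z -> odd `|d|%N -> coprimez c d ->
  jfac c (d + m * c) tau = jfac c d (tau + m%:~R).
Proof.
move=> c0 c4 od co; rewrite /jfac /shimura_symbol (ltNge c) (ltW c0) !andbF jacobi_period4 //.
congr (_ * _ * psq _ ^+ 3); last by rewrite rmorphD rmorphM /=; ring.
by rewrite /eps; congr (if _ == _ then _ else _); case/dvdzP: c4 => q ->; rewrite mulrA modzMDr || rewrite mulrA addrC modzMDl.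
Qed.

(** For [d > 0] the symbol depends on [c] modulo [d], so passing to [c + 4 d] changes the root
    alone, and [psq_div] splits the latter. *)
Lemma jfac_U (c d : int) tau : 0 < d -> odd `|d|%N -> coprimez c d -> (c, d) != (0, 0) ->
  0 < complex.Im tau ->
  jfac c d (Ut tau) * psq (4 * tau + 1) ^+ 3 = jfac (c + 4 * d) d tau.
Proof.
move=> d0 od co _ v0; rewrite /jfac /shimura_symbol (ltNge d) (ltW d0) !andFb.
have co' : coprimez c `|d|%N by rewrite coprimezE in co *.
have -> : jacobi (c + 4 * d) `|d|%N = jacobi c `|d|%N.
  apply/esym; apply: (jacobi_ext R) => //; rewrite eqz_mod_dvd opprD addrA subrr sub0r.
  by rewrite dvdzE abszN abszM dvdn_mull.
rewrite -[LHS]mulrA; congr (_ * _); rewrite -exprMn; congr (_ ^+ 3).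
have dn := den_neq0 v0.
have -> : c%:~R * Ut tau + d%:~R = ((c + 4 * d)%:~R * tau + d%:~R) / (4 * tau + 1).
  by rewrite /Ut rmorphD rmorphM /=; field.
have pd : psq (4 * tau + 1) != 0 by rewrite psq_eq0.
have eR : (c + 4 * d)%:~R = c%:~R + 4 * d%:~R :> R by rewrite rmorphD rmorphM.
rewrite psq_div ?divfK //.
- by rewrite Im_den; lra.
- apply/eqP => z0; have := Im_aff (c + 4 * d) d tau; rewrite z0 /= => /esym/eqP.
  rewrite mulf_eq0 (gt_eqF v0) orbF intr_eq0 => /eqP h; move: z0; rewrite h mul0r add0r => /eqP.
  by rewrite intr_eq0; lia.
have [h|h] := lerP 0 (c + 4 * d); [left|right].
  by rewrite Im_aff; apply: mulr_ge0; [rewrite ler0z|exact: ltW].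
have -> : ((c + 4 * d)%:~R * tau + d%:~R) / (4 * tau + 1) = c%:~R * Ut tau + d%:~R.
  by rewrite /Ut rmorphD rmorphM /=; field.
rewrite Im_aff pmulr_llt0 ?ltrz0; first by lia.
by rewrite Im_U // divr_gt0 // exprn_gt0 // cabs_gt0.
Qed.

Definition mob (a b c d : int) tau : C := (a%:~R * tau + b%:~R) / (c%:~R * tau + d%:~R).

Section Descent.
Variable F : C -> C.
Hypothesis FT : forall tau, 0 < complex.Im tau -> F (tau + 1) = F tau.
Hypothesis FU : forall tau, 0 < complex.Im tau -> F (Ut tau) = psq (4 * tau + 1) ^+ 3 * F tau.

Lemma F_Tint (m : int) tau : 0 < complex.Im tau -> F (tau + m%:~R) = F tau.
Proof.
have nat_case (k : nat) t : 0 < complex.Im t -> F (t + k%:R) = F t.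
  move=> t0; elim: k => [|k IH]; first by rewrite addr0.
  by rewrite -natr1 addrA FT // -(rc_nat R k) ImD addr0.
case: m => k v0; first by rewrite -pmulrn nat_case.
rewrite NegzE rmorphN /= -pmulrn -[in RHS](subrK k.+1%:R tau) nat_case //.
by rewrite -(rc_nat R k.+1) ImD ImN /= oppr0 addr0.
Qed.

Lemma aff_neq0 (c d : int) tau : 0 < complex.Im tau -> (c, d) != (0, 0) -> c%:~R * tau + d%:~R != 0.
Proof.
move=> v0; apply: contraNneq => z0; have := Im_aff c d tau; rewrite z0 /= => /esym/eqP.
rewrite mulf_eq0 (gt_eqF v0) orbF intr_eq0 => /eqP h; move: z0; rewrite h mul0r add0r => /eqP.
by rewrite intr_eq0 => /eqP ->.
Qed.

Lemma Im_mob (a b c d : int) tau : a * d - b * c = 1 -> 0 < complex.Im tau ->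
  complex.Im (mob a b c d tau) = complex.Im tau / cabs (c%:~R * tau + d%:~R) ^+ 2.
Proof.
move=> det v0; have d0 : c%:~R * tau + d%:~R != 0.
  by apply: aff_neq0 => //; apply: contraTneq isT => -[ec ed]; move: det; rewrite ec ed !mulr0 subr0.
have di : (c%:~R * tau + d%:~R)^-1 = rc (cabs (c%:~R * tau + d%:~R) ^+ 2)^-1 * cj (c%:~R * tau + d%:~R).
  by apply: (mulfI d0); rewrite mulfV // mulrCA mulcj -rcM mulVf // expf_neq0 // cabs_eq0.
rewrite /mob di mulrCA Im_rcM mulrC; congr (_ * _).
have detR : a%:~R * d%:~R - b%:~R * c%:~R = 1 :> R by rewrite -!rmorphM -rmorphB /= det.
rewrite -!rc_int; move: (a%:~R) (b%:~R) (c%:~R) (d%:~R) detR => x y z t detR.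
case: (tau) => u v /=; rewrite -[RHS]mul1r -detR; ring.
Qed.

Let P (a b c d : int) := forall tau, 0 < complex.Im tau ->
  F (mob a b c d tau) = jfac c d tau * F tau.

Lemma det_coprime (a b c d : int) : a * d - b * c = 1 -> coprimez c d.
Proof. by move=> det; apply/coprimezP; exists (- b, a); rewrite /= -det; ring. Qed.

Lemma odd_of_coprime (c d : int) : (4 %| c)%Z -> coprimez c d -> odd `|d|%N.
Proof.
rewrite dvdzE coprimezE => c4 co; rewrite -coprime2n.
by apply: (coprime_dvdl _ (coprime_dvdl c4 co)).
Qed.

Lemma P_neg (a b c d : int) : c != 0 -> (4 %| c)%Z -> a * d - b * c = 1 ->
  P (- a) (- b) (- c) (- d) -> P a b c d.
Proof.
move=> c0 c4 det h tau v0; have co := det_coprime det.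
rewrite -jfacN // ?(odd_of_coprime c4) // -h //; congr F.
rewrite /mob !rmorphN !mulNr -!opprD invrN mulrNN //.
Qed.

Lemma P_T (m a b c d : int) : 0 < c -> (4 %| c)%Z -> a * d - b * c = 1 ->
  P a (b + m * a) c (d + m * c) -> P a b c d.
Proof.
move=> c0 c4 det h tau v0; have co := det_coprime det.
have v1 : 0 < complex.Im (tau - m%:~R) by rewrite -rc_int -rcN ImD addr0.
have e : tau - m%:~R + m%:~R = tau by rewrite subrK.
rewrite -[in jfac _ _ _]e -jfac_T // ?(odd_of_coprime c4) //.
rewrite -[in F tau]e F_Tint // -h //; congr F.
by rewrite /mob !rmorphD !rmorphM /=; congr (_ / _); ring.
Qed.

Lemma mob_U (a b c d : int) tau : 0 < complex.Im tau ->
  (c + 4 * d, d) != (0, 0) -> mob a b c d (Ut tau) = mob (a + 4 * b) b (c + 4 * d) d tau.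
Proof.
move=> v0 cd; have dn := den_neq0 v0; have n1 := aff_neq0 v0 cd.
have e (x y : C) : x * (tau / (4 * tau + 1)) + y = ((x + 4 * y) * tau + y) / (4 * tau + 1) by field.
by rewrite /mob /Ut !e invf_div mulrA divfK // !rmorphD !rmorphM.
Qed.

Lemma P_U1 (a b c d : int) : 0 < d -> (4 %| c)%Z -> a * d - b * c = 1 ->
  P a b c d -> P (a + 4 * b) b (c + 4 * d) d.
Proof.
move=> d0 c4 det h tau v0; have co := det_coprime det.
have cd : (c + 4 * d, d) != (0, 0) by rewrite xpair_eqE; lia.
have cd' : (c, d) != (0, 0) by rewrite xpair_eqE; lia.
have U0 : 0 < complex.Im (Ut tau) by rewrite Im_U // divr_gt0 // exprn_gt0 // cabs_gt0 den_neq0.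
by rewrite -mob_U // h // FU // mulrA jfac_U // (odd_of_coprime c4).
Qed.

(** Converse of [P_U1]: [tau] is written as [Ut t], with [t] its image under the inverse
    generator. *)
Lemma P_U2 (a b c d : int) : 0 < d -> (4 %| c)%Z -> a * d - b * c = 1 ->
  P (a + 4 * b) b (c + 4 * d) d -> P a b c d.
Proof.
move=> d0 c4 det h tau v0; have co := det_coprime det.
pose t := mob 1 0 (-4) 1 tau.
have dn : (-4)%:~R * tau + 1%:~R != 0 by apply: aff_neq0.
have t0 : 0 < complex.Im t by rewrite Im_mob // divr_gt0 // exprn_gt0 // cabs_gt0.
have Ute : Ut t = tau.
  have e : 4 * t + 1 = ((-4)%:~R * tau + 1%:~R)^-1.
    by move: dn; rewrite /t /mob !rmorphN /= mul1r addr0 => dn; field.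
  by rewrite /Ut e invrK /t /mob mul1r addr0 divfK.
have cd : (c + 4 * d, d) != (0, 0) by rewrite xpair_eqE; lia.
have cd' : (c, d) != (0, 0) by rewrite xpair_eqE; lia.
rewrite -[in mob _ _ _ _ _]Ute mob_U // h // -jfac_U // ?(odd_of_coprime c4) //.
by rewrite -mulrA -FU // Ute.
Qed.

(** As [d] is odd and 4 divides [c], the residue of [d] nearest to 0 is odd, hence neither 0 nor
    [c / 2] in absolute value. *)
Lemma reduce_mod (c d : int) : 0 < c -> (4 %| c)%Z -> odd `|d|%N ->
  exists m : int, [/\ d + m * c != 0 & `|2 * (d + m * c)| < c].
Proof.
move=> c0 /dvdzP[q e] od; have dE : d = (d %/ c)%Z * c + (d %% c)%Z by exact: divz_eq.
have r0 : 0 <= (d %% c)%Z by rewrite modz_ge0 // gt_eqF.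
have rc : (d %% c)%Z < c by rewrite ltz_pmod.
set r := (d %% c)%Z in dE r0 rc; set k := (d %/ c)%Z in dE.
have odr : odd `|r|%N.
  have e2 : d = 4 * (k * q) + r by rewrite {1}dE {1}e; ring.
  by move: od; rewrite e2; move: (k * q) => x; lia.
have [h|h] := ltrP (2 * r) c.
  exists (- k); rewrite dE mulNr addrAC subrr add0r; split; lia.
exists (- k - 1); have -> : d + (- k - 1) * c = r - c by rewrite {1}dE; ring.
by split; lia.
Qed.

(** Euclid's algorithm on the bottom row. A translation makes |2 d| < c with d nonzero; then one
    step with [Ut] or its inverse, after a change of sign if d < 0, brings the lower left entry to c
    - 4 |d| up to sign, which is smaller in absolute value. *)
Lemma descent_int (n : nat) (a b c d : int) : (`|c| <= n)%N -> (4 %| c)%Z -> a * d - b * c = 1 ->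
  P a b c d.
Proof.
elim: n a b c d => [|n IH] a b c d.
  move=> cn _; have -> : c = 0 by lia.
  rewrite mulr0 subr0 => ad tau v0.
  have /eqP : (`|a| * `|d|)%N = 1%N by rewrite -abszM ad.
  rewrite muln_eq1 => /andP[/eqP a1 /eqP d1].
  have [ea|ea] : a = 1 \/ a = -1 by lia.
    have -> : d = 1 by rewrite ea mul1r in ad.
    rewrite ea /mob mul0r add0r mul1r divr1 F_Tint // /jfac mul0r add0r /eps /=.
    by rewrite -[1%:~R]/(rc 1) psq_rc ?ler01 // sqrtr1 expr1n !mulr1 /shimura_symbol /jacobi /= big_nil mul1r.
  have -> : d = -1 by move: ad; rewrite ea; lia.
  (* For minus a translation the factor is i * i^3 = 1: epsilon at -1 is i, the principal root of -1
     is i, and the symbol (0 / -1) is 1. *)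
  rewrite ea /mob mul0r add0r rmorphN1 mulN1r invrN1 mulrN1 opprD opprK -rmorphN /= F_Tint //.
  rewrite /jfac mul0r add0r /eps /= /shimura_symbol /jacobi /= big_nil mul1r.
  rewrite (psq_unique (s := ci R)); last by right; rewrite /= ler01.
    have -> : ci R * ci R ^+ 3 = ci R * ci R * (ci R * ci R) by ring.
    by rewrite ci2 mulrNN !mul1r.
  by rewrite expr2 ci2 rmorphN1.
move=> cn c4 det.
have [cn'|cn'] := leqP `|c| n; first exact: IH.
have step (a1 b1 c1 d1 : int) : 0 < c1 -> `|c1|%N = n.+1 -> (4 %| c1)%Z ->
    a1 * d1 - b1 * c1 = 1 -> P a1 b1 c1 d1.
  move=> c0 cn1 c41 det1; have od := odd_of_coprime c41 (det_coprime det1).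
  have [m [d0 dc]] := reduce_mod c0 c41 od.
  apply: (@P_T m) => //; set d' := d1 + m * c1 in d0 dc *; set b' := b1 + m * a1.
  have det' : a1 * d' - b' * c1 = 1 by rewrite -det1 /d' /b'; ring.
  have c4d (x : int) : (4 %| c1 + 4 * x)%Z by rewrite rpredD // dvdz_mulr.
  have c4n (x : int) : (4 %| - c1 + 4 * x)%Z by rewrite rpredD ?dvdz_mulr // dvdzE abszN.
  have [dp|dn] := ltrP 0 d'.
    have -> : a1 = (a1 - 4 * b') + 4 * b' by ring.
    have -> : c1 = (c1 + 4 * - d') + 4 * d' by ring.
    apply: P_U1 => //; first by rewrite -[RHS]det'; ring.
    by apply: IH => //; [lia|rewrite -[RHS]det'; ring].
  apply: P_neg => //; first by rewrite gt_eqF.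
  apply: P_U2; [lia|by rewrite dvdzE abszN|by rewrite -[RHS]det'; ring|].
  by apply: IH => //; [lia|rewrite -[RHS]det'; ring].
have [h|h] := ltrP 0 c; first by apply: step => //; lia.
apply: P_neg => //; first by lia.
by apply: step; [lia|lia|rewrite dvdzE abszN|rewrite -det; ring].
Qed.

Lemma descent (a b c d : int) tau : (4 %| c)%Z -> a * d - b * c = 1 -> 0 < complex.Im tau ->
  F (mob a b c d tau) = jfac c d tau * F tau.
Proof. by move=> c4 det; apply: (descent_int (leqnn _)). Qed.

End Descent.
End Automorphy.

(** * Fourier transform of (-i z)^(-3/2) with a Gaussian cutoff *)

Section FourierExpansion.
Variable R : realType.
Local Notation C := R[i].
Implicit Types (x y t h U V la xi s v : R) (z : C).

Lemma wl_series (I : eqType) (f : I -> R -> C) (k : I -> R) M g :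
  (forall n, wl (k n) (f n)) -> bsum k M -> (forall x, hsum (fun n => f n x) (g x)) -> wl M g.
Proof.
move=> fk kM fg; have M0 := bsum_ge0 kM; split=> [x|x h h1].
  apply: (hsum_le (fg x)); have := bsumZ (w2_ge0 x) kM; rewrite mulrC.
  by apply: bsum_le => n; rewrite mulrC (fk n).1.
apply: (hsum_le (hsumB (fg (x + h)) (fg x))).
have h0 : 0 <= `|h| * w2 x by rewrite mulr_ge0 ?w2_ge0.
have := bsumZ h0 kM; rewrite (_ : `|h| * w2 x * M = M * `|h| * w2 x); last by ring.
apply: bsum_le => n; rewrite (_ : `|h| * w2 x * k n = k n * `|h| * w2 x); last by ring.
exact: (fk n).2.
Qed.

Lemma Itg_series_wl (f : int -> R -> C) (k : int -> R) M g :
  (forall n, wl (k n) (f n)) -> bsum k M -> (forall x, hsum (fun n => f n x) (g x)) ->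
  hsum (fun n => Itg (f n)) (Itg g).
Proof.
move=> fk kM fg; apply: (Itg_series fk _ kM (wl_series fk kM fg) fg) => n x.
by rewrite (le_trans ((fk n).1 x)) // ler_wpM2l ?w2_le_w // (wl_ge0 (fk n)).
Qed.

Definition qexpo z x : C := cexp (ci R * rc pi * z * rc (x ^+ 2)).

Lemma qexpo_gau z x : qexpo z x = gau (psq (- (ci R * z))) 0 x.
Proof. by rewrite /qexpo /gau addr0 exprMn psq_sqr rcX; congr cexp; ring. Qed.

Lemma cabs_qexpo z x : cabs (qexpo z x) = expR (- (pi * complex.Im z * x ^+ 2)).
Proof.
rewrite cabs_cexp; congr expR; case: z => a b.
have -> : ci R * rc pi * Complex a b * rc (x ^+ 2) = rc (pi * x ^+ 2) * (ci R * Complex a b) by rewrite rcM; ring.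
by rewrite Re_rcM /=; ring.
Qed.

Lemma Re_NI z : complex.Re (- (ci R * z)) = complex.Im z.
Proof. by case: z => a b /=; ring. Qed.

(** The power (-i z)^(-3/2) becomes a second moment of the functions exp(i pi z x^2). In this form
    its sum over integer translates of [z] is, under the integral, a Gaussian sum to which Poisson
    summation applies. *)
Lemma psq_moment z : 0 < complex.Im z ->
  psq (- (ci R * z)) ^- 3 = rc (2 * pi) * Itg (fun x => rc (x ^+ 2) * qexpo z x).
Proof.
move=> z0; have cl : cone (psq (- (ci R * z))) by apply: psq_cone; rewrite Re_NI.
have -> : (fun x => rc (x ^+ 2) * qexpo z x) = fun x => rc (x ^+ 2) * gau (psq (- (ci R * z))) 0 x.
  by apply/funext => x; rewrite qexpo_gau.
rewrite gau_moment // (invfM (rc _)) mulVKf //.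
by rewrite rc_eq0 gt_eqF // mulr_gt0 ?pi_gt0.
Qed.

(* Poisson summation for [n |-> e((n + U) y) exp (- pi la (n + U)^2)] *)
Lemma poisson_gauss la U y : 0 < la -> exists P : C,
  hsum (fun n : int => ce ((n%:~R + U) * y) * rc (expR (- (pi * la * (n%:~R + U) ^+ 2)))) P /\
  hsum (fun m : int => rc (Num.sqrt la)^-1 * ce (m%:~R * U) * rc (expR (- (pi * (m%:~R - y) ^+ 2 / la)))) P.
Proof.
move=> la0; set l : C := rc (Num.sqrt la).
have s0 : 0 < Num.sqrt la by rewrite sqrtr_gt0.
have cl : cone l by exact: cone_rc.
have l0 := cone_neq0 cl.
have l2 : l ^+ 2 = rc la by rewrite -rcX sqr_sqrtr // ltW.
have la0' : rc la != 0 :> C by rewrite rc_eq0 gt_eqF.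
pose z : C := l * rc U - ci R * rc y / l.
have i2 := ci2 R.
exists (rc (expR (- (pi * y ^+ 2 / la))) * tsum (fun n : int => gau l z n%:~R)); split.
  apply: hsum_ext (hsumZ (rc (expR (- (pi * y ^+ 2 / la)))) (gau_sum z cl)) => n.
  rewrite -!cexp_rc /gau /ce -!cexpD; congr cexp.
  have -> : l * rc n%:~R + z = l * rc (n%:~R + U) - ci R * rc y / l by rewrite /z rcD; ring.
  have aux (a b : C) : (l * a - ci R * b / l) ^+ 2 = l ^+ 2 * a ^+ 2 - 2 * (ci R * (a * b)) + (ci R * ci R) * (b ^+ 2 / l ^+ 2) by field.
  rewrite aux i2 l2; move: (n%:~R + U) => X.
  by rewrite !(rc_nat R 2, rcM, rcN, rcV) -?rcX; rewrite !expr2 ?rcM; field.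
have [B _ hs] := gau_poisson z cl.
apply: hsum_ext (hsumZ (rc (expR (- (pi * y ^+ 2 / la)))) hs) => m.
rewrite mulrA mulrC -/l rcV -/l -[RHS]mulrA; congr (_ * _).
rewrite -!cexp_rc /ce -!cexpD; congr cexp; rewrite l2 /z.
have -> : ci R * rc (2 * pi * m%:~R) * (l * rc U - ci R * rc y / l) / l =
  ci R * rc (2 * pi * m%:~R * U) - (ci R * ci R) * rc (2 * pi * m%:~R * y) / l ^+ 2.
  by rewrite !rcM; field.
rewrite i2 l2 !(rc_nat R 2, rcM, rcN, rcD, rcV).
by field.
Qed.

Lemma gauss_poly_bound (k : nat) (c : R) : 0 < c ->
  exists2 B, 0 <= B & forall r : R, `|r| ^+ k * expR (- (c * r ^+ 2)) <= B * w2 r.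
Proof.
move=> c0; have [B B0 hB] := exp_growth k.+2 c0; exists B => // r.
have W1 : 1 <= 1 + r ^+ 2 by rewrite lerDl sqr_ge0.
have h : `|r| ^+ k <= (1 + r ^+ 2) ^+ k.
  apply: lerXn2r; rewrite ?nnegrE ?normr_ge0 //; first by lra.
  by rewrite -[r ^+ 2]real_normK ?num_real //; have := sqr_ge0 (`|r| - 1); nra.
rewrite /w2 /w exprVn ler_pdivlMr; last by rewrite exprn_gt0 // w_den.
apply: le_trans (hB r).
have -> : (1 + r ^+ 2) ^+ k.+2 = (1 + r ^+ 2) ^+ k * (1 + r ^+ 2) ^+ 2 by rewrite -exprD addn2.
rewrite (_ : `|r| ^+ k * _ * _ = `|r| ^+ k * (1 + r ^+ 2) ^+ 2 * expR (- (c * r ^+ 2))); last by ring.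
by apply: ler_wpM2r; [exact: expR_ge0|apply: ler_wpM2r => //; exact: sqr_ge0].
Qed.

Lemma cder_qexpo z x : cder (qexpo z) x (ci R * rc (2 * pi) * z * rc x * qexpo z x).
Proof.
have -> : qexpo z = fun x => cexp (ci R * rc pi * z * (rc x * rc x)).
  by apply/funext => y; rewrite /qexpo expr2 rcM.
apply: cder_eq (cder_cexp (cder_scale (ci R * rc pi * z) (cder_mul (cder_rc x) (cder_rc x)))) _.
by rewrite rcM (rc_nat _ 2); ring.
Qed.

Lemma wl_qexpo V : 0 < V -> exists2 B, 0 <= B &
  forall z, complex.Im z = V -> wl (B * (1 + cabs z)) (fun x => rc (x ^+ 2) * qexpo z x).
Proof.
move=> V0; have c0 : 0 < pi * V by rewrite mulr_gt0 ?pi_gt0.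
have [B1 B10 h1] := gauss_poly_bound 1 c0.
have [B2 B20 h2] := gauss_poly_bound 2 c0.
have [B3 B30 h3] := gauss_poly_bound 3 c0.
exists (18 * (B2 + 2 * B1 + 8 * B3)); first by lra.
move=> z zV; have z0 := cabs_ge0 z.
have iz : cabs (qexpo z 0) = cabs (qexpo z 0) by [].
pose f' x := rc (2 * x) * qexpo z x + rc (x ^+ 2) * (ci R * rc (2 * pi) * z * rc x * qexpo z x).
have d x : cder (fun x => rc (x ^+ 2) * qexpo z x) x (f' x).
  have -> : (fun x => rc (x ^+ 2) * qexpo z x) = fun x => (rc x * rc x) * qexpo z x.
    by apply/funext => y; rewrite expr2 rcM.
  apply: cder_eq (cder_mul (cder_mul (cder_rc x) (cder_rc x)) (cder_qexpo z x)) _.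
  by rewrite /f' !rcM (rc_nat _ 2); ring.
have -> : 18 * (B2 + 2 * B1 + 8 * B3) * (1 + cabs z) = 18 * ((B2 + 2 * B1 + 8 * B3) * (1 + cabs z)) by ring.
apply: wl_of_der d _ _ => x; have W := w2_ge0 x.
  rewrite cabsM cabs_rc cabs_qexpo zV ger0_norm ?sqr_ge0 //.
  have := h2 x; rewrite real_normK ?num_real // => h; apply: le_trans h _.
  by apply: ler_wpM2r => //; nra.
have p8 := @rc2pi_le R; set p2 := cabs (rc (2 * pi)) in p8.
rewrite /f' (le_trans (cabsD _ _)) // !cabsM -/p2 !cabs_rc cabs_qexpo zV.
rewrite (_ : cabs (ci R) = 1); last by rewrite -ce_fourth cabs_ce.
rewrite !normrM normr_nat; have := h1 x; have := h3 x; rewrite expr1.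
set E := expR _ => hx3 hx1.
have E0 : 0 <= E by exact: expR_ge0.
have a1 : 2 * `|x| * E <= 2 * B1 * w2 x by rewrite -!mulrA ler_wpM2l.
have p20 : 0 <= p2 by exact: cabs_ge0.
have a2 : `|x| * `|x| * (1 * p2 * cabs z * `|x| * E) <= 8 * B3 * cabs z * w2 x.
  have -> : `|x| * `|x| * (1 * p2 * cabs z * `|x| * E) = p2 * (cabs z * (`|x| ^+ 3 * E)) by ring.
  have -> : 8 * B3 * cabs z * w2 x = 8 * (cabs z * (B3 * w2 x)) by ring.
  by rewrite ler_pM ?mulr_ge0 ?exprn_ge0 // ler_wpM2l.
have c1 : 0 <= B2 * (1 + cabs z) * w2 x by apply: mulr_ge0 => //; apply: mulr_ge0; lra.
have c2 : 0 <= B1 * cabs z * w2 x by apply: mulr_ge0 => //; apply: mulr_ge0.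
have c3 : 0 <= B3 * w2 x by apply: mulr_ge0.
rewrite !mulrDl !mulrDr !mulr1 in c1 *; lra.
Qed.

(** The integrand left at frequency [x] after Poisson summation. As [la] tends to 0 the second
    Gaussian concentrates at r^2 = 2 x, which is possible only for x >= 0; the vanishing at negative
    frequencies originates here. *)
Definition omf V la x r : R :=
  r ^+ 2 * expR (- (pi * V * r ^+ 2) - pi * (x - r ^+ 2 / 2) ^+ 2 / la).

Lemma omf_ge0 V la x r : 0 <= omf V la x r.
Proof. by rewrite mulr_ge0 ?sqr_ge0 ?expR_ge0. Qed.

Lemma omf_wl V la x : 0 < V -> 0 < la -> exists K, wl K (fun r => rc (omf V la x r)).
Proof.
move=> V0 la0; have c0 : 0 < pi * V by rewrite mulr_gt0 ?pi_gt0.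
pose q : {poly C} := - ((rc (pi * V))%:P * 'X^2) - (rc (pi / la))%:P * ((rc x)%:P - (rc 2^-1)%:P * 'X^2) ^+ 2.
have qE r : q.[rc r] = rc (- (pi * V * r ^+ 2) - pi * (x - r ^+ 2 / 2) ^+ 2 / la).
  rewrite /q !(hornerD, hornerN, hornerM, horner_exp, hornerC, hornerX) !(rcB, rcN, rcM, rcV) ?rcX.
  by rewrite ?expr2; ring.
have hq r : complex.Re q.[rc r] <= 0 - pi * V * r ^+ 2.
  rewrite qE /= sub0r lerBlDr lerDl; apply: divr_ge0; last exact: ltW.
  by apply: mulr_ge0; [exact: pi_ge0|exact: sqr_ge0].
have [K hK] := pe_C2 'X^2 c0 hq; exists (18 * K); move: (C2_wl hK); congr wl.
by apply/funext => r; rewrite /pe qE cexp_rc hornerXn /omf rcM rcX.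
Qed.

Lemma omf_bound V la : 0 < V -> 0 < la -> exists2 K, 0 <= K &
  forall x r, omf V la x r <= K * w x * w r.
Proof.
move=> V0 la0; have c0 : 0 < pi * V by rewrite mulr_gt0 ?pi_gt0.
have c1 : 0 < pi / la by rewrite divr_gt0 ?pi_gt0.
have [B1 B10 h1] := exp_growth 1 c1; have [B2 B20 h2] := exp_growth 4 c0.
exists (2 * B1 * B2) => [|x r]; first by rewrite !mulr_ge0.
rewrite /w -mulrA -invfM ler_pdivlMr; last by rewrite mulr_gt0 // w_den.
rewrite /omf expRD; set Y := x - r ^+ 2 / 2.
have -> : pi * Y ^+ 2 / la = pi / la * Y ^+ 2 by ring.
have {h1}h1 := h1 Y; have {h2}h2 := h2 r; rewrite expr1 in h1.
set E1 := expR _ in h1 *; set E2 := expR _ in h2 *.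
have E10 : 0 <= E1 by exact: expR_ge0.
have E20 : 0 <= E2 by exact: expR_ge0.
have x2 : 1 + x ^+ 2 <= (2 * (1 + Y ^+ 2)) * (1 + r ^+ 4).
  have -> : x = Y + r ^+ 2 / 2 by rewrite /Y; ring.
  have -> : r ^+ 4 = (r ^+ 2) ^+ 2 by rewrite -exprM.
  move: (r ^+ 2) => s; have := sqr_ge0 (Y - s / 2); have := sqr_ge0 s; have := sqr_ge0 Y.
  have := mulr_ge0 (sqr_ge0 Y) (sqr_ge0 s); nra.
have r0 := sqr_ge0 r.
have r3 : r ^+ 2 * (1 + r ^+ 4) * (1 + r ^+ 2) <= (1 + r ^+ 2) ^+ 4.
  have -> : r ^+ 4 = (r ^+ 2) ^+ 2 by rewrite -exprM.
  move: (r ^+ 2) r0 => s s0.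
  have -> : (1 + s) ^+ 4 = s * (1 + s ^+ 2) * (1 + s) + (1 + 3 * s + 5 * s ^+ 2 + 3 * s ^+ 3) by ring.
  by rewrite lerDl !addr_ge0 ?mulr_ge0 ?exprn_ge0.
apply: (@le_trans _ _ ((r ^+ 2 * (1 + r ^+ 4) * (1 + r ^+ 2) * E2) * (2 * ((1 + Y ^+ 2) * E1)))).
  have -> : r ^+ 2 * (E2 * E1) * ((1 + x ^+ 2) * (1 + r ^+ 2)) = (r ^+ 2 * (1 + r ^+ 2) * E2 * E1) * (1 + x ^+ 2) by ring.
  have -> : r ^+ 2 * (1 + r ^+ 4) * (1 + r ^+ 2) * E2 * (2 * ((1 + Y ^+ 2) * E1)) =
    (r ^+ 2 * (1 + r ^+ 2) * E2 * E1) * (2 * (1 + Y ^+ 2) * (1 + r ^+ 4)) by ring.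
  apply: ler_wpM2l => //; apply: mulr_ge0 => //; apply: mulr_ge0 => //; apply: mulr_ge0 => //; lra.
rewrite (_ : 2 * B1 * B2 = B2 * (2 * B1)); last by ring.
apply: ler_pM; [| |apply: le_trans h2; exact: ler_wpM2r|lra].
- apply: mulr_ge0 => //; apply: mulr_ge0; last by lra.
  by apply: mulr_ge0 => //; rewrite addr_ge0 // exprn_even_ge0.
- by apply: mulr_ge0 => //; apply: mulr_ge0 => //; rewrite addr_ge0 // sqr_ge0.
Qed.

Definition omI V la x : R := complex.Re (Itg (fun r => rc (omf V la x r))).

Lemma omIP V la x : 0 < V -> 0 < la -> Itg (fun r => rc (omf V la x r)) = rc (omI V la x) /\ 0 <= omI V la x.
Proof.
move=> V0 la0; have [K hK] := omf_wl x V0 la0.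
by have [s s0 e] := Itg_ge0 hK (omf_ge0 V la x); rewrite /omI e.
Qed.

(** The Fourier transform in Re z, on the line Im z = V, of (-i z)^(-3/2) exp(-pi la |z|^2);
    [shifted_fourier] expresses this in summed form. Written as an integral of [omf] it is visibly
    nonnegative. *)
Definition OM V la x : R := 2 * pi / Num.sqrt la * expR (- (pi * la * V ^+ 2)) * omI V la x.

Lemma OM_ge0 V la x : 0 < V -> 0 < la -> 0 <= OM V la x.
Proof.
move=> V0 la0; rewrite /OM; apply: mulr_ge0; last by have [] := omIP x V0 la0.
by rewrite !mulr_ge0 ?pi_ge0 ?expR_ge0 // invr_ge0 sqrtr_ge0.
Qed.

(** The power is replaced by its moment integral. For each [r] the sum over [n] is then a Gaussian
    sum with phase [xi + r ^ 2 / 2], turned around by [poisson_gauss], and both series are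
    integrated term by term. *)
Theorem shifted_fourier (z : C) la xi : 0 < complex.Im z -> 0 < la -> exists S : C,
  hsum (fun n : int => ce (n%:~R * xi) * psq (- (ci R * (z + n%:~R))) ^- 3 *
     rc (expR (- (pi * la * cabs (z + n%:~R) ^+ 2)))) S /\
  hsum (fun m : int => ce ((m%:~R - xi) * complex.Re z) * rc (OM (complex.Im z) la (m%:~R - xi))) S.
Proof.
set V := complex.Im z; set U := complex.Re z => V0 la0.
have Imz (n : int) : complex.Im (z + n%:~R) = V by rewrite -rc_int ImD addr0.
have Rez (n : int) : complex.Re (z + n%:~R) = n%:~R + U by rewrite -rc_int ReD addrC.
have cab (n : int) : cabs (z + n%:~R) ^+ 2 = (n%:~R + U) ^+ 2 + V ^+ 2.
  by rewrite cabs_sqr Imz Rez.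
pose c (n : int) : C := ce (n%:~R * xi) * rc (expR (- (pi * la * cabs (z + n%:~R) ^+ 2))).
pose f (n : int) r : C := c n * (rc (r ^+ 2) * qexpo (z + n%:~R) r).
have [B B0 hB] := wl_qexpo V0.
have fk n : wl (cabs (c n) * (B * (1 + cabs (z + n%:~R)))) (f n).
  by apply: wlZ; exact: hB.
have pl : 0 < pi * la by rewrite mulr_gt0 ?pi_gt0.
have [M hM] : exists M, bsum (fun n => cabs (c n) * (B * (1 + cabs (z + n%:~R)))) M.
  have [B1 B10 h1] := gauss_poly_bound 0 pl; have [B2 B20 h2] := gauss_poly_bound 1 pl.
  have h01 : 0 < (1 : R) <= 1 by rewrite ltr01 lexx.
  have BB : 0 <= B * (B1 + B2) by rewrite mulr_ge0 // addr_ge0.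
  exists (B * (B1 + B2) * 8); apply: bsum_le (bsumZ BB (w_mesh U h01)) => n.
  rewrite mul1r mulr1 /c cabsM cabs_ce mul1r cabs_rc (ger0_norm (expR_ge0 _)).
  have {}h1 := h1 (cabs (z + n%:~R)); have {}h2 := h2 (cabs (z + n%:~R)).
  rewrite expr0 mul1r in h1; rewrite expr1 (ger0_norm (cabs_ge0 _)) in h2.
  set E := expR _ in h1 h2 *.
  have hw : w2 (cabs (z + n%:~R)) <= w (U + n%:~R).
    apply: le_trans (w2_le_w _) _; rewrite /w lef_pV2 ?posrE ?w_den // lerD2l cab addrC.
    by rewrite lerDl sqr_ge0.
  apply: (@le_trans _ _ (B * ((B1 + B2) * w2 (cabs (z + n%:~R))))).
    rewrite mulrCA ler_wpM2l // mulrDr mulr1 mulrDl lerD // mulrC //.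
  by rewrite mulrA ler_wpM2l.
have exP r := poisson_gauss U (xi + r ^+ 2 / 2) la0.
have [P hP] := choice exP.
pose g r := rc (r ^+ 2 * expR (- (pi * V * r ^+ 2)) * expR (- (pi * la * V ^+ 2))) * ce (- (U * xi)) * P r.
have fg r : hsum (fun n => f n r) (g r).
  apply: hsum_ext (hsumZ _ (hP r).1) => n.
  rewrite /f /c cab /qexpo.
  have -> : ci R * rc pi * (z + n%:~R) * rc (r ^+ 2) = ci R * rc (2 * pi * ((n%:~R + U) * (r ^+ 2 / 2))) + rc (- (pi * V * r ^+ 2)).
    have -> : z + n%:~R = rc (n%:~R + U) + ci R * rc V by rewrite -Rez -(Imz n); exact: complex_ri.
    have aux (p a b s : C) : ci R * p * (a + ci R * b) * s = ci R * (p * (a * s)) - p * b * s.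
      rewrite (_ : ci R * p * (a + ci R * b) * s = ci R * (p * (a * s)) + (ci R * ci R) * (p * b * s)); last by ring.
      by rewrite ci2 mulN1r.
    have -> : 2 * pi * ((n%:~R + U) * (r ^+ 2 / 2)) = pi * ((n%:~R + U) * r ^+ 2) by field.
    by rewrite aux -!rcM rcN.
  rewrite cexpD cexp_rc -/(ce _).
  have -> : - (pi * la * ((n%:~R + U) ^+ 2 + V ^+ 2)) = - (pi * la * (n%:~R + U) ^+ 2) - pi * la * V ^+ 2 by ring.
  have -> : ce ((n%:~R + U) * (xi + r ^+ 2 / 2)) = ce (n%:~R * xi) * ce (U * xi) * ce ((n%:~R + U) * (r ^+ 2 / 2)) :> C.
    by rewrite -!ceD; congr ce; ring.
  rewrite expRD ceN !(rcM _ (expR _)); field.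
  exact: ce_neq0.
have i1 := Itg_series_wl fk hM fg.
have gw := wl_series fk hM fg.
exists (rc (2 * pi) * Itg g); split.
  apply: hsum_ext (hsumZ (rc (2 * pi)) i1) => n.
  rewrite /f (ItgZ _ (hB _ (Imz n))) psq_moment ?Imz // /c; ring.
pose cm (m : int) : C := rc (expR (- (pi * la * V ^+ 2))) * ce (- (U * xi)) * (rc (Num.sqrt la)^-1 * ce (m%:~R * U)).
pose f' (m : int) r : C := cm m * rc (omf V la (m%:~R - xi) r).
have fg' r : hsum (fun m => f' m r) (g r).
  apply: hsum_ext (hsumZ _ (hP r).2) => m; rewrite /f' /cm /omf.
  have -> : m%:~R - xi - r ^+ 2 / 2 = m%:~R - (xi + r ^+ 2 / 2) by ring.
  by rewrite expRD !rcM; ring.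
have [k' hk'] := choice (fun m : int => omf_wl (m%:~R - xi) V0 la0).
have fk' m : wl (cabs (cm m) * k' m) (f' m) by apply: wlZ.
have [K K0 hK] := omf_bound V0 la0.
have acm m : cabs (cm m) <= (Num.sqrt la)^-1.
  rewrite /cm !cabsM !cabs_ce !mulr1 !cabs_rc ger0_norm ?expR_ge0 // ger0_norm ?invr_ge0 ?sqrtr_ge0 //.
  rewrite ler_piMl ?invr_ge0 ?sqrtr_ge0 // -expR0 ler_expR oppr_le0 mulr_ge0 ?sqr_ge0 //; exact: ltW.
have s0 : 0 <= (Num.sqrt la)^-1 by rewrite invr_ge0 sqrtr_ge0.
have h01 : 0 < (1 : R) <= 1 by rewrite ltr01 lexx.
have bm : bsum (fun m : int => (Num.sqrt la)^-1 * K * (1 * w (- xi + m%:~R * 1))) ((Num.sqrt la)^-1 * K * 8).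
  by apply: bsumZ; [rewrite mulr_ge0|exact: w_mesh].
have i2 := Itg_series (g := g) fk' _ bm gw fg'.
have {}i2 := i2 _; have hb m r : cabs (f' m r) <= (Num.sqrt la)^-1 * K * (1 * w (- xi + m%:~R * 1)) * w r.
  rewrite cabsM cabs_rc (ger0_norm (omf_ge0 _ _ _ _)) mul1r mulr1 (addrC (- xi)).
  by rewrite -!mulrA; apply: ler_pM; rewrite ?cabs_ge0 ?omf_ge0 // mulrA.
apply: hsum_ext (hsumZ (rc (2 * pi)) (i2 hb)) => m.
rewrite /f' (ItgZ _ (hk' m)) (omIP _ V0 la0).1 /cm /OM mulrBl ceD [xi * U]mulrC !rcM; ring.
Qed.

End FourierExpansion.

(** * Fourier series of the regularised series and of its average over translates *)

Section FourierOfSeries.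
Variable R : realType.
Local Notation C := R[i].
Implicit Types (tau z : C) (eta v : R).

Definition rA (A : nat) (N : int) : nat := \sum_(B < A.*2) ((4 * A%:Z)%R %| (B%:Z ^+ 2 + N)%R)%Z.

Definition row_coef (A : nat) eta v (N : int) : R :=
  (rA A N)%:R / Num.sqrt A%:R * OM (4 * A%:R * v) (eta / v) (N%:~R / (4 * A%:R)).

Lemma cf_ge0 A eta v N : (0 < A)%N -> 0 < eta -> 0 < v -> 0 <= row_coef A eta v N.
Proof.
move=> A0 e0 v0; apply: mulr_ge0; first by rewrite divr_ge0 ?ler0n ?sqrtr_ge0.
by apply: OM_ge0; rewrite ?divr_gt0 // !mulr_gt0 // ltr0n.
Qed.

(** Expanding the Gauss sum over [B] produces series with shift B^2 / (4 A). The dual frequencies m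
    - B^2 / (4 A), multiplied by 4 A, are exactly the integers [N] for which 4 A divides B^2 + N. *)
Lemma slice_pos (A : nat) eta tau : (0 < A)%N -> 0 < eta -> 0 < complex.Im tau -> exists S : C,
  hsum (fun n : int => Eterm A n tau * rc (expR (- (pi * eta * Qf A n tau)))) S /\
  hsum (fun N : int => rc (row_coef A eta (complex.Im tau) N) * ce (N%:~R * complex.Re tau)) S.
Proof.
move=> A0 e0 v0; set v := complex.Im tau in v0 *; set u := complex.Re tau.
have Ar : (0 : R) < A%:R by rewrite ltr0n.
pose z : C := 4 * A%:R * tau.
have zE : z = rc (4 * A%:R) * tau by rewrite /z rcM !rc_nat.
have Imz : complex.Im z = 4 * A%:R * v by rewrite zE Im_rcM.
have Rez : complex.Re z = 4 * A%:R * u by rewrite zE Re_rcM.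
have z0 : 0 < complex.Im z by rewrite Imz !mulr_gt0.
have la0 : 0 < eta / v by rewrite divr_gt0.
pose xi (B : 'I_A.*2) : R := B%:R ^+ 2 / (4 * A%:R).
have [S hS] := choice (fun B : 'I_A.*2 => shifted_fourier (xi B) z0 la0).
exists (rc (Num.sqrt A%:R)^-1 * \sum_(B < A.*2) S B); split.
  have h := hsum_finsum (index_enum _) (fun B => (hS B).1).
  apply: hsum_ext (hsumZ (rc (Num.sqrt A%:R)^-1) h) => n.
  have -> : Eterm A n tau = Ep A n tau by case: (A) A0.
  have WE : W A n tau = z + n%:~R by rewrite /W /z -!pmulrn.
  rewrite /Ep WE /Qf WE rcV -/v.
  have -> : pi * (eta / v) * cabs (z + n%:~R) ^+ 2 = pi * eta * (cabs (z + n%:~R) ^+ 2 / v) by ring.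
  rewrite /gg !mulr_suml mulr_sumr; apply: eq_bigr => B _.
  have -> : n%:~R * xi B = n%:~R * B%:R ^+ 2 / (4 * A%:R) by rewrite /xi mulrA.
  ring.
pose D : int := 4 * A%:Z.
have D0 : D != 0 by rewrite /D; lia.
have DR : D%:~R = 4 * A%:R :> R by rewrite /D rmorphM.
pose f (N : int) : C := ce (N%:~R * u) * rc (OM (4 * A%:R * v) (eta / v) (N%:~R / (4 * A%:R))).
have hB (B : 'I_A.*2) : hsum (fun N : int => if (D %| B%:Z ^+ 2 + N)%Z then f N else 0) (S B).
  apply: (proj2 (@hsum_reindex _ _ _ (fun m : int => m * D - B%:Z ^+ 2) (fun N => ((N + B%:Z ^+ 2) %/ D)%Z) _ _ _ _)).
  - by move=> m /=; rewrite subrK mulzK.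
  - move=> N /=; case: ifP => [dv _|_]; last by rewrite eqxx.
    by rewrite divzK ?addrK // addrC.
  apply: hsum_ext (hS B).2 => m.
  have -> : B%:Z ^+ 2 + (m * D - B%:Z ^+ 2) = m * D by ring.
  rewrite (dvdz_mull _ (dvdzz D)) /f.
  have -> : (m * D - B%:Z ^+ 2)%:~R = (m%:~R - xi B) * (4 * A%:R) :> R.
    by rewrite rmorphB rmorphM rmorphXn /= DR -pmulrn /xi; field; rewrite gt_eqF.
  rewrite mulfK; last by rewrite gt_eqF // mulr_gt0.
  by rewrite Rez Imz !mulrA.
have h := hsum_finsum (index_enum _) hB.
apply: hsum_ext (hsumZ (rc (Num.sqrt A%:R)^-1) h) => N.
rewrite /row_coef (rcM _ (OM _ _ _)) (rcM _ (Num.sqrt _)^-1) rc_nat /rA -/D.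
rewrite (eq_bigr (fun B : 'I_A.*2 => f N * ((D %| B%:Z ^+ 2 + N)%Z : nat)%:R)); last first.
  by move=> B _; case: ifP => _; rewrite ?mulr1 ?mulr0.
rewrite -mulr_sumr -natr_sum /f; ring.
Qed.

Lemma EE_abs (A n : int) tau : Eterm A n tau = if A < 0 then Eterm `|A|%N (- n) tau else Eterm `|A|%N n tau.
Proof. by case: A => a //; rewrite -[in LHS]EE_N NegzE opprK. Qed.

Lemma Qf_N (A n : int) tau : Qf (- A) (- n) tau = Qf A n tau.
Proof. by rewrite /Qf WN cabsN. Qed.

(** Rows with [A = 0] get coefficient 0: they depend on Im tau alone and disappear in the average
    over translates. *)
Definition Gm (ep v : R) (p : (nat * int) * int) : R :=
  if p.1.2 == 0 then 0 else (p.1.1.+1%:R ^+ 2)^-1 * row_coef `|p.1.2|%N (ep * p.1.1.+1%:R ^+ 4) v p.2.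

Lemma Gm_ge0 ep v p : 0 < ep -> 0 < v -> 0 <= Gm ep v p.
Proof.
move=> e0 v0; rewrite /Gm; case: eqP => // /eqP p0.
apply: mulr_ge0; first by rewrite invr_ge0 exprn_ge0.
by apply: cf_ge0 => //; [rewrite absz_gt0|rewrite mulr_gt0 // exprn_gt0].
Qed.

Lemma slice_int (ep : R) tau (k : nat) (A : int) : A != 0 -> 0 < ep -> 0 < complex.Im tau -> exists S : C,
  hsum (fun n : int => Ft ep tau (k, (A, n))) S /\
  hsum (fun N : int => rc (Gm ep (complex.Im tau) ((k, A), N)) * ce (N%:~R * complex.Re tau)) S.
Proof.
move=> A0 e0 v0; have A0' : (0 < `|A|)%N by rewrite absz_gt0.
have k0 : 0 < ep * k.+1%:R ^+ 4 by rewrite mulr_gt0 // exprn_gt0.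
have [S [h1 h2]] := slice_pos A0' k0 v0.
exists (rc (k.+1%:R ^+ 2)^-1 * S); split; last first.
  apply: hsum_ext (hsumZ _ h2) => N; rewrite /Gm /= (negbTE A0) (rcM _ (row_coef _ _ _ _)); ring.
have {}h1 := hsumZ (rc (k.+1%:R ^+ 2)^-1) h1.
have hx n : pi * (ep * k.+1%:R ^+ 4) * Qf `|A|%N n tau = pi * ep * k.+1%:R ^+ 4 * Qf `|A|%N n tau by ring.
case: (ltrP A 0) => [An|Ap].
  have h3 := hsum_bij (@opprK int) (@opprK int) h1.
  apply: hsum_ext h3 => n; rewrite /Ft /= EE_abs An hx mulrA.
  by congr (_ * rc (expR (- (_ * _)))); rewrite -Qf_N opprK; congr Qf; lia.
apply: hsum_ext h1 => n; rewrite /Ft /= EE_abs ltNge Ap /= hx mulrA.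
by congr (_ * rc (expR (- (_ * _)))); congr Qf; lia.
Qed.

Lemma reassoc (I J K : eqType) (f : I * (J * K) -> C) s : hsum f s ->
  hsum (fun p : (I * J) * K => f (p.1.1, (p.1.2, p.2))) s.
Proof.
by apply: (@hsum_bij _ _ _ (fun p : (I * J) * K => (p.1.1, (p.1.2, p.2))) (fun q => ((q.1, q.2.1), q.2.2))) => [[[i j] k]|[i [j k]]].
Qed.

Lemma reassoc_absb (I J K : eqType) (f : I * (J * K) -> C) M : absb f M ->
  absb (fun p : (I * J) * K => f (p.1.1, (p.1.2, p.2))) M.
Proof.
by apply: (bsum_inj (h := fun p : (I * J) * K => (p.1.1, (p.1.2, p.2)))) => -[[a b] c] [[a' b'] c'] /= [-> -> ->].
Qed.

Definition Tk ep tau (q : nat * int) : C := tsum (fun n : int => Ft ep tau (q.1, (q.2, n))).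

Lemma Tk_hsum ep tau : 0 < ep -> 0 < complex.Im tau ->
  (forall q, hsum (fun n : int => Ft ep tau (q.1, (q.2, n))) (Tk ep tau q)) /\
  exists M, absb (Tk ep tau) M /\ hsum (Tk ep tau) (Fe ep tau).
Proof.
move=> e0 v0; have [M hM] := Ft_absb e0 v0; have hM' := reassoc_absb hM.
have h1 q : hsum (fun n : int => Ft ep tau (q.1, (q.2, n))) (Tk ep tau q).
  by case: q => k A; exact: tsumP (absb_slice (k, A) hM').
split=> //; exists M; split.
  by apply: absb_sum hM' _ => -[k A]; exact: h1.
by apply: hsum_fubini (reassoc (Fe_hsum e0 v0)) => -[k A]; exact: h1.
Qed.

Lemma Tk_zero ep tau tau' k : complex.Im tau = complex.Im tau' -> Tk ep tau (k, 0) = Tk ep tau' (k, 0).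
Proof.
have Q0 (n : int) t : Qf 0 n t = cabs n%:~R ^+ 2 / complex.Im t by rewrite /Qf /W mulr0 mul0r add0r.
by move=> e; congr tsum; apply/funext => n; rewrite /Ft !Q0 e.
Qed.

(** At a purely imaginary point all phases are 1 and the terms are nonnegative, so the coefficients
    of a row add up to its value there. Absolute convergence of the regularised series thus bounds
    all coefficients together. *)
Lemma Gm_bsum ep v : 0 < ep -> 0 < v -> exists M, bsum (Gm ep v) M.
Proof.
move=> e0 v0; pose tau : C := ci R * rc v.
have Imt : complex.Im tau = v by rewrite /tau ciM_rc.
have Ret : complex.Re tau = 0 by rewrite /tau ciM_rc.
have v0' : 0 < complex.Im tau by rewrite Imt.
have [h1 [M [h2 h3]]] := Tk_hsum e0 v0'.
exists M; apply: (@bsum_prod _ _ _ _ (fun q => cabs (Tk ep tau q))) => [p|[k A]|]; [exact: Gm_ge0| |exact: h2].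
have [->|A0] := eqVneq A 0.
  by move=> G _; rewrite big1 ?cabs_ge0 // => n _; rewrite /Gm eqxx.
have [S [s1 s2]] := slice_int k A0 e0 v0'.
rewrite (hsum_unique (h1 (k, A)) s1).
have s3 : hsum (fun N : int => rc (Gm ep v ((k, A), N))) S.
  by apply: hsum_ext s2 => N; rewrite Ret mulr0 ce0 mulr1 Imt.
have e := hsum_real s3; rewrite e in s3.
apply: bsumW (hsum_bsum (fun N => Gm_ge0 _ e0 v0) s3).
by rewrite e; apply: le_trans (ler_norm _) (Re_le_cabs _).
Qed.

Definition Fe_osc ep tau : C := tsum (fun p => rc (Gm ep (complex.Im tau) p) * ce (p.2%:~R * complex.Re tau)).

Lemma DG_absb ep tau : 0 < ep -> 0 < complex.Im tau -> exists M,
  absb (fun p => rc (Gm ep (complex.Im tau) p) * ce (p.2%:~R * complex.Re tau)) M.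
Proof.
move=> e0 v0; have [M hM] := Gm_bsum e0 v0; exists M; apply: bsum_le hM => p.
by rewrite cabsM cabs_ce mulr1 cabs_rc ger0_norm // Gm_ge0.
Qed.

Lemma DG_hsum ep tau : 0 < ep -> 0 < complex.Im tau ->
  hsum (fun p => rc (Gm ep (complex.Im tau) p) * ce (p.2%:~R * complex.Re tau)) (Fe_osc ep tau).
Proof. by move=> e0 /(DG_absb e0)[M hM]; exact: tsumP hM. Qed.

(** Off the row [A = 0] the two series agree, and that row depends on Im tau alone, so it cancels in
    differences along a horizontal line. *)
Lemma Fe_DG ep tau tau' : 0 < ep -> 0 < complex.Im tau -> complex.Im tau = complex.Im tau' ->
  Fe ep tau - Fe ep tau' = Fe_osc ep tau - Fe_osc ep tau'.
Proof.
move=> e0 v0 e; have v0' : 0 < complex.Im tau' by rewrite -e.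
have [h1 [M [_ h2]]] := Tk_hsum e0 v0; have [h1' [M' [_ h2']]] := Tk_hsum e0 v0'.
have key t : 0 < complex.Im t -> hsum (fun q : nat * int => if q.2 == 0 then 0 else Tk ep t q) (Fe_osc ep t).
  move=> t0; apply: hsum_fubini (DG_hsum e0 t0) => -[k A] /=.
  have [k1 _] := Tk_hsum e0 t0.
  have [->|A0] := eqVneq A 0.
    by apply: hsum_ext (@hsum0 R int) => n; rewrite /Gm eqxx mul0r.
  by have [S [s1 s2]] := slice_int k A0 e0 t0; rewrite (hsum_unique (k1 (k, A)) s1).
apply: (hsum_unique (hsumB h2 h2')).
apply: hsum_ext (hsumB (key _ v0) (key _ v0')) => -[k A] /=.
by case: eqP => [->|//]; rewrite (Tk_zero _ _ e) !subrr.
Qed.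

Lemma root_sum (a : nat) (N : int) : (0 < a)%N ->
  \sum_(j < a) ce (N%:~R * j%:R / a%:R) = (if (a%:Z %| N)%Z then a%:R else 0) :> C.
Proof.
move=> a0; have ar : (0 : R) < a%:R by rewrite ltr0n.
case: ifP => [/dvdzP[q ->]|ndv].
  rewrite (eq_bigr (fun _ => 1)) ?sumr_const ?card_ord // => j _.
  rewrite -(ce_int R (q * j%:Z)); congr ce; rewrite !rmorphM /= -!pmulrn; field; exact: lt0r_neq0.
pose x : C := ce (N%:~R / a%:R).
rewrite (eq_bigr (fun j : 'I_a => x ^+ j)); last first.
  by move=> j _; rewrite /x -ceMn; congr ce; rewrite -[RHS]mulr_natr mulrAC.
have x1 : x != 1.
  have e : N = (N %/ a%:Z)%Z * a%:Z + (N %% a%:Z)%Z by exact: divz_eq.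
  have r0 : 0 <= (N %% a%:Z)%Z by rewrite modz_ge0 //; lia.
  have ra : (N %% a%:Z)%Z < a%:Z by rewrite ltz_pmod; lia.
  have r1 : (N %% a%:Z)%Z != 0 by apply: contraFN ndv => /eqP h; apply/dvdzP; exists (N %/ a%:Z)%Z; rewrite {1}e h addr0.
  have -> : x = ce ((N %% a%:Z)%Z%:~R / a%:R).
    rewrite /x {1}e -[RHS](ceDint _ (N %/ a%:Z)%Z); congr ce.
    by rewrite rmorphD rmorphM /= -!pmulrn; field; exact: lt0r_neq0.
  apply: ce_neq1; rewrite divr_gt0 ?ltr0z //=; last by lia.
  by rewrite ltr_pdivrMr // mul1r pmulrn ltr_int.
have xa : x ^+ a = 1.
  by rewrite /x -ceMn -[X in ce X]mulr_natr divfK ?ce_int // lt0r_neq0.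
have : (x - 1) * \sum_(j < a) x ^+ j = 0 by rewrite -subrX1 xa subrr.
by move/eqP; rewrite mulf_eq0 subr_eq0 (negbTE x1) => /eqP.
Qed.

(* The part of [Fe] with frequencies [N = b mod a]. *)
Definition Fb (a : nat) (b : int) ep tau : C :=
  rc a%:R^-1 * \sum_(j < a) ce (- (b%:~R * j%:R / a%:R)) * Fe ep (tau + rc (j%:R / a%:R)).

Theorem Fb_hsum (a : nat) (b : int) ep tau : (0 < a)%N -> ~~ (a%:Z %| b)%Z -> 0 < ep -> 0 < complex.Im tau ->
  hsum (fun p => if (a%:Z %| p.2 - b)%Z then rc (Gm ep (complex.Im tau) p) * ce (p.2%:~R * complex.Re tau) else 0)
    (Fb a b ep tau).
Proof.
move=> a0 ab e0 v0; have ar : (0 : R) < a%:R by rewrite ltr0n.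
have Imj (j : 'I_a) : complex.Im (tau + rc (j%:R / a%:R)) = complex.Im tau by rewrite ImD addr0.
have vj (j : 'I_a) : 0 < complex.Im (tau + rc (j%:R / a%:R)) by rewrite Imj.
(* As [a] does not divide [b], this character sum is 0, so the average annihilates [Fe - Fe_osc],
   which is constant along horizontal lines. *)
have z0 : \sum_(j < a) ce (- (b%:~R * j%:R / a%:R)) = 0 :> C.
  rewrite -[RHS](_ : (if (a%:Z %| - b)%Z then a%:R else 0) = 0); last by rewrite rpredN (negbTE ab).
  by rewrite -root_sum //; apply: eq_bigr => j _; rewrite rmorphN /= !mulNr.
have -> : Fb a b ep tau = rc a%:R^-1 * \sum_(j < a) ce (- (b%:~R * j%:R / a%:R)) * Fe_osc ep (tau + rc (j%:R / a%:R)).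
  congr (_ * _); apply/eqP; rewrite -subr_eq0 -sumrB.
  rewrite (eq_bigr (fun j : 'I_a => ce (- (b%:~R * j%:R / a%:R)) * (Fe ep tau - Fe_osc ep tau))).
    by rewrite -mulr_suml z0 mul0r.
  move=> j _; rewrite -mulrBr; congr (_ * _).
  have := Fe_DG e0 (vj j) (Imj j) => h.
  by rewrite -[Fe ep (_ + _)](subrK (Fe ep tau)) h; ring.
have h := hsum_finsum (index_enum _) (fun j : 'I_a => hsumZ (ce (- (b%:~R * j%:R / a%:R))) (DG_hsum e0 (vj j))).
apply: hsum_ext (hsumZ (rc a%:R^-1) h) => p.
rewrite (eq_bigr (fun j : 'I_a => rc (Gm ep (complex.Im tau) p) * ce (p.2%:~R * complex.Re tau) *
   ce ((p.2 - b)%:~R * j%:R / a%:R))); last first.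
  move=> j _; rewrite Imj ReD /= mulrDr ceD.
  have -> : (p.2 - b)%:~R * j%:R / a%:R = - (b%:~R * j%:R / a%:R) + p.2%:~R * (j%:R / a%:R) :> R.
    by rewrite rmorphB /=; ring.
  rewrite ceD; ring.
rewrite -mulr_sumr root_sum //; case: ifP => _; last by rewrite !mulr0.
have e : a%:R * rc a%:R^-1 = 1 :> C by rewrite -(rc_nat R a) -rcM mulfV // lt0r_neq0.
by rewrite mulrC -[LHS]mulrA e mulr1.
Qed.

End FourierOfSeries.

(** * Uniform bounds for the Fourier kernel [om] *)

Section OmegaBounds.
Variable R : realType.
Local Notation C := R[i].
Implicit Types (v h x y r : R).

Lemma Itg_mono K K' (g g' : R -> R) : wl K (fun x => rc (g x)) -> wl K' (fun x => rc (g' x)) ->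
  (forall x, g x <= g' x) -> complex.Re (Itg (fun x => rc (g x))) <= complex.Re (Itg (fun x => rc (g' x))).
Proof.
move=> gK gK' gg; rewrite -subr_ge0 -ReN -ReD -(ItgB gK' gK).
have w' : wl (K' + cabs (-1) * K) (fun x => rc (g' x - g x)).
  by have := wlD gK' (wlZ (-1) gK); congr wl; apply/funext => x; rewrite rcB mulN1r.
have h0 x : 0 <= g' x - g x by rewrite subr_ge0.
have [s s0 e] := Itg_ge0 w' h0.
rewrite (_ : (fun x => rc (g' x) - rc (g x)) = fun x => rc (g' x - g x)) ?e //.
by apply/funext => x; rewrite rcB.
Qed.

Definition om v x h : R := OM (4 * v) (h / v) (x / 4).

(* Only [eta A^2] enters, so the [k]- and [A]-dependence of the coefficients is through [j = k^2 A] alone. *)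
Lemma om_scale (A : nat) v x eta : (0 < A)%N -> 0 < v -> 0 < eta ->
  OM (4 * A%:R * v) (eta / v) (x / (4 * A%:R)) / Num.sqrt A%:R = om v x (eta * A%:R ^+ 2) / A%:R.
Proof.
move=> A0 v0 e0; have Ar : (0 : R) < A%:R by rewrite ltr0n.
have sa : 0 < Num.sqrt (A%:R : R) by rewrite sqrtr_gt0.
have sA : Num.sqrt (A%:R : R) ^+ 2 = A%:R by rewrite sqr_sqrtr // ltW.
set c := (Num.sqrt (A%:R : R))^-1; have c0 : 0 < c by rewrite invr_gt0.
have V0 : 0 < 4 * A%:R * v by rewrite !mulr_gt0.
have l0 : 0 < eta / v by rewrite divr_gt0.
have V1 : 0 < 4 * v by rewrite mulr_gt0.
have l1 : 0 < eta * A%:R ^+ 2 / v by rewrite divr_gt0 // mulr_gt0 // exprn_gt0.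
have [K hK] := omf_wl (x / (4 * A%:R)) V0 l0.
have [K' hK'] := omf_wl (x / 4) V1 l1.
have fE r : rc (omf (4 * A%:R * v) (eta / v) (x / (4 * A%:R)) (c * r)) =
    rc (c ^+ 2) * rc (omf (4 * v) (eta * A%:R ^+ 2 / v) (x / 4) r).
  rewrite -rcM; congr rc; rewrite /omf [RHS]mulrA -exprMn; congr (_ * expR _); rewrite exprMn.
  have -> : c ^+ 2 = A%:R^-1 by rewrite /c exprVn sA.
  by field; rewrite !gt_eqF.
have h := Itg_scale c0 hK.
rewrite (_ : (fun r => rc (omf _ _ _ (c * r))) = fun r => rc (c ^+ 2) * rc (omf (4 * v) (eta * A%:R ^+ 2 / v) (x / 4) r)) in h; last first.
  by apply/funext => r; exact: fE.
rewrite (ItgZ _ hK') (omIP _ V0 l0).1 (omIP _ V1 l1).1 -!rcM in h; move/rc_inj: h => h.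
have e : omI (4 * A%:R * v) (eta / v) (x / (4 * A%:R)) = c ^+ 3 * omI (4 * v) (eta * A%:R ^+ 2 / v) (x / 4).
  move: h; set I1 := omI (4 * A%:R * v) _ _; set I2 := omI _ _ _; clearbody I1 I2 => h.
  have -> : I1 = c * (c^-1 * I1) by rewrite mulVKf // lt0r_neq0.
  by rewrite -h; ring.
rewrite /om /OM e.
have -> : Num.sqrt (eta * A%:R ^+ 2 / v) = Num.sqrt (eta / v) * A%:R.
  have -> : eta * A%:R ^+ 2 / v = (eta / v) * A%:R ^+ 2 by ring.
  by rewrite (sqrtrM _ (ltW l0)) sqrtr_sqr (ger0_norm (ltW Ar)).
have -> : pi * (eta / v) * (4 * A%:R * v) ^+ 2 = pi * (eta * A%:R ^+ 2 / v) * (4 * v) ^+ 2 by field; rewrite gt_eqF.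
have sl : 0 < Num.sqrt (eta / v) by rewrite sqrtr_gt0.
set E := expR _; set I := omI _ _ _; rewrite -[A%:R in RHS]sA /c.
by field; rewrite !gt_eqF.
Qed.

Lemma om_ge0 v x h : 0 < v -> 0 < h -> 0 <= om v x h.
Proof. by move=> v0 h0; apply: OM_ge0; rewrite ?divr_gt0 // mulr_gt0. Qed.

(** With a = x/4 - r^2/2, the inequality of the means gives 8 |a| <= 16 h + a^2 / h, and x = 4 a + 2
    r^2 converts this into a bound for |x|. *)
Lemma bracket_ge h x r : 0 < h -> 8 * h + `|x| <= 16 * h + 4 * r ^+ 2 + (x / 4 - r ^+ 2 / 2) ^+ 2 / h.
Proof.
move=> h0; have r0 := sqr_ge0 r; move: (r ^+ 2) r0 => s s0.
set a := x / 4 - s / 2.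
have xa : x = 4 * a + 2 * s by rewrite /a; field.
have a1 : 8 * a <= 16 * h + a ^+ 2 / h.
  have : 0 <= (4 * h - a) ^+ 2 / h by rewrite divr_ge0 ?sqr_ge0 // ltW.
  have -> : (4 * h - a) ^+ 2 / h = 16 * h + a ^+ 2 / h - 8 * a by field; rewrite gt_eqF.
  lra.
have a2 : - (8 * a) <= 16 * h + a ^+ 2 / h.
  have : 0 <= (4 * h + a) ^+ 2 / h by rewrite divr_ge0 ?sqr_ge0 // ltW.
  have -> : (4 * h + a) ^+ 2 / h = 16 * h + a ^+ 2 / h + 8 * a by field; rewrite gt_eqF.
  lra.
have a3 : 0 <= a ^+ 2 / h by rewrite divr_ge0 ?sqr_ge0 // ltW.
have : `|x| <= 8 * h + 4 * s + a ^+ 2 / h by rewrite ler_norml; apply/andP; split; lra.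
lra.
Qed.

(* halving [v] trades half of the exponent for decay *)
Lemma om_half v x h (B : R) : 0 < v -> 0 < h ->
  (forall r, B <= 16 * h + 4 * r ^+ 2 + (x / 4 - r ^+ 2 / 2) ^+ 2 / h) ->
  om v x h <= 2 * expR (- (pi * v / 2 * B)) * om (v / 2) x h.
Proof.
move=> v0 h0 hB; have v2 : 0 < v / 2 by rewrite divr_gt0.
have V0 : 0 < 4 * v by rewrite mulr_gt0.
have V2 : 0 < 4 * (v / 2) by rewrite mulr_gt0.
have l0 : 0 < h / v by rewrite divr_gt0.
have l2 : 0 < h / (v / 2) by rewrite divr_gt0.
have [K hK] := omf_wl (x / 4) V0 l0; have [K' hK'] := omf_wl (x / 4) V2 l2.
set E := expR (- (pi * v / 2 * B)).
pose D : R := expR (pi * (h / v) * (4 * v) ^+ 2 - pi * (h / (v / 2)) * (4 * (v / 2)) ^+ 2) * E.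
have wD : wl (cabs (rc D) * K') (fun r => rc (D * omf (4 * (v / 2)) (h / (v / 2)) (x / 4) r)).
  by have := wlZ (rc D) hK'; congr wl; apply/funext => r; rewrite rcM.
have := Itg_mono hK wD; rewrite (_ : (fun r => rc (D * _)) = fun r => rc D * rc (omf (4 * (v / 2)) (h / (v / 2)) (x / 4) r)); last first.
  by apply/funext => r; rewrite rcM.
rewrite (ItgZ _ hK') Re_rcM => H.
have {}H : omI (4 * v) (h / v) (x / 4) <= D * omI (4 * (v / 2)) (h / (v / 2)) (x / 4).
  apply: H => r; rewrite /omf [X in _ <= X]mulrCA ler_wpM2l ?sqr_ge0 // /D /E -!expRD ler_expR.
  have := hB r; set a := x / 4 - r ^+ 2 / 2 => hr.
  have pv : 0 < pi * v / 2 by rewrite divr_gt0 // mulr_gt0 ?pi_gt0.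
  have := ler_wpM2l (ltW pv) hr.
  have -> : pi * v / 2 * (16 * h + 4 * r ^+ 2 + a ^+ 2 / h) = pi * v * 8 * h + 2 * pi * v * r ^+ 2 + pi * v / 2 * a ^+ 2 / h by field; rewrite gt_eqF.
  have -> : pi * (h / v) * (4 * v) ^+ 2 - pi * (h / (v / 2)) * (4 * (v / 2)) ^+ 2 = pi * v * 8 * h by field; rewrite gt_eqF.
  have -> : pi * a ^+ 2 / (h / v) = pi * v * a ^+ 2 / h by field; rewrite !gt_eqF.
  have -> : pi * a ^+ 2 / (h / (v / 2)) = pi * v / 2 * a ^+ 2 / h by field; rewrite !gt_eqF.
  have : pi * v * a ^+ 2 / h = 2 * (pi * v / 2 * a ^+ 2 / h) by field; rewrite gt_eqF.
  lra.
have I0 : 0 <= omI (4 * (v / 2)) (h / (v / 2)) (x / 4) by have [] := omIP (x / 4) V2 l2.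
rewrite /om /OM.
have p0 : 0 <= 2 * pi :> R by rewrite mulr_ge0 ?pi_ge0.
have s0 : 0 < Num.sqrt (h / v) by rewrite sqrtr_gt0.
have s2 : 0 < Num.sqrt (h / (v / 2)) by rewrite sqrtr_gt0.
have ss : (Num.sqrt (h / v))^-1 <= 2 / Num.sqrt (h / (v / 2)).
  rewrite ler_pdivlMr // mulrC ler_pdivrMr //.
  have -> : h / (v / 2) = 2 * (h / v) by field; rewrite gt_eqF.
  move: (h / v) l0; clear => q q0.
  have q1 : 0 <= Num.sqrt q by exact: sqrtr_ge0.
  have q2 : 0 <= Num.sqrt (2 * q) by exact: sqrtr_ge0.
  have e1 : Num.sqrt q ^+ 2 = q by rewrite sqr_sqrtr // ltW.
  have e2 : Num.sqrt (2 * q) ^+ 2 = 2 * q by rewrite sqr_sqrtr // mulr_ge0 // ltW.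
  by move: (Num.sqrt q) (Num.sqrt (2 * q)) q1 q2 e1 e2 => s t s0 t0 e1 e2; nra.
set E1 := expR (- (pi * (h / v) * _)); set E2 := expR (- (pi * (h / (v / 2)) * _)).
have DE : E1 * D = E2 * E by rewrite /E1 /E2 /D mulrA -expRD; congr (expR _ * _); ring.
apply: (@le_trans _ _ (2 * pi / Num.sqrt (h / v) * E1 * (D * omI (4 * (v / 2)) (h / (v / 2)) (x / 4)))).
  by rewrite ler_wpM2l // mulr_ge0 ?expR_ge0 // divr_ge0 // sqrtr_ge0.
rewrite [X in X <= _](_ : _ = (Num.sqrt (h / v))^-1 * (2 * pi * (E1 * D) * omI (4 * (v / 2)) (h / (v / 2)) (x / 4))); last by ring.
rewrite DE [X in _ <= X](_ : _ = 2 / Num.sqrt (h / (v / 2)) * (2 * pi * (E2 * E) * omI (4 * (v / 2)) (h / (v / 2)) (x / 4))); last by ring.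
by rewrite ler_wpM2r // mulr_ge0 // mulr_ge0 // mulr_ge0 ?expR_ge0.
Qed.

(** Comparison with the telescoping decrements of n^(-1/2): n^(-3/2) is at most four times the
    decrement from n to n + 1. *)
Lemma bsum_three_half (g : int -> R) (g0 : R) : (forall n, 0 <= g n) -> g 0 <= g0 ->
  (forall n : int, n != 0 -> g n * (`|n|%N%:R * Num.sqrt (`|n|%N%:R : R)) <= 1) -> bsum g (g0 + 4 + 4).
Proof.
move=> gp h0 hg.
have step (i : nat) (y : R) : 0 <= y -> y * (i.+1%:R * Num.sqrt (i.+1%:R : R)) <= 1 ->
    y <= 4 * ((Num.sqrt (i.+1%:R : R))^-1 - (Num.sqrt (i.+2%:R : R))^-1).
  move=> y0 hy; set a := Num.sqrt (i.+1%:R : R) in hy *; set b := Num.sqrt (i.+2%:R : R).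
  have a0 : 0 < a by rewrite sqrtr_gt0 ltr0n.
  have b0 : 0 < b by rewrite sqrtr_gt0 ltr0n.
  have a2 : a ^+ 2 = i.+1%:R by rewrite sqr_sqrtr ?ler0n.
  have b2 : b ^+ 2 = a ^+ 2 + 1 by rewrite a2 sqr_sqrtr ?ler0n // -[i.+2]addn1 natrD.
  have a1 : 1 <= a ^+ 2 by rewrite a2 ler1n.
  rewrite -a2 in hy.
  have -> : a^-1 - b^-1 = (a * b * (a + b))^-1.
    have : (b - a) * (b + a) = 1 by rewrite -subr_sqr b2; ring.
    move=> e; rewrite -[X in _ = X]mul1r -e; field; rewrite !gt_eqF // addr_gt0 //.
  have ab : 0 < a * b * (a + b) by rewrite !mulr_gt0 // addr_gt0.
  rewrite ler_pdivlMr //.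
  have ba : b <= 2 * a by rewrite -(ler_pXn2r (n := 2)) ?nnegrE ?mulr_ge0 ?ltW // exprMn b2; lra.
  have : a * b * (a + b) <= 4 * (a ^+ 2 * a).
    have -> : a * b * (a + b) = a * (a * b + b ^+ 2) by ring.
    have -> : 4 * (a ^+ 2 * a) = a * (4 * a ^+ 2) by ring.
    rewrite ler_wpM2l ?(ltW a0) // b2.
    have h1 : a * b <= 2 * a ^+ 2.
      by rewrite (_ : 2 * a ^+ 2 = a * (2 * a)) ?ler_wpM2l ?(ltW a0) //; ring.
    lra.
  by move=> /(ler_wpM2l y0) h; apply: (le_trans h); rewrite mulrCA; lra.
have tel (n : nat) (f : nat -> R) : (forall i, 0 <= f i) ->
    (forall i, f i * (i.+1%:R * Num.sqrt (i.+1%:R : R)) <= 1) -> \sum_(i < n) f i <= 4.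
  move=> f0 hf; apply: (@le_trans _ _ (4 * (1 - (Num.sqrt (n.+1%:R : R))^-1))); last first.
    by have : 0 <= (Num.sqrt (n.+1%:R : R))^-1; [rewrite invr_ge0 sqrtr_ge0|lra].
  elim: n => [|n IH]; first by rewrite big_ord0 sqrtr1 invr1 subrr mulr0.
  rewrite big_ord_recr /=; have := step n (f n) (f0 n) (hf n); lra.
apply: (@bsum_int _ _ (g0 + 4) 4) => //.
  apply: bsum_nat => // -[|n]; first by rewrite big_ord0; have := le_trans (gp 0) h0; lra.
  rewrite big_ord_recl lerD // (tel n (fun i => g i.+1%:Z)) // => i.
  by have := hg i.+1%:Z isT.
apply: bsum_nat => // n; rewrite (tel n (fun i => g (- i.+1%:Z))) // => i.
by have := hg (- i.+1%:Z) isT; rewrite abszN.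
Qed.

(** By [shifted_fourier] with shift -x/4, [om v x h] is the term [m = 0] of a series with
    nonnegative terms. The whole series is at most the sum of |4 v i + n|^(-3/2) over n, which
    involves neither [x] nor [h]. *)
Lemma om_bounded v : 0 < v -> exists2 K, 0 <= K & forall x h, 0 < h -> om v x h <= K.
Proof.
move=> v0; have V0 : 0 < 4 * v by rewrite mulr_gt0.
pose z : C := ci R * rc (4 * v).
have Imz : complex.Im z = 4 * v by rewrite /z ciM_rc.
have Rez : complex.Re z = 0 by rewrite /z ciM_rc.
have z0 : 0 < complex.Im z by rewrite Imz.
pose P (n : int) : R := cabs (psq (- (ci R * (z + n%:~R)))).
have P2 n : P n ^+ 2 = cabs (z + n%:~R).
  by rewrite /P cabs_psq cabsN cabsM (_ : cabs (ci R) = 1) ?mul1r // -ce_fourth cabs_ce.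
have Pge n : 0 <= P n by exact: cabs_ge0.
have P0 n : 0 < P n.
  rewrite /P cabs_gt0 psq_eq0 oppr_eq0 mulf_neq0 ?ci_neq0 //.
  apply/eqP => e; have : complex.Im (z + n%:~R) = 0 by rewrite e.
  by rewrite -rc_int ImD addr0 Imz => e4; move: V0; rewrite e4 ltxx.
pose g n := (P n ^+ 3)^-1.
have gp n : 0 <= g n by rewrite invr_ge0 exprn_ge0.
have hg (n : int) : n != 0 -> g n * (`|n|%N%:R * Num.sqrt (`|n|%N%:R : R)) <= 1.
  move=> n0; have P3 : 0 < P n ^+ 3 by rewrite exprn_gt0.
  rewrite mulrC ler_pdivrMr // mul1r exprSr.
  have nP : `|n|%N%:R <= P n ^+ 2.
    rewrite P2; apply: le_trans (Re_le_cabs _); rewrite ReD Rez add0r -rc_int /=.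
    by rewrite -intr_norm pmulrn abszE.
  apply: ler_pM; rewrite ?ler0n ?sqrtr_ge0 //.
  by rewrite -(ler_pXn2r (n := 2)) ?nnegrE ?sqrtr_ge0 // sqr_sqrtr ?ler0n.
have gb := bsum_three_half gp (lexx _) hg.
exists (g 0 + 4 + 4) => [|x h h0]; first by have := gp 0; lra.
have l0 : 0 < h / v by rewrite divr_gt0.
have [S [h1 h2]] := shifted_fourier (- (x / 4)) z0 l0.
have h3 : hsum (fun m : int => rc (OM (4 * v) (h / v) (m%:~R + x / 4))) S.
  by apply: hsum_ext h2 => m; rewrite Rez mulr0 ce0 mul1r opprK Imz.
have e := hsum_real h3; rewrite e in h3.
have b := hsum_bsum (fun m => OM_ge0 _ V0 l0) h3.
have := bsum_one 0 b; rewrite mulr0z add0r -/(om v x h) => H; apply: (le_trans H).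
apply: le_trans (ler_norm _) _; apply: le_trans (Re_le_cabs _) _.
apply: (hsum_le h1); apply: bsum_le gb => n.
rewrite !cabsM cabs_ce mul1r cabsV cabsX -/(P n) -/(g n) cabs_rc (ger0_norm (expR_ge0 _)).
rewrite ler_piMr // -expR0 ler_expR oppr_le0 mulr_ge0 ?sqr_ge0 //.
by rewrite mulr_ge0 ?pi_ge0 // ltW.
Qed.

Lemma om_decay v : 0 < v -> exists2 K, 0 <= K & forall x h, 0 < h ->
  om v x h <= K * expR (- (pi * v / 2 * (8 * h + `|x|))).
Proof.
move=> v0; have v2 : 0 < v / 2 by rewrite divr_gt0.
have [K K0 hK] := om_bounded v2; exists (2 * K) => [|x h h0]; first by rewrite mulr_ge0.
apply: le_trans (om_half v0 h0 (fun r => bracket_ge x r h0)) _.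
by rewrite mulrAC ler_wpM2r ?expR_ge0 // ler_wpM2l // hK.
Qed.

(** For [x <= -1] the quantity x/4 - r^2/2 is at most -1/4, so half of the exponent yields a factor
    exp(-c / h), which is at most a constant times h. *)
Lemma om_neg v : 0 < v -> exists2 K, 0 <= K & forall x h, 0 < h -> x <= -1 -> om v x h <= K * h.
Proof.
move=> v0; have v2 : 0 < v / 2 by rewrite divr_gt0.
have [K K0 hK] := om_bounded v2.
exists (2 * K * (32 / (pi * v))) => [|x h h0 x1].
  by rewrite !mulr_ge0 // invr_ge0 mulr_ge0 ?pi_ge0 // ltW.
have pv : 0 < pi * v by rewrite mulr_gt0 ?pi_gt0.
have hB r : (16 * h)^-1 <= 16 * h + 4 * r ^+ 2 + (x / 4 - r ^+ 2 / 2) ^+ 2 / h.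
  have r0 := sqr_ge0 r; have a1 : 1 / 4 <= - (x / 4 - r ^+ 2 / 2) by lra.
  have a2 : (1 / 4) ^+ 2 <= (x / 4 - r ^+ 2 / 2) ^+ 2.
    by rewrite -[X in _ <= X]sqrrN ler_pXn2r ?nnegrE //; lra.
  have : (1 / 4) ^+ 2 / h <= (x / 4 - r ^+ 2 / 2) ^+ 2 / h by rewrite ler_wpM2r // invr_ge0 ltW.
  have -> : (1 / 4) ^+ 2 / h = (16 * h)^-1 by field; rewrite gt_eqF.
  lra.
apply: le_trans (om_half v0 h0 hB) _.
have y0 : 0 < pi * v / 2 * (16 * h)^-1 by rewrite mulr_gt0 // ?divr_gt0 // invr_gt0 mulr_gt0.
have := expR_inv_le y0; rewrite (_ : (pi * v / 2 * (16 * h)^-1)^-1 = 32 / (pi * v) * h); last first.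
  have : pi != 0 :> R by rewrite gt_eqF // pi_gt0.
  by move: (pi : R) => p p0; field; rewrite ?p0 ?gt_eqF.
move=> hE; have om0 : 0 <= om (v / 2) x h by exact: om_ge0.
rewrite (_ : 2 * K * (32 / (pi * v)) * h = 2 * (32 / (pi * v) * h) * K); last by ring.
have E0 : 0 <= 2 * expR (- (pi * v / 2 * (16 * h)^-1)) by rewrite mulr_ge0 ?expR_ge0.
have E1 : 2 * expR (- (pi * v / 2 * (16 * h)^-1)) <= 2 * (32 / (pi * v) * h) by lra.
exact: (ler_pM E0 om0 E1 (hK _ _ h0)).
Qed.

End OmegaBounds.

(** * Laplace's method: the limit of the Fourier kernel at positive frequencies *)

Section OmegaLimit.
Variable R : realType.
Local Notation C := R[i].
Implicit Types (v h x y r t s : R).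

Lemma Itg_opp K (f : R -> C) : wl K f -> Itg (fun x => f (- x)) = Itg f.
Proof.
move=> fK; apply: isI_eq; have [K0 [h0 [h01 H]]] := isI_Itg fK; exists K0, h0; split=> // h hh.
have h1 : 0 < h <= 1 by case/andP: hh => -> /= /le_trans; apply; case/andP: h01.
rewrite (_ : Sm h (fun x => f (- x)) = Sm h f); first exact: H.
apply: tsum_eq; have := hsum_bij (@opprK int) (@opprK int) (Sm_hsum h1 (wl_w fK)).
by apply: hsum_ext => n; rewrite rmorphN mulNr.
Qed.

Lemma cder_continuous (f : R -> C) x l : cder f x l ->
  forall e : R, 0 < e -> exists2 d : R, 0 < d & forall h, `|h| < d -> cabs (f (x + h) - f x) <= e.
Proof.
move=> [d1 d2] e e0; have e2 : 0 < e / 2 by rewrite divr_gt0.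
have key (g : R -> R) (m : R) : is_derive x (1 : R) g m ->
    exists2 d : R, 0 < d & forall h, `|h| < d -> `|g (x + h) - g x| <= e / 2.
  move=> [dg _].
  have /cvgrPdist_le/(_ _ e2)/nbhs_ballP[d d0 hd] : {for x, continuous g}.
    by apply: differentiable_continuous; apply/derivable1_diffP.
  exists d => // h hh; rewrite distrC; apply: hd.
  by rewrite /ball /= opprD addNKr normrN.
have [a a0 ha] := key _ _ d1; have [b b0 hb] := key _ _ d2.
exists (Num.min a b) => [|h]; first by rewrite lt_min a0.
rewrite lt_min => /andP[h1 h2]; apply: le_trans (cabs_le_ReIm _) _.
rewrite !(ReD, ImD, ReN, ImN); have := ha _ h1; have := hb _ h2; lra.
Qed.

Lemma horner_one (z : C) : (1 : {poly C}).[z] = 1.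
Proof. exact: hornerC. Qed.

(** Times (1 + X)^5 this is 2^8 S((1 + X) / 2), where S is the polynomial of degree 9 that rises
    from 0 to 1 with four vanishing derivatives at both ends of [0, 1]. Its symmetry S(t) + S(1 - t)
    = 1 accounts for the constant 2^7. *)
Definition mult_cofactor : {poly C} := (5 * 7)%:P * 'X^4 - (5 * 5 * 7)%:P * 'X^3 + (3 * 5 * 23)%:P * 'X^2 - (5 * 5 * 13)%:P * 'X + (2 ^+ 7)%:P.
Definition odd_multiplier : {poly C} := (1 + 'X) ^+ 5 * mult_cofactor.

(* [odd_multiplier / 2^7 = 1 + odd]: integrating an even function against [odd_multiplier] multiplies its integral by 2^7,
   while the factor [(1 + t)^5] suppresses the peak at [t = -1] *)
Lemma MmE (z : C) : odd_multiplier.[z] = (1 + z) ^+ 5 * (5 * 7 * z ^+ 4 - 5 * 5 * 7 * z ^+ 3 + 3 * 5 * 23 * z ^+ 2 - 5 * 5 * 13 * z + 2 ^+ 7).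
Proof.
rewrite /odd_multiplier /mult_cofactor hornerM horner_exp hornerD hornerX horner_one; congr (_ * _).
by rewrite !(hornerD, hornerN) !hornerCM !hornerXn hornerX hornerC.
Qed.

Lemma Mm_odd (z : C) : odd_multiplier.[z] - 2 ^+ 7 = - (odd_multiplier.[- z] - 2 ^+ 7).
Proof. by rewrite !MmE; ring. Qed.

Lemma Mm1 : odd_multiplier.[1] = 2 ^+ 8.
Proof. by rewrite !MmE; ring. Qed.

(** The exponent decays in y through y (1 + t), which degenerates near t = -1. The factor (1 + t)^4
    compensates, since (1 + t)^2 (1 + y^2) is bounded in terms of 1 + t^2 and 1 + (y (1 + t))^2. *)
Lemma peak_bound (p : {poly C}) (a b : R) : 0 < a -> 0 < b -> exists2 B, 0 <= B & forall t y,
  cabs p.[rc t] * (1 + t) ^+ 4 * (1 + `|y * (1 + t)|) * expR (- (a * t ^+ 2) - b * (y * (1 + t)) ^+ 2) <= B * w2 y.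
Proof.
move=> a0 b0; have [A A0 hA] := poly_growth p.
have [B1 B10 h1] := exp_growth (size p).+2 a0; have [B2 B20 h2] := exp_growth 3 b0.
exists (18 * A * B1 * B2) => [|t y]; first by rewrite !mulr_ge0.
rewrite /w2 /w exprVn ler_pdivlMr ?exprn_gt0 ?w_den // expRD.
have {hA} := hA t; have {h1} := h1 t; have {h2} := h2 (y * (1 + t)).
set E2 := expR _; set E1 := expR _; set P := cabs _.
have E10 : 0 <= E1 by exact: expR_ge0.
have E20 : 0 <= E2 by exact: expR_ge0.
have P0 : 0 <= P by exact: cabs_ge0.
have yE : y ^+ 2 * (1 + t) ^+ 2 = (y * (1 + t)) ^+ 2 by rewrite exprMn.
set u := y * (1 + t) in yE *; have u2 := sqr_ge0 u; have t2 := sqr_ge0 t; have s2 := sqr_ge0 (1 + t).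
set T := 1 + t ^+ 2; set Y := 1 + u ^+ 2; rewrite -/T -/Y => h2 h1 hA.
have T1 : 1 <= T by rewrite /T; lra.
have Y1 : 1 <= Y by rewrite /Y; lra.
have k1 : (1 + t) ^+ 4 * (1 + y ^+ 2) ^+ 2 <= 9 * T ^+ 2 * Y ^+ 2.
  have -> : (1 + t) ^+ 4 * (1 + y ^+ 2) ^+ 2 = ((1 + t) ^+ 2 + u ^+ 2) ^+ 2 by rewrite -yE; ring.
  have -> : 9 * T ^+ 2 * Y ^+ 2 = (3 * T * Y) ^+ 2 by ring.
  have TY : 0 <= 3 * T * Y by rewrite mulr_ge0 ?mulr_ge0 //; lra.
  rewrite ler_pXn2r ?nnegrE // ?addr_ge0 //.
  have h : (1 + t) ^+ 2 <= 2 * T by have := sqr_ge0 (1 - t); rewrite /T; nra.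
  have : 0 <= (T - 1) * (Y - 1) by rewrite mulr_ge0 // subr_ge0.
  rewrite /Y in Y1 *; nra.
have k2 : 1 + `|u| <= 2 * Y.
  by rewrite /Y -(real_normK (num_real u)); have := sqr_ge0 (`|u| - 1); nra.
have T0 : 0 <= T by lra.
have Y0 : 0 <= Y by lra.
rewrite (_ : P * _ * _ * _ * _ = (P * E1) * (((1 + t) ^+ 4 * (1 + y ^+ 2) ^+ 2) * (1 + `|u|) * E2)); last by ring.
apply: (@le_trans _ _ (A * T ^+ size p * E1 * (9 * T ^+ 2 * Y ^+ 2 * (2 * Y) * E2))).
  have g0 : 0 <= (1 + t) ^+ 4 * (1 + y ^+ 2) ^+ 2 by rewrite mulr_ge0 ?sqr_ge0 ?exprn_even_ge0.
  have g1 : 0 <= 1 + `|u| by rewrite addr_ge0.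
  apply: ler_pM (mulr_ge0 P0 E10) (mulr_ge0 (mulr_ge0 g0 g1) E20) (ler_wpM2r E10 hA) _.
  by rewrite ler_wpM2r // ler_pM.
have -> : A * T ^+ size p * E1 * (9 * T ^+ 2 * Y ^+ 2 * (2 * Y) * E2) = 18 * A * (T ^+ (size p).+2 * E1) * (Y ^+ 3 * E2).
  by rewrite [T ^+ (size p).+2]exprS [T ^+ (size p).+1]exprS; move: (T ^+ size p) => Tp; ring.
have A18 : 0 <= 18 * A by rewrite mulr_ge0.
apply: (ler_pM _ _ (ler_wpM2l A18 h1) h2); last by rewrite mulr_ge0 ?exprn_ge0.
by rewrite (mulr_ge0 A18) // mulr_ge0 ?exprn_ge0.
Qed.

Section Peak.
Variables a b : R.
Hypotheses (a0 : 0 < a) (b0 : 0 < b).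

(** The integrand rescaled about its peak t = 1 by t = 1 + d y. At [d = 0] it is a constant times a
    Gaussian in y. *)
Definition peakf (d y : R) : C :=
  (odd_multiplier * 'X^2).[rc (1 + d * y)] * rc (expR (- (a * (1 + d * y) ^+ 2) - b * (y * (2 + d * y)) ^+ 2)).

Definition peakL (d : R) : {poly C} := 1 + (rc d)%:P * 'X.
Definition peakQ (d : R) : {poly C} :=
  - ((rc a)%:P * (peakL d * peakL d)) - (rc b)%:P * (('X * (1 + peakL d)) * ('X * (1 + peakL d))).

Lemma peakLE d y : (peakL d).[rc y] = rc (1 + d * y).
Proof. by rewrite /peakL !hornerE rcD rcM. Qed.

Lemma peakQE d y : (peakQ d).[rc y] = rc (- (a * (1 + d * y) ^+ 2) - b * (y * (2 + d * y)) ^+ 2).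
Proof.
rewrite /peakQ hornerD !hornerN hornerM hornerC hornerM peakLE hornerM hornerC !hornerM hornerD peakLE hornerX.
rewrite horner_one.
have -> : 2 + d * y = 1 + (1 + d * y) by ring.
by rewrite -!rcM -rcN -rc1 -rcD -!rcM -rcB; congr rc; ring.
Qed.

Lemma peakQ' d y : (peakQ d)^`().[rc y] =
  - rc (2 * a * d * (1 + d * y)) - rc (4 * b * (y * (2 + d * y)) * (1 + d * y)).
Proof.
have Ld : (peakL d)^`() = (rc d)%:P by rewrite /peakL derivD derivC derivM derivC derivX mul0r !add0r mulr1.
rewrite /peakQ; have := peakLE d y; move: (peakL d) Ld => L Ld LE.
have -> : (- ((rc a)%:P * (L * L)) - (rc b)%:P * ('X * (1 + L) * ('X * (1 + L))))^`() =
    - ((rc a)%:P * ((rc d)%:P * L + L * (rc d)%:P)) - (rc b)%:P * (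
    (1 + L + 'X * (rc d)%:P) * ('X * (1 + L)) + ('X * (1 + L)) * (1 + L + 'X * (rc d)%:P)).
  have d1 : (1 : {poly C})^`() = 0 by exact: derivC.
  have dX : ('X * (1 + L))^`() = 1 + L + 'X * (rc d)%:P by rewrite derivM derivX derivD d1 Ld add0r mul1r.
  have m1 : (L * L)^`() = (rc d)%:P * L + L * (rc d)%:P by rewrite derivM Ld.
  have m2 := derivM ('X * (1 + L)) ('X * (1 + L)); rewrite dX in m2.
  by rewrite derivB derivN (deriv_mulC (rc a)) (deriv_mulC (rc b)) m1 m2.
rewrite !(hornerD, hornerN, hornerM, hornerC, hornerX) LE.
by rewrite -!rcM -rc1 -!rcD -!rcM -!rcD -!rcM -!rcN -!rcD; congr rc; ring.
Qed.

Lemma peakE d y : peakf d y = pe ((odd_multiplier * 'X^2) \Po peakL d) (peakQ d) y.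
Proof. by rewrite /pe horner_comp peakLE peakQE cexp_rc. Qed.

(** The constant is uniform down to [d = 0]. Differentiation lowers the order of vanishing at t = -1
    from five to four, the power that [peak_bound] asks for. *)
Lemma peak_wl : exists K, forall d, 0 <= d <= 1 -> wl K (peakf d).
Proof.
pose p0 : {poly C} := (1 + 'X) * (mult_cofactor * 'X^2).
pose p1 : {poly C} := 5%:P * (mult_cofactor * 'X^2) + (1 + 'X) * (mult_cofactor * 'X^2)^`().
pose p2 : {poly C} := p0 * 'X.
have [B0 B00 h0] := peak_bound p0 a0 b0; have [B1 B10 h1] := peak_bound p1 a0 b0.
have [B2 B20 h2] := peak_bound p2 a0 b0.
pose K := B0 + B1 + (2 * a + 4 * b) * B2; exists (18 * K) => d /andP[d0 d1].
have N0 : odd_multiplier * 'X^2 = (1 + 'X) ^+ 4 * p0 by rewrite /odd_multiplier /p0; ring.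
have N1 : (odd_multiplier * 'X^2)^`() = (1 + 'X) ^+ 4 * p1.
  rewrite /odd_multiplier -mulrA derivM deriv_exp derivD derivX derivC add0r mul1r /= -mulr_natl /p1.
  by rewrite -(polyC_natr C 5); ring.
clearbody p0 p1.
have aexp y := expR_ge0 (- (a * (1 + d * y) ^+ 2) - b * (y * (2 + d * y)) ^+ 2).
have sE y : 2 + d * y = 1 + (1 + d * y) by ring.
have c4 y : cabs ((1 + 'X : {poly C}) ^+ 4).[rc (1 + d * y)] = (1 + (1 + d * y)) ^+ 4.
  by rewrite horner_exp hornerD horner_one hornerX -rc1 -rcD -rcX cabs_rc ger0_norm // exprn_even_ge0.
have W y := w2_ge0 y.
have bnd p B : (forall t y, cabs p.[rc t] * (1 + t) ^+ 4 * (1 + `|y * (1 + t)|) *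
      expR (- (a * t ^+ 2) - b * (y * (1 + t)) ^+ 2) <= B * w2 y) -> forall y (m : R), 0 <= m -> m <= 1 + `|y * (2 + d * y)| ->
    cabs p.[rc (1 + d * y)] * (1 + (1 + d * y)) ^+ 4 * m * expR (- (a * (1 + d * y) ^+ 2) - b * (y * (2 + d * y)) ^+ 2) <= B * w2 y.
  move=> hp y m m0 hm; apply: le_trans (hp (1 + d * y) y).
  rewrite -sE ler_wpM2r // ler_wpM2l // mulr_ge0 ?cabs_ge0 // exprn_even_ge0 //.
have der y : cder (peakf d) y (((1 + 'X) ^+ 4).[rc (1 + d * y)] * (rc d * p1.[rc (1 + d * y)] -
      rc (2 * a * d) * p2.[rc (1 + d * y)] - rc (4 * b * (y * (2 + d * y))) * p2.[rc (1 + d * y)]) *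
      rc (expR (- (a * (1 + d * y) ^+ 2) - b * (y * (2 + d * y)) ^+ 2))).
  rewrite (_ : peakf d = pe ((odd_multiplier * 'X^2) \Po peakL d) (peakQ d)); last by apply/funext => z; exact: peakE.
  apply: cder_eq (cder_pe _ _ _) _.
  have Ld : (peakL d)^`() = (rc d)%:P by rewrite /peakL derivD derivC derivM derivC derivX mul0r !add0r mulr1.
  rewrite /pe hornerD hornerM peakQ' deriv_comp hornerM !horner_comp peakLE Ld hornerC peakQE cexp_rc N1 N0 (hornerM _ p0) (hornerM _ p1).
  rewrite /p2 (hornerM p0) hornerX !rcM; set E := rc (expR _); set T := rc (1 + d * y); ring.
apply: wl_of_der der _ _ => y.
  rewrite /peakf N0 hornerM !cabsM c4 cabs_rc (ger0_norm (aexp y)).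
  have := bnd _ _ h0 y 1 ler01; rewrite lerDl normr_ge0 => /(_ isT).
  have : 0 <= (B1 + (2 * a + 4 * b) * B2) * w2 y.
    by rewrite mulr_ge0 // addr_ge0 // mulr_ge0 // addr_ge0 // mulr_ge0 // ltW.
  rewrite /K [_ ^+ 4 * cabs _]mulrC mulr1; lra.
rewrite !cabsM c4 cabs_rc (ger0_norm (aexp y)).
set T := rc (1 + d * y); set u := y * (2 + d * y); set E := expR _; set s4 := (1 + (1 + d * y)) ^+ 4.
have s40 : 0 <= s4 by rewrite exprn_even_ge0.
have E0 : 0 <= E by exact: expR_ge0.
have := bnd _ _ h1 y 1 ler01; rewrite lerDl normr_ge0 mulr1 => /(_ isT).
have := bnd _ _ h2 y 1 ler01; rewrite lerDl normr_ge0 mulr1 => /(_ isT).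
have := bnd _ _ h2 y _ (normr_ge0 u); rewrite lerDr ler01 => /(_ isT).
rewrite -/T -/u -/E -/s4 => k3 k2 k1.
have c : cabs (rc d * p1.[T] - rc (2 * a * d) * p2.[T] - rc (4 * b * u) * p2.[T]) <=
    cabs p1.[T] + 2 * a * cabs p2.[T] + 4 * b * (`|u| * cabs p2.[T]).
  have ab1 : `|2 * a * d| <= 2 * a by rewrite ger0_norm ?mulr_ge0 ?(ltW a0) // ler_piMr // mulr_ge0 ?(ltW a0).
  have ab2 : `|4 * b * u| = 4 * b * `|u| by rewrite normrM ger0_norm // mulr_ge0 ?(ltW b0).
  apply: le_trans (cabsB _ _) _; apply: le_trans (lerD (cabsB _ _) (lexx _)) _.
  rewrite !cabsM !cabs_rc ab2 (ger0_norm d0) !lerD ?ler_wpM2r ?cabs_ge0 ?ler_piMl ?cabs_ge0 // mulrA //.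
apply: (@le_trans _ _ (s4 * (cabs p1.[T] + 2 * a * cabs p2.[T] + 4 * b * (`|u| * cabs p2.[T])) * E)).
  by rewrite ler_wpM2r // ler_wpM2l.
have := mulr_ge0 B00 (W y); have := ler_wpM2l (ltW a0) k2; have := ler_wpM2l (ltW b0) k3.
rewrite /K; move=> *; lra.
Qed.

(** For fixed [y] the integrand is, as a function of the scale, again a polynomial times the
    exponential of a polynomial, hence continuous. *)
Lemma peak_lim y e : 0 < e -> exists2 d, 0 < d & forall t, 0 < t < d -> cabs (peakf t y - peakf 0 y) <= e.
Proof.
move=> e0; pose p := (odd_multiplier * 'X^2) \Po peakL y.
pose q := - ((rc a)%:P * (peakL y * peakL y)) - (rc (b * y ^+ 2))%:P * ((1 + peakL y) * (1 + peakL y)).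
have E t : peakf t y = pe p q t.
  rewrite /pe horner_comp peakLE /peakf [y * t]mulrC; congr (_ * _).
  rewrite -cexp_rc /q hornerD !hornerN hornerM hornerC hornerM peakLE hornerM hornerC !hornerM hornerD peakLE.
  rewrite horner_one [y * t]mulrC; congr cexp.
  by rewrite -rc1 -rcD -!rcM -rcN -rcB; congr rc; ring.
have [d d0 hd] := cder_continuous (cder_pe p q 0) e0.
exists d => // t /andP[t0 td]; have := hd t; rewrite add0r -!E gtr0_norm //; exact.
Qed.

Lemma peak_Itg0 : Itg (peakf 0) = rc (2 ^+ 8 * expR (- a) * Num.sqrt (pi / (4 * b))).
Proof.
pose c := Num.sqrt (4 * b / pi); have c2 : c ^+ 2 = 4 * b / pi by rewrite sqr_sqrtr // divr_ge0 ?pi_ge0 // mulr_ge0 // ltW.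
have c0 : 0 < c by rewrite sqrtr_gt0 divr_gt0 ?pi_gt0 // mulr_gt0.
have [K hK] := gau_wl1 0 (cone_rc c0).
have -> : peakf 0 = fun y => rc (2 ^+ 8 * expR (- a)) * gau (rc c) 0 y.
  apply/funext => y; have -> : gau (rc c) 0 y = rc (expR (- (pi * (c * y) ^+ 2))).
    by rewrite /gau addr0 -rcM -rcX -rcM -rcN cexp_rc.
  rewrite /peakf mul0r !addr0 hornerM hornerXn Mm1 rc1 !expr1n !mulr1 (rcM (2 ^+ 8)) rcX rc_nat -mulrA -rcM -expRD.
  congr (_ * rc (expR (_ - _))); rewrite !exprMn c2; have : pi != 0 :> R by rewrite gt_eqF ?pi_gt0.
  by move: (pi : R) => p p0; field.
rewrite (ItgZ _ hK) gau_I ?cone_rc // -rcV -rcM; congr (rc (_ * _)).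
by rewrite /c -sqrtrV ?divr_ge0 ?pi_ge0 ?mulr_ge0 ?ltW // invf_div.
Qed.

End Peak.
Arguments peakf a b d y : clear implicits.

(** The substitution r = sqrt(x / 2) t moves the peaks to t = 1 and t = -1. The even integrand may
    be multiplied by [odd_multiplier / 2^7], which suppresses the peak at -1, and t = 1 + sqrt(h) y
    rescales the other one. *)
Lemma om_peak v x h : 0 < v -> 0 < x -> 0 < h ->
  om v x h = 2 * pi * Num.sqrt v * Num.sqrt (x / 2) ^+ 3 / 2 ^+ 7 * expR (- (16 * pi * v * h)) *
    complex.Re (Itg (peakf (2 * pi * v * x) (pi * v * x ^+ 2 / 16) (Num.sqrt h))).
Proof.
move=> v0 x0 h0; set de := Num.sqrt h; set ro := Num.sqrt (x / 2).
have de0 : 0 < de by rewrite sqrtr_gt0.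
have de2 : de ^+ 2 = h by rewrite sqr_sqrtr // ltW.
have x2 : 0 < x / 2 by rewrite divr_gt0.
have ro0 : 0 < ro by rewrite sqrtr_gt0.
have ro2 : ro ^+ 2 = x / 2 by rewrite sqr_sqrtr // ltW.
have sv : 0 < Num.sqrt v by rewrite sqrtr_gt0.
set a := 2 * pi * v * x; set b := pi * v * x ^+ 2 / 16.
have a0 : 0 < a by rewrite !mulr_gt0 ?pi_gt0.
have b0 : 0 < b by rewrite divr_gt0 // !mulr_gt0 ?pi_gt0 // exprn_gt0.
pose Q : {poly C} := - ((rc a)%:P * 'X^2) - (rc (b / h))%:P * (1 - 'X^2) ^+ 2.
have QE t : Q.[rc t] = rc (- (a * t ^+ 2) - b / h * (1 - t ^+ 2) ^+ 2).
  rewrite /Q !(hornerD, hornerN, hornerM, horner_exp, hornerC, hornerX, horner_one).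
  by rewrite -!rcM -rc1 -!rcB -!rcM -rcN -rcB; congr rc; ring.
have Qre t : complex.Re Q.[rc t] <= 0 - a * t ^+ 2.
  by rewrite QE /= sub0r lerBlDr lerDl mulr_ge0 ?sqr_ge0 // divr_ge0 // ltW.
have wlQ p : exists K, wl K (pe p Q).
  by have [K hK] := pe_C2 p a0 Qre; exists (18 * K); exact: C2_wl hK.
have V0 : 0 < 4 * v by rewrite mulr_gt0.
have l0 : 0 < h / v by rewrite divr_gt0.
have [K1 hK1] := omf_wl (x / 4) V0 l0; have [K2 hK2] := wlQ 'X^2.
have [K3 hK3] := wlQ (odd_multiplier * 'X^2); have [K4 hK4] := wlQ ((odd_multiplier - (2 ^+ 7)%:P) * 'X^2).
have s1 : Itg (fun r => rc (omf (4 * v) (h / v) (x / 4) r)) = rc (ro ^+ 3) * Itg (pe 'X^2 Q).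
  have := Itg_scale ro0 hK1; rewrite (_ : (fun t => _) = fun t => rc (ro ^+ 2) * pe 'X^2 Q t); last first.
    apply/funext => t; rewrite /pe QE cexp_rc hornerXn -rcX -!rcM; congr rc; rewrite /omf [RHS]mulrA exprMn.
    congr (_ * expR _); rewrite ro2 /a /b; field; by rewrite !gt_eqF.
  rewrite (ItgZ _ hK2) => /(congr1 (fun z => rc ro * z)).
  by rewrite [RHS]mulrA -rcM mulfV ?gt_eqF // rc1 mul1r => <-; rewrite mulrA -rcM -exprS.
have s2 : Itg (pe (odd_multiplier * 'X^2) Q) = 2 ^+ 7 * Itg (pe 'X^2 Q).
  have z : Itg (pe ((odd_multiplier - (2 ^+ 7)%:P) * 'X^2) Q) = 0.
    have := Itg_opp hK4; rewrite (_ : (fun t => _) = fun t => -1 * pe ((odd_multiplier - (2 ^+ 7)%:P) * 'X^2) Q t); last first.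
      apply/funext => t; rewrite /pe !QE sqrrN !(hornerM _ 'X^2) !hornerD !hornerN !hornerC !hornerXn rcN sqrrN (Mm_odd (rc t)).
      ring.
    by rewrite (ItgZ _ hK4) mulN1r => /eqP; rewrite eqNr => /eqP.
  rewrite -(ItgZ _ hK2) -[RHS]add0r -z -(ItgD hK4 (wlZ _ hK2)); congr Itg; apply/funext => t.
  have HB : (odd_multiplier - (2 ^+ 7)%:P).[rc t] = odd_multiplier.[rc t] - 2 ^+ 7 by rewrite hornerD hornerN hornerC.
  by rewrite /pe !(hornerM _ 'X^2) HB; ring.
have s3 : Itg (peakf a b de) = rc de^-1 * Itg (pe (odd_multiplier * 'X^2) Q).
  have t1 : `|1 : R| <= 1 by rewrite normr1.
  rewrite -(Itg_trans 1 hK3) -(Itg_scale de0 (wl_trans t1 hK3)); congr Itg; apply/funext => y.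
  rewrite /pe QE cexp_rc /peakf [de * y + 1]addrC; congr (_ * rc (expR (_ - _))).
  rewrite -de2; field; by rewrite gt_eqF.
rewrite s3 s2 /om /OM.
have e1 := (omIP (x / 4) V0 l0).1; rewrite s1 in e1.
have e2 : omI (4 * v) (h / v) (x / 4) = ro ^+ 3 * complex.Re (Itg (pe 'X^2 Q)).
  by rewrite -Re_rcM e1.
have -> : rc de^-1 * (2 ^+ 7 * Itg (pe 'X^2 Q)) = rc (de^-1 * 2 ^+ 7) * Itg (pe 'X^2 Q) by rewrite rcM rcX rc_nat mulrA.
rewrite Re_rcM e2 sqrtrM ?(ltW h0) // sqrtrV ?(ltW v0) // -/de.
have -> : pi * (h / v) * (4 * v) ^+ 2 = 16 * pi * v * h by field; rewrite gt_eqF.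
set E := expR _; set I := complex.Re _; have : (2 ^+ 7 : R) != 0 by rewrite expf_neq0.
by move: (2 ^+ 7 : R) => k k0; field; rewrite k0 !gt_eqF.
Qed.

Lemma om_lim v x e : 0 < v -> 0 < x -> 0 < e -> exists2 d, 0 < d & forall h, 0 < h < d ->
  `|om v x h - 2 * pi * Num.sqrt 2 * Num.sqrt x * expR (- (2 * pi * v * x))| <= e.
Proof.
move=> v0 x0 e0; set a := 2 * pi * v * x; pose b := pi * v * x ^+ 2 / 16.
have a0 : 0 < a by rewrite !mulr_gt0 ?pi_gt0.
have b0 : 0 < b by rewrite divr_gt0 // !mulr_gt0 ?pi_gt0 // exprn_gt0.
pose c := 2 * pi * Num.sqrt v * Num.sqrt (x / 2) ^+ 3 / 2 ^+ 7.
have sv : 0 < Num.sqrt v by rewrite sqrtr_gt0.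
have c0 : 0 < c.
  have ro3 : 0 < Num.sqrt (x / 2) ^+ 3 by rewrite exprn_gt0 // sqrtr_gt0 divr_gt0.
  have k7 : (0 : R) < 2 ^+ 7 by rewrite exprn_gt0.
  by rewrite /c divr_gt0 // mulr_gt0 // mulr_gt0 // mulr_gt0 // pi_gt0.
(* The rescaled integral at scale 0, computed by [peak_Itg0]; times [c] it is the asserted limit. *)
pose I0 := 2 ^+ 8 * expR (- a) * Num.sqrt (pi / (4 * b)).
have -> : 2 * pi * Num.sqrt 2 * Num.sqrt x * expR (- a) = c * I0.
  rewrite /I0 /c; have -> : pi / (4 * b) = (2 / (Num.sqrt v * x)) ^+ 2.
    rewrite exprMn exprVn exprMn sqr_sqrtr ?(ltW v0) // /b.
    have : pi != 0 :> R by rewrite gt_eqF ?pi_gt0.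
    by move: (pi : R) => p p0; field; rewrite p0 !gt_eqF.
  rewrite sqrtr_sqr ger0_norm ?divr_ge0 ?mulr_ge0 ?(ltW sv) ?(ltW x0) //.
  rewrite sqrtrM ?(ltW x0) // sqrtrV // exprMn exprVn.
  have q2 : Num.sqrt (2 : R) ^+ 2 = 2 by rewrite sqr_sqrtr.
  have s20 : 0 < Num.sqrt (2 : R) by rewrite sqrtr_gt0.
  have sx0 : 0 < Num.sqrt x by rewrite sqrtr_gt0.
  have {sx0} [sx sx0 [sxE xE]] : exists2 sx, 0 < sx & Num.sqrt x = sx /\ x = sx ^+ 2.
    by exists (Num.sqrt x) => //; split=> //; rewrite sqr_sqrtr // ltW.
  rewrite sxE [in X in _ = X]xE; set E := expR _.
  have -> : (2 ^+ 8 : R) = 2 ^+ 7 * 2 by rewrite exprSr.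
  have : (2 ^+ 7 : R) != 0 by rewrite expf_neq0.
  move: (2 ^+ 7 : R) (Num.sqrt (2 : R)) q2 s20 => k s s2 s0 k0.
  have -> : 2 * pi * s = 2 * pi * (s ^+ 2 / s) by congr (_ * _); rewrite expr2 mulfK // gt_eqF.
  have -> : s ^- 3 = (2 * s)^-1 by rewrite exprSr s2.
  by rewrite s2; field; rewrite k0 !gt_eqF.
have [K hK] := peak_wl a0 b0.
have ec : 0 < e / (2 * c) by rewrite divr_gt0 // mulr_gt0.
have hK' t : 0 < t < 1 -> wl K (peakf a b t) by move=> /andP[t0 t1]; apply: hK; rewrite !ltW.
have hK0 : wl K (peakf a b 0) by apply: hK; rewrite lexx ler01.
have [d d0 hd] := Itg_dct ltr01 hK' hK0 (fun y e e0 => peak_lim a b y e0) ec.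
have I00 : 0 <= I0 by rewrite !mulr_ge0 ?exprn_ge0 ?expR_ge0 ?sqrtr_ge0.
pose m := 16 * pi * v; have m0 : 0 < m by rewrite !mulr_gt0 ?pi_gt0.
have I1 : 0 < I0 + 1 by rewrite ltr_wpDl.
have k0 : 0 < 2 * c * (I0 + 1) * m by apply: mulr_gt0 m0; apply: mulr_gt0 I1; exact: mulr_gt0.
exists (Num.min (d ^+ 2) (e / (2 * c * (I0 + 1) * m))) => [|h /andP[h0]].
  by rewrite lt_min exprn_gt0 //; exact: divr_gt0.
rewrite lt_min => /andP[hd2 he]; rewrite (om_peak v0 x0 h0) -/a -/b -/c.
have sh : 0 < Num.sqrt h < d.
  rewrite sqrtr_gt0 h0 /=; rewrite -[X in _ < X]gtr0_norm // -sqrtr_sqr ltr_sqrt // exprn_gt0 //.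
have {hd} := hd _ sh; rewrite (peak_Itg0 a b0) -/I0 => hd.
have {hd} : `|complex.Re (Itg (peakf a b (Num.sqrt h))) - I0| <= e / (2 * c).
  by apply: le_trans hd; apply: le_trans (Re_le_cabs _); rewrite ReD ReN.
set I := complex.Re _ => hI; set E := expR _.
have E1 : E <= 1 by rewrite /E -[leRHS]expR0 ler_expR oppr_le0; exact: (mulr_ge0 (ltW m0) (ltW h0)).
have E0 : 0 <= E by exact: expR_ge0.
have E2 : 1 - E <= m * h by have := expR_ge1Dx (- (m * h)); rewrite -/E; lra.
have he' : c * (m * h * I0) <= e / 2.
  move: he; rewrite ltr_pdivlMr // => he.
  have := mulr_ge0 (ltW (mulr_gt0 c0 m0)) (ltW h0); nra.
have -> : c * E * I - c * I0 = c * (E * (I - I0)) - c * ((1 - E) * I0) by ring.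
apply: le_trans (ler_normB _ _) _; rewrite !(normrM c) (normrM E) (normrM (1 - E)) (gtr0_norm c0) (ger0_norm E0) (ger0_norm I00) (@ger0_norm _ (1 - E)) ?subr_ge0 //.
have t1 : c * (E * `|I - I0|) <= c * (e / (2 * c)).
  by rewrite ler_pM2l //; apply: le_trans hI; rewrite ler_piMl.
have t2 : c * ((1 - E) * I0) <= c * (m * h * I0) by rewrite ler_pM2l // ler_wpM2r.
have t3 : c * (e / (2 * c)) = e / 2 by field; rewrite gt_eqF.
lra.
Qed.

End OmegaLimit.

(** * Reduction of binary quadratic forms and finiteness of the class number *)

Section Reduction.
Implicit Types (f g : qform) (a b c p q r s x y : int).

Definition qval f x y : int := qf_a f * x ^+ 2 + qf_b f * x * y + qf_c f * y ^+ 2.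

Lemma qf_eta f : f = ((qf_a f, qf_b f), qf_c f).
Proof. by case: f => -[]. Qed.

Lemma qf_act_comp p q r s p' q' r' s' f : qf_act p q r s (qf_act p' q' r' s' f) =
  qf_act (p' * p + q' * r) (p' * q + q' * s) (r' * p + s' * r) (r' * q + s' * s) f.
Proof. by rewrite /qf_act /qf_a /qf_b /qf_c /=; congr (_, _, _); ring. Qed.

Lemma qf_act1 f : qf_act 1 0 0 1 f = f.
Proof. by case: f => -[a b] c; rewrite /qf_act /qf_a /qf_b /qf_c /=; congr (_, _, _); ring. Qed.

Lemma qf_act_inv p q r s f : p * s - q * r = 1 -> qf_act s (- q) (- r) p (qf_act p q r s f) = f.
Proof.
move=> d; rewrite qf_act_comp -[RHS]qf_act1; congr qf_act; rewrite -?d; ring.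
Qed.

Lemma qf_disc_act p q r s f : p * s - q * r = 1 -> qf_disc (qf_act p q r s f) = qf_disc f.
Proof.
move=> d; have -> : qf_disc (qf_act p q r s f) = qf_disc f * (p * s - q * r) ^+ 2; last by rewrite d expr1n mulr1.
by rewrite /qf_disc /qf_act /qf_a /qf_b /qf_c /=; ring.
Qed.

Lemma qf_a_act p q r s f : qf_a (qf_act p q r s f) = qval f p r.
Proof. by rewrite /qf_act /qval /qf_a /=. Qed.

Lemma qval_act p q r s f x y : qval (qf_act p q r s f) x y = qval f (p * x + q * y) (r * x + s * y).
Proof. by rewrite /qval /qf_act /qf_a /qf_b /qf_c /=; ring. Qed.

Lemma qf_equiv_refl f : qf_equiv f f.
Proof. by exists 1, 0, 0, 1; rewrite qf_act1; split; first by ring. Qed.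

Lemma qf_equiv_sym f g : qf_equiv f g -> qf_equiv g f.
Proof.
move=> [p [q [r [s [d e]]]]]; exists s, (- q), (- r), p; rewrite -e qf_act_inv //; split => //.
by rewrite -d; ring.
Qed.

Lemma qf_equiv_trans f g h : qf_equiv f g -> qf_equiv g h -> qf_equiv f h.
Proof.
move=> [p' [q' [r' [s' [d' e']]]]] [p [q [r [s [d e]]]]].
do 4 eexists; rewrite -e -e' qf_act_comp; split; last by reflexivity.
by rewrite -[RHS]mulr1 -{1}d' -d; ring.
Qed.

(** Boundary cases are not identified, so a class may contain several reduced forms. The
    inequalities provide finiteness and upper bounds. *)
Definition qf_reduced f := (`|qf_b f| <= qf_a f) && (qf_a f <= qf_c f).

Lemma qval_sqr f x y : 4 * qf_a f * qval f x y = (2 * qf_a f * x + qf_b f * y) ^+ 2 - qf_disc f * y ^+ 2.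
Proof. by rewrite /qval /qf_disc; ring. Qed.

Lemma qval_gt0 f x y : 0 < qf_a f -> qf_disc f < 0 -> (x != 0) || (y != 0) -> 0 < qval f x y.
Proof.
move=> a0 d0 xy; have [|y0] := eqVneq y 0.
  move=> y0; have {xy}x0 : x != 0 by move: xy; rewrite y0 eqxx orbF.
  have x2 : 0 < x ^+ 2 by rewrite exprn_even_gt0.
  have -> : qval f x y = qf_a f * x ^+ 2 by rewrite y0 /qval; ring.
  exact: mulr_gt0.
have y2 : 0 < y ^+ 2 by rewrite exprn_even_gt0.
have := qval_sqr f x y; have := sqr_ge0 (2 * qf_a f * x + qf_b f * y); nia.
Qed.

Lemma reduction f : 0 < qf_a f -> qf_disc f < 0 -> exists p q r s,
  p * s - q * r = 1 /\ qf_reduced (qf_act p q r s f).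
Proof.
move: {2}(absz (qf_a f)) (leqnn (absz (qf_a f))) => n; elim: n f => [|n IH] f fn a0 d0; first by lia.
pose k : int := - ((qf_b f + qf_a f) %/ (2 * qf_a f))%Z.
have d1 : (1 : int) * 1 - k * 0 = 1 by ring.
set f1 := qf_act 1 k 0 1 f.
have a1 : qf_a f1 = qf_a f by rewrite qf_a_act /qval; ring.
have b1 : `|qf_b f1| <= qf_a f1.
  have -> : qf_b f1 = qf_b f + 2 * qf_a f * k by rewrite /f1 /qf_act /qf_a /qf_b /=; ring.
  rewrite a1 /k; have := divz_eq (qf_b f + qf_a f) (2 * qf_a f).
  have := @modz_ge0 (qf_b f + qf_a f) (2 * qf_a f); have := @ltz_pmod (qf_b f + qf_a f) (2 * qf_a f).
  by lia.
have D1 : qf_disc f1 = qf_disc f by exact: qf_disc_act.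
have [ac|ca] := lerP (qf_a f1) (qf_c f1).
  by exists 1, k, 0, 1; split => //; rewrite /qf_reduced b1.
have c1 : 0 < qf_c f1.
  have -> : qf_c f1 = qval f1 0 1 by rewrite /qval; ring.
  by apply: qval_gt0; rewrite ?D1 ?a1 ?orbT.
pose f2 := qf_act 0 (-1) 1 0 f1.
have a2 : qf_a f2 = qf_c f1 by rewrite qf_a_act /qval; ring.
have [||| p [q [r [s [d rd]]]]] := IH f2; rewrite ?a2 ?qf_disc_act ?D1 //; first by lia.
rewrite /f2 /f1 !qf_act_comp in rd; do 4 eexists; split; last exact: rd.
by rewrite -[RHS]d; ring.
Qed.

Lemma reduced_bounds f (N : int) : 0 < qf_a f -> qf_disc f = - N -> qf_reduced f ->
  3 * qf_a f * qf_c f <= N.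
Proof.
move=> a0; rewrite /qf_disc => D /andP[b ac].
have : qf_b f ^+ 2 <= qf_a f ^+ 2 by rewrite -[qf_b f ^+ 2]real_normK ?num_real //; nia.
nia.
Qed.

Definition forms_upto (N : nat) : seq qform :=
  let s := [seq (i%:Z - N%:Z : int) | i <- iota 0 (2 * N + 1)] in
  allpairs pair (allpairs pair s s) s.

Lemma mem_forms_upto (N : nat) f : `|qf_a f| <= N%:Z -> `|qf_b f| <= N%:Z -> `|qf_c f| <= N%:Z -> f \in forms_upto N.
Proof.
move=> ha hb hc; rewrite (qf_eta f).
have mem x : `|x| <= N%:Z -> x \in [seq (i%:Z - N%:Z : int) | i <- iota 0 (2 * N + 1)].
  by move=> hx; apply/mapP; exists (absz (x + N%:Z)); rewrite ?mem_iota; lia.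
by apply: allpairs_f; [apply: allpairs_f|]; exact: mem.
Qed.

Definition red_forms (N : nat) : seq qform :=
  undup [seq f <- forms_upto N | [&& 0 < qf_a f, qf_disc f == - N%:Z & qf_reduced f]].

Lemma mem_red_forms (N : nat) f : (f \in red_forms N) = [&& 0 < qf_a f, qf_disc f == - N%:Z & qf_reduced f].
Proof.
rewrite mem_undup mem_filter; case: and3P => //= -[a0 /eqP D rd].
have h := reduced_bounds a0 D rd; have /andP[b ac] := rd.
by apply: mem_forms_upto; nia.
Qed.

Lemma reduction_pd (N : nat) f : (0 < N)%N -> pd_form N f -> exists2 g, g \in red_forms N & qf_equiv f g.
Proof.
move=> N0 [a0 D]; have d0 : qf_disc f < 0 by rewrite D; lia.
have [p [q [r [s [d rd]]]]] := reduction a0 d0; exists (qf_act p q r s f); last by exists p, q, r, s.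
rewrite mem_red_forms rd qf_disc_act // D eqxx !andbT qf_a_act; apply: qval_gt0 => //.
by apply/negPn/negP; rewrite negb_or !negbK => /andP[/eqP p0 /eqP r0]; move: d; rewrite p0 r0; lia.
Qed.

Lemma representatives (T : eqType) (x0 : T) (E : T -> T -> Prop) (L : seq T) :
  (forall x : T, E x x) -> (forall x y : T, E x y -> E y x) -> exists s : seq T, [/\ {subset s <= L},
    forall i j, (i < j < size s)%N -> ~ E (nth x0 s i) (nth x0 s j) &
    forall x : T, x \in L -> exists2 g, g \in s & E x g].
Proof.
move=> Er Es; elim: L => [|x L [s [sL sE sc]]]; first by exists [::]; split=> // i j; rewrite ltn0 andbF.
case: (pselect (exists2 g, g \in s & E x g)) => [xs|nxs].
  exists s; split => // [y /sL|y]; first by rewrite inE orbC => ->.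
  by rewrite inE => /orP[/eqP->//|/sc].
exists (x :: s); split.
- by move=> y; rewrite !inE => /orP[->//|/sL ->]; rewrite orbT.
- move=> [|i] [|j] //= ij; last exact: sE.
  by move=> e; apply: nxs; exists (nth x0 s j) => //; apply: mem_nth.
- move=> y; rewrite inE => /orP[/eqP->|/sc[g gs e]]; first by exists x; rewrite ?mem_head.
  by exists g => //; rewrite inE gs orbT.
Qed.

Lemma class_reps_ex (N : nat) : (0 < N)%N -> exists s : seq qform, class_reps N s.
Proof.
move=> N0; have [s [sL sE sc]] := representatives ((0, 0), 0) (red_forms N) qf_equiv_refl qf_equiv_sym.
exists s; split => // [f /sL|f /(reduction_pd N0)[g /sc[g' gs e] e']].
  by rewrite mem_red_forms => /and3P[a0 /eqP D _].
by exists g' => //; exact: qf_equiv_trans e' e.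
Qed.

(** For N = 1, 2 modulo 4 no form has discriminant -N, because 4 would divide b^2 + N. The case
    split in [hurwitz] is then an empty sum, and one formula covers all N > 0. *)
Lemma hurwitz_reps (N : nat) : (0 < N)%N -> exists s : seq qform, [/\ class_reps N s, uniq s &
  hurwitz N = \sum_(f <- s) class_weight f].
Proof.
move=> N0; have ex := class_reps_ex N0.
have uq (s : seq qform) : class_reps N s -> uniq s.
  move=> [_ h _]; apply/(uniqP ((0, 0), 0)) => i j; rewrite !inE => hi hj e.
  case: (ltngtP i j) => // ij; exfalso.
    by apply: (h i j); rewrite ?ij // e; exact: qf_equiv_refl.
  by apply: (h j i); rewrite ?ij // e; exact: qf_equiv_refl.
rewrite /hurwitz; case: ifP => [|_]; first by lia.
case: ifP => [h|_].
  have [s [s1 s2 s3]] := ex; exists s; split; [by []|exact: uq|].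
  suff -> : s = [::] by rewrite big_nil.
  case: s s1 {s2 s3} => // f s /(_ f (mem_head _ _))[_]; rewrite /qf_disc => D; exfalso.
  have : (qf_b f ^+ 2 + N%:Z)%R = 4 * (qf_a f * qf_c f) by lia.
  move: (qf_a f * qf_c f) => m; have := divz_eq (qf_b f) 2; set c := (_ %/ 2)%Z.
  have : (qf_b f %% 2)%Z = 0 \/ (qf_b f %% 2)%Z = 1 by lia.
  case=> -> ->.
    have -> : (c * 2 + 0) ^+ 2 = 4 * (c * c) by ring.
    by move: (c * c) => cc; lia.
  have -> : (c * 2 + 1) ^+ 2 = 4 * (c * c + c) + 1 by ring.
  by move: (c * c + c) => cc; lia.
rewrite /weighted_class_count; destruct (pselect (exists s : seq qform, class_reps N s)) as [e|ne]; last by case: ne.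
exists (sval (cid e)).
by have h := svalP (cid e); split => //; exact: uq.
Qed.

Lemma class_weight_ge0 f : 0 <= class_weight f <= 1.
Proof. by rewrite /class_weight; case: ifP => // _; case: ifP. Qed.

Lemma hurwitz_bounds (N : nat) : (0 < N)%N -> 0 <= hurwitz N <= (size (red_forms N))%:R.
Proof.
move=> N0; have [s [[s1 s2 s3] us ->]] := hurwitz_reps N0; apply/andP; split.
  by apply: sumr_ge0 => f _; case/andP: (class_weight_ge0 f).
apply: (@le_trans _ _ (\sum_(f <- s) 1)).
  by apply: ler_sum => f _; case/andP: (class_weight_ge0 f).
rewrite big_const_seq count_predT iter_addr_0 ler_nat.
have hc f : f \in s -> exists g, g \in red_forms N /\ qf_equiv f g.
  by move=> /s1 /(reduction_pd N0)[g g1 g2]; exists g.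
have step f : exists g, f \in s -> g \in red_forms N /\ qf_equiv f g.
  by case: (boolP (f \in s)) => [/hc[g hg]|_]; [exists g|exists f].
have [h hh] := choice step.
rewrite -(size_map h); apply: uniq_leq_size.
  rewrite map_inj_in_uniq // => f g fs gs e.
  have fg : qf_equiv f g.
    by have [_ h1] := hh f fs; have [_ h2] := hh g gs; rewrite e in h1; exact: qf_equiv_trans h1 (qf_equiv_sym h2).
  have /(nthP ((0, 0), 0))[i hi ef] := fs; have /(nthP ((0, 0), 0))[j hj eg] := gs.
  case: (ltngtP i j) => ij; last by rewrite -ef -eg ij.
    by exfalso; apply: (s2 i j); rewrite ?ij // ef eg.
  by exfalso; apply: (s2 j i); rewrite ?ij // ef eg; exact: qf_equiv_sym.
by move=> g /mapP[f fs ->]; have [] := hh f fs.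
Qed.

End Reduction.

(** * Counting square roots of -N modulo 4 A, polynomially in N *)

Section ApexReduction.
Variable R : realType.
Implicit Types (A B N p q r s : int) (t : R).

(* Reducing the positive definite form with root the apex of the geodesic of [(A, B, C)] bounds [Q] in terms of [N]
   even when the form is indefinite. *)
Lemma apex N A B : ~ (exists x : int, x ^+ 2 = - N) -> 0 < A -> (4 * A %| B ^+ 2 + N)%Z ->
  exists Q p q r s, [/\ p * s - q * r = 1, qf_act p q r s Q = ((A, B), ((B ^+ 2 + N) %/ (4 * A))%Z),
    [&& `|qf_a Q| <= `|N|, `|qf_b Q| <= 3 * `|N| & `|qf_c Q| <= `|N|] & p ^+ 2 + r ^+ 2 <= 2 * A].
Proof.
move=> nsq A0 /dvdzP[C0 CE]; have -> : ((B ^+ 2 + N) %/ (4 * A))%Z = C0 by rewrite CE mulzK //; lia.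
have N0 : N != 0 by apply/eqP => n0; apply: nsq; exists 0; rewrite n0.
set D : int := `|N|; have D0 : 0 < D by rewrite normr_gt0.
(* [F] is (2 A x + B y)^2 + |N| y^2. For N > 0 it is 4 A times the given form; for N < 0 it is still
   positive definite, and its root is the apex of the geodesic. *)
pose F : qform := ((4 * A ^+ 2, 4 * A * B), B ^+ 2 + D).
have Fa : 0 < qf_a F by rewrite /F /qf_a /=; nia.
have Fd : qf_disc F = - (16 * A ^+ 2 * D) by rewrite /qf_disc /F /qf_a /qf_b /qf_c /=; ring.
have Fd0 : qf_disc F < 0 by rewrite Fd oppr_lt0; nia.
have [p [q [r [s [d rd]]]]] := reduction Fa Fd0.
pose f : qform := ((A, B), C0).
set Q := qf_act p q r s f; exists Q, s, (- q), (- r), p.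
have QF : qf_act s (- q) (- r) p Q = f by exact: qf_act_inv.
have BD : B ^+ 2 + D = 4 * A * C0 + (D - N) by move: CE; lia.
have h1 : 4 * A * qf_a Q = qf_a (qf_act p q r s F) - (D - N) * r ^+ 2.
  by rewrite /Q /f /F BD /qf_act /qf_a /qf_b /qf_c /=; ring.
have h3 : 4 * A * qf_c Q = qf_c (qf_act p q r s F) - (D - N) * s ^+ 2.
  by rewrite /Q /f /F BD /qf_act /qf_a /qf_b /qf_c /=; ring.
have Qd : qf_b Q ^+ 2 - 4 * qf_a Q * qf_c Q = - N.
  rewrite -/(qf_disc Q).
  rewrite qf_disc_act // /qf_disc /f /qf_a /qf_b /qf_c /=.
  have -> : 4 * A * C0 = B ^+ 2 + N by rewrite CE; ring.
  ring.
have Ga : 0 < qf_a (qf_act p q r s F).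
  rewrite qf_a_act; apply: qval_gt0 => //.
  by apply/negPn/negP; rewrite negb_or !negbK => /andP[/eqP p0 /eqP r0]; move: d; rewrite p0 r0; lia.
have Gd : qf_disc (qf_act p q r s F) = - (16 * A ^+ 2 * D) by rewrite qf_disc_act.
have Gv : qval (qf_act p q r s F) s (- r) = 4 * A ^+ 2.
  have g1 : p * s + q * - r = 1 by rewrite -[RHS]d; ring.
  have g2 : r * s + s * - r = 0 by ring.
  by rewrite qval_act g1 g2 /qval /F /qf_a /=; ring.
move: (qf_act p q r s F) rd Ga Gd Gv h1 h3 => G rd Ga Gd Gv h1 h3.
have /andP[Gb Gac] := rd; have Gac3 := reduced_bounds Ga Gd rd.
have D01 : 0 <= D - N <= 2 * D by rewrite /D; lia.
have /andP[Dn1 Dn2] := D01.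
have E1 : D * r ^+ 2 <= qf_a G.
  have := qval_sqr G s (- r); rewrite Gv Gd; have := sqr_ge0 (2 * qf_a G * s + qf_b G * - r).
  move: (_ ^+ 2) => X X0 e; have A2 : 0 < A ^+ 2 by rewrite exprn_gt0.
  have : 0 <= A ^+ 2 * (qf_a G - D * r ^+ 2) by lia.
  by rewrite pmulr_rge0 // subr_ge0.
have E2 : D * s ^+ 2 <= qf_c G.
  have e : 4 * qf_c G * qval G s (- r) = (2 * qf_c G * r - qf_b G * s) ^+ 2 - qf_disc G * s ^+ 2.
    by rewrite /qval /qf_disc; ring.
  move: e; rewrite Gv Gd; have := sqr_ge0 (2 * qf_c G * r - qf_b G * s).
  move: (_ ^+ 2) => X X0 e; have A2 : 0 < A ^+ 2 by rewrite exprn_gt0.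
  have : 0 <= A ^+ 2 * (qf_c G - D * s ^+ 2) by lia.
  by rewrite pmulr_rge0 // subr_ge0.
have E3 : qf_a G * (s ^+ 2 + r ^+ 2) <= 8 * A ^+ 2.
  have rs : `|qf_b G * s * r| <= qf_a G * `|s * r|.
    by rewrite -mulrA normrM ler_wpM2r.
  have sr : 2 * `|s * r| <= s ^+ 2 + r ^+ 2.
    rewrite normrM -(real_normK (num_real s)) -(real_normK (num_real r)).
    by have := sqr_ge0 (`|s| - `|r|); rewrite sqrrB; lia.
  have g3 := ler_wpM2l (ltW Ga) sr.
  have g2 : qf_a G * r ^+ 2 <= qf_c G * r ^+ 2 by rewrite ler_wpM2r ?sqr_ge0.
  have g1 := Gv; rewrite /qval sqrrN in g1; move: rs; rewrite ler_norml => /andP[rs1 rs2].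
  by move: (`|s * r|) rs1 rs2 g1 g2 g3; clear => m rs1 rs2 g1 g2 g3; lra.
move: (qf_a Q) (qf_b Q) (qf_c Q) h1 h3 Qd => al be ga h1 h3 Qd.
move: (qf_a G) (qf_b G) (qf_c G) Ga Gac Gac3 Gb E1 E2 E3 h1 h3 {Gv Gd rd} => a' b' c' Ga Gac Gac3 Gb E1 E2 E3 h1 h3.
have [r2 s2] := (sqr_ge0 r, sqr_ge0 s).
have p1 : (D - N) * r ^+ 2 <= 2 * D * r ^+ 2 by rewrite ler_wpM2r.
have p2 : (D - N) * s ^+ 2 <= 2 * D * s ^+ 2 by rewrite ler_wpM2r.
have p3 : 0 <= (D - N) * r ^+ 2 by rewrite mulr_ge0.
have p4 : 0 <= (D - N) * s ^+ 2 by rewrite mulr_ge0.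
have al1 : `|4 * A * al| <= a' by rewrite h1 ler_norml; move: p1 p3 E1; clear => *; apply/andP; split; lra.
have ga1 : `|4 * A * ga| <= c' by rewrite h3 ler_norml; move: p2 p4 E2; clear => *; apply/andP; split; lra.
have al0 : al != 0 by apply/eqP => e; apply: nsq; exists be; by move: Qd; rewrite e mulr0 mul0r subr0.
have a4 : 4 * A <= a'.
  apply: le_trans al1; rewrite normrM gtr0_norm ?mulr_gt0 // ler_peMr ?(mulr_ge0 _ (ltW A0)) //.
  by move: al0; clear; lia.
have A4 : 0 < 4 * A by rewrite mulr_gt0.
have c4 : 3 * c' <= 4 * A * D.
  have c0 : 0 <= 3 * c' by rewrite mulr_ge0 // (le_trans (ltW Ga)).
  have k1 := ler_wpM2r c0 a4.
  by rewrite -(ler_pM2l A4) (le_trans k1) // [a' * _]mulrCA mulrA (le_trans Gac3) // (_ : 16 * A ^+ 2 * D = 4 * A * (4 * A * D)) //; ring.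
have cD : c' <= 4 * A * D by move: c4 (le_trans (ltW Ga) Gac); clear; lra.
have gaD : `|ga| <= D.
  by rewrite -(ler_pM2l A4) (le_trans _ cD) // -{1}(gtr0_norm A4) -normrM.
have alD : `|al| <= D.
  by rewrite -(ler_pM2l A4) (le_trans _ cD) // (le_trans _ Gac) // -{1}(gtr0_norm A4) -normrM.
split; [by rewrite -[RHS]d; ring|exact: QF| |].
  rewrite alD gaD andbT /=.
  have be2 : be ^+ 2 <= 9 * D ^+ 2.
    have : al * ga <= D * D by apply: le_trans (ler_norm _) _; rewrite normrM ler_pM.
    have : D <= D * D by rewrite ler_peMr // ltW.
    move: Qd; have : - N <= D by rewrite /D -normrN ler_norm.
    rewrite expr2 [D ^+ 2]expr2; move: D0; clear; lra.
  have D3 : 0 <= 3 * D by rewrite mulr_ge0 // ltW.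
  by rewrite -(ler_pXn2r (n := 2)) ?nnegrE ?normr_ge0 // real_normK ?num_real // exprMn.
rewrite sqrrN -(ler_pM2l A4); apply: (@le_trans _ _ (a' * (s ^+ 2 + r ^+ 2))).
  by rewrite ler_wpM2r // addr_ge0.
by rewrite (_ : 4 * A * (2 * A) = 8 * A ^+ 2) //; ring.
Qed.

Lemma bsum_on (I J : eqType) (h : I -> J) (P : pred I) (g : I -> R) (k : J -> R) M :
  (forall i, ~~ P i -> g i = 0) -> (forall i, P i -> g i <= k (h i)) -> {in P &, injective h} ->
  bsum k M -> bsum g M.
Proof.
move=> g0 gk hi kM G uG; rewrite (bigID P) /= [X in _ + X]big1 ?addr0; last by move=> i /g0.
rewrite -big_filter; apply: (@le_trans _ _ (\sum_(i <- [seq i <- G | P i]) k (h i))).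
  by rewrite big_filter [X in _ <= X]big_filter; apply: ler_sum.
rewrite -(big_map h xpredT k); apply: kM; rewrite map_inj_in_uniq ?filter_uniq // => i j.
by rewrite !mem_filter => /andP[Pi _] /andP[Pj _]; exact: hi.
Qed.

Lemma bsum_ind (n : nat) : bsum (fun x : int => (`|x| <= n%:Z)%R%:R : R) (2 * n.+1%:R).
Proof.
have -> : 2 * n.+1%:R = n.+1%:R + n.+1%:R :> R by ring.
have key (f : nat -> bool) : (forall i, f i -> (i <= n)%N) -> bsum (fun i => (f i)%:R : R) n.+1%:R.
  move=> hf; apply: bsum_nat => // m; rewrite -natr_sum ler_nat.
  rewrite (eq_bigr (fun i : 'I_m => (f i && (i <= n)%N) : nat)); last by move=> i _; case: (boolP (f i)) => // /hf ->.
  apply: (@leq_trans (\sum_(i < m) (i <= n)%N)); first by apply: leq_sum => i _; case: (f i).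
  elim: m => [|m IH]; first by rewrite big_ord0.
  rewrite big_ord_recr /=; case: (leqP m n) => mn; last by rewrite addn0.
  rewrite (eq_bigr (fun=> 1%N)); first by rewrite sum1_card card_ord addn1.
  by move=> i _; rewrite (leq_trans (ltnW (ltn_ord i)) mn).
by apply: bsum_int => //; apply: key => i; lia.
Qed.

Lemma bsum_gauss : exists2 K : R, 0 <= K & forall t, 0 < t <= 1 ->
  bsum (fun v : int * int => expR (- (t * (v.1%:~R ^+ 2 + v.2%:~R ^+ 2)))) (K / t).
Proof.
have [B B0 hB] := @exp_growth R 1 1 ltr01; exists ((B * 8) ^+ 2) => [|t /andP[t0 t1]]; first exact: sqr_ge0.
set h := Num.sqrt t; have h0 : 0 < h by rewrite sqrtr_gt0.
have h2 : h ^+ 2 = t by rewrite sqr_sqrtr // ltW.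
have h1 : h <= 1 by rewrite -sqrtr1 ler_wsqrtr.
have g1 : bsum (fun n : int => expR (- (t * n%:~R ^+ 2))) (B * 8 / h).
  have h01 : 0 < h <= 1 by rewrite h0 h1.
  have hp : 0 <= B / h by rewrite divr_ge0 // ltW.
  have -> : B * 8 / h = B / h * 8 by ring.
  apply: bsum_le (bsumZ hp (w_mesh 0 h01)) => n.
  have := hB (n%:~R * h); rewrite expr1 mul1r exprMn h2 => hb.
  have -> : B / h * (h * w (0 + n%:~R * h)) = B * w (n%:~R * h) by rewrite add0r; field; rewrite gt_eqF.
  by rewrite /w ler_pdivlMr ?w_den // exprMn h2 mulrC [t * _]mulrC.
have -> : (B * 8) ^+ 2 / t = B * 8 / h * (B * 8 / h) by rewrite -h2; field; rewrite gt_eqF.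
have := bsum_mul (fun n : int => expR_ge0 (- (t * n%:~R ^+ 2))) (fun n : int => expR_ge0 (- (t * n%:~R ^+ 2))) g1 g1.
by apply: bsum_le => v; rewrite -expRD mulrDr opprD.
Qed.

Definition rAw (A B : nat) N : bool := [&& (0 < A)%N, (B < A.*2)%N & ((4 * A%:Z)%R %| (B%:Z ^+ 2 + N)%R)%Z].

(** The pair (A, B) is recovered from a form with coefficients of order |N| and the first column (p,
    r) of a matrix. There are O(|N|^3) such forms, p^2 + r^2 <= 2 A, and the Gaussian sum over (p,
    r) is of order 1/t. *)
Lemma rA_bound : exists2 K : R, 0 <= K & forall N, ~ (exists x : int, x ^+ 2 = - N) -> forall t, 0 < t <= 1 ->
  bsum (fun p : nat * nat => if rAw p.1 p.2 N then expR (- (t * p.1%:R)) else 0) (K * (`|N|%N.+1%:R) ^+ 3 / t).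
Proof.
have [K K0 hK] := bsum_gauss; exists (48 * K) => [|N nsq t t01]; first by rewrite mulr_ge0.
pose P (p : nat * nat) := rAw p.1 p.2 N.
pose J := (((int * int) * int) * (int * int))%type.
have step (p : nat * nat) : exists x : J, P p -> exists q s : int, [/\ x.2.1 * s - q * x.2.2 = 1,
   qf_act x.2.1 q x.2.2 s x.1 = ((p.1%:Z, p.2%:Z), ((p.2%:Z ^+ 2 + N) %/ (4 * p.1%:Z))%Z),
   [&& `|qf_a x.1| <= `|N|, `|qf_b x.1| <= 3 * `|N| & `|qf_c x.1| <= `|N|] & x.2.1 ^+ 2 + x.2.2 ^+ 2 <= 2 * p.1%:Z].
  case: (boolP (P p)) => [|_]; last by exists ((0, 0, 0), (0, 0)).
  rewrite /P /rAw; case: p => A B /= /and3P[A0 _ dv].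
  have A0' : 0 < A%:Z by rewrite ltz_nat.
  have [Q [p [q [r [s [h1 h2 h3 h4]]]]]] := apex nsq A0' dv.
  by exists (Q, (p, r)) => _; exists q, s.
have [h hh] := choice step; clear step.
pose ind (n : nat) (x : int) : R := (`|x| <= n%:Z)%R%:R.
pose k (x : J) : R := ind `|N|%N (qf_a x.1) * ind (3 * `|N|)%N (qf_b x.1) * ind `|N|%N (qf_c x.1) *
  expR (- (t / 2 * (x.2.1%:~R ^+ 2 + x.2.2%:~R ^+ 2))).
have t2 : 0 < t / 2 <= 1 by lra.
have i0 n x : 0 <= ind n x by exact: ler0n.
have kM : bsum k (2 * `|N|%N.+1%:R * (2 * (3 * `|N|)%N.+1%:R) * (2 * `|N|%N.+1%:R) * (K / (t / 2))).
  apply: (bsum_mul _ _ (bsum_mul _ _ (bsum_mul _ _ (bsum_ind _) (bsum_ind _)) (bsum_ind _)) (hK _ t2)) => *; rewrite ?mulr_ge0 ?expR_ge0 ?ler0n //.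
apply: (@bsum_on _ _ h P _ k).
- by move=> p; rewrite /P => /negbTE ->.
- move=> p Pp; have [q [s [h1 h2 /and3P[h3 h4 h5] h6]]] := hh p Pp.
  rewrite [X in X <= _](_ : _ = expR (- (t * p.1%:R))); last by move: Pp; rewrite /P => ->.
  rewrite /k /ind abszE h3 h5 (_ : (`|_| <= _) = true) ?mul1r ?ler_expR ?lerN2; last by move: h4; lia.
  have : (h p).2.1%:~R ^+ 2 + (h p).2.2%:~R ^+ 2 <= 2 * p.1%:R :> R.
    by have := h6; rewrite -(ler_int R) rmorphD /= !rmorphXn /= rmorphM /= -!pmulrn.
  by have /andP[t0 _] := t01; move=> hx; have := ler_wpM2l (ltW t0) hx; lra.
- move=> [A B] [A' B'] Pp Pp' e; have [q [s [h1 h2 _ _]]] := hh _ Pp.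
  have [q' [s' [h1' h2' _ _]]] := hh _ Pp'.
  move: h1 h2 h1' h2'; rewrite -e /=; move: (h (A, B)) => [Q [p r]] /= h1 h2 h1' h2'.
  have eA : A%:Z = A'%:Z by move: (congr1 (@qf_a) h2) (congr1 (@qf_a) h2'); rewrite !qf_a_act /qf_a /= => <- <-.
  (* Two completions of one column differ by a shear, here by [n], which changes [B] by 2 A n; as
     both values lie in [0, 2 A), [n] is 0. *)
  pose n := s * q' - q * s'.
  have e1 : p * s = 1 + q * r by lia.
  have e2 : p * s' = 1 + q' * r by lia.
  have e3 : q * r = p * s - 1 by lia.
  have hq : q' = q + (s * q' - q * s') * p.
    have -> : q + (s * q' - q * s') * p = q + q' * (p * s) - q * (p * s') by ring.
    by rewrite e1 e2; ring.
  have hs : s' = s + (s * q' - q * s') * r.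
    have -> : s + (s * q' - q * s') * r = s * (1 + q' * r) - s - s' * (q * r) + s by ring.
    by rewrite -e2 e3; ring.
  rewrite -/n in hq hs; clearbody n.
  have := congr1 (@qf_b) h2'; have := congr1 (@qf_b) h2; have := congr1 (@qf_a) h2.
  rewrite hq hs /qf_act /qf_a /qf_b /qf_c /= => k1 k2 k3.
  have eB : B'%:Z = B%:Z + 2 * A%:Z * n by rewrite -k1 -k2 -k3; ring.
  move: Pp Pp'; rewrite /P /rAw /= => /and3P[_ B1 _] /and3P[_ B2 _]; rewrite /= in B1 B2.
  move: B1 B2 eA eB; clear => B1 B2 eA eB.
  have n0 : n = 0 by nia.
  by move: eB eA; rewrite n0 mulr0 addr0 => -[->] [->].
have /andP[t0 _] := t01; apply: (bsumW _ kM).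
have m0 : (0 : R) <= `|N|%N.+1%:R by exact: ler0n.
have m3 : ((3 * `|N|)%N.+1%:R : R) <= 3 * `|N|%N.+1%:R by rewrite -natrM ler_nat; lia.
move: (`|N|%N.+1%:R : R) ((3 * `|N|)%N.+1%:R : R) m0 m3 => m m' m0 m3.
have c0 : 0 <= 16 * m ^+ 2 * K / t by rewrite divr_ge0 ?(ltW t0) // !mulr_ge0 // sqr_ge0.
rewrite (_ : _ * (K / (t / 2)) = 16 * m ^+ 2 * K / t * m'); last by field; rewrite gt_eqF.
by rewrite (_ : 48 * K * m ^+ 3 / t = 16 * m ^+ 2 * K / t * (3 * m)) ?ler_wpM2l //; ring.
Qed.

End ApexReduction.

(** * Stabilisers of forms in SL_2(Z) and the class weights *)

Section Torsor.
Implicit Types (f g : qform) (a b c k p q r s x y : int).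

Definition mat2 := ((int * int) * (int * int))%type.
Implicit Types (m n : mat2).

Definition mdet m : int := m.1.1 * m.2.2 - m.1.2 * m.2.1.
Definition mmul m n : mat2 :=
  ((m.1.1 * n.1.1 + m.1.2 * n.2.1, m.1.1 * n.1.2 + m.1.2 * n.2.2),
   (m.2.1 * n.1.1 + m.2.2 * n.2.1, m.2.1 * n.1.2 + m.2.2 * n.2.2)).
Definition madj m : mat2 := ((m.2.2, - m.1.2), (- m.2.1, m.1.1)).
Definition mact m f := qf_act m.1.1 m.1.2 m.2.1 m.2.2 f.

Lemma mdetM m n : mdet (mmul m n) = mdet m * mdet n.
Proof. by rewrite /mdet /=; ring. Qed.

Lemma mact_mul m n f : mact (mmul m n) f = mact n (mact m f).
Proof. by rewrite /mact qf_act_comp. Qed.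

Lemma mact_adj m f : mdet m = 1 -> mact (madj m) (mact m f) = f.
Proof. by move=> d; rewrite /mact /= qf_act_inv. Qed.

Lemma mdet_adj m : mdet (madj m) = mdet m.
Proof. by rewrite /mdet /=; ring. Qed.

Lemma madjK m n : mdet m = 1 -> mmul (madj m) (mmul m n) = n.
Proof.
move: m n => [[p q] [r s]] [[p' q'] [r' s']]; rewrite /mdet /mmul /= => d; congr ((_, _), (_, _)).
- by rewrite -[RHS]mul1r -d; ring.
- by rewrite -[RHS]mul1r -d; ring.
- by rewrite -[RHS]mul1r -d; ring.
- by rewrite -[RHS]mul1r -d; ring.
Qed.

Lemma mulmadjK m n : mdet m = 1 -> mmul m (mmul (madj m) n) = n.
Proof.
move: m n => [[p q] [r s]] [[p' q'] [r' s']]; rewrite /mdet /mmul /= => d; congr ((_, _), (_, _)).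
- by rewrite -[RHS]mul1r -d; ring.
- by rewrite -[RHS]mul1r -d; ring.
- by rewrite -[RHS]mul1r -d; ring.
- by rewrite -[RHS]mul1r -d; ring.
Qed.

Lemma mmulA m n l : mmul m (mmul n l) = mmul (mmul m n) l.
Proof. by rewrite /mmul /=; congr ((_, _), (_, _)); ring. Qed.

Lemma mmulKadj m n : mdet n = 1 -> mmul (mmul m n) (madj n) = m.
Proof.
move: m n => [[p q] [r s]] [[p' q'] [r' s']]; rewrite /mdet /mmul /= => d; congr ((_, _), (_, _)).
- by rewrite -[RHS]mulr1 -d; ring.
- by rewrite -[RHS]mulr1 -d; ring.
- by rewrite -[RHS]mulr1 -d; ring.
- by rewrite -[RHS]mulr1 -d; ring.
Qed.

Lemma mmuladjK m n : mdet n = 1 -> mmul (mmul m (madj n)) n = m.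
Proof.
move: m n => [[p q] [r s]] [[p' q'] [r' s']]; rewrite /mdet /mmul /= => d; congr ((_, _), (_, _)).
- by rewrite -[RHS]mulr1 -d; ring.
- by rewrite -[RHS]mulr1 -d; ring.
- by rewrite -[RHS]mulr1 -d; ring.
- by rewrite -[RHS]mulr1 -d; ring.
Qed.

Lemma qf_equivE f g : qf_equiv f g <-> exists2 m, mdet m = 1 & mact m f = g.
Proof.
split=> [[p [q [r [s [d e]]]]]|[[[p q] [r s]] d e]]; first by exists ((p, q), (r, s)).
by exists p, q, r, s.
Qed.

Definition stab_seq f (St : seq mat2) : Prop :=
  uniq St /\ forall m, (m \in St) = (mdet m == 1) && (mact m f == f).

Lemma stab_conj f g St : qf_equiv f g -> stab_seq f St -> exists2 St', stab_seq g St' & size St' = size St.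
Proof.
move=> /qf_equivE[m d e] [uS hS]; exists [seq mmul (mmul (madj m) h) m | h <- St]; last by rewrite size_map.
have inj : injective (fun h => mmul (mmul (madj m) h) m).
  move=> h h' /(congr1 (fun x : mat2 => mmul (mmul m x) (madj m))).
  by rewrite -!mmulA !mulmadjK // !mmulA !(mmulKadj _ d).
split; first by rewrite map_inj_uniq.
move=> h; apply/mapP/andP => [[h0]|[/eqP d1 /eqP e1]].
  rewrite hS => /andP[/eqP d0 /eqP e0] ->; split; first by rewrite !mdetM mdet_adj d d0.
  by rewrite !mact_mul -e mact_adj // e0.
exists (mmul (mmul m h) (madj m)); last by rewrite -!mmulA madjK // mmulA mmuladjK.
rewrite hS !mdetM mdet_adj d d1 /= !mact_mul e e1 -e; apply/eqP; exact: mact_adj.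
Qed.

Lemma mact_eq m f : mact m f = f <-> [/\ qval f m.1.1 m.2.1 = qf_a f,
  2 * qf_a f * m.1.1 * m.1.2 + qf_b f * (m.1.1 * m.2.2 + m.1.2 * m.2.1) + 2 * qf_c f * m.2.1 * m.2.2 = qf_b f &
  qval f m.1.2 m.2.2 = qf_c f].
Proof.
move: f => [[a b] c]; rewrite /mact /qf_act /qval /qf_a /qf_b /qf_c /=.
by split=> [[-> -> ->]|[-> -> ->]].
Qed.

Lemma small_cases x : -1 <= x <= 1 -> [\/ x = -1, x = 0 | x = 1].
Proof.
move=> h; have : (x = -1) \/ (x = 0) \/ (x = 1) by lia.
by case=> [|[]] ->; [constructor 1|constructor 2|constructor 3].
Qed.

Lemma mul_eq_self k x : 0 < k -> k * x = k -> x = 1.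
Proof. by move=> k0 e; apply: (mulfI (lt0r_neq0 k0)); rewrite e mulr1. Qed.

Lemma stab_square k : 0 < k -> exists2 St, stab_seq ((k, 0), k) St & size St = 4%N.
Proof.
move=> k0; exists [:: ((1, 0), (0, 1)); ((-1, 0), (0, -1)); ((0, -1), (1, 0)); ((0, 1), (-1, 0))] => //.
split=> // m; apply/idP/andP => [|[/eqP d /eqP /mact_eq]].
  by rewrite !inE => /or4P[] /eqP ->; (split; last by apply/eqP/mact_eq; rewrite /qval /qf_a /qf_b /qf_c /=; split; ring).
move: m d => [[p q] [r s]]; rewrite /mdet /qval /qf_a /qf_b /qf_c /= => d [h1 h2 h3].
have {h2} : 2 * k * p * q + 0 * (p * s + q * r) + 2 * k * r * s = 0 by [].
have {}h1 : p ^+ 2 + r ^+ 2 = 1 by apply: (mul_eq_self k0); rewrite -[RHS]h1; ring.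
have {}h3 : q ^+ 2 + s ^+ 2 = 1 by apply: (mul_eq_self k0); rewrite -[RHS]h3; ring.
have sq x y : x ^+ 2 + y ^+ 2 = 1 -> [\/ x = -1, x = 0 | x = 1].
  by move=> e; apply: small_cases; have := sqr_ge0 y; move: e; clear; nia.
have p1 := sq _ _ h1; have q1 := sq _ _ h3; move: h1 h3; rewrite addrC => h1; rewrite addrC => h3.
have r1 := sq _ _ h1; have s1 := sq _ _ h3; move: d h1 h3; clear -p1 q1 r1 s1 k0 => d h1 h3 h2.
have {h2 k0} h2 : p * q + r * s = 0.
  by apply: (mulfI (lt0r_neq0 k0)); rewrite mulr0; lia.
by case: p1 => pe; case: q1 => qe; case: r1 => re; case: s1 => se; rewrite pe qe re se in d h1 h2 h3 *; try (exfalso; lia).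
Qed.

Lemma stab_hexagon k : 0 < k -> exists2 St, stab_seq ((k, k), k) St & size St = 6%N.
Proof.
move=> k0; exists [:: ((1, 0), (0, 1)); ((-1, 0), (0, -1)); ((0, -1), (1, 1)); ((0, 1), (-1, -1));
  ((1, 1), (-1, 0)); ((-1, -1), (1, 0))] => //.
split=> // m; apply/idP/andP => [|[/eqP d /eqP /mact_eq]].
  by rewrite !inE => /orP[/eqP->|/orP[/eqP->|/orP[/eqP->|/orP[/eqP->|/orP[/eqP->|/eqP->]]]]];
    (split; last by apply/eqP/mact_eq; rewrite /qval /qf_a /qf_b /qf_c /=; split; ring).
move: m d => [[p q] [r s]]; rewrite /mdet /qval /qf_a /qf_b /qf_c /= => d [h1 h2 h3].
have {}h1 : p ^+ 2 + p * r + r ^+ 2 = 1 by apply: (mul_eq_self k0); rewrite -[RHS]h1; ring.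
have {}h2 : 2 * p * q + (p * s + q * r) + 2 * r * s = 1 by apply: (mul_eq_self k0); rewrite -[RHS]h2; ring.
have {}h3 : q ^+ 2 + q * s + s ^+ 2 = 1 by apply: (mul_eq_self k0); rewrite -[RHS]h3; ring.
have sq x y : x ^+ 2 + x * y + y ^+ 2 = 1 -> [\/ x = -1, x = 0 | x = 1].
  by move=> e; apply: small_cases; have := sqr_ge0 (2 * y + x); move: e; clear; nia.
have sq' x y : x ^+ 2 + x * y + y ^+ 2 = 1 -> [\/ y = -1, y = 0 | y = 1].
  by move=> e; apply: (sq _ x); rewrite -[RHS]e; ring.
have p1 := sq _ _ h1; have q1 := sq _ _ h3; have r1 := sq' _ _ h1; have s1 := sq' _ _ h3.
clear -p1 q1 r1 s1 d h1 h2 h3.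
by case: p1 => pe; case: q1 => qe; case: r1 => re; case: s1 => se; rewrite pe qe re se in d h1 h2 h3 *; try (exfalso; lia).
Qed.

(** If the lower left entry is not 0, then a = f(p, r) forces a = c together with b = 0 or |b| = a,
    the square and hexagonal forms excluded by hypothesis. Otherwise the matrix is a shear up to
    sign, and preservation of b makes the shear trivial. *)
Lemma stab_generic f : 0 < qf_a f -> qf_reduced f -> ~ (exists k, qf_equiv f ((k, 0), k)) ->
  ~ (exists k, qf_equiv f ((k, k), k)) -> stab_seq f [:: ((1, 0), (0, 1)); ((-1, 0), (0, -1))].
Proof.
move=> a0 rd n1 n2; split=> // m; apply/idP/andP => [|[/eqP d /eqP /mact_eq]].
  by rewrite !inE => /orP[] /eqP ->; (split; last by apply/eqP/mact_eq; rewrite /qval /=; split; ring).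
have hex : qf_c f = qf_a f -> `|qf_b f| = qf_a f -> False.
  move=> ec eb; apply: n2; exists (qf_a f); rewrite {1}(qf_eta f) ec.
  have [e|e] : qf_b f = qf_a f \/ qf_b f = - qf_a f by lia.
    by rewrite e; exact: qf_equiv_refl.
  exists 1, 1, 0, 1; rewrite e /qf_act /qf_a /qf_b /qf_c /=; split; first by ring.
  by congr (_, _, _); ring.
have sq : qf_c f = qf_a f -> qf_b f = 0 -> False.
  by move=> ec eb; apply: n1; exists (qf_a f); rewrite {1}(qf_eta f) ec eb; exact: qf_equiv_refl.
move: m d => [[p q] [r s]]; rewrite /mdet /qval /= => d [h1 h2 h3].
move: rd => /andP[]; move: (qf_a f) (qf_b f) (qf_c f) a0 hex sq h1 h2 h3 {n1 n2}.
move=> a b c a0 hex sq h1 h2 h3 ba ac.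
have r0 : r = 0.
  apply/eqP/negPn/negP => r0; have r2 : 1 <= r ^+ 2 by move: r0; clear; nia.
  have m0 : 0 <= `|p * r| by [].
  have bm : - (`|b| * `|p * r|) <= b * p * r by rewrite -mulrA -normrM; have := ler_norm (- (b * (p * r))); rewrite normrN; lra.
  have pm : 2 * `|p * r| <= p ^+ 2 + r ^+ 2.
    rewrite normrM -(real_normK (num_real p)) -(real_normK (num_real r)).
    by have := sqr_ge0 (`|p| - `|r|); rewrite sqrrB; lra.
  have x1 : 1 <= p ^+ 2 - `|p * r| + r ^+ 2 by move: (sqr_ge0 p) r2 pm; move: (`|p * r|) (p ^+ 2) (r ^+ 2); clear; lia.
  have t1 : 0 <= (c - a) * r ^+ 2 by rewrite mulr_ge0 ?subr_ge0 ?sqr_ge0.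
  have t2 : 0 <= (a - `|b|) * `|p * r| by rewrite mulr_ge0 ?subr_ge0.
  have ax := ler_wpM2l (ltW a0) x1; rewrite mulr1 in ax.
  have ec : c = a.
    apply/eqP; rewrite -subr_eq0; apply/negPn/negP => ca.
    have : 0 < (c - a) * r ^+ 2 by rewrite mulr_gt0 ?lt_def ?ca ?subr_ge0 //; lra.
    lra.
  have [p0|p0] := eqVneq p 0.
    have qr : q * r = -1 by rewrite p0 in d; lra.
    have b2 : b = a * (r * s) by rewrite p0 qr ec in h2; lra.
    have r1 : `|r| = 1.
      have : (`|q| * `|r|)%N = 1%N by rewrite -abszM qr.
      by move/eqP; rewrite muln_eq1 => /andP[_ /eqP h]; rewrite -abszE h.
    have [s0|s0] := eqVneq s 0; first by apply: sq => //; rewrite b2 s0 !mulr0.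
    apply: hex => //; apply/eqP; rewrite eq_le ba /= b2 !normrM r1 mul1r (gtr0_norm a0) ler_peMr ?(ltW a0) //.
    by move: s0; clear; lia.
  have mp : 0 < `|p * r| by rewrite normr_gt0 mulf_neq0.
  apply: hex => //; apply/eqP; rewrite eq_le ba /= leNgt; apply/negP => lt.
  have : 0 < (a - `|b|) * `|p * r| by rewrite mulr_gt0 ?subr_gt0.
  lra.
subst r; rewrite mulr0 subr0 in d.
have aq : a * (p * q) = 0 by move: h2; rewrite d; clear; lia.
have [[pe se]|[pe se]] : (p = 1 /\ s = 1) \/ (p = -1 /\ s = -1).
  have : (`|p| * `|s|)%N = 1%N by rewrite -abszM d.
  move=> /eqP; rewrite muln_eq1 => /andP[/eqP hp /eqP hs].
  have [pe|pe] : p = 1 \/ p = -1 by lia.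
    by left; rewrite pe in d *; lia.
  by right; rewrite pe in d *; lia.
  by move/eqP: aq; rewrite pe mulf_eq0 gt_eqF //= mul1r => /eqP->; rewrite se.
by move/eqP: aq; rewrite pe mulf_eq0 gt_eqF //= mulN1r oppr_eq0 => /eqP->; rewrite se.
Qed.

(** The weights 1/2, 1/3 and 1 are 2 divided by the order of the stabiliser in SL_2(Z), which is 4,
    6 or 2 and is invariant under equivalence. *)
Lemma stab_weight (N : nat) f : (0 < N)%N -> pd_form N f -> exists2 St, stab_seq f St &
  (size St)%:R * class_weight f = 2.
Proof.
move=> N0 [a0 D]; have d0 : qf_disc f < 0 by rewrite D; lia.
have pos g : qf_equiv f g -> 0 < qf_a g.
  move=> [p [q [r [s [d <-]]]]]; rewrite qf_a_act; apply: qval_gt0 => //.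
  by apply/negPn/negP; rewrite negb_or !negbK => /andP[/eqP p0 /eqP r0]; move: d; rewrite p0 r0; lia.
rewrite /class_weight; case: asboolP => [[k e]|n1].
  have [St h1 h2] := stab_square (pos _ e); have [St' h1' h2'] := stab_conj (qf_equiv_sym e) h1.
  by exists St' => //; rewrite h2' h2.
case: asboolP => [[k e]|n2].
  have [St h1 h2] := stab_hexagon (pos _ e); have [St' h1' h2'] := stab_conj (qf_equiv_sym e) h1.
  by exists St' => //; rewrite h2' h2.
have [p [q [r [s [d rd]]]]] := reduction a0 d0.
have e : qf_equiv f (qf_act p q r s f) by exists p, q, r, s.
have x1 : ~ (exists k, qf_equiv (qf_act p q r s f) ((k, 0), k)).
  by move=> [k ek]; apply: n1; exists k; exact: qf_equiv_trans e ek.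
have x2 : ~ (exists k, qf_equiv (qf_act p q r s f) ((k, k), k)).
  by move=> [k ek]; apply: n2; exists k; exact: qf_equiv_trans e ek.
have [St h1 h2] := stab_conj (qf_equiv_sym e) (stab_generic (pos _ e) rd x1 x2).
by exists St => //; rewrite h2.
Qed.

End Torsor.

(** * Lattice vectors, automorphs and pairs (A, B) *)

Section ClassCount.
Variable R : realType.
Local Notation C := R[i].
Implicit Types (f : qform) (N : nat) (t : R).

Lemma hsum_on (I J : eqType) (h : J -> I) (P : pred J) (f : I -> C) s : {in P &, injective h} ->
  (forall i, f i != 0 -> exists2 j, P j & h j = i) -> hsum f s -> hsum (fun j => if P j then f (h j) else 0) s.
Proof.
move=> hi hsj H e e0; have [F hF] := H e e0.
have step i : exists o : option J, f i != 0 -> exists2 j, o = Some j & P j /\ h j = i.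
  by case: (boolP (f i != 0)) => [/hsj[j Pj hj]|_]; [exists (Some j) => _; exists j|exists None].
have [k hk] := choice step; exists (pmap k F) => G uG FG.
pose H1 := [seq h j | j <- G & P j].
have uH1 : uniq H1.
  rewrite map_inj_in_uniq ?filter_uniq // => i j.
  by rewrite !mem_filter => /andP[Pi _] /andP[Pj _]; exact: hi.
pose H2 := H1 ++ [seq i <- undup F | i \notin H1].
have -> : \sum_(j <- G) (if P j then f (h j) else 0) = \sum_(i <- H2) f i.
  rewrite big_cat /= big_map big_filter -big_mkcond /= [X in _ = _ + X]big_seq_cond [X in _ = _ + X]big1 ?addr0 //.
  move=> i; rewrite andbT mem_filter mem_undup => /andP[iH iF]; apply/eqP; apply: contraNT iH => fi.
  have [j kj [Pj hj]] := hk i fi; apply/mapP; exists j => //; rewrite mem_filter Pj; apply: FG.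
  by rewrite mem_pmap; apply/mapP; exists i => //; rewrite kj.
apply: hF.
  rewrite cat_uniq uH1 filter_uniq ?undup_uniq // andbT /=; apply/hasPn => i.
  by rewrite mem_filter => /andP[].
by move=> i iF; rewrite mem_cat mem_filter mem_undup iF andbT orbN.
Qed.

Definition vform (A B N : nat) : qform := ((A%:Z, B%:Z), ((B%:Z ^+ 2 + N%:Z) %/ (4 * A%:Z))%Z).

(** The uniqueness half of the correspondence between primitive columns and normalised forms;
    [normal_column] is the existence half. *)
Lemma shear_unique (p q r s q' s' : int) f (A B A' B' N : nat) : p * s - q * r = 1 -> p * s' - q' * r = 1 ->
  rAw A B N -> rAw A' B' N -> qf_act p q r s f = vform A B N -> qf_act p q' r s' f = vform A' B' N ->
  [/\ A = A', B = B', q = q' & s = s'].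
Proof.
move=> h1 h1' Pp Pp' h2 h2'.
have eA : A%:Z = A'%:Z by move: (congr1 (@qf_a) h2) (congr1 (@qf_a) h2'); rewrite !qf_a_act /qf_a /= => <- <-.
pose n := s * q' - q * s'.
have e1 : p * s = 1 + q * r by lia.
have e2 : p * s' = 1 + q' * r by lia.
have e3 : q * r = p * s - 1 by lia.
have hq : q' = q + (s * q' - q * s') * p.
  have -> : q + (s * q' - q * s') * p = q + q' * (p * s) - q * (p * s') by ring.
  by rewrite e1 e2; ring.
have hs : s' = s + (s * q' - q * s') * r.
  have -> : s + (s * q' - q * s') * r = s * (1 + q' * r) - s - s' * (q * r) + s by ring.
  by rewrite -e2 e3; ring.
rewrite -/n in hq hs; clearbody n.
have := congr1 (@qf_b) h2'; have := congr1 (@qf_b) h2; have := congr1 (@qf_a) h2.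
rewrite hq hs /qf_act /qf_a /qf_b /qf_c /= => k1 k2 k3.
have eB : B'%:Z = B%:Z + 2 * A%:Z * n by rewrite -k1 -k2 -k3; ring.
move: Pp Pp'; rewrite /rAw => /and3P[_ B1 _] /and3P[_ B2 _].
have n0 : n = 0 by move: B1 B2 eA eB; clear => B1 B2 eA eB; nia.
rewrite n0 !mul0r !addr0; split => //; first by case: eA.
by move: eB; rewrite n0 mulr0 addr0 => -[].
Qed.

Lemma bezout (x y : int) : (x != 0) || (y != 0) -> exists (k : nat) (x' y' q s : int),
  [/\ x = k.+1%:Z * x', y = k.+1%:Z * y' & x' * s - q * y' = 1].
Proof.
move=> xy; have [u [v e]] := Bezoutz x y.
have g0 : gcdz x y != 0 by rewrite gcdz_eq0 negb_and.
have /dvdzP[x' ex] := dvdz_gcdl x y; have /dvdzP[y' ey] := dvdz_gcdr x y.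
have [k ke] : exists k : nat, gcdz x y = k.+1%:Z.
  have : 0 <= gcdz x y by [].
  by case: (gcdz x y) g0 => [[|k]|k] // _ _; exists k.
exists k, x', y', (- v), u; rewrite -ke; move: (gcdz x y) e ex ey g0 {ke} => g e ex ey g0.
split; [by rewrite mulrC|by rewrite mulrC|].
by apply: (mulfI g0); rewrite mulr1 -[RHS]e ex ey; ring.
Qed.

Lemma rAw_form (A B N : nat) f : rAw A B N -> 4 * A%:Z * qf_c (vform A B N) = B%:Z ^+ 2 + N%:Z.
Proof. by case/and3P => _ _ /divzK; rewrite mulrC. Qed.

(** Completions of a primitive column differ by shears, and division with remainder by twice the
    leading coefficient selects the one with 0 <= B < 2 A. *)
Lemma normal_column (N : nat) f (x y q s : int) : (0 < N)%N -> pd_form N f -> x * s - q * y = 1 ->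
  exists A B n, rAw A B N /\ qf_act x (q + n * x) y (s + n * y) f = vform A B N.
Proof.
move=> N0 [a0 D] d; have d0 : qf_disc f < 0 by rewrite D; lia.
set f1 := qf_act x q y s f.
have a1 : 0 < qf_a f1.
  rewrite qf_a_act; apply: qval_gt0 => //.
  by apply/negPn/negP; rewrite negb_or !negbK => /andP[/eqP p0 /eqP r0]; move: d; rewrite p0 r0; lia.
pose n := - (qf_b f1 %/ (2 * qf_a f1))%Z.
have nE : qf_act x (q + n * x) y (s + n * y) f = qf_act 1 n 0 1 f1.
  by rewrite qf_act_comp; congr qf_act; ring.
set f2 := qf_act 1 n 0 1 f1 in nE.
have a2 : qf_a f2 = qf_a f1 by rewrite qf_a_act /qval; ring.
have b2 : qf_b f2 = (qf_b f1 %% (2 * qf_a f1))%Z.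
  have := divz_eq (qf_b f1) (2 * qf_a f1); rewrite -[(_ %/ _)%Z]opprK -/n => e.
  by rewrite [RHS](_ : _ = qf_b f1 + n * (2 * qf_a f1)); [rewrite /f2 /qf_act /qf_b /qf_a /=; ring|rewrite {2}e; ring].
have D2 : qf_disc f2 = - N%:Z.
  by rewrite -D /f2 qf_disc_act; [exact: qf_disc_act|ring].
exists `|qf_a f2|%N, `|qf_b f2|%N, n; rewrite nE.
have A0 : 0 < qf_a f2 by rewrite a2.
have A2 : 0 < 2 * qf_a f1 by rewrite mulr_gt0.
have B0 : 0 <= qf_b f2 by rewrite b2 modz_ge0 // gt_eqF.
have B1 : qf_b f2 < 2 * qf_a f2 by rewrite b2 a2; exact: ltz_pmod.
have e : qf_b f2 ^+ 2 + N%:Z = qf_c f2 * (4 * qf_a f2) by move: D2; rewrite /qf_disc; lia.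
have ea : (`|qf_a f2|%N : int) = qf_a f2 by rewrite gez0_abs // ltW.
have eb : (`|qf_b f2|%N : int) = qf_b f2 by rewrite gez0_abs.
split; last by rewrite /vform ea eb e mulzK; [exact: qf_eta|lia].
by rewrite /rAw ea eb e dvdz_mull // andbT; apply/andP; split; lia.
Qed.

Definition qth t f (v : int * int) : C := if v == (0, 0) then 0 else rc (expR (- (t * (qval f v.1 v.2)%:~R))).
Definition jth t (j : nat * (nat * nat)) : C := rc (expR (- (t * (j.1.+1%:R ^+ 2 * j.2.1%:R)))).

(* Each [vform A B N] equivalent to [f] arises from as many primitive vectors as [f] has automorphs. *)
Lemma torsor_sum N f St t (S : C) : (0 < N)%N -> pd_form N f -> stab_seq f St -> hsum (qth t f) S ->
  hsum (fun j : nat * (nat * nat) => if rAw j.2.1 j.2.2 N && `[< qf_equiv f (vform j.2.1 j.2.2 N) >]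
    then (size St)%:R * jth t j else 0) S.
Proof.
move=> N0 pd [uS hS] hs.
have step (p : nat * nat) : exists g : mat2, qf_equiv f (vform p.1 p.2 N) -> mdet g = 1 /\ mact g f = vform p.1 p.2 N.
  case: (pselect (qf_equiv f (vform p.1 p.2 N))) => [h|h]; last by exists ((0, 0), (0, 0)).
  by have /qf_equivE[g g1 g2] := h; exists g.
have [g0 hg] := choice step; clear step.
pose P (x : (nat * (nat * nat)) * mat2) := [&& rAw x.1.2.1 x.1.2.2 N, `[< qf_equiv f (vform x.1.2.1 x.1.2.2 N) >] & x.2 \in St].
pose M (x : (nat * (nat * nat)) * mat2) : mat2 := mmul x.2 (g0 x.1.2).
(* The multiplier, the pair and an automorph are sent to [k.+1] times the first column of the
   automorph times [g0]. The admissible data thereby parametrise the nonzero vectors, each exactly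
   once. *)
pose h (x : (nat * (nat * nat)) * mat2) : int * int := (x.1.1.+1%:Z * (M x).1.1, x.1.1.+1%:Z * (M x).2.1).
have PM x : P x -> mdet (M x) = 1 /\ mact (M x) f = vform x.1.2.1 x.1.2.2 N.
  case/and3P => _ /asboolP /hg[d e]; rewrite hS => /andP[/eqP d1 /eqP e1].
  by rewrite /M mdetM mact_mul d1 e1 d e.
have hval x : P x -> qth t f (h x) = jth t x.1.
  move=> Px; have [d e] := PM x Px; have /and3P[/and3P[A0 _ _] _ _] := Px.
  have va : qval f (M x).1.1 (M x).2.1 = x.1.2.1%:Z by move: (congr1 qf_a e); rewrite /mact qf_a_act.
  rewrite /qth /jth; case: eqP => [h0|_].
    exfalso; have : qval f (h x).1 (h x).2 = 0 by rewrite h0 /qval /=; ring.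
    rewrite (_ : qval f (h x).1 (h x).2 = x.1.1.+1%:Z ^+ 2 * qval f (M x).1.1 (M x).2.1); last by rewrite /qval /h /=; ring.
    by rewrite va; nia.
  rewrite (_ : qval f (h x).1 (h x).2 = x.1.1.+1%:Z ^+ 2 * qval f (M x).1.1 (M x).2.1); last by rewrite /qval /h /=; ring.
  by rewrite va rmorphM rmorphXn /= -!pmulrn.
have key : hsum (fun x => if P x then qth t f (h x) else 0) S.
  apply: hsum_on hs => [x y Px Py|v].
    have [dx ex] := PM x Px; have [dy ey] := PM y Py; have /and3P[rx _ Sx] := Px; have /and3P[ry _ Sy] := Py.
    move=> e; have [e1 e2] : x.1.1.+1%:Z * (M x).1.1 = y.1.1.+1%:Z * (M y).1.1 /\ x.1.1.+1%:Z * (M x).2.1 = y.1.1.+1%:Z * (M y).2.1.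
      by case: e => -> ->.
    move Mx : (M x) dx ex e1 e2 => X dx ex e1 e2; move My : (M y) dy ey e1 e2 => Y dy ey e1 e2.
    move: x y Px Py Mx My dx ex dy ey rx ry Sx Sy e1 e2 {e} => [[k [A B]] m] [[k' [A' B']] m'] Px Py Mx My dx ex dy ey rx ry Sx Sy e1 e2.
    rewrite [_.1.1]/= [_.1.1]/= in e1 e2.
    (* Both columns are primitive, so the common vector has content [k.+1] and also [k'.+1]; the two
       determinants give the two divisibilities. *)
    have kk : k = k'.
      have := dx; have := dy; rewrite /mdet => dy' dx'.
      have d1 : (k.+1%:Z %| k'.+1%:Z)%Z.
        apply/dvdzP; exists (X.1.1 * Y.2.2 - Y.1.2 * X.2.1); rewrite -[LHS]mulr1 -dy'.
        transitivity (k'.+1%:Z * Y.1.1 * Y.2.2 - Y.1.2 * (k'.+1%:Z * Y.2.1)); first by ring.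
        by rewrite -e1 -e2; ring.
      have d2 : (k'.+1%:Z %| k.+1%:Z)%Z.
        apply/dvdzP; exists (Y.1.1 * X.2.2 - X.1.2 * Y.2.1); rewrite -[LHS]mulr1 -dx'.
        transitivity (k.+1%:Z * X.1.1 * X.2.2 - X.1.2 * (k.+1%:Z * X.2.1)); first by ring.
        by rewrite e1 e2; ring.
      by apply: succn_inj; apply/eqP; rewrite eqn_dvd; apply/andP.
    subst k'; have k0 : k.+1%:Z != 0 by [].
    move: (mulfI k0 e1) (mulfI k0 e2) => c1 c2 {e1 e2}.
    move: X Y Mx My dx ex dy ey c1 c2 => [[p q] [r s]] [[p' q'] [r' s']] Mx My; rewrite /mdet /mact /= => dx ex dy ey c1 c2; rewrite /= in rx ry.
    subst p' r'; have [eA eB eq es] := shear_unique dx dy rx ry ex ey.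
    subst A' B' q' s'; congr (_, _); have [d0 _] := hg (A, B) (asboolW (proj1 (andP (proj2 (andP Px))))).
    by rewrite -[m](mmulKadj _ d0) -[m'](mmulKadj _ d0); congr (mmul _ _); rewrite -/(M (k, (A, B), m)) Mx -My.
  rewrite /qth; case: (v =P (0, 0)) => [_|/eqP v0 _]; first by rewrite eqxx.
  have xy : (v.1 != 0) || (v.2 != 0) by move: v0; case: v => x y /=; rewrite xpair_eqE negb_and.
  have [k [x [y [q [s [e1 e2 d]]]]]] := bezout xy.
  have [A [B [n [r1 r2]]]] := normal_column N0 pd d.
  have eqv : qf_equiv f (vform A B N) by do 4 eexists; split; last exact: r2; rewrite -[RHS]d; ring.
  have [d0 e0] := hg (A, B) eqv; pose m' : mat2 := ((x, q + n * x), (y, s + n * y)).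
  have MM : M ((k, (A, B)), mmul m' (madj (g0 (A, B)))) = m' by exact: mmuladjK.
  exists ((k, (A, B)), mmul m' (madj (g0 (A, B)))); last by rewrite /h MM /= -e1 -e2; case: (v).
  rewrite /P /= r1 hS mdetM mdet_adj d0 mact_mul (_ : mdet m' = 1); last by rewrite -[RHS]d /mdet /=; ring.
  rewrite mulr1 eqxx /=; apply/andP; split; first exact/asboolP.
  by rewrite (_ : mact m' f = mact (g0 (A, B)) f) ?mact_adj // e0.
apply: hsum_fubini key => j; set b := _ && _.
have := hsum_fin (f := fun m => if m \in St then (if b then jth t j else 0) else 0) uS (fun m mS => ifN _ _ mS).
rewrite (eq_big_seq (fun=> if b then jth t j else 0)); last by move=> m ->.
rewrite big_const_seq count_predT iter_addr_0 (_ : (if b then _ else 0) *+ size St = if b then (size St)%:R * jth t j else 0); last first.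
  by case: (b); rewrite ?mul0rn // mulr_natl.
apply: hsum_ext => m; rewrite /P /= andbA -/b; case: (boolP (m \in St)) => mS; rewrite ?andbT ?andbF //.
by case: (boolP b) => // bb; rewrite hval // /P /= andbA -/b bb.
Qed.

End ClassCount.

(** * Theta functions of binary forms near t = 0 and the class number *)

Section ThetaAsymptotics.
Variable R : realType.
Local Notation C := R[i].
Implicit Types (f : qform) (N : nat) (t l z : R).

Lemma ex2_and (T : Type) (P Q : T -> Prop) : (exists2 x, P x & Q x) -> exists x, P x /\ Q x.
Proof. by case=> x; exists x. Qed.

(** Poisson summation isolates the zero frequency [1 / l], and [theta_tail] bounds the other
    frequencies. *)
Lemma gauss_line l z : 0 < l -> exists2 S : R, `|S - l^-1| <= 16 * l &
  hsum (fun n : int => rc (expR (- (pi * (l * n%:~R + z) ^+ 2))) : C) (rc S).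
Proof.
move=> l0; have cl := cone_rc l0.
have h1 := gau_sum (rc z) cl; have [B _ h2] := gau_poisson (rc z) cl.
have h3 : hsum (fun n : int => rc (expR (- (pi * (l * n%:~R + z) ^+ 2))) : C) (tsum (fun n : int => gau (rc l) (rc z) n%:~R)).
  by apply: hsum_ext h1 => n; rewrite /gau -rcM -rcD -rcX -rcM -rcN cexp_rc.
have e := hsum_real h3; rewrite e in h2 h3; move: (complex.Re _) h2 h3 {e h1} => S h2 h3; exists S => //.
have l2 : 0 < l ^- 2 by rewrite invr_gt0 exprn_gt0.
have hb j : cabs (rc l * (cexp (ci R * rc (2 * pi * j%:~R) * rc z / rc l - rc (pi * j%:~R ^+ 2) / rc l ^+ 2) / rc l)) <=
    expR (- (pi * j%:~R ^+ 2 * l ^- 2)).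
  rewrite mulrC divfK ?rc_eq0 ?gt_eqF // cabs_cexp ler_expR.
  move: (2 * pi * j%:~R) (pi * j%:~R ^+ 2) => X Y.
  have -> : ci R * rc X * rc z / rc l - rc Y / rc l ^+ 2 = ci R * rc (X * z / l) - rc (Y / l ^+ 2).
    by rewrite -rcX -!rcV -!mulrA -!rcM.
  by rewrite ReD ReN ciM_rc /= add0r.
have := theta_tail l2 (hsumZ (rc l) h2) hb.
rewrite mulr0z mulr0 rc0 mulr0 !mul0r expr0n mulr0 rc0 mul0r subr0 cexp0 mul1r mulfV ?rc_eq0 ?gt_eqF //.
rewrite -rcM -rc1 -rcB cabs_rc invrK => h.
rewrite -(ler_pM2l l0) -{1}(gtr0_norm l0) -normrM mulrBr mulfV ?gt_eqF //.
by apply: le_trans h _; rewrite expr2 mulrCA.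
Qed.

Lemma theta2 N f : (0 < N)%N -> pd_form N f -> exists K : R, forall t, 0 < t <= 1 -> exists2 S : R,
  `|t * S - 2 * pi / Num.sqrt N%:R| <= K * t & hsum (fun v : int * int => rc (expR (- (t * (qval f v.1 v.2)%:~R))) : C) (rc S).
Proof.
move=> N0 [a0 D]; have pi0 : 0 < pi :> R by exact: pi_gt0.
have [a aE] : exists a : R, a = (qf_a f)%:~R by eexists.
have [b bE] : exists b : R, b = (qf_b f)%:~R by eexists.
have ar : 0 < a by rewrite aE ltr0z.
have Nr : (0 : R) < N%:R by rewrite ltr0n.
set sN := Num.sqrt N%:R; have sN0 : 0 < sN by rewrite sqrtr_gt0.
have sN2 : sN ^+ 2 = N%:R by rewrite sqr_sqrtr // ltW.
exists (16 * (2 * a / sN) + 256 * (sN / (2 * pi)) + 16 * (sN / (2 * a))) => t /andP[t0 t1].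
(* Completing the square, t f(x, y) = pi (l x + l b y / (2 a))^2 + pi (l' y)^2. So [gauss_line] is
   applied in x for each y and then once in y. *)
pose l := Num.sqrt (t * a / pi); have ta : 0 < t * a / pi by rewrite divr_gt0 // mulr_gt0.
have l0 : 0 < l by rewrite sqrtr_gt0.
have l2 : l ^+ 2 = t * a / pi by rewrite sqr_sqrtr // ltW.
pose l' := l * (sN / (2 * a)); have l'0 : 0 < l' by rewrite mulr_gt0 // divr_gt0 // mulr_gt0.
have ll' : l * l' = t * (sN / (2 * pi)) by rewrite /l' mulrA -expr2 l2; move: (pi : R) pi0 => p p0; field; rewrite !gt_eqF.
pose E (y : int) : R := expR (- (pi * (l' * y%:~R + 0) ^+ 2)).
have [S' S'1 S'2] := gauss_line 0 l'0.
have [T hT] := choice (fun y : int => ex2_and (gauss_line (l * (b * y%:~R / (2 * a))) l0)).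
have gE (x y : int) : expR (- (t * (qval f x y)%:~R)) = E y * expR (- (pi * (l * x%:~R + l * (b * y%:~R / (2 * a))) ^+ 2)) :> R.
  rewrite /E -expRD; congr expR.
  have q4 : 4 * a * (qval f x y)%:~R = (2 * a * x%:~R + b * y%:~R) ^+ 2 + N%:R * y%:~R ^+ 2 :> R.
    have := congr1 (fun x : int => x%:~R : R) (qval_sqr f x y); rewrite D mulNr opprK aE bE.
    by rewrite !(rmorphM, rmorphD, rmorphXn) /= -!pmulrn.
  have -> : (qval f x y)%:~R = ((2 * a * x%:~R + b * y%:~R) ^+ 2 + N%:R * y%:~R ^+ 2) / (4 * a) :> R.
    by rewrite -q4; field; rewrite gt_eqF.
  have -> : - (pi * (l' * y%:~R + 0) ^+ 2) - pi * (l * x%:~R + l * (b * y%:~R / (2 * a))) ^+ 2 =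
      - (l ^+ 2 * pi * ((sN / (2 * a) * y%:~R) ^+ 2 + (x%:~R + b * y%:~R / (2 * a)) ^+ 2)).
    by rewrite /l'; ring.
  by rewrite l2 -sN2; move: (pi : R) pi0 => p p0; field; rewrite !gt_eqF.
have E0 y : 0 <= E y by exact: expR_ge0.
have inner y : hsum (fun x : int => rc (expR (- (t * (qval f x y)%:~R))) : C) (rc (E y * T y)).
  have [_ h] := hT y; rewrite rcM; apply: hsum_ext (hsumZ (rc (E y)) h) => x.
  by rewrite gE rcM.
have bT y : `|T y - l^-1| <= 16 * l by case: (hT y).
have Tm y : T y <= l^-1 + 16 * l by have := ler_norm (T y - l^-1); have := bT y; lra.
have bEs := hsum_bsum E0 S'2.
have m0 : 0 <= l^-1 + 16 * l by rewrite addr_ge0 ?mulr_ge0 ?invr_ge0 // ltW.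
have bg : bsum (fun p : int * int => expR (- (t * (qval f p.2 p.1)%:~R))) ((l^-1 + 16 * l) * S').
  apply: (@bsum_prod _ _ _ _ (fun y => E y * T y)) => [p|y|]; first exact: expR_ge0.
    by apply: hsum_bsum (inner y) => x; exact: expR_ge0.
  by apply: bsum_le (bsumZ m0 bEs) => y; rewrite mulrC ler_wpM2r.
have ag : absb (fun p : int * int => rc (expR (- (t * (qval f p.2 p.1)%:~R))) : C) ((l^-1 + 16 * l) * S').
  by apply: bsum_le bg => p; rewrite cabs_rc ger0_norm ?expR_ge0.
have hg := tsumP ag; have e := hsum_real hg; rewrite e in hg; move: (complex.Re _) hg {e} => S hg.
exists S; last by apply: hsum_ext (hsum_swap hg) => -[x y].
have ho : hsum (fun y => rc (E y * T y) : C) (rc S) by apply: hsum_fubini hg => y; exact: inner.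
have S'0 : 0 <= S' by exact: hsum_ge0 E0 S'2.
have d1 : `|S - l^-1 * S'| <= 16 * l * S'.
  have := hsum_le (hsumB ho (hsumZ (rc l^-1) S'2)); rewrite -rcM -rcB cabs_rc; apply.
  have l16 : 0 <= 16 * l by rewrite mulr_ge0 // ltW.
  apply: bsum_le (bsumZ l16 bEs) => y; rewrite -rcM -rcB cabs_rc [l^-1 * _]mulrC -mulrBr normrM ger0_norm // mulrC.
  by rewrite ler_wpM2r.
have S'b : S' <= l'^-1 + 16 * l' by have := ler_norm (S' - l'^-1); lra.
have d2 : `|S - (l * l')^-1| <= 16 * l * (l'^-1 + 16 * l') + l^-1 * (16 * l').
  have -> : S - (l * l')^-1 = (S - l^-1 * S') + l^-1 * (S' - l'^-1) by rewrite invfM; ring.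
  apply: le_trans (ler_normD _ _) _; rewrite lerD //.
    by apply: le_trans d1 _; rewrite ler_wpM2l // mulr_ge0 // ltW.
  by rewrite normrM gtr0_norm ?invr_gt0 // ler_wpM2l // invr_ge0 ltW.
have -> : t * S - 2 * pi / sN = t * (S - (l * l')^-1).
  by rewrite ll'; move: (pi : R) pi0 => p p0; field; rewrite !gt_eqF.
rewrite normrM gtr0_norm // mulrC ler_pM2r //; apply: le_trans d2 _.
have -> : 16 * l * (l'^-1 + 16 * l') + l^-1 * (16 * l') = 16 * (2 * a / sN) + 256 * (l * l') + 16 * (sN / (2 * a)).
  by rewrite /l'; field; rewrite !gt_eqF.
apply: lerD => //; apply: lerD => //; apply: ler_wpM2l; first exact: ler0n.
by rewrite ll' ler_piMl // divr_ge0 ?(ltW sN0) // mulr_ge0 // pi_ge0.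
Qed.

Lemma vform_pd (A B N : nat) : rAw A B N -> pd_form N (vform A B N).
Proof.
move=> h; have e := rAw_form ((0, 0), 0) h; have /and3P[A0 _ _] := h; split; first by rewrite ltz_nat.
by rewrite /qf_disc e /vform /qf_b /=; ring.
Qed.

(** A class contributes its theta function, with main term 2 pi / sqrt N, divided by the order of
    its stabiliser, that is times half the class weight. Summation over the classes gives pi H(N) /
    sqrt N; the subtracted zero vector falls into the error. *)
Lemma count_asymptotics N : (0 < N)%N -> exists K : R, forall t, 0 < t <= 1 -> exists2 U : R,
  `|t * U - pi / Num.sqrt N%:R * ratr (hurwitz N)| <= K * t &
  hsum (fun j : nat * (nat * nat) => if rAw j.2.1 j.2.2 N then jth t j else 0 : C) (rc U).
Proof.
move=> N0; have [s [[s1 s2 s3] us ->]] := hurwitz_reps N0.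
pose F (i : 'I_(size s)) := nth ((0, 0), 0) s i.
have pF i : pd_form N (F i) by apply: s1; apply: mem_nth.
have [K hK] := choice (fun i => theta2 N0 (pF i)).
have [St hSt] := choice (fun i => ex2_and (stab_weight N0 (pF i))).
pose c (i : 'I_(size s)) : R := ((size (St i))%:R)^-1.
have cE i : c i = ratr (class_weight (F i)) / 2.
  have [_ /(congr1 (fun x : rat => ratr x : R))] := hSt i; rewrite rmorphM /= !ratr_nat => e.
  have z : (size (St i))%:R != 0 :> R by apply/eqP => z; move: e; rewrite z mul0r => /eqP; rewrite eq_sym pnatr_eq0.
  by apply: (mulfI z); rewrite mulfV // mulrA e mulfV // pnatr_eq0.
have c0 i : 0 <= c i by rewrite invr_ge0 ler0n.
exists (\sum_i c i * (`|K i| + 1)) => t t01; have /andP[t0 _] := t01.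
have [S hS] := choice (fun i => ex2_and (hK i t t01)).
have h1 i : hsum (qth t (F i)) (rc (S i - 1)).
  have o : hsum (fun v : int * int => if v \in [:: (0, 0)] then 1 else 0 : C) 1.
    have := @hsum_fin R _ [:: ((0, 0) : int * int)] (fun v => if v \in [:: (0, 0)] then 1 else 0) isT (fun v vS => ifN _ _ vS).
    by rewrite big_seq1 mem_head.
  rewrite rcB rc1; apply: hsum_ext (hsumB (hS i).2 o) => v; rewrite /qth inE.
  have q0 : qval (F i) 0 0 = 0 by rewrite /qval; ring.
  by case: eqP => [->|_]; rewrite ?subr0 //= q0 mulr0z mulr0 oppr0 expR0 rc1 subrr.
have h2 i := hsumZ (rc (c i)) (torsor_sum N0 (pF i) (hSt i).1 (h1 i)).
exists (\sum_i c i * (S i - 1)); last first.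
  rewrite rc_sum; under [X in hsum _ X]eq_bigr do rewrite rcM.
  apply: hsum_ext (hsum_finsum (index_enum _) h2) => -[k [A B]] /=.
  case: (boolP (rAw A B N)) => r; last by rewrite big1 // => i _; rewrite mulr0.
  have [g gs /qf_equiv_sym eg] := s3 _ (vform_pd r).
  have /(nthP ((0, 0), 0))[i hi ei] := gs.
  rewrite (bigD1 (Ordinal hi)) //= big1 ?addr0.
    rewrite /F /= ei asboolT //= mulrA -(rc_nat R (size _)) -rcM mulVf ?rc1 ?mul1r //.
    have [_ e] := hSt (Ordinal hi); apply/eqP => z; move: e; move/eqP: z; rewrite pnatr_eq0 => /eqP ->.
    by rewrite mul0r.
  move=> j ji; case: asboolP => [e|]; last by rewrite /= mulr0.
  have ne (i1 i2 : nat) : (i1 < i2 < size s)%N -> qf_equiv (nth ((0, 0), 0) s i1) (vform A B N) ->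
      qf_equiv (nth ((0, 0), 0) s i2) (vform A B N) -> False.
    by move=> h e1 e2; apply: (s2 _ _ h); exact: qf_equiv_trans e1 (qf_equiv_sym e2).
  exfalso; rewrite -ei in eg; have := ltn_ord j; move: ji; rewrite -val_eqE /= => ji jl.
  case: (ltngtP j i) => ij; last by rewrite ij eqxx in ji.
    by apply: (ne j i); rewrite ?ij.
  by apply: (ne i j); rewrite ?ij.
have -> : t * (\sum_i c i * (S i - 1)) - pi / Num.sqrt N%:R * ratr (\sum_(f <- s) class_weight f) =
    \sum_i c i * ((t * S i - 2 * pi / Num.sqrt N%:R) - t).
  rewrite (big_nth ((0, 0), 0)) big_mkord rmorph_sum /= !mulr_sumr -sumrB; apply: eq_bigr => i _.
  by rewrite -/(F i) (_ : ratr _ = 2 * c i) ?cE; field; rewrite ?gt_eqF ?sqrtr_gt0 ?ltr0n.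
apply: le_trans (ler_norm_sum _ _ _) _; rewrite mulr_suml; apply: ler_sum => i _.
rewrite (normrM (c i)) (ger0_norm (c0 i)) -[leRHS]mulrA; apply: ler_wpM2l => //; apply: le_trans (ler_normB _ _) _.
have h3 := (hS i).1; have h4 : K i * t <= `|K i| * t by rewrite ler_wpM2r ?(ltW t0) ?ler_norm.
by rewrite (gtr0_norm t0); lra.
Qed.

End ThetaAsymptotics.

(** * Logarithmic growth of sums over triples (k, A, B) *)

Section CoefficientLimit.
Variable R : realType.
Local Notation C := R[i].
Implicit Types (N : int) (s t v h : R).

Definition nonsq N := ~ (exists x : int, x ^+ 2 = - N).

(** The value k^2 A of the form at the vector encoded by the triple; the kernels below depend on the
    triple through it. *)
Definition jj (j : nat * (nat * nat)) : R := j.1.+1%:R ^+ 2 * j.2.1%:R.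

Definition onN N (g : R -> R) (j : nat * (nat * nat)) : R := if rAw j.2.1 j.2.2 N then g (jj j) else 0.

Lemma jj_ge1 N j : rAw j.2.1 j.2.2 N -> 1 <= jj j.
Proof. by move=> /and3P[A0 _ _]; rewrite /jj mulr_ege1 ?exprn_ege1 ?ler1n. Qed.

Lemma onN_ge0 N g j : (forall x, 1 <= x -> 0 <= g x) -> 0 <= onN N g j.
Proof. by move=> g0; rewrite /onN; case: ifP => // /jj_ge1 /g0. Qed.

Lemma onN_le N g g' j : (forall x, 1 <= x -> g x <= g' x) -> onN N g j <= onN N g' j.
Proof. by move=> gg; rewrite /onN; case: ifP => // /jj_ge1 /gg. Qed.

Lemma onN_exp_bound : exists2 K : R, 0 <= K & forall N, nonsq N -> forall t, 0 < t <= 1 ->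
  bsum (onN N (fun x => expR (- (t * x)))) (K * (`|N|%N.+1%:R) ^+ 3 / t).
Proof.
have [K K0 hK] := rA_bound R; exists (K * 16) => [|N nsq t /andP[t0 t1]]; first by rewrite mulr_ge0.
set M := K * (`|N|%N.+1%:R) ^+ 3; have M0 : 0 <= M by rewrite mulr_ge0 ?exprn_ge0.
(* [rA_bound] covers u <= 1. For u > 1, as A >= 1, comparison with the case u = 1 gains exp(-(u -
   1)) <= 1/u. *)
have all_t u : 0 < u -> bsum (fun p : nat * nat => if rAw p.1 p.2 N then expR (- (u * p.1%:R)) else 0) (M / u).
  move=> u0; have [u1|u1] := lerP u 1; first by apply: hK => //; rewrite u0.
  have h1 : 0 < (1 : R) <= 1 by rewrite ltr01 lexx.
  have u' : 0 <= u^-1 by rewrite invr_ge0 ltW.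
  have := bsumZ u' (hK N nsq 1 h1); rewrite divr1 -/M mulrC; apply: bsum_le => p.
  case: ifP => [/and3P[A0 _ _]|_]; last by rewrite mulr0.
  have A1 : (1 : R) <= p.1%:R by rewrite ler1n.
  rewrite mul1r; apply: (@le_trans _ _ (expR (- (u - 1)) * expR (- p.1%:R))).
    have hx : 0 <= (u - 1) * (p.1%:R - 1) by apply: mulr_ge0; lra.
    by rewrite -expRD ler_expR; lra.
  rewrite ler_wpM2r ?expR_ge0 // expRN lef_pV2 ?posrE ?expR_gt0 //.
  by have := expR_ge1Dx (u - 1); lra.
rewrite (_ : K * 16 * _ / t = M / t * 16); last by rewrite /M; ring.
apply: (@bsum_prod _ _ _ _ (fun k => M / t * (k.+1%:R ^+ 2)^-1)) => [j|k|].
- by apply: onN_ge0 => x _; exact: expR_ge0.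
- have k0 : (0 : R) < k.+1%:R ^+ 2 by rewrite exprn_gt0.
  rewrite -mulrA -invfM; apply: bsum_le (all_t _ (mulr_gt0 t0 k0)) => p.
  by rewrite /onN /jj /= mulrA.
- by apply: bsumZ; [rewrite divr_ge0 // ltW|exact: @bsum_invsq R].
Qed.

(** Along these parameters log(1 / t) is the integer [m]. *)
Definition tm (m : nat) : R := expR (- m%:R).

Lemma tm01 m : 0 < tm m <= 1.
Proof. by rewrite expR_gt0 /= -expR0 ler_expR oppr_le0. Qed.

(** Passing from t to t / e increases the kernel exp(-t x) / x by at most t exp(-(t / e) x). By
    [onN_exp_bound], of order 1 / t, each such step adds an amount bounded independently of [m]. *)
Lemma onN_log_bound : exists2 K : R, 0 <= K & forall N, nonsq N -> forall m,
  bsum (onN N (fun x => expR (- (tm m * x)) / x)) (K * (`|N|%N.+1%:R) ^+ 3 * m.+1%:R).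
Proof.
have [K K0 hK] := onN_exp_bound; pose e1 : R := expR 1; have e10 : 0 < e1 by exact: expR_gt0.
have e11 : 1 <= e1 by rewrite /e1 -[leLHS]expR0 ler_expR.
exists (K * e1) => [|N nsq m]; first by rewrite mulr_ge0 // ltW.
set M := (`|N|%N.+1%:R) ^+ 3; have M0 : (0 : R) <= M by rewrite exprn_ge0.
have KM : 0 <= K * M by rewrite mulr_ge0.
elim: m => [|m IH].
  have h1 : 0 < (1 : R) <= 1 by rewrite ltr01 lexx.
  have := hK N nsq 1 h1; rewrite divr1 => h.
  apply: (@bsumW _ _ _ (K * M)); first by rewrite mulr1 -/M; rewrite mulrAC ler_peMr.
  apply: bsum_le h => j; apply: onN_le => x x1.
  by rewrite /tm oppr0 expR0 ler_pdivrMr ?(lt_le_trans ltr01) // ler_peMr ?expR_ge0.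
have t1 := tm01 m.+1; have /andP[t0 _] := t1; have /andP[t0' _] := tm01 m.
have tt : tm m = e1 * tm m.+1 by rewrite /tm /e1 -expRD; congr expR; rewrite -[m.+1]addn1 natrD; ring.
have := bsumD IH (bsumZ (ltW t0') (hK N nsq _ t1)).
have -> : K * e1 * M * m.+1%:R + tm m * (K * M / tm m.+1) = K * e1 * M * m.+2%:R.
  by rewrite tt -[m.+2]addn1 natrD; field; rewrite gt_eqF.
apply: bsum_le => j; rewrite /onN; case: ifP => [/jj_ge1 x1|_]; last by rewrite mulr0 addr0.
set x := jj j in x1 *; have x0 : 0 < x by exact: lt_le_trans x1.
have h := expR_ge1Dx (- (tm m * x - tm m.+1 * x)).
have : expR (- (tm m * x)) = expR (- (tm m.+1 * x)) * expR (- (tm m * x - tm m.+1 * x)) by rewrite -expRD; congr expR; ring.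
move=> ->; set E := expR (- (tm m.+1 * x)); have E0 : 0 <= E by exact: expR_ge0.
rewrite -(ler_pM2r x0) mulfVK ?gt_eqF // mulrDl mulfVK ?gt_eqF //.
have := ler_wpM2l E0 h; have : 0 <= E * (tm m.+1 * x) by rewrite !mulr_ge0 // ltW.
rewrite (_ : tm m * E * x = E * (tm m * x)); last by ring.
lra.
Qed.

Lemma expR_sub1_le h : 0 < h -> h <= 1 / 2 -> expR h - 1 <= h + 2 * h ^+ 2.
Proof.
move=> h0 h2; have := expR_ge1Dx (- h); rewrite expRN; set E := expR h => hE.
have E0 : 0 < E by exact: expR_gt0.
have : (1 - h) * E <= 1 by rewrite -ler_pdivlMr // mul1r; lra.
have : 1 <= (1 - h) * (1 + h + 2 * h ^+ 2).
  have -> : (1 - h) * (1 + h + 2 * h ^+ 2) = 1 + h ^+ 2 * (1 - 2 * h) by ring.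
  by rewrite lerDl mulr_ge0 ?sqr_ge0 //; lra.
move=> a1 a2; have : (1 - h) * E <= (1 - h) * (1 + h + 2 * h ^+ 2) by lra.
by rewrite ler_pM2l; lra.
Qed.

Lemma one_sub_expRN_ge h : 0 <= h -> h - h ^+ 2 <= 1 - expR (- h).
Proof.
move=> h0; have := expR_le_inv1 h0; have : (1 + h)^-1 <= 1 - h + h ^+ 2.
  rewrite -div1r ler_pdivrMr 1?mulrC; last by lra.
  have -> : (1 + h) * (1 - h + h ^+ 2) = 1 + h ^+ 3 by ring.
  by rewrite lerDl exprn_ge0.
lra.
Qed.

Lemma step_upper h x y e : 0 < h -> h <= 1 / 2 -> 0 <= x -> 0 <= e -> 2 * (x + e) * h <= e -> y - x <= e ->
  (expR h - 1) * y <= h * (x + 2 * e).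
Proof.
move=> h0 h2 x0 e0 he yx; have up := expR_sub1_le h0 h2; have h0' := ltW h0; have xe : 0 <= x + e by exact: addr_ge0.
apply: (@le_trans _ _ ((expR h - 1) * (x + e))).
  by rewrite ler_wpM2l; [lra|have := expR_ge1Dx h; lra|lra].
apply: (@le_trans _ _ ((h + 2 * h ^+ 2) * (x + e))); first by rewrite ler_wpM2r.
have -> : (h + 2 * h ^+ 2) * (x + e) = h * (x + e + 2 * (x + e) * h) by ring.
by rewrite ler_wpM2l //; lra.
Qed.

Lemma step_lower h x y e : 0 < h -> h <= 1 / 2 -> 0 <= x -> 0 <= e -> 2 * (x + e) * h <= e -> x - y <= e -> 0 <= y ->
  h * (x - 2 * e) <= (1 - expR (- h)) * y.
Proof.
move=> h0 h2 x0 e0 he yx y0; have h0' := ltW h0; have lo := one_sub_expRN_ge h0'.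
have lo0 : 0 <= h - h ^+ 2 by rewrite expr2 subr_ge0 ler_piMl //; lra.
have [c|c] := lerP (x - e) 0.
  apply: (@le_trans _ _ 0); last by rewrite mulr_ge0 //; lra.
  by rewrite mulr_ge0_le0 //; lra.
apply: (@le_trans _ _ ((h - h ^+ 2) * (x - e))); last by apply: ler_pM => //; lra.
have -> : (h - h ^+ 2) * (x - e) = h * (x - e - h * (x - e)) by ring.
rewrite ler_wpM2l //; have : h * (x - e) <= h * (x + e) by rewrite ler_wpM2l //; lra.
have : 0 <= h * (x + e) by rewrite mulr_ge0 //; lra.
lra.
Qed.

(* [T] is the derivative of [G] up to exponential factors, so [G] grows like [rho m]. *)
Lemma log_average (G T : R -> R) (rho : R) : 0 <= rho -> (forall s, 0 <= s -> 0 <= T s) ->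
  (forall s h, 0 <= s -> 0 <= h <= 1 -> (1 - expR (- h)) * T s <= G (s + h) - G s <= (expR h - 1) * T (s + h)) ->
  (forall e, 0 < e -> exists m0 : nat, forall s, m0%:R <= s -> `|T s - rho| <= e) ->
  forall e, 0 < e -> exists m0 : nat, forall m, (m0 <= m)%N -> `|G m%:R - rho * m%:R| <= e * m%:R.
Proof.
move=> rho0 T0 HG HT e e0.
have [e' e'0 e'E] : exists2 e', 0 < e' & e = 4 * e' by exists (e / 4); [rewrite divr_gt0|field].
have [m0 hm0] := HT e' e'0.
have r0 : 0 <= 2 * (rho + e') by rewrite mulr_ge0 // addr_ge0 // ltW.
have arch (x : R) : 0 <= x -> exists n : nat, x <= n%:R.
  by move=> x0; exists (Num.truncn x).+1; have /andP[_ /ltW] := truncn_itv x0.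
have [n hn] := arch _ (divr_ge0 r0 (ltW e'0)).
(* The step is the reciprocal of an integer, so that repeated steps from [m0] reach every later
   integer; [n] is large enough to keep the second-order error below [e']. *)
pose h : R := n.+2%:R^-1; have h0 : 0 < h by rewrite invr_gt0 ltr0n.
have nh : n.+2%:R * h = 1 by rewrite mulfV // pnatr_eq0.
have h2 : h <= 1 / 2 by rewrite div1r lef_pV2 ?posrE ?ltr0n // ler_nat.
have hh : 0 <= h <= 1 by apply/andP; split; lra.
have he : 2 * (rho + e') * h <= e'.
  rewrite -ler_pdivlMr // invrK -ler_pdivrMl // mulrC; apply: le_trans hn _.
  by rewrite ler_nat; lia.
have ind (i : nat) : i%:R * (h * (rho - 2 * e')) <= G (m0%:R + i%:R * h) - G m0%:R <= i%:R * (h * (rho + 2 * e')).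
  elim: i => [|i /andP[IH1 IH2]]; first by rewrite !mul0r addr0 subrr lexx.
  have s0 : 0 <= m0%:R + i%:R * h by rewrite addr_ge0 // mulr_ge0 // ltW.
  have := HG _ _ s0 hh; rewrite -addrA (_ : i%:R * h + h = i.+1%:R * h); last by rewrite -addn1 natrD; ring.
  move=> /andP[g1 g2].
  have b1 : `|T (m0%:R + i%:R * h) - rho| <= e' by apply: hm0; rewrite lerDl mulr_ge0 // ltW.
  have b2 : `|T (m0%:R + i.+1%:R * h) - rho| <= e' by apply: hm0; rewrite lerDl mulr_ge0 // ltW.
  have T1 := T0 _ s0; move: b1 b2 g1 g2 T1; set T1 := T _; set T2 := T _.
  rewrite !ler_norml => /andP[b1 _] /andP[_ b2] g1 g2 T1p.
  have u1 := step_upper h0 h2 rho0 (ltW e'0) he (_ : T2 - rho <= e').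
  have u2 := step_lower h0 h2 rho0 (ltW e'0) he (_ : rho - T1 <= e') T1p.
  have {}u1 := u1 b2; have {}u2 : h * (rho - 2 * e') <= (1 - expR (- h)) * T1 by apply: u2; rewrite -opprB lerNl.
  move: (G (m0%:R + i.+1%:R * h)) g1 g2 => g' g1 g2.
  have -> : i.+1%:R = i%:R + 1 :> R by rewrite -addn1 natrD.
  by rewrite !mulrDl !mul1r; move: u1 u2 g1 g2 IH1 IH2; clear => *; apply/andP; split; lra.
have G0 : 0 <= `|G m0%:R| + rho * m0%:R by rewrite addr_ge0 // mulr_ge0.
have [m1 hm1] := arch _ (divr_ge0 G0 (ltW e'0)).
exists (m0 + m1)%N => m hm; have [k mk] : exists k, m = (m0 + k)%N.
  by exists (m - m0)%N; rewrite subnKC // (leq_trans _ hm) // leq_addr.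
have knh : (k * n.+2)%:R * h = k%:R by rewrite natrM -mulrA nh mulr1.
have := ind (k * n.+2)%N; rewrite !mulrA knh -natrD -mk => /andP[g1 g2].
have m1m : (m1%:R : R) <= m%:R by rewrite ler_nat (leq_trans _ hm) // leq_addl.
have hm2 : `|G m0%:R| + rho * m0%:R <= e' * m%:R.
  by have := le_trans hm1 m1m; rewrite ler_pdivrMr // [m%:R * _]mulrC.
have kr : (k%:R : R) <= m%:R by rewrite ler_nat mk leq_addl.
have mkr : m%:R = m0%:R + k%:R :> R by rewrite mk natrD.
have ek : e' * k%:R <= e' * m%:R by rewrite ler_pM2l.
have e4 : e * m%:R = 4 * (e' * m%:R) by rewrite e'E; ring.
have mm : 0 <= e' * m%:R by rewrite mulr_ge0 // ltW.
have rm : rho * m%:R = rho * m0%:R + k%:R * rho by rewrite mkr; ring.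
have := ler_norm (G m0%:R); have := ler_norm (- G m0%:R); rewrite normrN => n1 n2.
have rm0 : 0 <= rho * m0%:R by rewrite mulr_ge0.
rewrite ler_norml e4; move: g1 g2 hm2 ek mm rm n1 n2 rm0; clear => *; apply/andP; split; lra.
Qed.

End CoefficientLimit.

(** * Comparison of the coefficient sums with the logarithmic model sum *)

Section CoefficientSums.
Variable R : realType.
Local Notation C := R[i].
Implicit Types (N : int) (s t v h x : R).

Definition rsum (I : eqType) (g : I -> R) : R := complex.Re (tsum (fun i => rc (g i) : C)).

Lemma rsumP (I : eqType) (g : I -> R) M : (forall i, 0 <= g i) -> bsum g M ->
  hsum (fun i => rc (g i) : C) (rc (rsum g)) /\ 0 <= rsum g <= M.
Proof.
move=> g0 gM; have gM' : absb (fun i => rc (g i) : C) M by apply: bsum_le gM => i; rewrite cabs_rc ger0_norm.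
have h := tsumP gM'; have e := hsum_real h; rewrite /rsum -e; split => //.
rewrite e in h; rewrite (hsum_ge0 g0 h) /=; apply: le_trans (ler_norm _) _; apply: le_trans (Re_le_cabs _) _.
by rewrite {1}e; exact: hsum_le h gM'.
Qed.

Lemma rsum_eq (I : eqType) (g : I -> R) s : hsum (fun i => rc (g i) : C) (rc s) -> rsum g = s.
Proof. by move=> /tsum_eq h; rewrite /rsum h. Qed.

Lemma hsum_ler (I : eqType) (g g' : I -> R) s s' : hsum (fun i => rc (g i) : C) (rc s) ->
  hsum (fun i => rc (g' i) : C) (rc s') -> (forall i, g i <= g' i) -> s <= s'.
Proof.
move=> h h' gg; rewrite -subr_ge0; apply: (@hsum_ge0 _ _ (fun i => g' i - g i)) => [i|]; first by rewrite subr_ge0.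
by rewrite rcB; apply: hsum_ext (hsumB h' h) => i; rewrite rcB.
Qed.

Lemma hsum_rcZ (I : eqType) (g : I -> R) s c : hsum (fun i => rc (g i) : C) (rc s) ->
  hsum (fun i => rc (c * g i) : C) (rc (c * s)).
Proof. by move=> h; rewrite rcM; apply: hsum_ext (hsumZ (rc c) h) => i; rewrite rcM. Qed.

Lemma hsum_rcB (I : eqType) (g g' : I -> R) s s' : hsum (fun i => rc (g i) : C) (rc s) ->
  hsum (fun i => rc (g' i) : C) (rc s') -> hsum (fun i => rc (g i - g' i) : C) (rc (s - s')).
Proof. by move=> h h'; rewrite rcB; apply: hsum_ext (hsumB h h') => i; rewrite rcB. Qed.

Definition UL N t := rsum (onN N (fun x => expR (- (t * x)))).
Definition GL N t := rsum (onN N (fun x => expR (- (t * x)) / x)).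

Lemma onN_exp_ge0 N t j : 0 <= onN N (fun x => expR (- (t * x))) j.
Proof. by apply: onN_ge0 => x _; exact: expR_ge0. Qed.

Lemma onN_log_ge0 N t j : 0 <= onN N (fun x => expR (- (t * x)) / x) j.
Proof. by apply: onN_ge0 => x x1; rewrite divr_ge0 ?expR_ge0 // (le_trans ler01). Qed.

Lemma UL_hsum N t : nonsq N -> 0 < t <= 1 -> hsum (fun j => rc (onN N (fun x => expR (- (t * x))) j) : C) (rc (UL N t)).
Proof. by move=> nsq t1; have [K _ hK] := onN_exp_bound R; exact: (rsumP (onN_exp_ge0 N t) (hK N nsq t t1)).1. Qed.

Lemma GL_hsum N t : nonsq N -> 0 < t <= 1 -> hsum (fun j => rc (onN N (fun x => expR (- (t * x)) / x) j) : C) (rc (GL N t)).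
Proof.
move=> nsq t1; have [K _ hK] := onN_exp_bound R; apply: (rsumP (onN_log_ge0 N t) _).1.
apply: bsum_le (hK N nsq t t1) => j; apply: onN_le => x x1.
by rewrite ler_pdivrMr ?(lt_le_trans ltr01) // ler_peMr ?expR_ge0.
Qed.

(** In the variable s = -log t, the derivative of [GL] is t times [UL], which tends to pi H(n) /
    sqrt n by [count_asymptotics]. [log_average] integrates this to linear growth in [m]. *)
Lemma GL_lim (n : nat) : (0 < n)%N -> forall e : R, 0 < e -> exists m0 : nat, forall m, (m0 <= m)%N ->
  `|GL n (tm R m) - pi / Num.sqrt n%:R * ratr (hurwitz n) * m%:R| <= e * m%:R.
Proof.
move=> n0; have nsq : nonsq n by move=> [x]; have := sqr_ge0 x; lia.
have ex (s : R) : 0 <= s -> 0 < expR (- s) <= 1 by move=> s0; rewrite expR_gt0 -[X in _ <= X]expR0 ler_expR oppr_le0.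
apply: (@log_average R (fun s => GL n (expR (- s))) (fun s => expR (- s) * UL n (expR (- s)))).
- apply: mulr_ge0; first by rewrite divr_ge0 ?pi_ge0 ?sqrtr_ge0.
  by rewrite ler0q; have /andP[] := hurwitz_bounds n0.
- move=> s s0; rewrite mulr_ge0 ?expR_ge0 //.
  by apply: hsum_ge0 (UL_hsum nsq (ex s s0)) => j; exact: onN_exp_ge0.
- move=> s h s0 /andP[h0 h1]; have sh : 0 <= s + h by rewrite addr_ge0.
  have hd := hsum_rcB (GL_hsum nsq (ex _ sh)) (GL_hsum nsq (ex s s0)).
  have eh : expR (- s) = expR h * expR (- (s + h)) by rewrite -expRD; congr expR; ring.
  have eh' : expR (- (s + h)) = expR (- h) * expR (- s) by rewrite -expRD; congr expR; ring.
  rewrite !mulrA; apply/andP; split.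
    apply: hsum_ler (hsum_rcZ _ (UL_hsum nsq (ex s s0))) hd _ => j.
    rewrite /onN; case: ifP => [/(jj_ge1 R)|_]; last by rewrite mulr0 subrr.
    move: (jj R j) => x x1; have x0 : 0 < x by exact: lt_le_trans x1.
    rewrite -mulrBl ler_pdivlMr //; move: (expR (- s)) eh' => t ->; set t' := expR (- h) * t.
    have -> : expR (- (t' * x)) = expR (- (t * x)) * expR (t * x - t' * x) by rewrite -expRD; congr expR; ring.
    have := ler_wpM2l (expR_ge0 (- (t * x))) (expR_ge1Dx (t * x - t' * x)); rewrite /t'; lra.
  apply: hsum_ler hd (hsum_rcZ _ (UL_hsum nsq (ex _ sh))) _ => j.
  rewrite /onN; case: ifP => [/(jj_ge1 R)|_]; last by rewrite mulr0 subrr.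
  move: (jj R j) => x x1; have x0 : 0 < x by exact: lt_le_trans x1.
  rewrite -mulrBl ler_pdivrMr //; move: (expR (- (s + h))) eh => t' ->; set t := expR h * t'.
  have -> : expR (- (t * x)) = expR (- (t' * x)) * expR (- (t * x - t' * x)) by rewrite -expRD; congr expR; ring.
  have := ler_wpM2l (expR_ge0 (- (t' * x))) (expR_ge1Dx (- (t * x - t' * x))); rewrite /t; lra.
move=> e e0; have [K hK] := count_asymptotics R n0.
have [m0 hm0] : exists m0 : nat, `|K| / e <= m0%:R.
  have c0 : 0 <= `|K| / e by rewrite divr_ge0 // ltW.
  by exists (Num.truncn (`|K| / e)).+1; have /andP[_ /ltW] := truncn_itv c0.
exists m0 => s hs; have s0 : 0 <= s by exact: le_trans hs.
have t1 := ex s s0; have [U hU1 hU2] := hK _ t1.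
have -> : UL n (expR (- s)) = U.
  apply: rsum_eq; apply: hsum_ext hU2 => j; rewrite /onN /jth /jj; by case: ifP.
apply: le_trans hU1 _; have /andP[t0 _] := t1.
apply: (@le_trans _ _ (`|K| * expR (- s))); first by rewrite ler_pM2r // ler_norm.
have := expR_ge1Dx s; rewrite expRN ler_pdivrMr ?expR_gt0 // => h.
rewrite -ler_pdivrMl // mulrC; apply: le_trans hm0 _; lra.
Qed.

(** Completing a square bounds 4 pi v x^2 from below by x minus a constant, which trades Gaussian
    decay for the simple exponential occurring in [GL]. *)
Lemma om_exp_bound v : 0 < v -> exists2 K : R, 0 <= K & forall N x, 0 < x ->
  om v N%:~R (x ^+ 2) <= K * expR (- (pi * v / 2 * `|N|%N%:R)) * expR (- x).
Proof.
move=> v0; have [K K0 hK] := om_decay v0; have p0 : 0 < pi * v by rewrite mulr_gt0 ?pi_gt0.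
exists (K * expR ((16 * (pi * v))^-1)) => [|N x x0]; first by rewrite mulr_ge0 ?expR_ge0.
apply: le_trans (hK N%:~R _ (exprn_gt0 2 x0)) _; rewrite -[leRHS]mulrA -[leRHS]mulrA ler_wpM2l // -!expRD ler_expR.
have -> : `|N%:~R| = `|N|%N%:R :> R by rewrite -intr_norm pmulrn abszE.
have : 0 <= (2 * (pi * v) * x - 1 / 4) ^+ 2 / (pi * v) by rewrite divr_ge0 ?sqr_ge0 // ltW.
have -> : (2 * (pi * v) * x - 1 / 4) ^+ 2 / (pi * v) = 4 * (pi * v) * x ^+ 2 - x + (16 * (pi * v))^-1.
  by move: (pi * v) p0 => p p0; field; rewrite gt_eqF.
move: (pi * v) => p; lra.
Qed.

Definition SL v N t := rsum (onN N (fun x => om v N%:~R ((t * x) ^+ 2) / x)).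

Lemma SL_hsum v N t : 0 < v -> nonsq N -> 0 < t <= 1 ->
  (forall j, 0 <= onN N (fun x => om v N%:~R ((t * x) ^+ 2) / x) j) /\
  hsum (fun j => rc (onN N (fun x => om v N%:~R ((t * x) ^+ 2) / x) j) : C) (rc (SL v N t)).
Proof.
move=> v0 nsq t1; have /andP[t0 _] := t1; have [K K0 hK] := om_exp_bound v0.
have g0 j : 0 <= onN N (fun x => om v N%:~R ((t * x) ^+ 2) / x) j.
  apply: onN_ge0 => x x1; have x0 : 0 < x by exact: lt_le_trans x1.
  by rewrite divr_ge0 ?(ltW x0) // om_ge0 // exprn_gt0 // mulr_gt0.
split=> //; set c := K * expR (- (pi * v / 2 * `|N|%N%:R)).
have c0 : 0 <= c by rewrite mulr_ge0 ?expR_ge0.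
have b := hsum_bsum (onN_log_ge0 N t) (GL_hsum nsq t1).
apply: (rsumP g0 _).1; apply: bsum_le (bsumZ c0 b) => j; rewrite /onN; case: ifP => [/(jj_ge1 R)|_]; last by rewrite mulr0.
move: (jj R j) => x x1; have x0 : 0 < x by exact: lt_le_trans x1.
by rewrite mulrA ler_pM2r ?invr_gt0 //; apply: hK; rewrite mulr_gt0.
Qed.

Lemma SL_bound v : 0 < v -> exists2 K : R, 0 <= K & forall N, nonsq N -> forall m,
  0 <= SL v N (tm R m) <= K * expR (- (pi * v / 2 * `|N|%N%:R)) * (`|N|%N.+1%:R) ^+ 3 * m.+1%:R.
Proof.
move=> v0; have [K K0 hK] := om_exp_bound v0; have [K' K'0 hK'] := onN_log_bound R.
exists (K * K') => [|N nsq m]; first by rewrite mulr_ge0.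
have t1 := tm01 R m; have /andP[t0 _] := t1; have [g0 h] := SL_hsum v0 nsq t1.
rewrite (hsum_ge0 g0 h) /=; set c := K * expR (- (pi * v / 2 * `|N|%N%:R)).
have c0 : 0 <= c by rewrite mulr_ge0 ?expR_ge0.
have b : bsum (onN N (fun x => om v N%:~R ((tm R m * x) ^+ 2) / x)) (c * (K' * (`|N|%N.+1%:R) ^+ 3 * m.+1%:R)).
  apply: bsum_le (bsumZ c0 (hK' N nsq m)) => j; rewrite /onN; case: ifP => [/(jj_ge1 R)|_]; last by rewrite mulr0.
  move: (jj R j) => x x1; have x0 : 0 < x by exact: lt_le_trans x1.
  by rewrite mulrA ler_pM2r ?invr_gt0 //; apply: hK; rewrite mulr_gt0.
have /andP[_] := (rsumP g0 b).2; rewrite -/(SL _ _ _) => hb; apply: le_trans hb _.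
by rewrite le_eqVlt; apply/orP; left; apply/eqP; rewrite /c; ring.
Qed.

(** Both kernels tend to [o] as t x tends to 0. Where t x is small their difference is a small
    multiple of exp(-t x) / x, which costs a small multiple of m; elsewhere 1 / x is at most a
    constant times t, and the contribution stays bounded. *)
Lemma SL_GL v N o : 0 < v -> nonsq N -> 0 <= o ->
  (forall e, 0 < e -> exists2 d, 0 < d & forall h, 0 < h < d -> `|om v N%:~R h - o| <= e) ->
  forall e, 0 < e -> exists m0 : nat, forall m, (m0 <= m)%N -> `|SL v N (tm R m) - o * GL N (tm R m)| <= e * m.+1%:R.
Proof.
move=> v0 nsq o0 ho e e0.
have [K K0 hK] := om_exp_bound v0; have [K1 K10 hK1] := onN_exp_bound R; have [K2 K20 hK2] := onN_log_bound R.
set M : R := (`|N|%N.+1%:R) ^+ 3; have M0 : 0 <= M by rewrite exprn_ge0.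
pose e1 : R := expR 1; have e10 : 0 < e1 by exact: expR_gt0.
have KM : 0 < K2 * M + 1 by rewrite ltr_wpDl // mulr_ge0.
have [et et0 etE] : exists2 et, 0 < et & e = 4 * et * e1 * (K2 * M + 1).
  by exists (e / (4 * e1 * (K2 * M + 1))); [rewrite divr_gt0 // !mulr_gt0|field; rewrite !gt_eqF].
have [d0 d00 hd0] := ho et et0; have o1 : 0 < o + 1 by rewrite ltr_wpDl.
(* [de] is the threshold for t x. Below it (t x)^2 < [d0], the exponential times [o] is within [et]
   of [o], and exp(-t x) >= 1 / e, which explains the factor [e1]. *)
have [de de0 [de1 de2 de3]] : exists2 de, 0 < de & [/\ de <= 1, de <= Num.sqrt d0 / 2 & de <= et / (o + 1)].
  exists (Num.min 1 (Num.min (Num.sqrt d0 / 2) (et / (o + 1)))).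
    by rewrite !lt_min ltr01 /= !divr_gt0 // sqrtr_gt0.
  by rewrite !ge_min !lexx !orbT.
have kk N' x : 0 < x -> om v N'%:~R (x ^+ 2) <= K * expR (- x).
  move=> x0; apply: le_trans (hK N' x x0) _; rewrite ler_wpM2r ?expR_ge0 // ler_piMr //.
  by rewrite -[leRHS]expR0 ler_expR oppr_le0 mulr_ge0 // divr_ge0 // mulr_ge0 ?pi_ge0 // ltW.
have [B B0 BE] : exists2 B, 0 <= B & B = (K + o) / de * (K1 * M).
  by eexists; [|reflexivity]; apply: mulr_ge0; [rewrite divr_ge0 ?addr_ge0 // ltW|exact: mulr_ge0].
have [m0 hm0] : exists m0 : nat, 2 * B / e <= m0%:R.
  have c0 : 0 <= 2 * B / e by rewrite divr_ge0 ?mulr_ge0 // ltW.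
  by exists (Num.truncn (2 * B / e)).+1; have /andP[_ /ltW] := truncn_itv c0.
exists m0 => m hm; have t1 := tm01 R m; have /andP[t0 _] := t1; set t := tm R m in t0 t1 *.
have [g0 hS] := SL_hsum v0 nsq t1.
have := hsum_rcB hS (hsum_rcZ o (GL_hsum nsq t1)) => hd.
have e2 : 0 <= 2 * et * e1 by rewrite !mulr_ge0 // ltW.
have e3 : 0 <= (K + o) / de * t by rewrite mulr_ge0 ?divr_ge0 ?addr_ge0 // ltW.
have bb := bsumD (bsumZ e2 (hK2 N nsq m)) (bsumZ e3 (hK1 N nsq t t1)).
have : absb (fun j => rc (onN N (fun x => om v N%:~R ((t * x) ^+ 2) / x) j - o * onN N (fun x => expR (- (t * x)) / x) j) : C)
   (2 * et * e1 * (K2 * M * m.+1%:R) + (K + o) / de * t * (K1 * M / t)).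
  apply: bsum_le bb => j; rewrite /onN; case: ifP => [/(jj_ge1 R)|_]; last by rewrite !mulr0 addr0 subrr rc0 cabs0.
  move: (jj R j) => x x1; have x0 : 0 < x by exact: lt_le_trans x1.
  rewrite -/t cabs_rc mulrA -mulrBl normrM (gtr0_norm (_ : 0 < x^-1)) ?invr_gt0 //.
  rewrite -(ler_pM2r x0) mulfVK ?gt_eqF // mulrDl !mulrA mulfVK ?gt_eqF //.
  have tx : 0 < t * x by rewrite mulr_gt0.
  have E0 : 0 <= expR (- (t * x)) by exact: expR_ge0.
  have [c|c] := lerP (t * x) de.
    have hh : 0 < (t * x) ^+ 2 < d0.
      rewrite exprn_gt0 //=; have : (t * x) ^+ 2 <= (Num.sqrt d0 / 2) ^+ 2.
        by rewrite ler_pXn2r ?nnegrE ?(ltW tx) ?divr_ge0 ?sqrtr_ge0 // (le_trans c).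
      have -> : (Num.sqrt d0 / 2) ^+ 2 = d0 / 4 by rewrite expr_div_n sqr_sqrtr ?(ltW d00) //; field.
      lra.
    have h1 := hd0 _ hh; have h2 := expR_ge1Dx (- (t * x)).
    have h3 : `|o - o * expR (- (t * x))| <= et.
      have E1 : expR (- (t * x)) <= 1 by rewrite -[leRHS]expR0 ler_expR oppr_le0 ltW.
      have -> : o - o * expR (- (t * x)) = o * (1 - expR (- (t * x))) by ring.
      rewrite ger0_norm; last by rewrite mulr_ge0 // subr_ge0.
      apply: (@le_trans _ _ (o * (et / (o + 1)))); first by rewrite ler_wpM2l //; lra.
      by rewrite mulrA ler_pdivrMr // mulrDr mulr1 mulrC lerDl ltW.
    have h4 : 1 <= e1 * expR (- (t * x)) by rewrite /e1 -expRD -[leLHS]expR0 ler_expR; lra.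
    apply: (@le_trans _ _ (2 * et * e1 * expR (- (t * x)))); last first.
      by rewrite lerDl !mulr_ge0 ?invr_ge0 ?addr_ge0 // ltW.
    have := ler_normD (om v N%:~R ((t * x) ^+ 2) - o) (o - o * expR (- (t * x))); rewrite subrKA => h5.
    have et2 : 0 <= 2 * et by rewrite mulr_ge0 // ltW.
    by have := ler_wpM2l et2 h4; lra.
  have hx : 1 <= t * x / de by rewrite ler_pdivlMr // mul1r ltW.
  apply: (@le_trans _ _ ((K + o) * expR (- (t * x)))).
    have om0 : 0 <= om v N%:~R ((t * x) ^+ 2) by rewrite om_ge0 // exprn_gt0.
    have oE0 : 0 <= o * expR (- (t * x)) by rewrite mulr_ge0.
    by apply: le_trans (ler_normB _ _) _; rewrite (ger0_norm om0) (ger0_norm oE0) mulrDl lerD2r kk.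
  apply: ler_wpDl; first by rewrite !mulr_ge0 // ltW.
  have -> : (K + o) / de * t * expR (- (t * x)) * x = (K + o) * expR (- (t * x)) * (t * x / de) by ring.
  by rewrite ler_peMr // mulr_ge0 // addr_ge0.
move/(hsum_le hd); rewrite cabs_rc => H; apply: le_trans H _.
have -> : (K + o) / de * t * (K1 * M / t) = B by rewrite BE; field; rewrite !gt_eqF.
have mr : (0 : R) <= m.+1%:R by exact: ler0n.
have p1 : 2 * et * e1 * (K2 * M * m.+1%:R) <= e / 2 * m.+1%:R.
  rewrite mulrA ler_wpM2r //; have -> : e / 2 = 2 * et * e1 * (K2 * M + 1).
    by rewrite etE; field.
  by rewrite ler_wpM2l // lerDl.
have p2 : B <= e / 2 * m.+1%:R.
  have mm : (m0%:R : R) <= m.+1%:R by rewrite ler_nat leqW.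
  by have := le_trans hm0 mm; rewrite ler_pdivrMr //; lra.
lra.
Qed.

End CoefficientSums.

(** * Convergence of the normalised averages to the class number series *)

Section SieveLimit.
Variable R : realType.
Local Notation C := R[i].
Implicit Types (N : int) (t v x : R) (tau : C).

Lemma Gm_om t v k (A : int) N : 0 < t -> 0 < v -> A != 0 ->
  Gm (t ^+ 2) v ((k, A), N) = (rA `|A|%N N)%:R * (om v N%:~R ((t * (k.+1%:R ^+ 2 * `|A|%N%:R)) ^+ 2) / (k.+1%:R ^+ 2 * `|A|%N%:R)).
Proof.
move=> t0 v0 A0; rewrite /Gm /= (negbTE A0) /row_coef; have B0 : (0 < `|A|)%N by rewrite absz_gt0.
set x : R := k.+1%:R; have x0 : 0 < x by rewrite ltr0n.
have e0 : 0 < t ^+ 2 * x ^+ 4 by rewrite mulr_gt0 // exprn_gt0.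
have h := om_scale N%:~R B0 v0 e0; set a : R := `|A|%N%:R in h *; have a0 : 0 < a by rewrite ltr0n.
have -> : (rA `|A|%N N)%:R / Num.sqrt a * OM (4 * a * v) (t ^+ 2 * x ^+ 4 / v) (N%:~R / (4 * a)) =
  (rA `|A|%N N)%:R * (OM (4 * a * v) (t ^+ 2 * x ^+ 4 / v) (N%:~R / (4 * a)) / Num.sqrt a) :> R by ring.
have e4 : t ^+ 2 * x ^+ 4 * a ^+ 2 = (t * (x ^+ 2 * a)) ^+ 2 by ring.
rewrite e4 in h; move: h; move: (OM _ _ _) (om v N%:~R _) => Z W h; rewrite h.
by rewrite [(x ^+ 2 * a)^-1]invfM; move: (x ^- 2) a^-1 => z u; ring.
Qed.

(** The rows [A] and [-A] have equal coefficients, whence the factor 2. Spreading the count [rA]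
    over the residues [B] themselves identifies the sum over (k, A) with the triple sum [SL]. *)
Lemma Gm_slice t v N : 0 < t <= 1 -> 0 < v -> nonsq N ->
  hsum (fun p : nat * int => rc (Gm (t ^+ 2) v (p, N)) : C) (rc (2 * SL v N t)).
Proof.
move=> t1 v0 nsq; have /andP[t0 _] := t1; have [_ h] := SL_hsum v0 nsq t1.
have [om1 OE] : exists om1 : R -> R, om1 = om v N%:~R by eexists.
rewrite -OE in h; pose g (p : nat * nat) : R := if p.2 == 0%N then 0 else (rA p.2 N)%:R *
  (om1 ((t * (p.1.+1%:R ^+ 2 * p.2%:R)) ^+ 2) / (p.1.+1%:R ^+ 2 * p.2%:R)).
have hg : hsum (fun p => rc (g p) : C) (rc (SL v N t)).
  apply: hsum_fubini (reassoc h) => -[k A]; rewrite /onN /jj /=.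
  set y : R := om1 _ / _.
  have -> : rc (g (k, A)) = \sum_(B <- iota 0 A.*2) rc (if rAw A B N then y else 0) :> C.
    rewrite /g /=; case: eqP => [->|/eqP A0]; first by rewrite double0 big_nil rc0.
    rewrite -/y -rc_sum; congr rc.
    have -> : iota 0 A.*2 = index_iota 0 A.*2 by rewrite /index_iota subn0.
    rewrite big_mkord /rA natr_sum mulr_suml.
    apply: eq_bigr => B _; rewrite /rAw lt0n A0 ltn_ord /=; case: (_ %| _)%Z; by rewrite ?mul1r ?mul0r.
  apply: hsum_fin => [|B]; first exact: iota_uniq.
  rewrite mem_iota add0n leq0n /= => B0; rewrite /rAw (negbTE B0) andbF; exact: rc0.
have sgn (P : pred int) : (forall A, P A -> A != 0) -> (forall A B : int, P A -> P B -> absz A = absz B -> A = B) ->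
    (forall n : nat, n != 0%N -> exists2 A : int, P A & absz A = n) ->
  hsum (fun p : nat * int => if P p.2 then rc (g (p.1, absz p.2)) else 0 : C) (rc (SL v N t)).
  move=> P0 Pi Ps; apply: (hsum_on (h := fun p : nat * int => (p.1, absz p.2)) (P := fun p => P p.2)) hg.
    by move=> [k A] [k' A'] PA PA' [-> e]; rewrite (Pi A A').
  move=> [k n]; rewrite /g /=; case: (n =P 0%N) => [_|/eqP n0 _]; first by rewrite rc0 eqxx.
  by have [A PA <-] := Ps n n0; exists (k, A).
have h1 : hsum (fun p : nat * int => if 0 < p.2 then rc (g (p.1, absz p.2)) else 0 : C) (rc (SL v N t)).
  apply: (sgn (fun A => 0 < A)) => [A|A B|n n0]; [lia|lia|exists n%:Z; lia].
have h2 : hsum (fun p : nat * int => if p.2 < 0 then rc (g (p.1, absz p.2)) else 0 : C) (rc (SL v N t)).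
  apply: (sgn (fun A => A < 0)) => [A|A B|n n0]; [lia|lia|exists (- n%:Z); lia].
have -> : rc (2 * SL v N t) = rc (SL v N t) + rc (SL v N t) :> C by rewrite -rcD; congr rc; ring.
apply: hsum_ext (hsumD h1 h2) => -[k A] /=; have [A0|A0|->] := ltrgt0P A; last by rewrite /Gm /= addr0 rc0.
  by rewrite addr0 Gm_om ?gt_eqF // -OE /g /= (negbTE (_ : `|A|%N != 0%N)) // absz_eq0 gt_eqF.
by rewrite add0r Gm_om ?lt_eqF // -OE /g /= (negbTE (_ : `|A|%N != 0%N)) // absz_eq0 lt_eqF.
Qed.

Lemma Fb_coefficients (a : nat) (b : int) t tau : (0 < a)%N -> (forall N, (a%:Z %| N - b)%Z -> nonsq N) ->
  0 < t <= 1 -> 0 < complex.Im tau ->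
  hsum (fun N => if (a%:Z %| N - b)%Z then rc (2 * SL (complex.Im tau) N t) * ce (N%:~R * complex.Re tau) else 0)
    (Fb a b (t ^+ 2) tau).
Proof.
move=> a0 nsq t1 v0; have /andP[t0 _] := t1.
have ab : ~~ (a%:Z %| b)%Z.
  by apply/negP => ab; apply: (nsq 0); [rewrite sub0r rpredN|exists 0; rewrite expr0n oppr0].
have h := hsum_swap (Fb_hsum a0 ab (exprn_gt0 2 t0) v0).
apply: hsum_fubini h => N /=; case: ifP => [/nsq/(Gm_slice t1 v0) h|_]; last exact: hsum0.
rewrite [rc (2 * _) * _]mulrC; apply: hsum_ext (hsumZ (ce (N%:~R * complex.Re tau)) h) => p; exact: mulrC.
Qed.

(** The product of 2 for the rows [A] and [-A], of 2 pi sqrt(2 N) from the limit of the kernel, and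
    of the density pi / sqrt N multiplying H(N). *)
Definition sieve_const : R := 4 * Num.sqrt 2 * pi ^+ 2.

Lemma sieve_const_gt0 : 0 < sieve_const.
Proof. by rewrite /sieve_const mulr_gt0 ?mulr_gt0 ?sqrtr_gt0 ?exprn_gt0 ?pi_gt0. Qed.

Definition coef_lim v N : R :=
  if 0 < N then sieve_const * ratr (hurwitz `|N|%N) * expR (- (2 * pi * v * `|N|%N%:R)) else 0.

Lemma SL_lim v N : 0 < v -> nonsq N -> forall e, 0 < e -> exists m0 : nat, forall m, (m0 <= m)%N ->
  `|2 * SL v N (tm R m) / m.+1%:R - coef_lim v N| <= e.
Proof.
move=> v0 nsq e e0.
(* [main] treats both signs: for N > 0 through the growth of [GL], for N < 0 with kernel limit
   [o = 0], where the comparison term vanishes. *)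
have main (o l : R) : 0 <= o -> 0 <= l ->
    (forall e, 0 < e -> exists2 d, 0 < d & forall h, 0 < h < d -> `|om v N%:~R h - o| <= e) ->
    (o = 0 \/ forall e : R, 0 < e -> exists m0 : nat, forall m, (m0 <= m)%N -> `|GL N (tm R m) - l * m%:R| <= e * m%:R) ->
  exists m0 : nat, forall m, (m0 <= m)%N -> `|2 * SL v N (tm R m) / m.+1%:R - 2 * o * l| <= e.
  move=> o0 l0 ho hl; have e6 : 0 < e / 6 by rewrite divr_gt0.
  have [m1 h1] := SL_GL v0 nsq o0 ho e6.
  have [m2 h2] : exists m2 : nat, forall m, (m2 <= m)%N -> `|o * GL N (tm R m) - o * l * m%:R| <= e / 6 * m.+1%:R.
    case: hl => [->|hl].
      by exists 0%N => m _; rewrite !mul0r subr0 normr0 mulr_ge0 // ltW.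
    have o1 : 0 < o + 1 by rewrite ltr_wpDl.
    have [m2 h2] := hl (e / 6 / (o + 1)) (divr_gt0 e6 o1); exists m2 => m hm.
    rewrite -mulrA -mulrBr normrM (ger0_norm o0); apply: le_trans (ler_wpM2l o0 (h2 m hm)) _.
    have -> : o * (e / 6 / (o + 1) * m%:R) = (o / (o + 1)) * (e / 6 * m%:R) by ring.
    have oo : 0 <= o / (o + 1) <= 1 by rewrite divr_ge0 ?(ltW o1) //= ler_pdivrMr // mul1r lerDl.
    have em : 0 <= e / 6 * m%:R by rewrite mulr_ge0 // ltW.
    case/andP: oo => _ oo; apply: le_trans (ler_wpM2r em oo) _; rewrite mul1r.
    by rewrite ler_pM2l // ler_nat.
  have [m3 h3] : exists m3 : nat, 6 * o * l / e <= m3%:R.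
    have c0 : 0 <= 6 * o * l / e by rewrite divr_ge0 ?mulr_ge0 // ltW.
    by exists (Num.truncn (6 * o * l / e)).+1; have /andP[_ /ltW] := truncn_itv c0.
  exists (maxn m1 (maxn m2 m3)) => m; rewrite !geq_max => /and3P[/h1 a1 /h2 a2 m3m].
  have n0 : (0 : R) < m.+1%:R by rewrite ltr0n.
  have a3 : o * l <= e / 6 * m.+1%:R.
    have : (m3%:R : R) <= m.+1%:R by rewrite ler_nat leqW.
    by move=> /(le_trans h3); rewrite ler_pdivrMr //; lra.
  have -> : 2 * SL v N (tm R m) / m.+1%:R - 2 * o * l = 2 * (SL v N (tm R m) - o * l * m.+1%:R) / m.+1%:R.
    by field; rewrite gt_eqF.
  rewrite normrM (gtr0_norm (_ : 0 < m.+1%:R^-1)) ?invr_gt0 // ler_pdivrMr // normrM ger0_norm //.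
  have ol : 0 <= o * l by rewrite mulr_ge0.
  have -> : SL v N (tm R m) - o * l * m.+1%:R = (SL v N (tm R m) - o * GL N (tm R m)) +
     (o * GL N (tm R m) - o * l * m%:R) - o * l by rewrite -natr1; ring.
  have := ler_normB ((SL v N (tm R m) - o * GL N (tm R m)) + (o * GL N (tm R m) - o * l * m%:R)) (o * l).
  have := ler_normD (SL v N (tm R m) - o * GL N (tm R m)) (o * GL N (tm R m) - o * l * m%:R).
  rewrite (ger0_norm ol); lra.
rewrite /coef_lim; case: ifP => [N0|/negbT].
  have nE : N = `|N|%N%:Z by lia.
  set n := `|N|%N in nE *; rewrite nE in main; have n0 : (0 < n)%N by lia.
  have nr : (0 : R) < n%:R by rewrite ltr0n.
  have l0 : 0 <= pi / Num.sqrt n%:R * ratr (hurwitz n) :> R.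
    apply: mulr_ge0; first by rewrite divr_ge0 ?pi_ge0 ?sqrtr_ge0.
    by rewrite ler0q; have /andP[] := hurwitz_bounds n0.
  have o0 : 0 <= 2 * pi * Num.sqrt 2 * Num.sqrt n%:R * expR (- (2 * pi * v * n%:R)) :> R.
    by rewrite !mulr_ge0 ?pi_ge0 ?sqrtr_ge0 ?expR_ge0.
  have ho := om_lim v0 nr; have [|m0 hm] := main _ _ o0 l0 ho; first by right; exact: GL_lim.
  exists m0 => m /hm; rewrite -nE; congr (`|_ - _| <= _); rewrite /sieve_const.
  have : 0 < Num.sqrt (n%:R : R) by rewrite sqrtr_gt0.
  move: (Num.sqrt (n%:R : R)) (ratr (hurwitz n) : R) (expR (- (2 * pi * v * n%:R))) (Num.sqrt 2) (pi : R) => q r x s p q0.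
  by field; rewrite gt_eqF.
rewrite -leNgt => N0; have N1 : N <= -1.
  have : N != 0 by apply/eqP => e'; apply: nsq; exists 0; rewrite e' expr0n oppr0.
  lia.
have [K K0 hK] := om_neg v0.
have Nr : N%:~R <= -1 :> R by have : (N%:~R : R) <= (-1)%:~R by rewrite ler_int.
have [||m0 hm] := main 0 0 (lexx _) (lexx _); last by exists m0 => m /hm; rewrite !mulr0.
  move=> e' e'0; have K1 : 0 < K + 1 by rewrite ltr_wpDl.
  exists (e' / (K + 1)) => [|h /andP[h0 h1]]; first by rewrite divr_gt0.
  rewrite subr0 ger0_norm ?om_ge0 //; apply: le_trans (hK _ h h0 Nr) _.
  by move: h1; rewrite ltr_pdivlMr //; lra.
by left.
Qed.

Lemma bsum_exp_poly (c K : R) : 0 < c -> 0 <= K ->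
  exists M, bsum (fun N : int => K * expR (- (c * `|N|%N%:R)) * (`|N|%N.+1%:R) ^+ 3) M.
Proof.
move=> c0 K0; have [B B0 hB] := exp_growth 5 c0; exists (K * B * 8).
have B1 : 0 <= K * B by exact: mulr_ge0.
apply: bsum_le (bsumZ B1 (bsum_w R)) => N; rewrite -!mulrA ler_wpM2l //.
set n : R := `|N|%N%:R; have n0 : 0 <= n by rewrite /n.
have -> : w (N%:~R : R) = (1 + n ^+ 2)^-1.
  by rewrite /w /n -[N%:~R ^+ 2]real_normK ?num_real // -intr_norm pmulrn abszE.
rewrite -natr1 -/n ler_pdivlMr ?ltr_wpDr ?sqr_ge0 //.
have := hB (Num.sqrt n); rewrite sqr_sqrtr //; apply: le_trans.
have -> : expR (- (c * n)) * (n + 1) ^+ 3 * (1 + n ^+ 2) = (n + 1) ^+ 3 * (1 + n ^+ 2) * expR (- (c * n)) by ring.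
rewrite ler_wpM2r ?expR_ge0 // [1 + n]addrC (exprD _ 3 2) ler_wpM2l ?exprn_ge0 ?addr_ge0 //.
by rewrite sqrrD1; lra.
Qed.

Variables (a : nat) (b : int).
Hypotheses (a0 : (0 < a)%N) (nsq : forall N, (a%:Z %| N - b)%Z -> nonsq N).

Definition qsum_term tau (n : nat) : C :=
  if (a%:Z %| n%:Z - b)%Z then rc (ratr (hurwitz n) * expR (- (2 * pi * complex.Im tau * n%:R))) * ce (n%:R * complex.Re tau) else 0.

Definition qsum tau : C := tsum (qsum_term tau).

(** The bound of [SL_bound] passes to the limit; its factor [m.+1] is the one divided out in
    [SL_lim]. *)
Lemma coef_lim_bound v : 0 < v -> exists2 K : R, 0 <= K & forall N, nonsq N ->
  0 <= coef_lim v N <= K * expR (- (pi * v / 2 * `|N|%N%:R)) * (`|N|%N.+1%:R) ^+ 3.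
Proof.
move=> v0; have [K K0 hK] := SL_bound v0; exists (2 * K) => [|N hN]; first exact: mulr_ge0.
rewrite /coef_lim; apply/andP; split.
  case: ifP => // N0; have N1 : (0 < `|N|)%N by rewrite absz_gt0 gt_eqF.
  apply: mulr_ge0; last exact: expR_ge0.
  apply: mulr_ge0; first exact: ltW sieve_const_gt0.
  by rewrite ler0q; have /andP[] := hurwitz_bounds N1.
apply/ler_addgt0Pr => e e0; have [m0 hm] := SL_lim v0 hN e0.
have := hm m0 (leqnn _); rewrite -/(coef_lim v N) => h; have /andP[_] := hK N hN m0.
set B := _ * _ ^+ 3; have n0 : (0 : R) < m0.+1%:R by rewrite ltr0n.
rewrite -ler_pdivrMr // => h2; have := ler_norm (coef_lim v N - 2 * SL v N (tm R m0) / m0.+1%:R).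
rewrite distrC => h3; have := le_trans h3 h.
have -> : 2 * K * expR (- (pi * v / 2 * `|N|%N%:R)) * `|N|.+1%:R ^+ 3 = 2 * B by rewrite /B; ring.
move: h2; rewrite -[2 * _ / _]mulrA; move: (_ / _) (coef_lim v N) B => x y z; lra.
Qed.

Lemma qsum_hsum tau : 0 < complex.Im tau -> hsum (qsum_term tau) (qsum tau) /\
  hsum (fun N => if (a%:Z %| N - b)%Z then rc (coef_lim (complex.Im tau) N) * ce (N%:~R * complex.Re tau) else 0)
    (rc sieve_const * qsum tau).
Proof.
move=> v0; have [K K0 hK] := coef_lim_bound v0.
have c0 : 0 < pi * complex.Im tau / 2 by rewrite divr_gt0 // mulr_gt0 ?pi_gt0.
have [M hM] := bsum_exp_poly c0 K0; have s0 := sieve_const_gt0.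
set f := fun N : int => if (a%:Z %| N - b)%Z then rc (coef_lim (complex.Im tau) N) * ce (N%:~R * complex.Re tau) else 0.
have fM : absb f M.
  apply: bsum_le hM => N; rewrite /f; case: ifP => [/nsq/hK /andP[l0 l1]|_].
    by rewrite cabsM cabs_ce mulr1 cabs_rc ger0_norm.
  by rewrite cabs0 !mulr_ge0 ?expR_ge0 ?exprn_ge0.
have hf := tsumP fM.
have hq : hsum (qsum_term tau) (rc sieve_const^-1 * tsum f).
  have fE n : rc sieve_const^-1 * f n%:Z = qsum_term tau n.
    rewrite /f /qsum_term; case: ifP => [h|_]; last by rewrite mulr0.
    rewrite /coef_lim; case: ltrP => [n0|n0]; last first.
      exfalso; apply: (nsq h); exists 0; rewrite expr0n; lia.
    rewrite absz_nat mulrA -rcM; congr (rc _ * _).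
    by move: sieve_const s0 (ratr _ : R) => c c0' r; rewrite mulrA mulrA mulVf ?gt_eqF // mul1r.
  apply: hsum_ext fE _; apply: hsumZ; apply: (hsum_reindex (h := Posz) (k := absz) _ _ _).1 hf => // N.
  rewrite /f; case: ifP => [h|_]; last by rewrite eqxx.
  by rewrite /coef_lim; case: ltrP => [|_]; [lia|rewrite rc0 mul0r eqxx].
have qE := tsum_eq hq; rewrite -/(qsum tau) in qE; rewrite qE; split=> //.
by rewrite mulrA -rcM mulfV ?gt_eqF // mul1r.
Qed.

(** Dominated convergence over the frequencies: each coefficient converges by [SL_lim], under a
    majorant exp(-c |N|) (|N| + 1)^3 that does not depend on [m]. *)
Lemma Fb_lim tau e : 0 < complex.Im tau -> 0 < e -> exists m0 : nat, forall m, (m0 <= m)%N ->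
  cabs (Fb a b (tm R m ^+ 2) tau / m.+1%:R - rc sieve_const * qsum tau) <= e.
Proof.
move=> v0 e0; have [K K0 hK] := coef_lim_bound v0; have [K' K'0 hK'] := SL_bound v0.
have c0 : 0 < pi * complex.Im tau / 2 by rewrite divr_gt0 // mulr_gt0 ?pi_gt0.
have KK : 0 <= K + 2 * K' by rewrite addr_ge0 // mulr_ge0.
have [M hM] := bsum_exp_poly c0 KK; have [_ hs] := qsum_hsum v0.
have [|F [d d0 hF]] := tannery _ hM e0; first by move=> N; rewrite !mulr_ge0 ?expR_ge0 ?exprn_ge0.
have [m0 hm0] : exists m0 : nat, forall m, (m0 <= m)%N -> forall N, N \in F -> (a%:Z %| N - b)%Z ->
    `|2 * SL (complex.Im tau) N (tm R m) / m.+1%:R - coef_lim (complex.Im tau) N| <= d.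
  elim: F {hF} => [|N F [m1 h1]]; first by exists 0%N.
  case: (boolP (a%:Z %| N - b)%Z) => hN; last first.
    exists m1 => m /h1 h N'; rewrite inE => /orP[/eqP ->|/h //]; by rewrite (negbTE hN).
  have [m2 h2] := SL_lim v0 (nsq hN) d0; exists (maxn m1 m2) => m; rewrite geq_max => /andP[/h1 h /h2 h'] N'.
  by rewrite inE => /orP[/eqP -> //|/h].
exists m0 => m /hm0 h; have := hsumZ (m.+1%:R^-1) (Fb_coefficients a0 nsq (tm01 R m) v0) => hFb.
rewrite mulrC; have n0 : (0 : R) < m.+1%:R by rewrite ltr0n.
have nE (x y : R) : m.+1%:R^-1 * (rc (2 * x) * ce y) = rc (2 * x / m.+1%:R) * ce y :> C.
  by rewrite mulrA -(rc_nat R) -rcV -rcM; congr (rc _ * _); rewrite mulrC.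
apply: hF hFb hs _ _ _ => N; rewrite ?[_ \in _]/=.
- case: ifP => [/nsq hN|_]; last first.
    by rewrite mulr0 cabs0 !mulr_ge0 ?expR_ge0 ?exprn_ge0.
  rewrite nE cabsM cabs_ce mulr1 cabs_rc; have /andP[s0 s1] := hK' N hN m.
  rewrite ger0_norm ?divr_ge0 ?mulr_ge0 // ler_pdivrMr //.
  have E0 : 0 <= expR (- (pi * complex.Im tau / 2 * `|N|%:R)) * (`|N|.+1%:R ^+ 3 * m.+1%:R).
    by rewrite !mulr_ge0 ?expR_ge0 ?exprn_ge0.
  have := mulr_ge0 K0 E0; move: s1; set E := expR _; set n3 := _ ^+ 3; set mm := m.+1%:R.
  have -> : (K + 2 * K') * E * n3 * mm = K * (E * (n3 * mm)) + 2 * (K' * E * n3 * mm) by ring.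
  by move: (SL _ _ _) (K * _) (K' * _ * _ * _) => x y z; lra.
- case: ifP => [/nsq/hK /andP[l0 l1]|_]; last first.
    by rewrite cabs0 !mulr_ge0 ?expR_ge0 ?exprn_ge0.
  rewrite cabsM cabs_ce mulr1 cabs_rc ger0_norm //; apply: le_trans l1 _.
  by rewrite -!mulrA ler_wpM2r ?mulr_ge0 ?expR_ge0 ?exprn_ge0 // lerDl mulr_ge0.
move=> NF; case: ifP => [hN|_]; last by rewrite mulr0 subrr cabs0 ltW.
by rewrite nE -mulrBl -rcB cabsM cabs_ce mulr1 cabs_rc; exact: h.
Qed.

End SieveLimit.

(** * Growth of the class number series towards the real line *)

Section Growth.
Variable R : realType.
Local Notation C := R[i].
Implicit Types (x y : R).

Lemma bsum_geometric x : 0 < x -> bsum (fun c : int => if 0 < c then expR (- (x * c%:~R)) else 0) x^-1.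
Proof.
move=> x0; have h : bsum (fun n : nat => expR (- (x * n.+1%:R))) x^-1.
  apply: bsum_nat => [n|n]; first exact: expR_ge0.
  suff : \sum_(i < n) expR (- (x * i.+1%:R)) <= (1 - expR (- (x * n%:R))) / x.
    move=> h; apply: le_trans h _; rewrite -[leRHS]mul1r ler_wpM2r ?invr_ge0 ?(ltW x0) //.
  elim: n => [|n IH]; first by rewrite big_ord0 mulr0 oppr0 expR0 subrr mul0r.
  rewrite big_ord_recr /=; apply: le_trans (lerD IH (lexx _)) _.
  rewrite ler_pdivlMr // mulrDl mulfVK ?gt_eqF //.
  have -> : expR (- (x * n%:R)) = expR (- (x * n.+1%:R)) * expR x by rewrite -expRD -natr1; congr expR; ring.
  have := ler_wpM2l (expR_ge0 (- (x * n.+1%:R))) (expR_ge1Dx x); lra.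
apply: (bsum_on (h := fun c : int => (absz c).-1) (P := fun c => 0 < c)) h => [c /negbTE -> //|c c0|c d].
  by rewrite c0 prednK ?absz_gt0 ?gt_eqF // pmulrn gez0_abs // ltW.
rewrite !unfold_in => c0 d0; lia.
Qed.

Definition reduced_weight y (f : qform) : R :=
  if (0 < qf_a f) && qf_reduced f then expR (- (y * (3 * qf_a f * qf_c f)%:~R)) else 0.

(** As 3 a c >= a^2 + 2 a c, the sum over c is geometric, of order 1 / (a y). The O(a) values of b
    cancel the 1 / a, and the remaining sum of exp(-y a^2) is of order y^(-1/2). *)
Lemma bsum_reduced y : 0 < y <= 1 -> bsum (reduced_weight y) (32 / (y * Num.sqrt y)).
Proof.
move=> /andP[y0 y1]; have s0 : 0 < Num.sqrt y by rewrite sqrtr_gt0.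
have s1 : 0 < Num.sqrt y <= 1 by rewrite s0 /= -[leRHS]sqrtr1 ler_sqrt.
have hA : bsum (fun a : int => 2 * expR (- (y * a%:~R ^+ 2)) / y) (32 / (y * Num.sqrt y)).
  have -> : 32 / (y * Num.sqrt y) = 4 / (y * Num.sqrt y) * 8 by field; rewrite !gt_eqF.
  have c0 : 0 <= 4 / (y * Num.sqrt y) by rewrite divr_ge0 // mulr_ge0 // ltW.
  apply: bsum_le (bsumZ c0 (w_mesh 0 s1)) => a.
  have := expR_le_w (a%:~R * Num.sqrt y) ltr01; rewrite mul1r exprMn sqr_sqrtr ?(ltW y0) // invr1 add0r.
  rewrite [a%:~R ^+ 2 * y]mulrC => h.
  have -> : 4 / (y * Num.sqrt y) * (Num.sqrt y * w (a%:~R * Num.sqrt y)) = 2 * ((1 + 1) * w (a%:~R * Num.sqrt y)) / y.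
    by field; rewrite !gt_eqF.
  by rewrite ler_pM2r ?invr_gt0 // ler_pM2l.
have hAB : bsum (fun p : int * int => if (0 < p.1) && (`|p.2| <= p.1) then
    expR (- (y * p.1%:~R ^+ 2)) / (2 * y * p.1%:~R) else 0) (32 / (y * Num.sqrt y)).
  apply: bsum_prod hA => [[a b]|a] /=.
    by case: ifP => // /andP[a0 _]; rewrite divr_ge0 ?expR_ge0 // !mulr_ge0 ?(ltW y0) // ler0z ltW.
  case: (ltrP 0 a) => a0 /=; last first.
    by move=> G _; rewrite big1 // divr_ge0 ?mulr_ge0 ?expR_ge0 ?(ltW y0).
  have ar : (0 : R) < a%:~R by rewrite ltr0z.
  have c0 : 0 <= expR (- (y * a%:~R ^+ 2)) / (2 * y * a%:~R) :> R by rewrite divr_ge0 ?expR_ge0 // !mulr_ge0 // ltW.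
  have aE : a = `|a|%N%:Z by rewrite gez0_abs // ltW.
  have h := bsumZ c0 (@bsum_ind R `|a|%N); apply: bsumW (bsum_le _ h) => [|b].
    have -> : (`|a|%N.+1%:R : R) = a%:~R + 1 by rewrite -natr1 pmulrn -aE.
    have a1 : (1 : R) <= a%:~R by rewrite ler1z.
    have -> : expR (- (y * a%:~R ^+ 2)) / (2 * y * a%:~R) * (2 * (a%:~R + 1)) =
       expR (- (y * a%:~R ^+ 2)) / y * ((a%:~R + 1) / a%:~R) :> R by field; rewrite !gt_eqF.
    rewrite [leRHS](_ : _ = expR (- (y * a%:~R ^+ 2)) / y * 2); last by ring.
    rewrite ler_wpM2l ?divr_ge0 ?expR_ge0 ?(ltW y0) //.
    by rewrite ler_pdivrMr //; lra.
  by rewrite -aE; case: ifP => _; rewrite ?mulr1 ?mulr0.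
apply: (bsum_prod (m := fun p => if (0 < p.1) && (`|p.2| <= p.1) then
    expR (- (y * p.1%:~R ^+ 2)) / (2 * y * p.1%:~R) else 0)) hAB => [f|[a b]] /=.
  by rewrite /reduced_weight; case: ifP => // _; exact: expR_ge0.
rewrite /reduced_weight /qf_reduced /qf_a /qf_b /qf_c /=; case: (ltrP 0 a) => a0 /=; last by move=> G _; rewrite big1.
case: (lerP `|b| a) => ba /=; last by move=> G _; rewrite big1.
have ar : (0 : R) < a%:~R by rewrite ltr0z.
have x0 : 0 < 2 * y * a%:~R by rewrite !mulr_gt0.
apply: bsum_le (bsumZ (expR_ge0 (- (y * a%:~R ^+ 2))) (bsum_geometric x0)) => c.
case: ifP => ac; last by rewrite mulr_ge0 ?expR_ge0 //; case: ifP => // _; exact: expR_ge0.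
rewrite (lt_le_trans a0 ac) -expRD ler_expR.
have acr : (a%:~R : R) <= c%:~R by rewrite ler_int.
rewrite !rmorphM /= -opprD lerN2.
have := ler_wpM2l (ltW (mulr_gt0 y0 ar)) acr; lra.
Qed.

(** A form determines its discriminant, so the pairs of an index and a reduced form of that
    discriminant inject into the reduced forms, where 3 a c <= n compares the exponentials. *)
Lemma bsum_red_forms y : 0 < y <= 1 ->
  bsum (fun n : nat => if (0 < n)%N then (size (red_forms n))%:R * expR (- (y * n%:R)) else 0) (32 / (y * Num.sqrt y)).
Proof.
move=> y1; have /andP[y0 _] := y1.
have h : bsum (fun p : nat * qform => if (0 < p.1)%N && (p.2 \in red_forms p.1) then expR (- (y * p.1%:R)) else 0)
    (32 / (y * Num.sqrt y)).
  apply: (bsum_on (h := snd) (P := fun p : nat * qform => (0 < p.1)%N && (p.2 \in red_forms p.1))) (bsum_reduced y1).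
  - by move=> p /negbTE ->.
  - move=> [n f] /= /andP[n0 fn]; rewrite n0 fn /=.
    move: fn; rewrite mem_red_forms => /and3P[a0 /eqP d r].
    rewrite /reduced_weight a0 r ler_expR lerN2 ler_pM2l // -[n%:R]/(n%:Z%:~R : R) ler_int; exact: reduced_bounds d r.
  - move=> [n f] [n' f'] /andP[_ /= h1] /andP[_ /= h2] e; move: h1 h2; rewrite e !mem_red_forms.
    by move=> /and3P[_ /eqP d _] /and3P[_ /eqP d' _]; move: d; rewrite d' => /oppr_inj [->].
move=> G uG; set L := [seq (n, f) | n <- G, f <- red_forms n].
have uL : uniq L by apply: allpairs_uniq_dep => // [n _|[n f] [n' f'] _ _ /=]; [exact: undup_uniq|case=> -> ->].
apply: le_trans (h L uL); rewrite big_allpairs_dep /= le_eqVlt; apply/orP; left; apply/eqP.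
apply: eq_bigr => n _; case: ifP => n0 /=; last by rewrite big1.
rewrite big_seq (eq_bigr (fun _ => expR (- (y * n%:R)))) => [|f ->] //.
by rewrite -big_seq big_const_seq count_predT iter_addr_0 mulr_natl.
Qed.

Section Qsum.
Variables (a : nat) (b : int).
Hypotheses (a0 : (0 < a)%N) (nsq : forall N : int, (a%:Z %| N - b)%Z -> nonsq N).

Lemma qsum_growth : exists2 K : R, 0 <= K & forall tau : C, 0 < complex.Im tau ->
  cabs (qsum a b tau) <= K * (1 + (Num.sqrt (complex.Im tau)) ^- 3).
Proof.
exists 64 => // tau v0; have [hq _] := qsum_hsum a0 nsq v0.
set v := complex.Im tau in v0 *; have s0 : 0 < Num.sqrt v by rewrite sqrtr_gt0.
have p1 : 1 <= pi :> R by have := pi_ge2 R; lra.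
(* [y] is the smaller of v and 1, because [bsum_red_forms] asks for y <= 1; the two cases produce
   the two summands of the bound. *)
have [y [y1 yv hy]] : exists y, [/\ 0 < y <= 1, y <= 2 * pi * v & 32 / (y * Num.sqrt y) <= 64 * (1 + (Num.sqrt v) ^- 3)].
  have [v1|v1] := lerP v 1.
    exists v; split; [by rewrite v0| |].
      by have := ler_wpM2r (ltW v0) p1; lra.
    have -> : v * Num.sqrt v = Num.sqrt v ^+ 3 by rewrite exprSr sqr_sqrtr // ltW.
    have : 0 <= Num.sqrt v ^- 3 by rewrite invr_ge0 exprn_ge0 // ltW.
    lra.
  exists 1; split; [by rewrite ltr01 lexx| |].
    have : 1 * 1 <= pi * v by rewrite ler_pM // ltW.
    lra.
  have : 0 <= Num.sqrt v ^- 3 by rewrite invr_ge0 exprn_ge0 // ltW.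
  rewrite sqrtr1; lra.
apply: le_trans hy; apply: hsum_le hq _; apply: bsum_le (bsum_red_forms y1) => n.
rewrite /qsum_term; case: ifP => [h|_]; last first.
  by rewrite cabs0; case: ifP => // _; rewrite mulr_ge0 ?expR_ge0.
have n0 : (0 < n)%N by rewrite lt0n; apply/eqP => n0; apply: (nsq h); exists 0; rewrite n0 expr0n oppr0.
rewrite n0 cabsM cabs_ce mulr1 cabs_rc; have /andP[h0 h1] := hurwitz_bounds n0.
have h0r : 0 <= ratr (hurwitz n) :> R by rewrite ler0q.
rewrite normrM !ger0_norm ?expR_ge0 // ler_pM ?expR_ge0 //.
  by rewrite -(ratr_nat R) ler_rat.
by rewrite ler_expR lerN2 ler_wpM2r.
Qed.

End Qsum.
End Growth.

(** * Termwise differentiation and convergence of the partial sums *)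

Section Holomorphy.
Variable R : realType.
Local Notation C := R[i].
Implicit Types (x y : R) (tau z h : C).

(** The mean value theorem is applied twice along the segment from 0 to [z]; each application costs
    a factor 2. *)
Lemma cexp_taylor z : cabs (cexp z - 1 - z) <= 4 * cabs z ^+ 2 * expR (cabs z).
Proof.
have c0 := cabs_ge0 z; have E0 := expR_ge0 (cabs z).
have e0 (x : R) : 0 <= x <= 1 -> cabs (cexp (rc x * z)) <= expR (cabs z).
  move=> /andP[x0 x1]; rewrite cabs_cexp ler_expR Re_rcM; apply: le_trans (ler_norm _) _.
  rewrite normrM ger0_norm // -[leRHS]mul1r ler_pM //; exact: Re_le_cabs.
have d (x : R) : cder (fun x => rc x * z) x z.
  by apply: cder_eq (cder_mul (cder_rc x) (cder_cst z x)) _; ring.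
have d1 (x : R) : cder (fun x => cexp (rc x * z)) x (z * cexp (rc x * z)) by exact: cder_cexp (d x).
have h1 (x : R) : 0 <= x <= 1 -> cabs (cexp (rc x * z) - 1) <= 2 * (cabs z * expR (cabs z)).
  move=> /andP[x0 x1]; have -> : (1 : C) = cexp (rc 0 * z) by rewrite rc0 mul0r cexp0.
  apply: (@le_trans _ _ (2 * (cabs z * expR (cabs z)) * (x - 0))).
    apply: (cmvt d1 x0) => y /andP[y0 yx].
    by rewrite cabsM ler_wpM2l // e0 // y0 (le_trans yx).
  by rewrite subr0 ler_piMr // !mulr_ge0.
have d2 (x : R) : cder (fun x => cexp (rc x * z) - 1 - rc x * z) x (z * (cexp (rc x * z) - 1)).
  by apply: cder_eq (cder_sub (cder_sub (d1 x) (cder_cst 1 x)) (d x)) _; ring.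
have h2 : forall x : R, 0 <= x <= 1 -> cabs (z * (cexp (rc x * z) - 1)) <= cabs z * (2 * (cabs z * expR (cabs z))).
  by move=> x x01; rewrite cabsM ler_wpM2l // h1.
have := cmvt d2 ler01 h2; rewrite rc0 rc1 !mul0r !mul1r cexp0 subrr !subr0 mulr1.
by congr (_ <= _); ring.
Qed.

Lemma linear_exp_bound (c : R) : 0 < c -> exists2 B : R, 0 <= B & forall n : nat, n%:R ^+ 2 * expR (- (c * n%:R)) <= B.
Proof.
move=> c0; have [B B0 hB] := exp_growth 2 c0; exists B => // n; have n0 : (0 : R) <= n%:R by exact: ler0n.
have := hB (Num.sqrt n%:R); rewrite sqr_sqrtr //; apply: le_trans.
by rewrite ler_wpM2r ?expR_ge0 // ler_pXn2r ?nnegrE ?addr_ge0 // lerDr.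
Qed.

Variables (a : nat) (b : int).
Hypotheses (a0 : (0 < a)%N) (nsq : forall N : int, (a%:Z %| N - b)%Z -> nonsq N).

Definition qco (n : nat) : R := if (a%:Z %| n%:Z - b)%Z then ratr (hurwitz n) else 0.
Definition qz : C := ci R * rc (2 * pi).

Lemma qsum_termE tau n : qsum_term a b tau n = rc (qco n) * cexp (n%:R * (qz * tau)).
Proof.
rewrite /qsum_term /qco; case: ifP => _; last by rewrite rc0 mul0r.
rewrite rcM -mulrA -cexp_rc -cexpD; congr (_ * cexp _).
have [p pE] : exists p : R, p = 2 * pi by eexists.
rewrite /qz -pE -(rc_nat R n) [in RHS](complex_ri tau); move: (complex.Im tau) (complex.Re tau) (n%:R : R) => v u m.
transitivity (rc m * rc p * (ci R * rc u + (ci R * ci R) * rc v)); last by ring.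
by rewrite ci2 rcN !rcM; ring.
Qed.

Lemma cabs_qexp tau n : cabs (cexp (n%:R * (qz * tau))) = expR (- (2 * pi * complex.Im tau * n%:R)).
Proof.
rewrite cabs_cexp -(rc_nat R) Re_rcM /qz; congr expR.
by rewrite -mulrA ReM /= mul0r mul1r Im_rcM; ring.
Qed.

Lemma qco_bsum v : 0 < v -> exists M : R, bsum (fun n => `|qco n| * expR (- (2 * pi * v * n%:R))) M.
Proof.
move=> v0; have [K K0 hK] := coef_lim_bound v0; have s0 := sieve_const_gt0 R.
have c0 : 0 < pi * v / 2 by rewrite divr_gt0 // mulr_gt0 ?pi_gt0.
have [M hM] := bsum_exp_poly c0 K0; exists ((sieve_const R)^-1 * M).
have si : 0 <= (sieve_const R)^-1 by rewrite invr_ge0 ltW.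
have hM' := bsumZ si (bsum_inj (h := Posz) _ hM); apply: bsum_le (hM' _) => [n|x y [] //].
rewrite /qco; case: ifP => [/nsq h|_]; last by rewrite normr0 mul0r !mulr_ge0 ?expR_ge0 ?exprn_ge0.
have /andP[l0 l1] := hK _ h; rewrite [leRHS]mulrC ler_pdivlMr //; apply: le_trans l1.
have n0 : (0 < n)%N by rewrite lt0n; apply/eqP => n0; apply: h; exists 0; rewrite n0 expr0n oppr0.
have /andP[h0 _] := hurwitz_bounds n0; rewrite ger0_norm ?ler0q // /coef_lim /= ltz_nat n0.
by rewrite mulrC mulrA.
Qed.

Lemma qsum_derivative tau : 0 < complex.Im tau -> exists D : C, exists2 K : R, 0 <= K &
  forall h : C, cabs h <= complex.Im tau / 4 -> cabs (qsum a b (tau + h) - qsum a b tau - h * D) <= K * cabs h ^+ 2.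
Proof.
move=> v0; set v := complex.Im tau in v0 *; have v2 : 0 < v / 2 by rewrite divr_gt0.
have [M hM] := qco_bsum v2; have pv : 0 < pi * v / 2 by rewrite divr_gt0 // mulr_gt0 ?pi_gt0.
have [B B0 hB] := linear_exp_bound pv.
have p0 : 0 < 2 * pi :> R by rewrite mulr_gt0 ?pi_gt0.
have cqz : cabs qz = 2 * pi.
  by rewrite /qz cabsM cabs_rc ger0_norm ?(ltW p0) // cabsE /= expr0n expr1n add0r sqrtr1 mul1r.
pose d n : C := rc (qco n) * (n%:R * qz) * cexp (n%:R * (qz * tau)).
have en (n : nat) : n%:R * expR (- (2 * pi * v * n%:R)) <= B * expR (- (2 * pi * (v / 2) * n%:R)).
  have -> : expR (- (2 * pi * v * n%:R)) = expR (- (pi * v / 2 * n%:R)) * expR (- (pi * v / 2 * n%:R)) * expR (- (2 * pi * (v / 2) * n%:R)) :> R.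
    by rewrite -!expRD; congr expR; field.
  rewrite !mulrA ler_wpM2r ?expR_ge0 //; apply: le_trans (hB n).
  rewrite -[leRHS]mulr1 ler_pM ?mulr_ge0 ?expR_ge0 //.
    rewrite ler_wpM2r ?expR_ge0 // -natrX ler_nat; by case: n => // n; rewrite expnS leq_pmulr.
  by rewrite -[leRHS]expR0 ler_expR oppr_le0 mulr_ge0 // ltW.
have cn (n : nat) : cabs (n%:R : C) = n%:R by rewrite -(rc_nat R) cabs_rc ger0_norm.
have dM : absb d (2 * pi * B * M).
  have c0 : 0 <= 2 * pi * B by rewrite mulr_ge0 // ltW.
  apply: bsum_le (bsumZ c0 hM) => n; rewrite /d 3!cabsM cabs_rc cabs_qexp -/v cn cqz.
  have h1 := en n; have h2 := normr_ge0 (qco n).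
  have -> : `|qco n| * (n%:R * (2 * pi)) * expR (- (2 * pi * v * n%:R)) =
    (2 * pi) * (`|qco n| * (n%:R * expR (- (2 * pi * v * n%:R)))) by ring.
  by rewrite -[leRHS]mulrA ler_pM2l // [leRHS]mulrCA ler_wpM2l.
exists (tsum d), (4 * (2 * pi) ^+ 2 * B * M).
  have M0 := bsum_ge0 hM; by rewrite !mulr_ge0 // ?pi_ge0.
move=> h hh; have [q1 _] := qsum_hsum a0 nsq v0.
have vh : 0 < complex.Im (tau + h).
  by rewrite ImD; have := Im_le_cabs h; have := ler_norm (- complex.Im h); rewrite normrN -/v; lra.
have [q2 _] := qsum_hsum a0 nsq vh.
have hs := hsumB (hsumB q2 q1) (hsumZ h (tsumP dM)).
have c0 : 0 <= 4 * (2 * pi) ^+ 2 * B * cabs h ^+ 2 by have ch := cabs_ge0 h; rewrite !mulr_ge0 // ?pi_ge0.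
have bb := bsumZ c0 hM; have -> : 4 * (2 * pi) ^+ 2 * B * M * cabs h ^+ 2 = 4 * (2 * pi) ^+ 2 * B * cabs h ^+ 2 * M by ring.
apply: hsum_le hs _; apply: bsum_le bb => n; rewrite !qsum_termE /d.
set W := n%:R * (qz * h).
have -> : rc (qco n) * cexp (n%:R * (qz * (tau + h))) - rc (qco n) * cexp (n%:R * (qz * tau)) -
     h * (rc (qco n) * (n%:R * qz) * cexp (n%:R * (qz * tau))) =
   rc (qco n) * cexp (n%:R * (qz * tau)) * (cexp W - 1 - W).
  by rewrite mulrDr mulrDr cexpD -/W /W; ring.
have cW : cabs W = 2 * pi * n%:R * cabs h by rewrite /W 2!cabsM cn cqz; ring.
have n0 : (0 : R) <= n%:R by exact: ler0n.
rewrite 2!cabsM cabs_rc cabs_qexp -/v.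
have W1 : expR (cabs W) <= expR (pi * v / 2 * n%:R).
  rewrite ler_expR cW; have pn : 0 <= 2 * pi * n%:R :> R by rewrite mulr_ge0 // ltW.
  by have := ler_wpM2l pn hh; lra.
have h1 : cabs (cexp W - 1 - W) <= 4 * cabs W ^+ 2 * expR (pi * v / 2 * n%:R).
  by apply: le_trans (cexp_taylor W) _; apply: ler_wpM2l W1; rewrite mulr_ge0 // exprn_ge0 // cabs_ge0.
have E0 : 0 <= `|qco n| * expR (- (2 * pi * v * n%:R)) by rewrite mulr_ge0 ?expR_ge0.
apply: le_trans (ler_wpM2l E0 h1) _; rewrite cW.
(* The decay is split in three: one quarter of the exponent absorbs n^2, another the growth caused
   by [h], and the remaining half is summable against the coefficients. *)
have -> : expR (- (2 * pi * v * n%:R)) = expR (- (pi * v / 2 * n%:R)) * expR (- (pi * v / 2 * n%:R)) * expR (- (2 * pi * (v / 2) * n%:R)) :> R.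
  by rewrite -!expRD; congr expR; field.
have ee : expR (- (pi * v / 2 * n%:R)) * expR (pi * v / 2 * n%:R) = 1 by rewrite -expRD addNr expR0.
have -> : `|qco n| * (expR (- (pi * v / 2 * n%:R)) * expR (- (pi * v / 2 * n%:R)) * expR (- (2 * pi * (v / 2) * n%:R))) *
   (4 * (2 * pi * n%:R * cabs h) ^+ 2 * expR (pi * v / 2 * n%:R)) =
   4 * (2 * pi) ^+ 2 * (n%:R ^+ 2 * expR (- (pi * v / 2 * n%:R))) * cabs h ^+ 2 * (`|qco n| * expR (- (2 * pi * (v / 2) * n%:R))) *
   (expR (- (pi * v / 2 * n%:R)) * expR (pi * v / 2 * n%:R)) by ring.
by rewrite ee mulr1 ler_wpM2r ?mulr_ge0 ?expR_ge0 // ler_wpM2r ?exprn_ge0 ?cabs_ge0 // ler_wpM2l // mulr_ge0 // exprn_ge0 // ltW.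
Qed.

Lemma cpos_rc (e : Cx R) : 0 < e -> exists2 x : R, 0 < x & e = rc x.
Proof.
by case: e => x y; rewrite ltcE /= => /andP[/eqP -> x0]; exists x.
Qed.

Lemma lecR_rc (z : Cx R) x : cabs z <= x -> (`|z| <= rc x).
Proof. by move=> h; rewrite normcE' lecR. Qed.

(** Agreement with [qsum] is asked for on the upper half-plane, which is where the limit of partial
    sums in the final statement is controlled. *)
Lemma qsum_derivable tau (f : Cx R -> Cx R) : 0 < complex.Im tau ->
  (forall z : C, 0 < complex.Im z -> f z = qsum a b z) -> derivable (f : (Cx R)^o -> (Cx R)^o) tau 1.
Proof.
move=> v0 fq; have [D [K K0 hK]] := qsum_derivative v0.
apply: (@cvgP _ _ (D : (Cx R)^o)); apply/cvgrPdist_le => e /cpos_rc [x x0 ->].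
have v4 : 0 < complex.Im tau / 4 by rewrite divr_gt0.
have K1 : 0 < K + 1 by rewrite ltr_wpDl.
have d1 : (0 : Cx R) < rc (complex.Im tau / 4) by rewrite ltcR.
have d2 : (0 : Cx R) < rc (x / (K + 1)) by rewrite ltcR divr_gt0.
near=> h.
have h0 : h != 0 by near: h; exact: nbhs_dnbhs_neq.
have h1 : `|h| < rc (complex.Im tau / 4) by near: h; exact: dnbhs0_lt.
have h2 : `|h| < rc (x / (K + 1)) by near: h; exact: dnbhs0_lt.
rewrite !normcE' !ltcR in h1 h2.
apply: lecR_rc; apply: (@le_trans _ _ (cabs (D - h^-1 * (f (tau + h) - f tau)))).
  rewrite le_eqVlt; apply/orP; left; apply/eqP; congr (cabs (D - h^-1 * (f _ - f tau))).
  by rewrite /= addrC; congr (_ + _); exact: mulr1.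
have vh : 0 < complex.Im (tau + h).
  by rewrite ImD; have := Im_le_cabs h; have := ler_norm (- complex.Im h); rewrite normrN; lra.
rewrite !fq //; have -> : D - h^-1 * (qsum a b (tau + h) - qsum a b tau) =
    - (h^-1 * (qsum a b (tau + h) - qsum a b tau - h * D)).
  by move: (qsum a b _) (qsum a b _) => x1 x2; rewrite [in RHS]mulrBr mulKf //; ring.
rewrite cabsN cabsM cabsV; have c0 : 0 < cabs h by rewrite cabs_gt0.
rewrite mulrC ler_pdivrMr //; apply: le_trans (hK h (ltW h1)) _.
rewrite expr2 mulrA ler_wpM2r ?(ltW c0) //.
by move: h2; rewrite ltr_pdivlMr //; have := ltW c0; lra.
Unshelve. all: by end_near.
Qed.

Lemma qsum_cvg tau : 0 < complex.Im tau ->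
  (series (qsum_term a b tau : nat -> Cx R) n @[n --> \oo] --> (qsum a b tau : Cx R))%classic.
Proof.
move=> v0; have [hq _] := qsum_hsum a0 nsq v0.
apply/cvgrPdist_le => e /cpos_rc [x x0 ->]; have [N hN] := hsum_nat hq x0.
near=> n; apply: lecR_rc; rewrite cabs_distC; apply: ltW.
rewrite /series /= big_mkord; apply: hN; near: n; exact: nbhs_infty_ge.
Unshelve. all: by end_near.
Qed.

End Holomorphy.

(** * Modularity on G_a of the averages and of their limit *)

Section Modularity.
Variable R : realType.
Local Notation C := R[i].
Implicit Types (tau z : C).

Lemma coprimez_shift (x c d m : int) : (x %| c)%Z -> coprimez x d -> coprimez x (d + m * c).
Proof. by case/dvdzP => y -> h; rewrite addrC mulrA /coprimez gcdzMDl. Qed.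

Lemma coprimez_abs (x d : int) : coprimez x `|d|%N = coprimez x d.
Proof. by rewrite !coprimezE absz_nat. Qed.

Lemma odd_shift (c d m : int) : (4 %| c)%Z -> odd `|d|%N -> odd (absz (d + m * c)).
Proof. by case/dvdzP => y ->; rewrite mulrA; move: (m * y) => k; lia. Qed.

(** The symbol splits as (c/d)(a/d). The first factor has period [c], as 4 divides [c]. The second
    has period [a] if 4 divides [a], and 4 [a] in general; in either case this divides [c], which is
    why the level depends on whether 4 divides [a]. *)
Lemma jacobi_level (a : nat) (c d m : int) : (0 < a)%N -> 0 < c -> (4 %| c)%Z -> (a%:Z %| c)%Z ->
  (4 %| a%:Z)%Z || (4 * a%:Z %| c)%Z -> odd `|d|%N -> coprimez (c * a%:Z) d ->
  jacobi (c * a%:Z) (absz (d + m * c)) = jacobi (c * a%:Z) `|d|%N.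
Proof.
move=> a0 c0 c4 ac lev od; rewrite coprimezM => /andP[cc ca].
have od' := odd_shift m c4 od.
rewrite !(jacobiM R) ?coprimez_abs ?coprimez_shift // (jacobi_period4 R) //; congr (_ * _).
case/orP: lev => [a4|/dvdzP[s ->]].
  by case/dvdzP: ac => q ->; rewrite mulrA (jacobi_period4 R).
by rewrite mulrA (jacobi_period R) //; rewrite coprimezE in ca.
Qed.

(** Conjugation by the translation j/a turns the bottom row (c a, d) into (c a, d - j c) and
    preserves the value of the linear form. What has to be compared is the symbol and the residue of
    d modulo 4. *)
Lemma jfac_level (a : nat) (c d j : int) tau x : (0 < a)%N -> (4 %| c)%Z -> (a%:Z %| c)%Z ->
  (4 %| a%:Z)%Z || (4 * a%:Z %| c)%Z -> odd `|d|%N -> coprimez (c * a%:Z) d -> 0 < complex.Im tau ->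
  x * a%:R = j%:~R :> R ->
  jfac (c * a%:Z) (d - j * c) (tau + rc x) = jfac (c * a%:Z) d tau.
Proof.
move=> a0 c4 ac lev od co v0 xa.
have pos (c' d' j' : int) x' : 0 < c' -> (4 %| c')%Z -> (a%:Z %| c')%Z -> (4 %| a%:Z)%Z || (4 * a%:Z %| c')%Z ->
    odd `|d'|%N -> coprimez (c' * a%:Z) d' -> x' * a%:R = j'%:~R :> R ->
    jfac (c' * a%:Z) (d' - j' * c') (tau + rc x') = jfac (c' * a%:Z) d' tau.
  move=> c0 c4' ac' lev' od' co' xa'; have ca0 : (c' * a%:Z < 0) = false by apply/negbTE; rewrite -leNgt mulr_ge0 // ltW.
  rewrite /jfac /shimura_symbol ca0 !andbF -mulNr jacobi_level //; congr (_ * _ * psq _ ^+ 3).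
    by rewrite /eps; congr (if _ == _ then _ else _); case/dvdzP: c4' => q ->; rewrite mulrA addrC modzMDl.
  have -> : (c' * a%:Z)%:~R * (tau + rc x') = (c' * a%:Z)%:~R * tau + c'%:~R * rc (x' * a%:R) :> C.
    by rewrite rmorphM /= rcM rc_nat pmulrn; ring.
  rewrite xa' rc_int (_ : d' + - j' * c' = d' - c' * j'); last by ring.
  by rewrite rmorphB rmorphM /=; ring.
have [c0|c0|c0] := ltrgt0P c.
- exact: pos.
- have n0 : c * a%:Z != 0 by rewrite mulf_eq0 negb_or (lt_eqF c0) /=; move: a0; clear; lia.
  have v1 : 0 < complex.Im (tau + rc x) by rewrite ImD addr0.
  rewrite -(jfacN n0 od co v0) -(jfacN n0 _ _ v1).
  + have -> : - (d - j * c) = - d - j * (- c) by ring.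
    rewrite -mulNr; apply: pos => //; first [by rewrite oppr_gt0|by rewrite rpredN|by rewrite abszN|idtac].
    by move: co; rewrite !coprimezE mulNr !abszN.
  + by rewrite -mulNr odd_shift.
  + by rewrite coprimezM -mulNr; move: co; rewrite coprimezM => /andP[h1 h2]; rewrite !coprimez_shift.
by rewrite c0 mul0r mulr0 subr0 /jfac !mul0r.
Qed.

Definition level (a : nat) : nat := if (4 %| a)%N then (a ^ 2)%N else (4 * a ^ 2)%N.

(** Determinant 1 and al^2 = 1 modulo a give de = al modulo a. Hence conjugation by the translation
    j/a yields an integral matrix of Gamma_0(4), and each term of the average is carried to itself
    with the same factor and the same root of unity. *)
Lemma Fb_modular (a : nat) (b : int) ep (al be ga de : int) tau : (0 < a)%N -> ((level a)%:Z %| ga)%Z ->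
  al * de - be * ga = 1 -> (a%:Z %| al ^+ 2 - 1)%Z -> 0 < ep -> 0 < complex.Im tau ->
  Fb a b ep (mob al be ga de tau) = jfac ga de tau * Fb a b ep tau.
Proof.
move=> a0 lev det al2 e0 v0; have ar : (a%:R : R) != 0 by rewrite pnatr_eq0 -lt0n.
have [g [gE ag g4 glev]] : exists g : int, [/\ ga = g * a%:Z, (a%:Z %| g)%Z, (4 %| g)%Z & (4 %| a%:Z)%Z || (4 * a%:Z %| g)%Z].
  case/dvdzP: lev => q ->; rewrite /level; case: ifP => a4.
    by exists (q * a%:Z); split; [lia|exact: dvdz_mull|apply: dvdz_mull|apply/orP; left].
  exists (q * (4 * a%:Z)); split; [lia|by rewrite mulrA dvdz_mull|by rewrite mulrA dvdz_mulr // dvdz_mull|].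
  by apply/orP; right; exact: dvdz_mull.
have [k kE] : exists k, de - al = k * a%:Z.
  apply/dvdzP; have -> : de - al = de * (1 - al ^+ 2) + al * (al * de - 1) by ring.
  have -> : al * de - 1 = be * ga by rewrite -det; ring.
  apply: rpredD; first by apply: dvdz_mull; rewrite -opprB rpredN.
  by apply: dvdz_mull; apply: dvdz_mull; rewrite gE; exact: dvdz_mull.
have /dvdzP[g2 g2E] := ag; have co := det_coprime det; rewrite gE in co.
have ga4 : (4 %| ga)%Z by rewrite gE dvdz_mulr.
have od := odd_of_coprime ga4; rewrite gE in od; have {}od := od _ co.
rewrite /Fb [RHS]mulrCA; congr (_ * _); rewrite mulr_sumr; apply: eq_bigr => j _.
rewrite [RHS]mulrCA; congr (_ * _); set jz : int := (j : nat)%:Z.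
have xa : j%:R / a%:R * a%:R = jz%:~R :> R by rewrite mulfVK.
have v1 : 0 < complex.Im (tau + rc (j%:R / a%:R)) by rewrite ImD addr0.
(* The conjugate of the matrix by the translation j/a. Its upper right entry be + j k - j^2 g2 is
   integral because [a] divides de - al and a^2 divides ga. *)
have det' : (al + jz * g) * (de - jz * g) - (be + jz * k - jz ^+ 2 * g2) * ga = 1.
  by rewrite -det gE g2E (_ : al = de - k * a%:Z); [ring|rewrite -kE; ring].
have ds : (ga, de) != (0, 0) by apply/eqP => -[h1 h2]; move: det; rewrite h1 h2 !mulr0.
have den := aff_neq0 v0 ds.
have -> : mob al be ga de tau + rc (j%:R / a%:R) =
    mob (al + jz * g) (be + jz * k - jz ^+ 2 * g2) ga (de - jz * g) (tau + rc (j%:R / a%:R)).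
  set x := rc (j%:R / a%:R); have xa' : x * a%:R = jz%:~R by rewrite -(rc_nat R) -rcM xa rc_int.
  have dE : ga%:~R * (tau + x) + (de - jz * g)%:~R = ga%:~R * tau + de%:~R.
    by rewrite gE !rmorphB !rmorphM /= -xa'; ring.
  have dE2 : de = al + k * a%:Z by rewrite -kE; ring.
  have aE : (a%:Z)%:~R = a%:R :> C by [].
  rewrite /mob dE; apply: (mulIf den); rewrite mulrDl !mulfVK //.
  rewrite gE g2E dE2 expr2 !rmorphD rmorphN !rmorphM /= aE -xa'; ring.
rewrite (descent (fun t => @Fe_T R ep t e0) (fun t => @Fe_U R ep t e0) ga4 det' v1).
by rewrite gE (jfac_level a0 g4 ag glev od co v0 xa).
Qed.

Variables (a : nat) (b : int).
Hypotheses (a0 : (0 < a)%N) (nsq : forall N : int, (a%:Z %| N - b)%Z -> nonsq N).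

(** The automorphy factor does not involve the cutoff, so the exact relation for [Fb] at the
    parameters exp(-m) passes to the limit. *)
Lemma qsum_modular (al be ga de : int) tau : ((level a)%:Z %| ga)%Z ->
  al * de - be * ga = 1 -> (a%:Z %| al ^+ 2 - 1)%Z -> 0 < complex.Im tau ->
  qsum a b (mob al be ga de tau) = jfac ga de tau * qsum a b tau.
Proof.
move=> lev det al2 v0; have s0 := sieve_const_gt0 R; set J := jfac ga de tau.
have v1 : 0 < complex.Im (mob al be ga de tau).
  rewrite Im_mob // divr_gt0 // exprn_gt0 // cabs_gt0 aff_neq0 //.
  by apply/eqP => -[h1 h2]; move: det; rewrite h1 h2 !mulr0.
have sc : rc (sieve_const R) != 0 :> C by rewrite rc_eq0 gt_eqF.
apply: (mulfI sc); apply/eqP; rewrite -subr_eq0 -cabs_eq0 eq_le cabs_ge0 andbT.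
apply/ler_addgt0Pr => e e0; rewrite add0r.
have J1 : 0 < 1 + cabs J by rewrite ltr_wpDr ?cabs_ge0.
have e1 : 0 < e / (1 + cabs J) by rewrite divr_gt0.
have [m1 h1] := Fb_lim a0 nsq v1 e1; have [m2 h2] := Fb_lim a0 nsq v0 e1.
pose m := maxn m1 m2; have {}h1 := h1 m (leq_maxl _ _); have {}h2 := h2 m (leq_maxr _ _).
have t0 : 0 < tm R m ^+ 2 by rewrite exprn_gt0 //; have /andP[] := tm01 R m.
rewrite Fb_modular // -/J in h1.
have -> : rc (sieve_const R) * qsum a b (mob al be ga de tau) - rc (sieve_const R) * (J * qsum a b tau) =
   J * (Fb a b (tm R m ^+ 2) tau / m.+1%:R - rc (sieve_const R) * qsum a b tau) -
   (J * Fb a b (tm R m ^+ 2) tau / m.+1%:R - rc (sieve_const R) * qsum a b (mob al be ga de tau)).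
  by move: (rc (sieve_const R)) (m.+1%:R^-1 : C) => s' x; ring.
apply: le_trans (cabsB _ _) _; rewrite cabsM.
have -> : e = cabs J * (e / (1 + cabs J)) + e / (1 + cabs J) by field; rewrite gt_eqF.
by apply: lerD h1; rewrite ler_wpM2l // cabs_ge0.
Qed.

End Modularity.

(** * Boundedness at all cusps *)

Section Cusps.
Variable R : realType.
Local Notation C := R[i].
Implicit Types (tau z : C).

Lemma jacobi_le1 (c : int) (n : nat) : `|jacobi c n| <= 1.
Proof.
rewrite /jacobi; elim/big_rec: _ => [|p x _ hx]; first by rewrite normr1.
have l1 : `|legendre c p| <= 1 by rewrite /legendre; case: ifP => _; [rewrite normr0|case: ifP].
by rewrite normrM -[leRHS]mulr1 ler_pM // normrX exprn_ile1.
Qed.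

Lemma jfac_le (c d : int) tau : cabs (jfac c d tau) <= cabs (psq (c%:~R * tau + d%:~R)) ^+ 3.
Proof.
rewrite /jfac 2!cabsM cabsX ler_piMl ?exprn_ge0 ?cabs_ge0 //.
have e1 : cabs (eps R d) = 1.
  by rewrite /eps; case: ifP => _; rewrite cabsE /= expr0n expr1n ?addr0 ?add0r sqrtr1.
rewrite e1 mulr1 -rc_int cabs_rc -intr_norm -[1]/(1%:~R) ler_int /shimura_symbol.
by case: ifP => _; rewrite ?normrN jacobi_le1.
Qed.

Variables (a : nat) (b : int).
Hypotheses (a0 : (0 < a)%N) (nsq : forall N : int, (a%:Z %| N - b)%Z -> nonsq N).

Let slash (al be ga de : int) tau : R :=
  cabs (qsum a b (mob al be ga de tau)) / cabs (psq (ga%:~R * tau + de%:~R)) ^+ 3.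

Lemma det_neq0 (al be ga de : int) : al * de - be * ga = 1 -> (ga, de) != (0, 0).
Proof. by move=> det; apply/eqP => -[h1 h2]; move: det; rewrite h1 h2 !mulr0. Qed.

(* [sigma T^(k level) sigma^-1] lies in [G_a]. *)
Lemma slash_translate (al be ga de k : int) tau : al * de - be * ga = 1 -> 0 < complex.Im tau ->
  slash al be ga de (tau + (k * (level a)%:Z)%:~R) <= slash al be ga de tau.
Proof.
move=> det v0; set B := k * (level a)%:Z; have ds := det_neq0 det.
have v1 : 0 < complex.Im (tau + B%:~R) by rewrite -rc_int ImD addr0.
have den := aff_neq0 v0 ds; have den1 := aff_neq0 v1 ds.
have v2 : 0 < complex.Im (mob al be ga de tau) by rewrite Im_mob // divr_gt0 // exprn_gt0 // cabs_gt0.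
have detZ : al%:~R * de%:~R - be%:~R * ga%:~R = 1 :> C by rewrite -!intrM -rmorphB det.
have det1 : (1 - B * al * ga) * (1 + B * al * ga) - B * al ^+ 2 * - (B * ga ^+ 2) = 1 by ring.
have lev : ((level a)%:Z %| - (B * ga ^+ 2))%Z by rewrite rpredN /B mulrAC dvdz_mull.
have aB : (a%:Z %| B)%Z.
  apply: dvdz_mull; rewrite /level; case: ifP => _; first by rewrite expnS PoszM dvdz_mulr.
  by rewrite expnS !PoszM dvdz_mull // dvdz_mulr.
have al2 : (a%:Z %| (1 - B * al * ga) ^+ 2 - 1)%Z.
  have -> : (1 - B * al * ga) ^+ 2 - 1 = (B * al * ga - 2) * al * ga * B by ring.
  exact: dvdz_mull.
have cE : (- (B * ga ^+ 2))%:~R * mob al be ga de tau + (1 + B * al * ga)%:~R =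
   (ga%:~R * (tau + B%:~R) + de%:~R) / (ga%:~R * tau + de%:~R) :> C.
  apply: (mulIf den); rewrite mulfVK // mulrDl /mob -[_ * (_ / _) * _]mulrA mulfVK //.
  apply/eqP; rewrite -subr_eq0; apply/eqP.
  transitivity (B%:~R * ga%:~R * ((al%:~R * de%:~R - be%:~R * ga%:~R) - 1) : C); last by rewrite detZ subrr mulr0.
  by rewrite expr2 !rmorphD rmorphN !rmorphM /=; ring.
have nE : (1 - B * al * ga)%:~R * mob al be ga de tau + (B * al ^+ 2)%:~R =
   (al%:~R * (tau + B%:~R) + be%:~R) / (ga%:~R * tau + de%:~R) :> C.
  apply: (mulIf den); rewrite mulfVK // mulrDl /mob -[_ * (_ / _) * _]mulrA mulfVK //.
  apply/eqP; rewrite -subr_eq0; apply/eqP.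
  transitivity (B%:~R * al%:~R * ((al%:~R * de%:~R - be%:~R * ga%:~R) - 1) : C); last by rewrite detZ subrr mulr0.
  by rewrite expr2 !rmorphD rmorphN !rmorphM /=; ring.
have mE : mob al be ga de (tau + B%:~R) =
    mob (1 - B * al * ga) (B * al ^+ 2) (- (B * ga ^+ 2)) (1 + B * al * ga) (mob al be ga de tau).
  by rewrite {2}/mob cE nE invf_div mulrA mulfVK.
rewrite /slash mE qsum_modular // cabsM.
set x := cabs (qsum a b _).
have c1 : 0 < cabs (psq (ga%:~R * tau + de%:~R)) by rewrite cabs_gt0 psq_eq0.
have c2 : 0 < cabs (psq (ga%:~R * (tau + B%:~R) + de%:~R)) by rewrite cabs_gt0 psq_eq0.
rewrite ler_pdivrMr ?exprn_gt0 //.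
have j1 := jfac_le (- (B * ga ^+ 2)) (1 + B * al * ga) (mob al be ga de tau); rewrite cE in j1.
have jE : cabs (psq ((ga%:~R * (tau + B%:~R) + de%:~R) / (ga%:~R * tau + de%:~R))) =
   cabs (psq (ga%:~R * (tau + B%:~R) + de%:~R)) / cabs (psq (ga%:~R * tau + de%:~R)).
  apply/eqP; rewrite -(eqrXn2 (n := 2)) ?cabs_ge0 ?divr_ge0 ?cabs_ge0 //.
  by rewrite expr_div_n !cabs_psq cabsM cabsV.
rewrite jE expr_div_n in j1; have x0 : 0 <= x by exact: cabs_ge0.
apply: le_trans (ler_wpM2r x0 j1) _; rewrite le_eqVlt; apply/orP; left; apply/eqP; ring.
Qed.

(** [slash_translate] moves the real part into a bounded range, where 1 <= |ga z + de| <= D Im z.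
    Inserting Im (sigma z) = Im z / |ga z + de|^2 into [qsum_growth] then bounds the slashed
    value. *)
Lemma slash_bounded (al be ga de : int) : al * de - be * ga = 1 ->
  exists M : R, forall tau, 1 < complex.Im tau -> slash al be ga de tau <= M.
Proof.
move=> det; have ds := det_neq0 det; have [K K0 hK] := qsum_growth R a0 nsq.
set A : R := (level a)%:R; have A0 : 0 < A.
  by rewrite ltr0n /level; case: ifP => _; rewrite !muln_gt0 /= a0.
have [D D1 DE] : exists2 D : R, 1 <= D & D = `|ga%:~R| * (A + 1) + `|de%:~R|.
  eexists; last reflexivity; rewrite -!intr_norm.
  have [g0|g0] := eqVneq ga 0.
    have d0 : de != 0 by apply: contraNneq ds => ->; rewrite g0.
    by rewrite g0 normr0 mul0r add0r ler1z -gtz0_ge1 normr_gt0.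
  have : (1 : R) <= `|ga|%:~R by rewrite ler1z -gtz0_ge1 normr_gt0.
  have : (0 : R) <= `|de|%:~R by rewrite ler0z.
  move=> d0 g1; have g2 := ler_wpM2r (ltW A0) g1; lra.
exists (K * (1 + D ^+ 3)) => tau v1; have v0 : 0 < complex.Im tau by exact: lt_trans v1.
pose k := Num.floor (complex.Re tau / A).
have kP : `|complex.Re tau - k%:~R * A| <= A.
  have /andP[k1 k2] := floor_itv (complex.Re tau / A).
  rewrite -/k in k1 k2; rewrite ler_pdivlMr // in k1; rewrite ltr_pdivrMr // rmorphD /= in k2.
  rewrite ger0_norm; lra.
pose w := tau + ((- k) * (level a)%:Z)%:~R.
have tE : tau = w + (k * (level a)%:Z)%:~R by rewrite /w mulNr rmorphN /= subrK.
have wR : complex.Re w = complex.Re tau - k%:~R * A.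
  by rewrite /w -rc_int ReD /= mulNr rmorphN rmorphM.
have wI : complex.Im w = complex.Im tau by rewrite /w -rc_int ImD addr0.
rewrite -wI in v0 v1; rewrite -wR in kP; rewrite tE; apply: le_trans (slash_translate k det v0) _.
have den := aff_neq0 v0 ds; set u := ga%:~R * w + de%:~R in den *.
have v2 : 0 < complex.Im (mob al be ga de w) by rewrite Im_mob // divr_gt0 // exprn_gt0 // cabs_gt0.
have := hK _ v2; rewrite Im_mob // -/u /slash -/u; set q := cabs (qsum a b _) => hq.
have [s s1 sE] : exists2 s, 1 <= s & complex.Im w = s ^+ 2.
  by exists (Num.sqrt (complex.Im w)); rewrite ?sqr_sqrtr ?(ltW v0) // -[leLHS]sqrtr1 ler_sqrt ltW.
have uE : cabs u = cabs (psq u) ^+ 2 by rewrite cabs_psq.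
have p0 : 0 < cabs (psq u) by rewrite cabs_gt0 psq_eq0.
have s0 : 0 < s by exact: lt_le_trans s1.
have ub : cabs u <= D * complex.Im w.
  rewrite /u; apply: le_trans (cabsD _ _) _; rewrite cabsM -!rc_int !cabs_rc DE mulrDl.
  have d1 : `|de%:~R| * 1 <= `|de%:~R| * complex.Im w by rewrite ler_wpM2l // ltW.
  have : cabs w <= (A + 1) * complex.Im w.
    apply: le_trans (cabs_le_ReIm _) _; rewrite (ger0_norm (ltW v0)) mulrDl mul1r lerD2r.
    by apply: le_trans kP _; rewrite ler_peMr // ltW.
  by move/(ler_wpM2l (normr_ge0 (ga%:~R : R))); rewrite mulrA; lra.
have lb : 1 <= cabs u.
  have [g0|g0] := eqVneq ga 0.
    have d0 : de != 0 by apply: contraNneq ds => ->; rewrite g0.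
    by rewrite /u g0 mul0r add0r -rc_int cabs_rc -intr_norm ler1z -gtz0_ge1 normr_gt0.
  apply: le_trans (Im_le_cabs u); rewrite /u Im_aff normrM -intr_norm (ger0_norm (ltW v0)).
  have g1 : (1 : R) <= `|ga|%:~R by rewrite ler1z -gtz0_ge1 normr_gt0.
  by rewrite -[leLHS]mulr1 ler_pM // ltW.
rewrite sE uE in hq ub; rewrite uE in lb; move: (cabs (psq u)) p0 ub lb hq => p p0 ub lb hq.
have p1 : 1 <= p by rewrite -(ler_pXn2r (n := 2)) ?nnegrE ?expr1n ?(ltW p0).
have pD : p <= D * s.
  rewrite -(ler_pXn2r (n := 2)) ?nnegrE ?(ltW p0) ?mulr_ge0 ?(ltW s0) ?(le_trans _ D1) //.
  rewrite exprMn; apply: le_trans ub _; rewrite ler_wpM2r ?sqr_ge0 // expr2 ler_peMl // (le_trans _ D1) //.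
rewrite ler_pdivrMr ?exprn_gt0 //; apply: le_trans hq _; rewrite -[leRHS]mulrA ler_wpM2l //.
have -> : s ^+ 2 / (p ^+ 2) ^+ 2 = (s / p ^+ 2) ^+ 2 by rewrite expr_div_n.
rewrite sqrtr_sqr ger0_norm ?divr_ge0 ?exprn_ge0 ?(ltW p0) ?(ltW s0) // expr_div_n invf_div.
have p3 : 1 <= p ^+ 3 by rewrite exprn_ege1.
rewrite mulrDl mul1r; apply: lerD => //.
rewrite ler_pdivrMr ?exprn_gt0 //.
have -> : (p ^+ 2) ^+ 3 = p ^+ 3 * p ^+ 3 by ring.
have -> : D ^+ 3 * p ^+ 3 * s ^+ 3 = (D * s) ^+ 3 * p ^+ 3 by ring.
by rewrite ler_wpM2r ?exprn_ge0 ?(ltW p0) // lerXn2r // nnegrE ?(ltW p0) // (le_trans (ltW p0)).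
Qed.

End Cusps.

Theorem theorem13 (R : realType) (a b : int) :
  1 <= a ->
  ~ (exists x : int, (x ^+ 2 == - b %[mod a])%Z) ->
  let A : int := if (4 %| a)%Z then a ^+ 2 else 4 * a ^+ 2 in
  let G := fun al be ga de : int =>
    [/\ al * de - be * ga = 1, (A %| ga)%Z & (al ^+ 2 == 1 %[mod a])%Z] in
  let coef := fun (z : Cx R) (N : nat) =>
    if (N%:Z == b %[mod a])%Z then ratr (hurwitz N) * qexp z ^+ N else 0 in
  (forall z : Cx R, 0 < cim z -> cvgn (series (coef z))) /\
  half_int_modular_form 3 G (fun z : Cx R => limn (series (coef z))).
Proof.
move=> a1 hb A G coef; have [n n0 aE] : exists2 n : nat, (0 < n)%N & a = n%:Z by exists `|a|%N; move: a1; clear; lia.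
(* If -N were a square for some N = b modulo a, then -b would be a quadratic residue modulo a. *)
have nsq (N : int) : (n%:Z %| N - b)%Z -> nonsq N.
  move=> h [x e]; apply: hb; exists x; rewrite eqz_mod_dvd aE e.
  have -> : - N - - b = - (N - b) by ring.
  by rewrite rpredN.
have AE : A = (level n)%:Z.
  by rewrite /A aE /level dvdzE /=; case: ifP => _; [rewrite -mulnn PoszM|rewrite PoszM -mulnn PoszM].
have coefE z : coef z = qsum_term n b z.
  apply: funext => N; rewrite qsum_termE /coef /qco eqz_mod_dvd aE; case: ifP => _; last by rewrite rc0 mul0r.
  have -> : qexp z = cexp (@qz R * z).
    have h1 : complex.Re (@qz R * z) = - (2 * pi * complex.Im z) by rewrite /qz -[ci R * _ * z]mulrA ReM Im_rcM /=; ring.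
    have h2 : complex.Im (@qz R * z) = 2 * pi * complex.Re z by rewrite /qz -[ci R * _ * z]mulrA ImM Re_rcM /=; ring.
    by rewrite /cexp h1 h2.
  rewrite [N%:R * _]mulr_natl cexpMn; congr (_ * _).
  by rewrite /ratr rcM rcV !rc_int.
(* [limn] is tied to the series where it converges, so [f] is identified with [qsum] on the upper
   half-plane, and the rest of the argument evaluates it only there. *)
pose f z := limn (series (coef z)); have fE z : 0 < cim z -> f z = qsum n b z.
  by move=> v0; rewrite /f coefE; apply: (cvg_lim (@norm_hausdorff _ (Cx R)) (qsum_cvg n0 nsq v0)).
split; first by move=> z v0; rewrite coefE; apply: cvgP (qsum_cvg n0 nsq v0).
change (half_int_modular_form 3 G f); clearbody f.
have mobE al be ga de (z : Cx R) : al * de - be * ga = 1 -> 0 < cim z -> 0 < cim (mobius al be ga de z).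
  move=> det v0; rewrite /cim [complex.Im _](@Im_mob R al be ga de z) // divr_gt0 // exprn_gt0 // cabs_gt0.
  exact: aff_neq0 v0 (det_neq0 det).
split.
- by move=> z v0; apply: (qsum_derivable n0 nsq v0); exact: fE.
- move=> al be ga de [det lev al2] z v0; rewrite (fE _ (mobE _ _ _ _ _ det v0)) (fE _ v0).
  rewrite AE in lev; rewrite eqz_mod_dvd aE in al2.
  apply: etrans (qsum_modular n0 nsq lev det al2 v0) _; rewrite /jfac.
  (* The statement has eps^-3 and [jfac] has eps; they agree because i^4 = 1. *)
  congr (_ * _ * _ * _); rewrite /eps /eps_d; case: ifP => _; first by rewrite exp1rz.
  have c2 := ci2 R; have c0 : ci R != 0 by apply/eqP => h; move: c2; rewrite h mul0r => /eqP; rewrite eq_sym oppr_eq0 oner_eq0.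
  have c3 : ci R ^+ 3 != 0 by exact: expf_neq0.
  rewrite -[RHS]/((ci R ^+ 3)^-1); apply: (mulfI c3); rewrite mulfV //.
  by rewrite -exprSr (exprM _ 2 2) [ci R ^+ 2]expr2 c2 expr2 mulrNN mulr1.
move=> al be ga de det; have [M hM] := slash_bounded R n0 nsq det.
exists M, 1 => z v1; have v0 : 0 < cim z by exact: lt_trans v1.
rewrite (fE _ (mobE _ _ _ _ _ det v0)) normcE' lecR; apply: le_trans (hM z v1).
by rewrite cabsM mulrC /half_pow -[psqrt _ ^ _]/((psq (ga%:~R * z + de%:~R) ^+ 3)^-1) cabsV cabsX.
Qed.
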